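(* Let $T>0$ and assume: (a) for each $1\le i\le m$, $\mathcal K_i:\mathbb R\times\mathbb R^n\to[0,\infty)$ is continuous with $\mathcal K_i(t,0)>0$ and $\int_{\mathbb R^n}\mathcal K_i(t,x)\,\mathrm dx=1$ for all $t\in\mathbb R$; (b) $g\in C^{0,0,1}(\mathbb R\times\overline\Omega_0\times\mathbb R^m,\mathbb R^m)$; for all $t\ge0$, $x\in\overline\Omega_0$, $u\in\mathbb M$ the matrix $(\partial g_i(t,x,u)/\partial u_j)_{m\times m}$ is cooperative and irreducible; for each $1\le i\le m$, $g_i(t,x,0)=0$, and $g_i(t,x,u)\le0$ whenever $u\in\mathbb M$ with $u_i=v_i$; (c) $\alpha g(t,x,u)<g(t,x,\alpha u)$ for $u\in\mathbb M\cap\mathrm{Int}(\mathbb R^m_+)$, $t\ge0$, $x\in\overline\Omega_0$, $\alpha\in(0,1)$; (d) $\mathcal K_i(t+T,x)=\mathcal K_i(t,x)$ and $g_i(t+T,x,u)=g_i(t,x,u)$ for each $1\le i\le m$. Consider the periodic problem $$\frac{\partial u}{\partial t}=D\int_{\Omega_0}\mathcal K(t,x-y)u(t,y)\,\mathrm dy-Du+g(t,x,u),\qquad u(t,x)=u(t+T,x),\quad t\in\mathbb R,\ x\in\overline\Omega_0.\qquad(\mathrm P)$$ With $\omega(\Phi)$ the exponential growth bound defined in the context, the following hold: (1) If $\omega(\Phi)<0$, then $0$ is the unique nonnegative solution of $(\mathrm P)$ in $\tilde X_+^v$. (2) If $\omega(\Phi)=0$, and either $\alpha g(t,x,u)\ll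 g(t,x,\alpha u)$ for all $u\in\mathbb M\cap\mathrm{Int}(\mathbb R^m_+)$, $t\ge0$, $x\in\overline\Omega_0$, $\alpha\in(0,1)$, or $\omega(\Phi)=0$ is the principal eigenvalue (of $L_T$), then $0$ is the unique nonnegative solution of $(\mathrm P)$ in $\tilde X_+^v$. (3) If $\omega(\Phi)>0$, then $(\mathrm P)$ admits a unique positive solution $w^\ast\in\tilde X_+^v$. Moreover, $w^\ast\in\mathrm{Int}(\mathcal C_T^+)$.
   Context: $m,n\ge1$ are integers; $\Omega_0\subset\mathbb R^n$ is a bounded, simply connected domain with smooth boundary; $D=\mathrm{diag}\{d_1,\dots,d_m\}$, $d_i>0$. $\mathcal K(t,x-y)u(t,y):=(\mathcal K_1(t,x-y)u_1(t,y),\dots,\mathcal K_m(t,x-y)u_m(t,y))^T$. In $\mathbb R^m$: $a\ge b$ means $a-b\in\mathbb R^m_+$; $a>b$ means $a\ge b$, $a\ne b$; $a\gg b$ means $a-b\in\mathrm{Int}(\mathbb R^m_+)$. $v\in\mathrm{Int}(\mathbb R^m_+)$ is fixed and $\mathbb M=\{u\in\mathbb R^m:0\le u\le v\}$. A matrix is cooperative if its off-diagonal entries are nonnegative. $C^{0,0,1}$: continuous in $(t,x,u)$ with continuous first derivatives in $u$. $X=C(\overline\Omega_0,\mathbb R^m)$ with the sup norm. $\mathcal C_T$: continuous $u:\mathbb R\times\overline\Omega_0\to\mathbb R^m$ with $u(t+T,x)=u(t,x)$, with the sup norm; $\mathcal C_T^+$: its cone of nonnegative functions. $\tilde X$: bounded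 measurable functions $u:\mathbb R\times\overline\Omega_0\to\mathbb R^m$ (defined everywhere) with $u(t+T,x)=u(t,x)$, with the sup norm; $\tilde X_+^v=\{u\in\tilde X:0\le u(t,x)\le v\ \forall (t,x)\}$. A solution of $(\mathrm P)$ in $\tilde X_+^v$ is differentiable in $t$ and satisfies $(\mathrm P)$ at every $(t,x)$. A positive solution is one all of whose components are $>0$ at every $(t,x)$. $\Phi(t,s)$, $t\ge s$, is the evolution family on $X$ generated by $\frac{\partial u}{\partial t}=D\int_{\Omega_0}\mathcal K(t,x-y)u(t,y)\,\mathrm dy-Du+\left(\frac{\partial g_i(t,x,0)}{\partial u_j}\right)_{m\times m}u$, and $\omega(\Phi)=\inf\{\tilde\omega:\exists M\ge1\text{ such that }\|\Phi(t,s)\|\le Me^{\tilde\omega(t-s)}\ \forall t\ge s\}$. $L_T$ is the operator $[L_Tu](t,x)=-\frac{\partial u}{\partial t}(t,x)+D\int_{\Omega_0}\mathcal K(t,x-y)u(t,y)\,\mathrm dy-Du+\left(\frac{\partial g_i(t,x,0)}{\partial u_j}\right)_{m\times m}u(t,x)$ on $\mathcal C_T$ (domain: functions $C^1$ in $t$); its spectral bound satisfies $s(L_T)=\omega(\Phi)=\frac{\ln r(\Phi(T,0))}{T}$. ''$\omega(\Phi)=0$ is the principal eigenvalue'' means that $0=s(L_T)$ is an eigenvalue of $L_T$ with an eigenfunction in $\mathrm{Int}(\mathcal C_T^+)$. *)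

(* Defs.v *)
From HB Require Import structures.
From mathcomp Require Import all_boot all_order all_algebra.
From mathcomp Require Import all_classical all_reals all_analysis.
From mathcomp Require Import measurable_realfun.

Set Implicit Arguments.
Unset Strict Implicit.
Unset Printing Implicit Defensive.
Import Order.TTheory GRing.Theory Num.Theory.
Import numFieldNormedType.Exports.

Local Open Scope classical_set_scope.
Local Open Scope ring_scope.

(* Vectors of R^n are column vectors. The norm of 'cV[R]_n is the max norm; the
   growth bound, the interior of the cone and the spectral bound below do not
   depend on the choice of the norm.

   A function on the closure of Omega is represented by a function on R^n of
   which only the values on the closure of Omega are ever constrained: equality
   of such functions is always stated pointwise on the closure of Omega. *)

(** * Lebesgue measure on R^n *)

(* Borel sigma-algebra. *)
HB.instance Definition _ (R : realType) (n : nat) :=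
  @isMeasurable.Build default_measure_display 'cV[R]_n
    <<s @open 'cV[R]_n >>
    (@sigma_algebra0 _ _ _) (@sigma_algebraC _ _) (@sigma_algebra_bigcup _ _ _).

Fixpoint lebesgue_n (R : realType) (n : nat) : set 'cV[R]_n -> \bar R :=
  match n with
  | 0 => \d_(0 : 'cV[R]_0)
  | k.+1 => pushforward (lebesgue_measure \x @lebesgue_n R k)%E
              (fun p : R * 'cV[R]_k => col_mx p.1%:M p.2 : 'cV[R]_(1 + k))
  end.
Arguments lebesgue_n {R} n.

(* Lebesgue (not only Borel) measurability on R x R^n: preimages of Borel sets
   lie in the completion of the Borel sigma-algebra. *)
Definition lebesgue_measurable_fun (R : realType) (n : nat)
    (A : set (R * 'cV[R]_n)) (f : R * 'cV[R]_n -> R) : Prop :=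
  forall Y : set R, measurable Y ->
    completed_algebra_gen (lebesgue_measure \x lebesgue_n n)%E
      (A `&` f @^-1` Y).

(** * Order on R^m and matrices *)

Section order.
Context {R : realType} {m : nat}.
Implicit Types (a b v : 'cV[R]_m) (A : 'M[R]_m).

Definition Rplus : set 'cV[R]_m := [set a | forall i, 0 <= a i 0].

Definition vle a b : Prop := Rplus (b - a).
Definition vlt a b : Prop := vle a b /\ a <> b.
Definition vll a b : Prop := interior Rplus (b - a).

Definition order_box v : set 'cV[R]_m := [set u | vle 0 u /\ vle u v].

Definition cooperative A : Prop := forall i j, i != j -> 0 <= A i j.

(* No permutation of the indices makes A block triangular; every 1 x 1 matrix
   is irreducible. *)
Definition irreducible_mx A : Prop :=
  forall S : {set 'I_m}, S != finset.set0 -> S != [set: 'I_m]%SET ->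
    exists i j, [/\ i \in S, j \notin S & A i j != 0].

End order.

(** * Bounded simply connected domains with smooth boundary *)

Section domain.
Context {R : realType} {n : nat}.
Implicit Types (Omega : set 'cV[R]_n) (f : 'cV[R]_n -> R).

Definition is_domain Omega : Prop :=
  [/\ open Omega, connected Omega & Omega !=set0].

Definition path_connected Omega : Prop :=
  forall x y, Omega x -> Omega y ->
    exists c : R -> 'cV[R]_n,
      [/\ {within `[0, 1], continuous c}, c 0 = x, c 1 = y &
          forall s, s \in `[0, 1] -> Omega (c s)].

Definition simply_connected Omega : Prop :=
  path_connected Omega /\
  forall c : R -> 'cV[R]_n,
    {within `[0, 1], continuous c} -> c 0 = c 1 ->
    (forall s, s \in `[0, 1] -> Omega (c s)) ->
    exists H : R * R -> 'cV[R]_n,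
      [/\ {within `[0, 1] `*` `[0, 1], continuous H},
          forall s r, s \in `[0, 1] -> r \in `[0, 1] -> Omega (H (s, r)),
          forall s, s \in `[0, 1] -> H (s, 0) = c s /\ H (s, 1) = c 0 &
          forall r, r \in `[0, 1] -> H (0, r) = c 0 /\ H (1, r) = c 0].

Fixpoint iter_partial (s : seq 'I_n) f : 'cV[R]_n -> R :=
  if s is j :: s' then iter_partial s' (fun x => 'D_(delta_mx j 0) f x) else f.

Definition smooth_fun f : Prop :=
  forall s : seq 'I_n,
    continuous (iter_partial s f) /\
    forall x j, derivable (iter_partial s f) x (delta_mx j 0).

(* Near each boundary point, Omega is the strict epigraph of a C^oo function of
   the other coordinates, in the direction of a coordinate axis or its
   opposite. *)
Definition smooth_boundary Omega : Prop :=
  forall p, (closure Omega `\` interior Omega) p ->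
    exists (i : 'I_n) (b : bool) (gamma : 'cV[R]_n -> R),
      [/\ smooth_fun gamma,
          forall x y : 'cV[R]_n, (forall k, k != i -> x k 0 = y k 0) ->
            gamma x = gamma y &
          \forall x \near p, Omega x <-> gamma x < (-1) ^+ b * x i 0].

End domain.

(** * Function spaces *)

Section spaces.
Context {R : realType} {m n : nat}.
Variables (Omega : set 'cV[R]_n) (T : R).
Implicit Types (phi : 'cV[R]_n -> 'cV[R]_m) (u w : R -> 'cV[R]_n -> 'cV[R]_m).

Definition supnorm (E : Type) (A : set E) (f : E -> 'cV[R]_m) : \bar R :=
  ereal_sup [set `|f z|%:E | z in A].

Definition space_X : set ('cV[R]_n -> 'cV[R]_m) :=
  [set phi | {within closure Omega, continuous phi}].

Definition normX phi : \bar R := supnorm (closure Omega) phi.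

Definition cyl : set (R * 'cV[R]_n) := [set p | closure Omega p.2].

Definition normT u : \bar R := supnorm cyl (fun p => u p.1 p.2).

Definition periodic_in_time u : Prop :=
  forall t x, closure Omega x -> u (t + T) x = u t x.

Definition C_T : set (R -> 'cV[R]_n -> 'cV[R]_m) :=
  [set u | {within cyl, continuous (fun p => u p.1 p.2)} /\
           periodic_in_time u].

Definition C_T_plus : set (R -> 'cV[R]_n -> 'cV[R]_m) :=
  [set u | C_T u /\ forall t x, closure Omega x -> vle 0 (u t x)].

(* Interior of the cone in the normed space C_T. *)
Definition int_C_T_plus : set (R -> 'cV[R]_n -> 'cV[R]_m) :=
  [set u | C_T u /\
    exists e : R, 0 < e /\
      forall w, C_T w -> (normT (fun t x => (w t x - u t x)%R) < e%:E)%E ->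
        C_T_plus w].

Definition X_tilde : set (R -> 'cV[R]_n -> 'cV[R]_m) :=
  [set u | [/\ (normT u < +oo)%E,
      forall i, lebesgue_measurable_fun cyl (fun p => u p.1 p.2 i 0) &
      periodic_in_time u]].

Definition X_tilde_box (v : 'cV[R]_m) : set (R -> 'cV[R]_n -> 'cV[R]_m) :=
  [set u | X_tilde u /\
    forall t x, closure Omega x -> vle 0 (u t x) /\ vle (u t x) v].

End spaces.

(** * The nonlocal dispersal system *)

Section system.
Context {R : realType} {m n : nat}.
Variables (Omega : set 'cV[R]_n) (d : 'rV[R]_m)
  (K : 'I_m -> R -> 'cV[R]_n -> R)
  (g : R -> 'cV[R]_n -> 'cV[R]_m -> 'cV[R]_m).
Implicit Types (phi : 'cV[R]_n -> 'cV[R]_m) (u : R -> 'cV[R]_n -> 'cV[R]_m).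

(* Entry (i, j) is the partial derivative of g_i with respect to u_j. *)
Definition jacobian_u (t : R) (x : 'cV[R]_n) (a : 'cV[R]_m) : 'M[R]_m :=
  \matrix_(i, j) 'D_(delta_mx j 0) (fun b : 'cV[R]_m => g t x b i 0) a.

Definition class_C001 : Prop :=
  let A : set (R * 'cV[R]_n * 'cV[R]_m) := [set p | closure Omega p.1.2] in
  {within A, continuous (fun p => g p.1.1 p.1.2 p.2)} /\
  forall i j,
    (forall t x a, closure Omega x ->
       derivable (fun b : 'cV[R]_m => g t x b i 0) a (delta_mx j 0)) /\
    {within A, continuous (fun p => jacobian_u p.1.1 p.1.2 p.2 i j)}.

(* The integral of a nonnegative function is the supremum of the integrals of
   its Borel simple minorants, hence agrees with the integral for the completed
   measure on Lebesgue-measurable functions. *)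
Definition dispersal (t : R) phi (x : 'cV[R]_n) : 'cV[R]_m :=
  \col_i fine (\int[lebesgue_n n]_(y in Omega)
                  (K i t (x - y)%R * phi y i 0)%:E)%E.

Definition rhs (t : R) phi (x : 'cV[R]_n) : 'cV[R]_m :=
  diag_mx d *m dispersal t phi x - diag_mx d *m phi x + g t x (phi x).

Definition solves_P (T : R) u : Prop :=
  periodic_in_time Omega T u /\
  forall t x, closure Omega x ->
    is_derive t (1 : R) (fun s => u s x) (rhs t (u t) x).

Definition linear_part (t : R) phi (x : 'cV[R]_n) : 'cV[R]_m :=
  diag_mx d *m dispersal t phi x - diag_mx d *m phi x
  + jacobian_u t x 0 *m phi x.

(** ** Evolution family *)

(* Only the values Phi t s phi with s <= t and phi in X are constrained. *)
Record is_evolution_family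
    (Phi : R -> R -> ('cV[R]_n -> 'cV[R]_m) -> ('cV[R]_n -> 'cV[R]_m)) : Prop :=
{ evol_X : forall s t phi, s <= t -> space_X Omega phi ->
    space_X Omega (Phi t s phi);
  evol_linear : forall s t (a : R) phi psi, s <= t ->
    space_X Omega phi -> space_X Omega psi ->
    forall x, closure Omega x ->
      Phi t s (fun y => a *: phi y + psi y) x
      = a *: Phi t s phi x + Phi t s psi x;
  evol_bounded : forall s t, s <= t -> exists M : R,
    forall phi, space_X Omega phi ->
      (normX Omega (Phi t s phi) <= M%:E * normX Omega phi)%E;
  evol_id : forall s phi, space_X Omega phi ->
    forall x, closure Omega x -> Phi s s phi x = phi x;
  evol_comp : forall s r t phi, s <= r -> r <= t -> space_X Omega phi ->
    forall x, closure Omega x -> Phi t r (Phi r s phi) x = Phi t s phi x;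
  evol_continuous : forall s t phi (e : R), s <= t -> space_X Omega phi ->
    0 < e ->
    \forall p \near within [set p : R * R | p.2 <= p.1] (nbhs (t, s)),
      (normX Omega (fun x => (Phi p.1 p.2 phi x - Phi t s phi x)%R) < e%:E)%E;
  (* In X, t |-> Phi t s phi is differentiable on [s, +oo) (from the right at
     s), with derivative given by the linearized equation. *)
  evol_generated : forall s t phi (e : R), s <= t -> space_X Omega phi ->
    0 < e ->
    \forall h \near (0 : R)^', s <= t + h ->
      (normX Omega (fun x => (h^-1 *: (Phi (t + h) s phi x - Phi t s phi x)
                              - linear_part t (Phi t s phi) x)%R)
       < e%:E)%E }.

Definition opnormX
    (A : ('cV[R]_n -> 'cV[R]_m) -> ('cV[R]_n -> 'cV[R]_m)) : \bar R :=
  ereal_sup [set normX Omega (A phi) |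
    phi in [set phi | space_X Omega phi /\ (normX Omega phi <= 1)%E]].

Definition growth_bound
    (Phi : R -> R -> ('cV[R]_n -> 'cV[R]_m) -> ('cV[R]_n -> 'cV[R]_m)) :
    \bar R :=
  ereal_inf [set w%:E | w in [set w : R |
    exists M : R, 1 <= M /\
      forall s t, s <= t ->
        (opnormX (Phi t s) <= (M * expR (w * (t - s)))%:E)%E]].

(** ** The operator L_T *)

Definition dom_L (T : R) : set (R -> 'cV[R]_n -> 'cV[R]_m) :=
  [set u | [/\ C_T Omega T u,
      forall t x, closure Omega x -> derivable (fun s => u s x) t (1 : R) &
      {within cyl Omega, continuous (fun p => derive1 (fun s => u s p.2) p.1)}]].

Definition L_T u (t : R) (x : 'cV[R]_n) : 'cV[R]_m :=
  - derive1 (fun s => u s x) t + linear_part t (u t) x.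

(* L_T - (a + b i) has a bounded inverse on the complexification of C_T, whose
   elements u1 + i u2 are given by their real and imaginary parts. *)
Definition in_resolvent_set (T a b : R) : Prop :=
  let re u1 u2 t x := L_T u1 t x - a *: u1 t x + b *: u2 t x in
  let im u1 u2 t x := L_T u2 t x - a *: u2 t x - b *: u1 t x in
  (forall f1 f2, C_T Omega T f1 -> C_T Omega T f2 ->
     exists u1 u2, [/\ dom_L T u1, dom_L T u2 &
       forall t x, closure Omega x ->
         re u1 u2 t x = f1 t x /\ im u1 u2 t x = f2 t x]) /\
  (exists M : R, forall u1 u2, dom_L T u1 -> dom_L T u2 ->
     (maxe (normT Omega u1) (normT Omega u2)
      <= M%:E * maxe (normT Omega (re u1 u2)) (normT Omega (im u1 u2)))%E).

Definition spectral_bound (T : R) : \bar R :=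
  ereal_sup [set a%:E | a in [set a : R | exists b, ~ in_resolvent_set T a b]].

(* lambda is the spectral bound of L_T, and an eigenvalue of L_T with an
   eigenfunction in the interior of the cone of C_T. *)
Definition is_principal_eigenvalue (T lambda : R) : Prop :=
  spectral_bound T = lambda%:E /\
  exists u, [/\ dom_L T u, int_C_T_plus Omega T u &
    forall t x, closure Omega x -> L_T u t x = lambda *: u t x].

End system.

(* Main.v *)
Require Import Defs.
From HB Require Import structures.
From mathcomp Require Import finmap all_boot all_order all_algebra.
From mathcomp Require Import all_classical all_reals all_analysis.
From mathcomp Require Import measurable_realfun.
From mathcomp Require Import ring lra.
Import Order.TTheory GRing.Theory Num.Theory.
Import numFieldNormedType.Exports.
Set Implicit Arguments.
Unset Strict Implicit.
Unset Printing Implicit Defensive.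
Local Open Scope classical_set_scope.
Local Open Scope ring_scope.

(** Let J(t,x) be the Jacobian of g(t,x,.) at 0 and M = [0,v]. Subhomogeneity
   puts g below its linearization on M ([g_le_linear]), and near 0 the two agree
   up to a small relative error ([g_ge_linear]); this is why the growth bound of
   the linearized family decides between the three regimes. Solutions are only
   bounded and measurable, and the equation does not smooth in x, so orbits are
   not compact. What replaces compactness is a quantitative Harnack inequality
   ([harnack]): irreducibility passes a lower bound from one component to the
   others at the same point ([local_harnack]), and K_i(t,0) > 0 together with
   the connectedness of Omega spreads the mass of one component over the whole
   closure of Omega ([spread]), with constants depending only on the data. Its
   periodic form with a forcing term is [periodic_harnack].

   A slice u(t,.) of a solution need not be Borel measurable. The integral of a
   nonnegative function is the supremum over its measurable minorants, hence
   monotone ([ge0_le_Rintegral]), and monotonicity is all that the comparison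
   arguments ask of the solution; what it is compared with is measurable.

   Negative growth: a periodic solution is dominated by the linear flow, which
   tends to 0, and periodicity leaves only u = 0 ([damped_comparison],
   [periodic_vanish], [negative_growth_zero]).

   Zero growth: a nonzero solution is bounded below, on all of the closure of
   Omega if some slice has mass, and otherwise at one point, where the equation
   is then local. If subhomogeneity is strong, g(u) <= Ju - eps u there, and the
   previous argument applies to the damped linear flow ([strong_decay]). If L_T
   has a positive eigenfunction phi, the least k with u <= k phi could be
   decreased because phi - u/k would satisfy a forced periodic inequality
   ([zero_growth_eigen]).

   Positive growth: iterating w' + c w = F(w_old) from w = v, with c so large
   that F is monotone, decreases to the largest solution in M, and this solution
   lies above every subsolution that returns above its initial value after some
   periods ([maximal_solution]). For 0 < th < omega(Phi) the functions
   z = e^{-th (t-s)} Phi(t,s) 1 are unbounded. If their mass over Omega becomes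
   large, the Harnack inequality makes z exceed its initial values everywhere
   and a small multiple of z is such a subsolution ([large_mass_positive]). If
   the mass stays bounded, then at a point where z is huge the nonlocal term is
   negligible, so the discounted solution of the linear ODE at this point,
   frozen in x over a small ball, is such a subsolution
   ([bounded_mass_positive]). Hence the maximal solution w is bounded below by
   a positive constant. Given two solutions bounded below, the largest ratio
   al < 1 with al w <= u could be increased by [periodic_harnack]
   ([ratio_step]); this gives uniqueness ([positive_le]), and, applied to w at
   two neighbouring points, the continuity of w in x
   ([solution_space_modulus]). A measurable solution that is positive everywhere
   is bounded below by a constant because, by Tonelli, one of its slices
   dominates a constant on a Borel set of positive measure ([positive_section]). *)

(** * Lebesgue measure on R^n *)

Section lebesgue_n_measure.
Context {R : realType}.

Lemma open_cV_measurable n (U : set 'cV[R]_n) : open U -> measurable U.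
Proof. exact: sub_sigma_algebra. Qed.

Lemma closed_cV_measurable n (U : set 'cV[R]_n) : closed U -> measurable U.
Proof.
by move=> /closed_openC/open_cV_measurable/measurableC; rewrite setCK.
Qed.

Lemma rat_dense_ball (x e : R) : 0 < e -> exists q : rat, `|x - ratr q| < e.
Proof.
move=> e0; have [] := @dense_rat R (ball x e); first by exists x; exact: ballxx.
  exact: ball_open.
by move=> y [xe [q _ qy]]; exists q; rewrite qy.
Qed.

(** The product sigma-algebra contains the open sets because rational boxes
    form a countable base; [lebesgue_n] pushes a product measure forward, so this is
    what makes the gluing map measurable. *)
Lemma open_prod_measurable n (U : set (R * 'cV[R]_n)) : open U ->
  measurable U.
Proof.
move=> oU.
pose B (k : rat * 'cV[rat]_n * nat) : set (R * 'cV[R]_n) :=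
  ball (ratr k.1.1 : R) (k.2.+1%:R^-1) `*`
  ball (map_mx ratr k.1.2 : 'cV[R]_n) (k.2.+1%:R^-1).
pose C k := if `[< B k `<=` U >] then B k else set0.
rewrite (_ : U = \bigcup_k C k).
  apply: countable_bigcupT_measurable => [|k]; first exact: countableP.
  rewrite /C; case: ifP => // _; apply: measurableX.
  - exact: measurable_ball.
  - apply: open_cV_measurable; exact: ball_open.
apply/seteqP; split => [[t x] Utx|p [k _]]; last first.
  by rewrite /C; case: asboolP => // BU /BU.
have /nbhs_ballP[e /= e0 eU] : nbhs (t, x) U by exact: open_nbhs_nbhs.
have [k ke] : exists k : nat, 2 * k.+1%:R^-1 < e.
  have /ltr_add_invr[k] : 0 < e / 2 by rewrite divr_gt0.
  by rewrite add0r => ke; exists k; rewrite mulrC -ltr_pdivlMr.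
have k0 : 0 < k.+1%:R^-1 :> R by rewrite invr_gt0.
have [q tq] := rat_dense_ball t k0.
have /choice[w xw] : forall i, exists q : rat, `|x i 0 - ratr q| < k.+1%:R^-1.
  by move=> i; exact: rat_dense_ball.
exists (q, \col_i w i, k) => //; rewrite /C; case: asboolP => [_|].
  split=> /=; first by rewrite /ball/= distrC.
  split=> // i j; rewrite !mxE ord1 /ball/= distrC; exact: xw.
case=> -[s y] [/= sq yq]; apply: eU; split=> /=.
- rewrite /ball/=; apply: lt_trans ke; rewrite mulr2n mulrDl mul1r.
  rewrite /= in sq; have -> : t - s = (t - ratr q) + (ratr q - s) by ring.
  apply: le_lt_trans (ler_normD _ _) _; exact: ltrD.
- split=> // i j; rewrite /ball/=; apply: lt_trans ke; rewrite mulr2n mulrDl mul1r.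
  have -> : x i j - y i j = (x i 0 - ratr (w i)) + (ratr (w i) - y i j).
    by rewrite ord1; ring.
  apply: le_lt_trans (ler_normD _ _) _; apply: ltrD; first exact: xw.
  by case: yq => _ /(_ i j); rewrite /ball/= !mxE.
Qed.

Definition glue (n : nat) (p : R * 'cV[R]_n) : 'cV[R]_n.+1 :=
  (col_mx p.1%:M p.2 : 'cV[R]_(1 + n)).

Lemma glue0 n (p : R * 'cV[R]_n) : glue p ord0 0 = p.1.
Proof.
rewrite /glue (_ : ord0 = lshift n (0 : 'I_1)); last exact: val_inj.
by apply: (etrans (col_mxEu (p.1%:M : 'M[R]_1) p.2 0 0)); rewrite mxE eqxx mulr1n.
Qed.

Lemma glueS n (p : R * 'cV[R]_n) (i : 'I_n) :
  glue p (lift ord0 i) 0 = p.2 i 0.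
Proof.
rewrite /glue (_ : lift ord0 i = rshift 1 i); last exact: val_inj.
exact: (col_mxEd (p.1%:M : 'M[R]_1) p.2 i 0).
Qed.

Lemma glue_continuous n : continuous (@glue n).
Proof.
move=> p; apply/cvg_ballP => e e0; have H := @nbhsx_ballx _ _ p e e0; near=> q.
have : ball p e q by near: q; exact: H.
move=> [pq1 [_ pq2]]; split=> // i j; rewrite !ord1.
by case: (unliftP ord0 i) => [k|] ->; rewrite ?glueS ?glue0.
Unshelve. all: by end_near. Qed.

Lemma glue_measurable n : measurable_fun setT (@glue n).
Proof.
apply: (@measurability _ _ _ _ setT (@glue n) open) => //.
move=> _ [U oU <-]; rewrite setTI; apply: open_prod_measurable.
by move: oU; apply: (continuousP _).1; exact: glue_continuous.
Qed.

Definition box n (a b : 'cV[R]_n) : set 'cV[R]_n :=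
  [set y | forall i, y i 0 \in `[a i 0, b i 0]].

Lemma box_closed n (a b : 'cV[R]_n) : closed (box a b).
Proof.
rewrite (_ : box a b = \bigcap_(i in setT) ((fun y : 'cV[R]_n => y i 0) @^-1` `[a i 0, b i 0])).
  apply: closed_bigI => i _; apply: closed_comp => [y _|]; last exact: interval_closed.
  exact: coord_continuous.
by apply/seteqP; split => [y yab i _|y yab i]; [exact: yab|exact: (yab i I)].
Qed.

Definition tail n (a : 'cV[R]_n.+1) : 'cV[R]_n := \col_i a (lift ord0 i) 0.

Lemma box_measurable n (a b : 'cV[R]_n) : measurable (box a b).
Proof. by apply: closed_cV_measurable; exact: box_closed. Qed.

Lemma glue_box n (a b : 'cV[R]_n.+1) :
  @glue n @^-1` box a b =
  `[a ord0 0, b ord0 0]%classic `*` box (tail a) (tail b).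
Proof.
apply/seteqP; split => [p pab|p [p1 p2] i].
  split=> [|i /=]; first by have := pab ord0; rewrite glue0.
  by have := pab (lift ord0 i); rewrite glueS !mxE.
case: (unliftP ord0 i) => [k|] ->; rewrite ?glueS ?glue0 //.
by have := p2 k; rewrite !mxE.
Qed.

Lemma bigcup_box n : \bigcup_k box (const_mx (- k%:R)) (const_mx k%:R)
   = [set: 'cV[R]_n].
Proof.
apply/seteqP; split => // y _.
exists (Num.trunc `|y|).+1 => // i; rewrite !mxE in_itv/= -ler_norml.
apply: ltW; apply: le_lt_trans (truncnS_gt _).
rewrite [leRHS]/Num.Def.normr/= mx_normrE.
exact: (le_bigmax _ (fun ij : 'I_n * 'I_1 => `|y ij.1 ij.2|) (i, 0)).
Qed.

Lemma prod_itv_box n (mu : {sigma_finite_measure set 'cV[R]_n -> \bar R})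
    (mubox : forall a b : 'cV[R]_n, (forall i, a i 0 <= b i 0) ->
      mu (box a b) = (\prod_i (b i 0 - a i 0))%:E) (a b : 'cV[R]_n.+1) :
  (forall i, a i 0 <= b i 0) ->
  (lebesgue_measure \x mu)%E (@glue n @^-1` box a b) =
  (\prod_i (b i 0 - a i 0))%:E.
Proof.
move=> ab; rewrite glue_box product_measure1E//; last first.
  exact: box_measurable.
have tl i : tail a i 0 <= tail b i 0 by rewrite !mxE.
rewrite mubox// big_ord_recl EFinM; congr (_ * _)%E.
  rewrite [LHS]lebesgue_measure_itv/= lte_fin.
  by have := ab ord0; rewrite le_eqVlt => /orP[/eqP->|->]; rewrite ?ltxx ?subrr.
rewrite (eq_bigr (fun i => b (lift ord0 i) 0 - a (lift ord0 i) 0)) => [//|i _]; first by rewrite !mxE.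
Qed.

(** [lebesgue_n] is a bare set function defined by recursion. That it is a
    sigma-finite measure has to be proved along the recursion, together with its
    value on boxes, since the product measure at the next dimension needs
    sigma-finiteness at the previous one. *)
Lemma lebesgue_n_is_measure n :
  exists mu : {sigma_finite_measure set 'cV[R]_n -> \bar R},
    lebesgue_n n = mu :> (set 'cV[R]_n -> \bar R) /\
    forall a b : 'cV[R]_n, (forall i, a i 0 <= b i 0) ->
      mu (box a b) = (\prod_i (b i 0 - a i 0))%:E.
Proof.
elim: n => [|n [mu [mun mubox]]].
  exists (\d_(0 : 'cV[R]_0)); split=> // a b _.
  rewrite big_ord0 -[LHS]/(\d_(0 : 'cV[R]_0) (box a b) : \bar R) diracE mem_set //.
  by move=> [].
pose nu : {measure set 'cV[R]_n.+1 -> \bar R} :=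
  measure_function.measure_function_pushforward__canonical__measure_function_Measure
    (lebesgue_measure \x mu)%E (@glue_measurable n).
have nun : lebesgue_n n.+1 = nu :> (set 'cV[R]_n.+1 -> \bar R).
  by rewrite /= mun.
have nubox (a b : 'cV[R]_n.+1) : (forall i, a i 0 <= b i 0) ->
    nu (box a b) = (\prod_i (b i 0 - a i 0))%:E.
  by move=> ab; rewrite /nu/= /pushforward prod_itv_box.
have sf : sigma_finite setT nu.
  exists (fun k => box (const_mx (- k%:R)) (const_mx k%:R)).
    by rewrite bigcup_box.
  move=> k; split; first exact: box_measurable.
  by rewrite nubox ?ltry// => i; rewrite !mxE ge0_cp.
pose sfm := Measure_isSigmaFinite.Build _ _ _ (nu : set _ -> _) sf.
by exists (HB.pack_for {sigma_finite_measure set 'cV[R]_n.+1 -> \bar R}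
  (nu : set _ -> _) (Measure.class nu) sfm).
Qed.

Let lebesgue_n0 n : lebesgue_n n set0 = 0%E :> \bar R.
Proof. by have [mu [-> _]] := lebesgue_n_is_measure n; exact: measure0. Qed.

Let lebesgue_n_ge0 n (A : set 'cV[R]_n) : (0 <= lebesgue_n n A)%E.
Proof. by have [mu [-> _]] := lebesgue_n_is_measure n; exact: measure_ge0. Qed.

Let lebesgue_n_sigma_additive n :
  semi_sigma_additive (lebesgue_n n : set 'cV[R]_n -> \bar R).
Proof.
by have [mu [-> _]] := lebesgue_n_is_measure n; exact: measure_semi_sigma_additive.
Qed.

HB.instance Definition _ n := isMeasure.Build _ 'cV[R]_n R (lebesgue_n n)
  (@lebesgue_n0 n) (@lebesgue_n_ge0 n) (@lebesgue_n_sigma_additive n).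

Let lebesgue_n_sigma_finite n :
  sigma_finite setT (lebesgue_n n : set 'cV[R]_n -> \bar R).
Proof.
by have [mu [-> _]] := lebesgue_n_is_measure n; exact: sigma_finiteT.
Qed.

HB.instance Definition _ n := Measure_isSigmaFinite.Build _ 'cV[R]_n R
  (lebesgue_n n) (@lebesgue_n_sigma_finite n).

Lemma lebesgue_n_box n (a b : 'cV[R]_n) : (forall i, a i 0 <= b i 0) ->
  lebesgue_n n (box a b) = (\prod_i (b i 0 - a i 0))%:E.
Proof. by have [mu [-> H]] := lebesgue_n_is_measure n; exact: H. Qed.

Lemma coord_le_norm n (y : 'cV[R]_n) i : `|y i 0| <= `|y|.
Proof.
rewrite [leRHS]/Num.Def.normr/= mx_normrE.
exact: (le_bigmax _ (fun ij : 'I_n * 'I_1 => `|y ij.1 ij.2|) (i, 0)).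
Qed.

Lemma lebesgue_n_bounded n (A : set 'cV[R]_n) : bounded_set A -> measurable A ->
  (lebesgue_n n A < +oo)%E.
Proof.
move=> [M [_ AM]] mA; pose N := `|M| + 1.
have {}AM y : A y -> `|y| <= N.
  by apply: AM; rewrite (le_lt_trans (ler_norm M))// ltrDl.
have N0 : 0 <= N by rewrite addr_ge0.
apply: (@le_lt_trans _ _ (lebesgue_n n
    (box (const_mx (- N)) (const_mx N) : set 'cV[R]_n))).
  apply: le_measure; rewrite ?inE//; [exact: box_measurable|].
  move=> y /AM yM i; rewrite !mxE in_itv/= -ler_norml.
  exact: le_trans (coord_le_norm y i) yM.
by rewrite lebesgue_n_box ?ltry// => i; rewrite !mxE ge0_cp.
Qed.

Lemma lebesgue_n_open_gt0 n (A : set 'cV[R]_n) : open A -> A !=set0 ->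
  (0 < lebesgue_n n A)%E.
Proof.
move=> oA [x Ax]; have /nbhs_ballP[e /= e0 eA] : nbhs x A by exact: open_nbhs_nbhs.
have e20 : 0 < e / 2 by rewrite divr_gt0.
apply: (@lt_le_trans _ _ (lebesgue_n n (box (x - const_mx (e / 2)) (x + const_mx (e / 2))))).
  rewrite lebesgue_n_box; last by move=> i; rewrite !mxE; lra.
  by rewrite lte_fin; apply: prodr_gt0 => i _; rewrite !mxE; lra.
apply: le_measure; rewrite ?inE; [exact: box_measurable| |].
  exact: open_cV_measurable.
move=> y yx; apply: eA; split=> // i j; rewrite ord1.
have := yx i; rewrite !mxE in_itv/= /ball/= => yxi.
by rewrite ltr_norml; lra.
Qed.

End lebesgue_n_measure.

(** * Reflection invariance and lower integrals *)

Section reflection.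
Context {R : realType}.

Lemma sub_measurable1 (x : R) : measurable_fun setT (fun y : measurableTypeR R => x - y : measurableTypeR R).
Proof. exact: measurable_funB. Qed.

Lemma lebesgue_measure_reflect (x : R) (A : set R) : measurable A ->
  lebesgue_measure ((fun y : R => x - y) @^-1` A) = lebesgue_measure A.
Proof.
move=> mA; pose phi : measurableTypeR R -> measurableTypeR R := fun y => x - y.
pose nu : {measure set (measurableTypeR R) -> \bar R} :=
  measure_function.measure_function_pushforward__canonical__measure_function_Measure
    lebesgue_measure (sub_measurable1 x).
apply/esym/(@lebesgue_measure_unique R nu) => // _ [[a b] _ <-].
rewrite /nu/= /pushforward.
rewrite [X in _ = lebesgue_measure X](_ : _ = `[x - b, x - a[%classic); last first.
  by apply/seteqP; split => y /=; rewrite !in_itv/=; lra.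
by rewrite !lebesgue_measure_itv/= !lte_fin !EFinN; case: ifPn; case: ifPn; rewrite -?EFinB => ? ?;
 (try congr EFin); lra.
Qed.

Lemma sub_cV_measurable n (x : 'cV[R]_n) : measurable_fun setT (fun y : 'cV[R]_n => x - y).
Proof.
apply: (@measurability _ _ _ _ setT (fun y : 'cV[R]_n => x - y) open) => //.
move=> _ [U oU <-]; rewrite setTI; apply: open_cV_measurable.
move: oU; apply: (continuousP _).1 => y.
by apply: (@continuousB R 'cV[R]_n 'cV[R]_n (cst x) id y); [exact: cst_continuous|].
Qed.

Lemma glue_sub n (x : 'cV[R]_n.+1) (p : R * 'cV[R]_n) :
  x - glue p = glue (x ord0 0 - p.1, tail x - p.2).
Proof.
apply/colP => i; rewrite mxE [in LHS]mxE.
by case: (unliftP ord0 i) => [k|] ->; rewrite ?glueS ?glue0 ?mxE.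
Qed.

(** By uniqueness of the product measure the invariance under y |-> x - y reduces
    to one coordinate. *)
Lemma lebesgue_n_reflect n (x : 'cV[R]_n) (A : set 'cV[R]_n) : measurable A ->
  lebesgue_n n ((fun y => x - y) @^-1` A) = lebesgue_n n A.
Proof.
elim: n x A => [|n IH] x A mA.
  rewrite (_ : (fun y => x - y) @^-1` A = A)//.
  by apply/seteqP; split => y /=; rewrite (_ : x - y = y)//; apply/colP => -[].
pose phi (p : measurableTypeR R * 'cV[R]_n) : measurableTypeR R * 'cV[R]_n :=
  (x ord0 0 - p.1, tail x - p.2).
have mphi : measurable_fun setT phi.
  apply: measurable_fun_pair.
    exact: (measurableT_comp (sub_measurable1 (x ord0 0)) measurable_fst).
  exact: (measurableT_comp (sub_cV_measurable (tail x)) measurable_snd).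
pose nu : {measure set (measurableTypeR R * 'cV[R]_n) -> \bar R} :=
  measure_function.measure_function_pushforward__canonical__measure_function_Measure
    (lebesgue_measure \x lebesgue_n n)%E mphi.
have mB : measurable (@glue R n @^-1` A).
  by rewrite -[X in measurable X]setTI; exact: glue_measurable.
rewrite /= /pushforward; transitivity (nu (@glue R n @^-1` A)).
  rewrite /nu/= /pushforward; congr (product_measure1 _ _ _).
  by apply/seteqP; split => p /=; rewrite -[col_mx _ _]/(glue p) glue_sub.
rewrite -(@product_measure_unique _ _ _ _ _ lebesgue_measure (lebesgue_n n) nu)//.
move=> B C mB' mC; rewrite /nu/= /pushforward.
rewrite (_ : phi @^-1` (B `*` C) =
  (fun y : R => x ord0 0 - y) @^-1` B `*` (fun y => tail x - y) @^-1` C)//.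
rewrite product_measure1E//; first by congr (_ * _)%E; [exact: lebesgue_measure_reflect|exact: IH].
  by rewrite -[X in measurable X]setTI; exact: sub_measurable1.
by rewrite -[X in measurable X]setTI; exact: sub_cV_measurable.
Qed.

Lemma integral_reflect n (x : 'cV[R]_n) (f : 'cV[R]_n -> \bar R) :
  measurable_fun setT f -> (forall y, 0 <= f y)%E ->
  (\int[lebesgue_n n]_y f (x - y)%R = \int[lebesgue_n n]_y f y)%E.
Proof.
move=> mf f0.
transitivity (\int[pushforward (lebesgue_n n) (fun y => x - y)%R]_y f y)%E.
  by rewrite (ge0_integral_pushforward (sub_cV_measurable x)) // => y _; exact: f0.
apply: eq_measure_integral => [|? A mA _]; first exact: sub_cV_measurable.
exact: lebesgue_n_reflect.
Qed.

End reflection.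

Section lower_integral.
Context {R : realType} {n : nat}.
Variables (D : set 'cV[R]_n).
Hypotheses (mD : measurable D) (Doo : (lebesgue_n n D < +oo)%E).
Implicit Types (f h : 'cV[R]_n -> R).
Local Notation mu := (lebesgue_n n).

Definition bounded_meas f := measurable_fun D f /\ exists M, forall y, D y -> `|f y| <= M.

Lemma bounded_measD f h : bounded_meas f -> bounded_meas h ->
  bounded_meas (fun y => f y + h y).
Proof.
move=> [mf [M fM]] [mh [N hN]]; split; first exact: measurable_funD.
by exists (M + N) => y Dy; rewrite (le_trans (ler_normD _ _))// lerD ?fM ?hN.
Qed.

Lemma bounded_measM f h : bounded_meas f -> bounded_meas h ->
  bounded_meas (fun y => f y * h y).
Proof.
move=> [mf [M fM]] [mh [N hN]]; split; first exact: measurable_funM.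
by exists (M * N) => y Dy; rewrite normrM ler_pM ?fM ?hN.
Qed.

Lemma bounded_meas_cst c : bounded_meas (fun=> c).
Proof. by split => //; exists `|c|. Qed.

Lemma bounded_meas_integrable f : bounded_meas f -> mu.-integrable D (EFin \o f).
Proof.
move=> [mf [M fM]]; apply: measurable_bounded_integrable => //.
exists M; split; first exact: num_real.
by move=> N MN y Dy /=; rewrite (le_trans (fM y Dy))// ltW.
Qed.

(** The integral of a nonnegative function is a supremum over simple minorants,
    hence monotone for arbitrary f and h; the upper bound M keeps both integrals
    finite. *)
Lemma ge0_le_Rintegral f h M : (forall y, D y -> 0 <= f y <= h y) ->
  (forall y, D y -> h y <= M) ->
  \int[mu]_(y in D) f y <= \int[mu]_(y in D) h y.
Proof.
move=> fh hM.
have f0 y : D y -> (0 <= (f y)%:E)%E by move=> /fh/andP[? _]; rewrite lee_fin.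
have h0 y : D y -> (0 <= (h y)%:E)%E.
  by move=> /fh/andP[? ?]; rewrite lee_fin (le_trans _ (_ : f y <= _)).
have le_int (f1 f2 : 'cV[R]_n -> R) : (forall y, D y -> 0 <= f1 y) ->
    (forall y, D y -> f1 y <= f2 y) ->
    (\int[mu]_(y in D) (f1 y)%:E <= \int[mu]_(y in D) (f2 y)%:E)%E.
  move=> f10 f12; rewrite !ge0_integralE; last 2 first.
  - by move=> y Dy; rewrite lee_fin; exact: le_trans (f10 _ Dy) (f12 _ Dy).
  - by move=> y Dy; rewrite lee_fin; exact: f10.
  apply: ereal_sup_le => _ [g gf <-]; exists g => // y.
  apply: (le_trans (gf y)); rewrite /patch; case: ifPn => //.
  by rewrite inE lee_fin => /f12.
have hoo : (\int[mu]_(y in D) (h y)%:E < +oo)%E.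
  apply: (@le_lt_trans _ _ (\int[mu]_(y in D) (cst M%:E y))%E).
    by apply: le_int => // y Dy; rewrite -lee_fin h0.
  case: (pselect (exists y, D y)) => [[y Dy]|nD]; last first.
    by rewrite (_ : D = set0) ?integral_set0//; apply/seteqP; split=> // z Dz; exfalso; apply: nD; exists z.
  have M0 : 0 <= M by rewrite (le_trans _ (hM _ Dy))// -lee_fin h0.
  by rewrite (integral_cst mu mD) lte_mul_pinfty.
apply: fine_le; [| |exact: le_int (fun y Dy => (andP (fh y Dy)).1) (fun y Dy => (andP (fh y Dy)).2)].
- rewrite ge0_fin_numE ?integral_ge0//; apply: le_lt_trans hoo.
  by apply: le_int => y /fh/andP[].
- by rewrite ge0_fin_numE ?integral_ge0.
Qed.

Lemma bounded_meas_limit (f : nat -> 'cV[R]_n -> R) h (M : R) :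
  (forall k, measurable_fun D (f k)) ->
  (forall k y, D y -> `|f k y| <= M) ->
  (forall y, D y -> f ^~ y @ \oo --> h y) ->
  bounded_meas h /\
  (fun k => \int[mu]_(y in D) f k y) @ \oo --> \int[mu]_(y in D) h y.
Proof.
move=> mf fM fh.
have hM y : D y -> `|h y| <= M.
  move=> Dy; have cv : `|f k y| @[k --> \oo] --> `|h y| by apply: cvg_norm; exact: fh.
  rewrite -(cvg_lim _ cv)//; apply: limr_le; first exact: cvgP cv.
  by apply: nearW => k; exact: fM.
have mh : measurable_fun D h by exact: (@measurable_fun_cvg _ _ _ D f h).
split; first by split=> //; exists M.
have fE y : D y -> (fun k => (f k y)%:E) @ \oo --> (h y)%:E.
  by move=> Dy; apply: cvg_EFin; [exact: nearW|exact: fh].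
have [_ _ cv] := @dominated_convergence _ _ R mu D mD
  (fun k y => (f k y)%:E) (fun y => (h y)%:E) (fun=> M%:E)
  (fun k => (measurable_EFinP _ _).2 (mf k)) ((measurable_EFinP _ _).2 mh)
  (aeW _ fE) (bounded_meas_integrable (bounded_meas_cst M))
  (aeW _ (fun y k Dy => fM k y Dy)).
apply: fine_cvg.
rewrite fineK//; apply: integrable_fin_num => //.
by apply: bounded_meas_integrable; split => //; exists M.
Qed.

Import HBNNSimple.
(** For slices of solutions: if no measurable minorant has mass, the nonlocal term
    vanishes. *)
Lemma Rintegral_no_minorant f (M : R) : (forall y, D y -> 0 <= f y <= M) ->
  (forall h, bounded_meas h -> (forall y, D y -> 0 <= h y <= f y) ->
     \int[mu]_(y in D) h y <= 0) ->
  \int[mu]_(y in D) f y = 0.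
Proof.
move=> fM hf.
have f0 y : D y -> (0 <= (f y)%:E)%E by move=> /fM/andP[? _]; rewrite lee_fin.
rewrite /Rintegral (_ : integral _ _ _ = 0%E)//; apply/eqP.
rewrite eq_le integral_ge0// andbT ge0_integralE//.
apply: ge_ereal_sup => _ [g gf <-].
have gD y : g y = ((g : _ -> R) \_ D) y.
  rewrite /patch; case: ifPn => // /negP yD; apply/eqP; rewrite eq_le fun_ge0 andbT.
  by have := gf y; rewrite /patch; case: ifPn => [/yD//|_]; rewrite lee_fin.
rewrite (eq_sintegral _ _ gD) -integral_nnsfun//.
have gfD y : D y -> 0 <= g y <= f y.
  by move=> Dy; rewrite fun_ge0/=; have := gf y; rewrite /patch mem_set// lee_fin.
have bg : bounded_meas g.
  split; first exact: measurable_funTS.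
  exists M => y Dy; have /andP[g0 gfy] := gfD y Dy.
  by rewrite ger0_norm// (le_trans gfy)//; have /andP[] := fM y Dy.
have := hf _ bg gfD; rewrite /Rintegral => fi.
by rewrite -[X in (X <= _)%E]fineK ?lee_fin//; apply: integrable_fin_num => //; exact: bounded_meas_integrable.
Qed.

End lower_integral.

(** * Differential inequalities and cooperative systems *)

Section trajectories.
Context {R : realType}.
Implicit Types (a b c e s t : R) (f g : R -> R).

Definition traj a b f f' :=
  {within `[a, b], continuous f} /\ forall t, a < t < b -> is_derive t 1 f (f' t).

Lemma derive_traj a b f f' :
  (forall t, a <= t <= b -> is_derive t 1 f (f' t)) -> traj a b f f'.
Proof.
move=> df; split; last by move=> t /andP[a_t t_b]; apply: df; rewrite !ltW.
apply: derivable_within_continuous => t; rewrite in_itv/= => /df[]//.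
Qed.

Lemma traj_sub a b a' b' f f' : a <= a' -> b' <= b -> traj a b f f' -> traj a' b' f f'.
Proof.
move=> aa bb [cf df]; split => [|t /andP[at_ tb]].
  apply: continuous_subspaceW cf; apply: subset_itv; rewrite bnd_simp//.
by apply: df; rewrite (le_lt_trans aa)//= (lt_le_trans tb).
Qed.

Lemma traj_lin a b f f' g g' (k : R) : traj a b f f' -> traj a b g g' ->
  traj a b (fun t => f t + k * g t) (fun t => f' t + k * g' t).
Proof.
move=> [cf df] [cg dg]; split => [x|t tab].
  by apply: cvgD; [exact: cf|apply: cvgM; [exact: cvg_cst|exact: cg]].
have ? := df t tab; have ? := dg t tab.
apply: is_derive_eq; rewrite /GRing.scale/=; ring.
Qed.

Lemma traj_exp a b (k l s : R) :
  traj a b (fun t => k * expR (l * (t - s))) (fun t => l * (k * expR (l * (t - s)))).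
Proof.
apply: derive_traj => t _; apply: is_derive_eq; rewrite /GRing.scale/=; ring.
Qed.

Lemma traj_mul a b f f' g g' : traj a b f f' -> traj a b g g' ->
  traj a b (fun t => f t * g t) (fun t => f' t * g t + f t * g' t).
Proof.
move=> [cf df] [cg dg]; split => [x|t tab].
  by apply: cvgM; [exact: cf|exact: cg].
have ? := df t tab; have ? := dg t tab.
apply: is_derive_eq; rewrite /GRing.scale/=; ring.
Qed.

Lemma traj_sum a b (I : Type) (r : seq I) (P : pred I) (p p' : I -> R -> R) :
  (forall i, traj a b (p i) (p' i)) ->
  traj a b (fun t => \sum_(i <- r | P i) p i t) (fun t => \sum_(i <- r | P i) p' i t).
Proof.
move=> H; elim: r => [|i r IH].
  under [X in traj _ _ X]eq_fun do rewrite big_nil.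
  under [X in traj _ _ _ X]eq_fun do rewrite big_nil.
  by apply: derive_traj => t _; exact: is_derive_cst.
under [X in traj _ _ X]eq_fun do rewrite big_cons.
under [X in traj _ _ _ X]eq_fun do rewrite big_cons.
case: (P i) => //.
have := traj_lin 1 (H i) IH.
by under [X in traj _ _ X]eq_fun do rewrite mul1r;
  under [X in traj _ _ _ X]eq_fun do rewrite mul1r.
Qed.

Lemma traj_nondecr a b f f' : a <= b -> traj a b f f' ->
  (forall t, a < t < b -> 0 <= f' t) -> f a <= f b.
Proof.
rewrite le_eqVlt => /orP[/eqP->//|ab] [cf df] f'0.
have dfI x : x \in `]a, b[ -> is_derive x 1 f (f' x) by rewrite in_itv/=; exact: df.
have [t + H] := MVT ab dfI cf; rewrite in_itv/= => tab.
by rewrite -subr_ge0 H mulr_ge0 ?f'0 ?subr_ge0 ?ltW.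
Qed.

(** Variation of constants: multiply f - e/c by e^{c t} and use
    monotonicity. *)
Lemma exp_lower a b f f' c e : a <= b -> 0 < c -> traj a b f f' ->
  (forall t, a < t < b -> e <= f' t + c * f t) ->
  e / c + expR (- (c * (b - a))) * (f a - e / c) <= f b.
Proof.
move=> ab c0 tf H.
have tC : traj a b (fun=> e / c) (fun=> 0).
  by apply: derive_traj => t _; exact: is_derive_cst.
have tE := traj_mul (traj_exp a b 1 c a) (traj_lin (-1) tf tC).
have /(traj_nondecr ab tE) : forall t, a < t < b ->
    0 <= c * (1 * expR (c * (t - a))) * (f t + -1 * (e / c)) +
         1 * expR (c * (t - a)) * (f' t + -1 * 0).
  move=> t tab; have -> : c * (1 * expR (c * (t - a))) * (f t + -1 * (e / c)) +
      1 * expR (c * (t - a)) * (f' t + -1 * 0) =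
      expR (c * (t - a)) * (f' t + c * f t - c * (e / c)) by ring.
  by rewrite mulr_ge0 ?expR_ge0// [c * (e / c)]mulrC divfK ?gt_eqF// subr_ge0; exact: H.
rewrite subrr mulr0 expR0 !mul1r !mulN1r expRN => HH.
have E0 := expR_gt0 (c * (b - a)).
by rewrite -lerBrDl ler_pdivrMl.
Qed.

(** Infinite systems (J is an arbitrary index type, later the points of a set
    and the components) admit no first exit time. Instead, the lower bound
    -N e^{lam (t-a)} with lam = 2L - c improves to one with N/2, so N can be halved
    indefinitely. The last hypothesis says that the right-hand side depends
    monotonically on p, up to the rate L. *)
Lemma comparison (J : Type) a b (p p' : R -> J -> R) c L B : 0 < L ->
  (forall j, traj a b (p ^~ j) (p' ^~ j)) ->
  (forall j, 0 <= p a j) ->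
  (forall t j, a <= t <= b -> - B <= p t j) ->
  (forall t N, a < t < b -> 0 <= N -> (forall j, - N <= p t j) ->
     forall j, - (L * N) <= p' t j + c * p t j) ->
  forall t j, a <= t <= b -> 0 <= p t j.
Proof.
move=> L0 tp p0 pB H; pose lam := 2 * L - c.
(* the weighted lower bound halves at each pass *)
have half N : 0 <= N -> (forall t j, a <= t <= b -> - (N * expR (lam * (t - a))) <= p t j) ->
    forall t j, a <= t <= b -> - (N / 2 * expR (lam * (t - a))) <= p t j.
  move=> N0 HN t j /andP[a_t t_b].
  have tq := traj_lin 1 (traj_sub (lexx a) t_b (tp j)) (traj_exp a t (N / 2) lam a).
  have tr := traj_mul (traj_exp a t 1 c a) tq.
  have /(traj_nondecr a_t tr) : forall r, a < r < t ->
    0 <= c * (1 * expR (c * (r - a))) * (p r j + 1 * (N / 2 * expR (lam * (r - a)))) +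
         1 * expR (c * (r - a)) * (p' r j + 1 * (lam * (N / 2 * expR (lam * (r - a))))).
    move=> r /andP[ar rt].
    have arb : a < r < b by rewrite ar (lt_le_trans rt).
    have NE : 0 <= N * expR (lam * (r - a)) by rewrite mulr_ge0// expR_ge0.
    have HNr k : - (N * expR (lam * (r - a))) <= p r k.
      by apply: HN; rewrite ltW//= ltW// (lt_le_trans rt).
    have := H r _ arb NE HNr j.
    set E := expR (lam * (r - a)); set F := expR (c * (r - a)) => HH.
    have -> : c * (1 * F) * (p r j + 1 * (N / 2 * E)) + 1 * F * (p' r j + 1 * (lam * (N / 2 * E)))
     = F * (p' r j + c * p r j + L * (N * E)).
      by rewrite /lam; field.
    by rewrite mulr_ge0 ?expR_ge0// -lerBlDr sub0r.
  rewrite subrr !mulr0 expR0 !mul1r mulr1 => HH.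
  have F0 := expR_gt0 (c * (t - a)).
  rewrite -subr_ge0 opprK -(pmulr_rge0 _ F0); apply: le_trans HH.
  by rewrite addr_ge0// divr_ge0.
pose N0 := `|B| * expR (`|lam| * (b - a)).
have HN0 t j : a <= t <= b -> - (N0 * expR (lam * (t - a))) <= p t j.
  move=> /andP[a_t t_b]; apply: (@le_trans _ _ (- `|B|)); last first.
    by apply: (le_trans _ (pB t j _)); rewrite ?a_t// lerN2 ler_norm.
  rewrite lerN2 /N0 -mulrA -expRD ler_peMr// -expR0 ler_expR.
  have : - (`|lam| * (t - a)) <= lam * (t - a).
    by rewrite -mulNr ler_wpM2r ?subr_ge0// lerNl ler_normr lexx orbT.
  have : `|lam| * (t - a) <= `|lam| * (b - a) by rewrite ler_wpM2l// lerD2r.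
  lra.
have HNk k t j : a <= t <= b -> - (N0 / 2 ^+ k * expR (lam * (t - a))) <= p t j.
  elim: k t j => [|k IH] t j; first by rewrite expr0 divr1; exact: HN0.
  rewrite exprSr invfM mulrA; apply: half => //.
  by rewrite divr_ge0 ?exprn_ge0// mulr_ge0// expR_ge0.
move=> t j tab; rewrite leNgt; apply/negP => pneg.
set C := N0 * expR (lam * (t - a)).
have C0 : 0 <= C by rewrite mulr_ge0 ?expR_ge0// mulr_ge0// expR_ge0.
have [k Hk] : exists k : nat, C / 2 ^+ k < - p t j.
  have p0' : 0 < - p t j by rewrite oppr_gt0.
  have /ltr_add_invr[k] : 0 < - p t j / (C + 1) by rewrite divr_gt0// ltr_wpDl.
  rewrite add0r => Hk; exists k.+1.
  have C1 : 0 < C + 1 by rewrite ltr_wpDl.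
  move: Hk; rewrite ltr_pdivlMr// => Hk; apply: le_lt_trans Hk.
  rewrite mulrC; apply: ler_pM => //; rewrite ?invr_ge0 ?exprn_ge0 ?lerDl//.
  rewrite lef_pV2 ?posrE ?exprn_gt0//.
  by rewrite -natrX ler_nat; exact: ltnW (ltn_expl k.+1 (isT : 1 < 2)%N).
by have := HNk k t j tab; rewrite mulrAC -/C; lra.
Qed.

Lemma expR_lt1 (x : R) : 0 < x -> expR (- x) < 1.
Proof. by move=> x0; rewrite -expR0 ltr_expR oppr_lt0. Qed.

(** A periodic supersolution of f' + c f = e has no initial value to remember:
    over one period [exp_lower] compares f(t) with itself. *)
Lemma periodic_lower (T : R) f f' c e : 0 < T -> 0 < c ->
  (forall t, f (t + T) = f t) ->
  (forall t, is_derive t 1 f (f' t)) ->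
  (forall t, e <= f' t + c * f t) -> forall t, e / c <= f t.
Proof.
move=> T0 c0 fT df H t.
have tf : traj t (t + T) f f' by apply: derive_traj.
have tT : t <= t + T by rewrite lerDl ltW.
have := exp_lower tT c0 tf (fun r _ => H r); rewrite fT.
have -> : t + T - t = T by ring.
have E1 : expR (- (c * T)) < 1 by rewrite expR_lt1// mulr_gt0.
set E := expR _ in E1 * => HH.
have : 0 <= (1 - E) * (f t - e / c) by lra.
by rewrite pmulr_rge0 ?subr_ge0// subr_gt0.
Qed.

(** A subset that grows strictly until it is everything exhausts a finite type in
    #|I| steps. Used twice: for the components of the system and for the balls of a
    cover of Omega. *)
Lemma infection (I : finType) (P : nat -> {set I} -> Prop) :
  (exists A, P 0%N A /\ A != finset.set0) ->
  (forall k A, P k A -> A != finset.set0 -> exists B : {set I},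
     [/\ P k.+1 B, A \subset B & A != [set: I]%SET -> A != B]) ->
  P #|I| [set: I]%SET.
Proof.
move=> [A0 [P0 A0n]] step.
have H k : exists A, [/\ P k A, A != finset.set0 &
    (k < #|A|)%N \/ A = [set: I]%SET].
  elim: k => [|k [A [PA An Ak]]].
    by exists A0; split=> //; left; rewrite card_gt0.
  have [B [PB AB ABn]] := step k A PA An.
  exists B; split=> //.
    by apply: contraNneq An => B0; rewrite -finset.subset0 -B0.
  case: (eqVneq A [set: I]%SET) => [AT|/[dup] AT /ABn nAB].
    by right; apply/eqP; rewrite -finset.subTset -AT.
  case: Ak => [kA|/eqP]; last by rewrite (negbTE AT).
  left; apply: (leq_ltn_trans kA); apply: proper_card.
  by rewrite finset.properEneq nAB.
have [A [PA _ [kA|<-//]]] := H #|I|.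
by have := leq_trans kA (max_card (mem A)); rewrite ltnn.
Qed.

(** Uniform irreducibility: no matter how the indices are split, the coupling
    between the two parts is at least b0. *)
Definition irreducible_at m (b0 : R) (beta : 'I_m -> 'I_m -> R) :=
  (forall i k, i != k -> 0 <= beta i k) /\
  (forall S : {set 'I_m}, S != finset.set0 -> S != [set: 'I_m]%SET ->
     exists i k, [/\ i \in S, k \notin S & b0 <= beta i k]).

(** Over a time step h the components in A keep a fixed fraction of their level,
    and the sum of the components outside A is fed by the edge that irreducibility
    provides. The edge may change with time, so only the sum is controlled, and then
    one of its terms is large at the end of the step. *)
Lemma harnack_step m (c b0 h : R) : 0 < c -> 0 < b0 -> 0 < h ->
  exists rho kap : R, [/\ 0 < rho, rho <= 1, 0 < kap &
  forall (p p' : R -> 'I_m -> R) beta s eps a (A : {set 'I_m}),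
  (forall i, traj s (s + h) (p ^~ i) (p' ^~ i)) ->
  (forall t i, s <= t <= s + h -> 0 <= p t i) ->
  (forall t i, s < t < s + h ->
    - (c * p t i) + \sum_(k | k != i) beta t i k * p t k - eps <= p' t i) ->
  (forall t, s < t < s + h -> irreducible_at b0 (beta t)) ->
  0 <= eps <= kap * a -> (forall i, i \in A -> a <= p s i) -> 0 <= a ->
  A != finset.set0 ->
  exists B : {set 'I_m}, [/\ forall i, i \in B -> rho * a <= p (s + h) i,
    A \subset B & A != [set: 'I_m]%SET -> A != B]].
Proof.
move=> c0 b00 h0; pose E := expR (- (c * h)).
have E0 : 0 < E by exact: expR_gt0.
have E1 : E < 1 by rewrite expR_lt1// mulr_gt0.
have m0 : 0 < m.+1%:R :> R by rewrite ltr0n.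
pose r1 := b0 * E / 4 / c * (1 - E) / m.+1%:R.
have r10 : 0 < r1 by rewrite !mulr_gt0 ?invr_gt0// subr_gt0.
pose k1 := b0 * E / 4 / m.+1%:R.
have k10 : 0 < k1 by rewrite !mulr_gt0 ?invr_gt0.
pose rho := Num.min (E / 2) r1; pose kap := Num.min (c * E / 2) k1.
exists rho, kap; split.
- by rewrite lt_min r10 andbT divr_gt0.
- by rewrite ge_min; apply/orP; left; lra.
- by rewrite lt_min k10 andbT divr_gt0// mulr_gt0.
move=> p p' beta s eps a A tp p0 H irr /andP[eps0 epsk] pA a0 An.
have sh : s <= s + h by rewrite lerDl ltW.
have eps1 : eps <= c * E / 2 * a.
  by apply: (le_trans epsk); rewrite ler_wpM2r// ge_min lexx.
have eps2 : eps <= k1 * a.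
  by apply: (le_trans epsk); rewrite ler_wpM2r// ge_min lexx orbT.
have pk_ge0 t i : s < t < s + h -> 0 <= \sum_(k | k != i) beta t i k * p t k.
  move=> st; apply: sumr_ge0 => k ki; rewrite mulr_ge0//.
    by have [H1 _] := irr t st; apply: H1; rewrite eq_sym.
  by apply: p0; case/andP: st => *; rewrite !ltW.
(* the components already at level a stay above E * a / 2 *)
have keep i t : i \in A -> s <= t <= s + h -> E / 2 * a <= p t i.
  move=> iA /andP[st tsh].
  have tE : E <= expR (- (c * (t - s))) by rewrite ler_expR lerN2 ler_pM2l//; lra.
  have Hd r : s < r < t -> - eps <= p' r i + c * p r i.
    move=> /andP[sr rt]; have sr' : s < r < s + h by rewrite sr (lt_le_trans rt).
    by have := H r i sr'; have := pk_ge0 r i sr'; lra.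
  have := exp_lower st c0 (traj_sub (lexx s) tsh (tp i)) Hd.
  set F := expR _ in tE * => HH.
  have F1 : F <= 1 by rewrite /F -expR0 ler_expR oppr_le0 mulr_ge0 ?subr_ge0// ltW.
  have epc : eps / c <= E / 2 * a.
    by rewrite ler_pdivrMr//; apply: (le_trans eps1); lra.
  have psa := pA i iA.
  have : E * a <= F * p s i by apply: ler_pM => //; exact: ltW.
  have : 0 <= F * (eps / c) by rewrite mulr_ge0 ?expR_ge0// divr_ge0// ltW.
  lra.
have keepB i : i \in A -> rho * a <= p (s + h) i.
  move=> iA; apply: le_trans (keep i (s + h) iA _); last by rewrite sh lexx.
  by rewrite ler_wpM2r// ge_min lexx.
case: (eqVneq A [set: 'I_m]%SET) => [AT|AT].
  by exists A; split => //; rewrite AT eqxx.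
(* a component outside A is fed through an edge of the irreducible matrix *)
have [i iA ri] : exists2 i, i \notin A & rho * a <= p (s + h) i.
  have tP := traj_sum (index_enum 'I_m) (fun i => i \notin A) tp.
  have P0 : 0 <= \sum_(i | i \notin A) p s i.
    by apply: sumr_ge0 => i _; apply: p0; rewrite lexx.
  have Hd t : s < t < s + h -> b0 * E / 4 * a <=
      \sum_(i | i \notin A) p' t i + c * \sum_(i | i \notin A) p t i.
    move=> st; have [b0p irrS] := irr t st.
    have [i [k [iA kA bik]]] : exists i k,
        [/\ i \in ~: A, k \notin ~: A & b0 <= beta t i k].
      apply: irrS; first by rewrite -finset.setCT (inj_eq (can_inj (@finset.setCK _))).
      by rewrite -finset.setC0 (inj_eq (can_inj (@finset.setCK _))).
    rewrite finset.in_setC in iA; rewrite finset.in_setC negbK in kA.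
    have ik : k != i by apply: contraNneq iA => <-.
    pose x i := \sum_(k | k != i) beta t i k * p t k.
    have xi : b0 * (E / 2 * a) <= x i.
      rewrite /x (bigD1 k)//=; apply: (@le_trans _ _ (beta t i k * p t k)).
        apply: ler_pM => //; [exact: ltW|by rewrite mulr_ge0// divr_ge0// ltW|].
        by apply: keep => //; case/andP: st => *; rewrite !ltW.
      rewrite lerDl; apply: sumr_ge0 => l /andP[li _].
      rewrite mulr_ge0//; first by apply: b0p; rewrite eq_sym.
      by apply: p0; case/andP: st => *; rewrite !ltW.
    have : \sum_(i | i \notin A) (x i - eps) <=
        \sum_(i | i \notin A) p' t i + c * \sum_(i | i \notin A) p t i.
      rewrite mulr_sumr -big_split/=; apply: ler_sum => l _.
      by have := H t l st; rewrite -/(x l); lra.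
    apply: le_trans; rewrite sumrB.
    have xs : x i <= \sum_(l | l \notin A) x l.
      by rewrite (bigD1 i)//= lerDl; apply: sumr_ge0 => l _; exact: pk_ge0.
    have es : \sum_(l | l \notin A) eps <= m.+1%:R * eps.
      rewrite sumr_const -[X in X <= _]mulr_natl ler_wpM2r//.
      by rewrite ler_nat (leq_trans (max_card _))// card_ord.
    have : m.+1%:R * eps <= b0 * E / 4 * a.
      apply: (@le_trans _ _ (m.+1%:R * (k1 * a))); first by rewrite ler_wpM2l.
      by rewrite /k1 le_eqVlt; apply/orP; left; apply/eqP; field; rewrite gt_eqF.
    lra.
  have := exp_lower sh c0 tP Hd.
  rewrite (_ : s + h - s = h); last by ring.
  rewrite -/E => HP.
  have {}HP : m.+1%:R * (r1 * a) <= \sum_(i | i \notin A) p (s + h) i.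
    apply: le_trans HP; rewrite mulrBr.
    have -> : m.+1%:R * (r1 * a) = b0 * E / 4 * a / c * (1 - E).
      by rewrite /r1; field; rewrite !gt_eqF.
    have : 0 <= E * \sum_(i | i \notin A) p s i by rewrite mulr_ge0// ltW.
    lra.
  have [/existsP[i /andP[iA ri]]|] := boolP [exists i, (i \notin A) && (rho * a <= p (s + h) i)].
    by exists i.
  rewrite negb_exists => /forallP nri.
  have [i iA] : exists i, i \notin A.
    by apply/existsP; rewrite -negb_forall; apply: contra AT => /forallP AA; apply/eqP/setP => i; rewrite AA finset.inE.
  have [a00|a00] := eqVneq a 0.
    by exists i; rewrite // a00 mulr0 p0// sh lexx.
  exfalso; have : \sum_(i | i \notin A) p (s + h) i <= m%:R * (r1 * a).
    apply: (@le_trans _ _ (\sum_(i | i \notin A) (r1 * a))).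
      apply: ler_sum => l lA; have := nri l; rewrite lA/= -ltNge => /ltW/le_trans; apply.
      by rewrite ler_wpM2r// ge_min lexx orbT.
    rewrite sumr_const -[X in X <= _]mulr_natl ler_wpM2r//.
      by rewrite mulr_ge0// ltW.
    by rewrite ler_nat (leq_trans (max_card _))// card_ord.
  have ra : 0 < r1 * a by rewrite mulr_gt0// lt_def a00.
  move=> /(le_trans HP); by rewrite ler_pM2r// ler_nat ltnn.
exists (i |: A); split=> [l|  |].
- by rewrite finset.in_setU1 => /orP[/eqP->//|]; exact: keepB.
- exact: finset.subsetUr.
- by move=> _; apply: contraNneq iA => ->; rewrite finset.setU11.
Qed.

(** Cut the interval into as many steps as there are components and let the set of
    components above the (decreasing) level grow at each of them. *)
Lemma local_harnack m (c b0 tau : R) : 0 < c -> 0 < b0 -> 0 < tau ->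
  exists rho kap : R, [/\ 0 < rho, 0 < kap &
  forall (p p' : R -> 'I_m -> R) beta s eps a j,
  (forall i, traj s (s + tau) (p ^~ i) (p' ^~ i)) ->
  (forall t i, s <= t <= s + tau -> 0 <= p t i) ->
  (forall t i, s < t < s + tau ->
    - (c * p t i) + \sum_(k | k != i) beta t i k * p t k - eps <= p' t i) ->
  (forall t, s < t < s + tau -> irreducible_at b0 (beta t)) ->
  0 <= eps <= kap * a -> a <= p s j -> 0 <= a ->
  forall i, rho * a <= p (s + tau) i].
Proof.
move=> c0 b00 tau0; case: m => [|m].
  by exists 1, 1; split=> // p p' beta s eps a [].
pose h := tau / m.+1%:R.
have h0 : 0 < h by rewrite divr_gt0// ltr0n.
have [r [k [r0 r1 k0 step]]] := @harnack_step m.+1 c b0 h c0 b00 h0.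
exists (r ^+ m.+1), (k * r ^+ m.+1); split; rewrite ?mulr_gt0 ?exprn_gt0//.
move=> p p' beta s eps a j tp p0 H irr /andP[eps0 epsk] pa a0 i.
pose P l (A : {set 'I_m.+1}) := (l <= m.+1)%N ->
  forall i, i \in A -> r ^+ l * a <= p (s + l%:R * h) i.
have hm : m.+1%:R * h = tau by rewrite /h mulrC divfK// pnatr_eq0.
suff : P m.+1 [set: 'I_m.+1]%SET.
  by move=> /(_ (leqnn _) i); rewrite hm; apply; rewrite finset.inE.
rewrite -{1}[m.+1]card_ord; apply: infection.
  exists [set j]%SET; split; last by rewrite -finset.card_gt0 finset.cards1.
  by move=> _ l; rewrite finset.in_set1 mul0r addr0 expr0 mul1r => /eqP->.
move=> l A PA An; case: (ltnP m l) => [ml|lm].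
  exists [set: 'I_m.+1]%SET; split=> // /leq_trans/(_ ml).
  by rewrite ltnn.
have ls t : s + l%:R * h <= t <= s + l%:R * h + h -> s <= t <= s + tau.
  have : 0 <= l%:R * h by rewrite mulr_ge0// ltW.
  have : l.+1%:R * h <= tau by rewrite -hm ler_pM2r// ler_nat.
  rewrite -natr1 mulrDl mul1r => *; lra.
have ls' t : s + l%:R * h < t < s + l%:R * h + h -> s < t < s + tau.
  have : 0 <= l%:R * h by rewrite mulr_ge0// ltW.
  have : l.+1%:R * h <= tau by rewrite -hm ler_pM2r// ler_nat.
  rewrite -natr1 mulrDl mul1r => *; lra.
have [||||||||B [HB AB ABn]] := step p p' beta (s + l%:R * h) eps (r ^+ l * a) A.
- move=> q; apply: traj_sub (tp q).
  + by have := ls (s + l%:R * h); lra.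
  + by have := ls (s + l%:R * h + h); lra.
- by move=> t q /ls; exact: p0.
- by move=> t q /ls'; exact: H.
- by move=> t /ls'; exact: irr.
- rewrite eps0 (le_trans epsk)// -mulrA ler_wpM2l ?(ltW k0)// ler_wpM2r//.
  by apply: ler_wiXn2l => //; [exact: ltW|exact: leqW].
- by apply: PA; exact: ltnW.
- by rewrite mulr_ge0// exprn_ge0// ltW.
- by [].
exists B; split=> // _ q /HB; rewrite exprS -mulrA; congr (_ <= p _ q).
by rewrite -natr1; ring.
Qed.

(** The sum of the components is a periodic supersolution with right-hand side e0,
    so some component is at least of size e0; [local_harnack] over one period carries
    the bound to all of them. This converts a strict inequality, however weak and
    however distributed over the components, into a uniform gap. *)
Lemma periodic_harnack m (c b0 tau : R) : 0 < c -> 0 < b0 -> 0 < tau ->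
  exists rho kap : R, [/\ 0 < rho, 0 < kap &
  forall (p p' : R -> 'I_m -> R) beta eps e0,
  (forall t i, p (t + tau) i = p t i) ->
  (forall t i, is_derive t 1 (p ^~ i) (p' t i)) ->
  (forall t i, 0 <= p t i) ->
  (forall t i, - (c * p t i) + \sum_(k | k != i) beta t i k * p t k - eps <= p' t i) ->
  (forall t, irreducible_at b0 (beta t)) ->
  (forall t, e0 <= \sum_i (p' t i + c * p t i)) ->
  0 <= eps <= kap * e0 ->  0 <= e0 ->
  forall t i, rho * e0 <= p t i].
Proof.
move=> c0 b00 tau0; have [r [k [r0 k0 H]]] := @local_harnack m c b0 tau c0 b00 tau0.
have cm0 : 0 < (c * m.+1%:R)^-1 by rewrite invr_gt0 mulr_gt0.
exists (r / (c * m.+1%:R)), (k / (c * m.+1%:R)); split; try exact: mulr_gt0.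
move=> p p' beta eps e0 pT dp p0 Hp irr He /andP[eps0 epsk] e00 t i.
have tp a b l : traj a b (p ^~ l) (p' ^~ l).
  by apply: derive_traj.
have [j pj] : exists j, e0 / (c * m.+1%:R) <= p t j.
  apply/existsP; apply: contraT; rewrite negb_exists => /forallP np.
  have [e0E|e0E] := eqVneq e0 0.
    by have := np i; rewrite e0E mul0r p0.
  have e0p : 0 < e0 by rewrite lt_def e0E.
  have Pd s : is_derive s 1 (fun s => \sum_l p s l) (\sum_l p' s l).
    have [_ /(_ s)] := traj_sum (index_enum 'I_m) predT (tp (s - 1) (s + 1)).
    by apply; lra.
  have PT s : \sum_l p (s + tau) l = \sum_l p s l by apply: eq_bigr => l _.
  have He' s : e0 <= \sum_l p' s l + c * \sum_l p s l.
    by rewrite mulr_sumr -big_split; exact: He.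
  have := periodic_lower tau0 c0 PT Pd He' t.
  have : \sum_l p t l <= \sum_(l < m) (e0 / (c * m.+1%:R)).
    by apply: ler_sum => l _; have := np l; rewrite -ltNge => /ltW.
  rewrite sumr_const card_ord -[X in _ <= X]mulr_natl => h1 h2.
  have := le_trans h2 h1; rewrite (_ : m%:R * _ = e0 / c * (m%:R / m.+1%:R)); last first.
    have key (M N : R) : N != 0 -> M * (e0 / (c * N)) = e0 / c * (M / N).
      by move=> N0; field; rewrite N0 gt_eqF.
    by apply: key; rewrite pnatr_eq0.
  by rewrite ler_pMr ?divr_gt0// ler_pdivlMr ?ltr0n// mul1r ler_nat ltnn.
have -> : t = t - tau + tau by ring.
have -> : r / (c * m.+1%:R) * e0 = r * (e0 / (c * m.+1%:R)) by ring.
apply: (H p p' beta (t - tau) eps _ j) => //.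
- by rewrite eps0 (le_trans epsk)// mulrA mulrAC.
- by rewrite -pT subrK.
- by rewrite divr_ge0// mulr_ge0// ltW.
Qed.
End trajectories.

Lemma traj_ext {R : realType} (a b : R) (f f' q q' : R -> R) : f =1 q -> f' =1 q' -> traj a b f f' -> traj a b q q'.
Proof. by move=> /funext -> /funext ->. Qed.

(** * Continuity and compactness *)

Section cont_on.
Context {R : realType}.
Implicit Types X Y : pseudoMetricType R.

(** Continuity relative to A in epsilon-delta form, which avoids the subspace
    topology in the estimates below. *)
Definition cont_on X (A : set X) (f : X -> R) :=
  forall p, A p -> forall e, 0 < e ->
    exists2 r, 0 < r & forall q, A q -> ball p r q -> `|f p - f q| < e.

Lemma within_cont_on X (A : set X) (f : X -> R) :
  {within A, continuous f} <-> cont_on A f.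
Proof.
rewrite subspace_continuousP; split=> [cf p Ap e e0|cf p Ap].
  have /cvgrPdist_lt/(_ e e0) := cf p Ap.
  rewrite near_withinE => /nbhs_ballP[r /= r0 rf]; exists r => // q Aq pq.
  exact: rf.
apply/cvgrPdist_lt => e e0; have [r r0 rf] := cf p Ap e e0.
rewrite near_withinE; apply/nbhs_ballP; exists r => //= q pq Aq; exact: rf.
Qed.

Lemma cont_onS X (A B : set X) f : B `<=` A -> cont_on A f -> cont_on B f.
Proof.
move=> BA cf p /BA Ap e e0; have [r r0 H] := cf p Ap e e0.
by exists r => // q /BA; exact: H.
Qed.

Lemma cont_onD X (A : set X) f g : cont_on A f -> cont_on A g ->
  cont_on A (fun p => f p + g p).
Proof.
move=> cf cg p Ap e e0; have e20 : 0 < e / 2 by rewrite divr_gt0.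
have [r r0 Hf] := cf p Ap _ e20; have [s s0 Hg] := cg p Ap _ e20.
exists (Num.min r s); first by rewrite lt_min r0.
move=> q Aq pq.
have /(Hf _ Aq) : ball p r q by apply: le_ball pq; rewrite ge_min lexx.
have /(Hg _ Aq) : ball p s q by apply: le_ball pq; rewrite ge_min lexx orbT.
rewrite (_ : f p + g p - _ = (f p - f q) + (g p - g q)); last by ring.
move=> h1 h2; apply: (le_lt_trans (ler_normD _ _)); lra.
Qed.

Lemma cont_onZ X (A : set X) f (k : R) : cont_on A f -> cont_on A (fun p => k * f p).
Proof.
move=> cf p Ap e e0; have k0 : 0 < `|k| + 1 by rewrite ltr_wpDl.
have [r r0 Hf] := cf p Ap (e / (`|k| + 1)) (divr_gt0 e0 k0).
exists r => // q Aq pq; rewrite -mulrBr normrM.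
have := Hf q Aq pq; rewrite ltr_pdivlMr// => h.
apply: le_lt_trans h; rewrite mulrC ler_wpM2l// lerDl//.
Qed.

Lemma cont_on_cst X (A : set X) (k : R) : cont_on A (fun=> k).
Proof. by move=> p Ap e e0; exists 1 => // q _ _; rewrite subrr normr0. Qed.

Lemma cont_on_sum X (A : set X) I (s : seq I) (P : pred I) (f : I -> X -> R) :
  (forall i, cont_on A (f i)) -> cont_on A (fun p => \sum_(i <- s | P i) f i p).
Proof.
move=> cf; elim: s => [|i s IH].
  by under [X in cont_on _ X]eq_fun do rewrite big_nil; exact: cont_on_cst.
under [X in cont_on _ X]eq_fun do rewrite big_cons.
by case: (P i) => //; exact: cont_onD.
Qed.

Lemma cont_on_comp X Y (A : set X) (B : set Y) f (phi : Y -> X) :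
  (forall q, B q -> A (phi q)) -> continuous phi -> cont_on A f ->
  cont_on B (f \o phi).
Proof.
move=> BA cphi cf q Bq e e0; have [r r0 Hf] := cf _ (BA q Bq) e e0.
have /cvg_ballP/(_ r r0) := cphi q.
move=> /nbhs_ballP[s /= s0 Hs]; exists s => // z Bz qz; apply: Hf; [exact: BA|exact: Hs].
Qed.

Lemma compact_pos_lower X (A : set X) f : compact A -> cont_on A f ->
  (forall p, A p -> 0 < f p) -> exists2 e : R, 0 < e & forall p, A p -> e <= f p.
Proof.
move=> /compact_near_coveringP cA cf f0.
have : \forall e \near (0 : R)^'+, A `<=` (fun p => A p -> e <= f p).
  apply: cA => p Ap; have fp0 := f0 p Ap.
  have fp2 : 0 < f p / 2 by rewrite divr_gt0.
  have [r r0 Hr] := cf p Ap _ fp2.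
  exists (ball p r, [set e : R | e < f p / 2]) => /=.
    by split; [exact: nbhsx_ballx|exact: nbhs_right_lt].
  move=> [q e] [/= pq ef] Aq; have := Hr q Aq pq.
  by rewrite ltr_norml => /andP[_]; lra.
move=> H; have [e [He e0]] : exists e : R, (A `<=` (fun p => A p -> e <= f p)) /\ 0 < e.
  by apply: (@filter_ex _ (0 : R)^'+); apply: filterI => //; exact: nbhs_right_gt.
by exists e => // p Ap; exact: He.
Qed.

Lemma compact_bound X (A : set X) f : compact A -> cont_on A f ->
  exists2 C : R, 0 < C & forall p, A p -> `|f p| <= C.
Proof.
move=> /compact_near_coveringP cA cf.
have : \forall C \near +oo, A `<=` (fun p => A p -> `|f p| <= C).
  apply: cA => p Ap; have [r r0 Hr] := cf p Ap 1 ltr01.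
  exists (ball p r, [set C : R | `|f p| + 1 < C]) => /=.
    by split; [exact: nbhsx_ballx|apply: nbhs_pinfty_gt; exact: num_real].
  move=> [q C] [/= pq fC] Aq; have h := Hr q Aq pq; apply: ltW; apply: lt_trans fC.
  rewrite -(subrK (f p) (f q)) addrC; apply: le_lt_trans (ler_normD _ _) _.
  by rewrite ltrD2l distrC.
move=> H; have [C [HC C0]] : exists C : R, (A `<=` (fun p => A p -> `|f p| <= C)) /\ 0 < C.
  by apply: (@filter_ex _ (+oo : set_system R)); apply: filterI => //; exact: nbhs_pinfty_gt.
by exists C => // p Ap; exact: HC.
Qed.

Lemma compact_unif_cont X (A : set X) f : compact A -> cont_on A f ->
  forall e, 0 < e -> exists2 r, 0 < r &
    forall p q, A p -> A q -> ball p r q -> `|f p - f q| < e.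
Proof.
move=> /compact_near_coveringP cA cf e e0; have e20 : 0 < e / 2 by rewrite divr_gt0.
have : \forall r \near (0 : R)^'+, A `<=` (fun p => A p -> forall q, A q -> ball p r q -> `|f p - f q| < e).
  apply: cA => p Ap; have [r r0 Hr] := cf p Ap _ e20.
  have r20 : 0 < r / 2 by rewrite divr_gt0.
  exists (ball p (r / 2), [set s : R | s < r / 2]) => /=.
    by split; [exact: nbhsx_ballx|exact: nbhs_right_lt].
  move=> [x s] [/= px sr] Ax q Aq xq.
  have h1 : ball p r x by apply: le_ball px; lra.
  have h2 : ball p r q.
    by rewrite (splitr r); apply: ball_triangle px _; apply: le_ball xq; exact: ltW.
  have := Hr x Ax h1; have := Hr q Aq h2 => a b.
  rewrite (_ : f x - f q = (f x - f p) + (f p - f q)); last by ring.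
  by apply: le_lt_trans (ler_normD _ _) _; rewrite distrC; lra.
move=> H; have [r [Hr r0]] : exists r : R, (A `<=` (fun p => A p -> forall q, A q -> ball p r q -> `|f p - f q| < e)) /\ 0 < r.
  by apply: (@filter_ex _ (0 : R)^'+); apply: filterI => //; exact: nbhs_right_gt.
by exists r => // p q Ap; exact: Hr.
Qed.

Lemma cV_compact n (A : set 'cV[R]_n) : bounded_set A -> closed A -> compact A.
Proof.
move=> bA clA.
have ctr p q : continuous (@trmx R p q).
  move=> x B [P xP PB]; exists (fun i j => P j i) => [i j|y Py].
    by have := xP j i; rewrite mxE.
  by apply: PB => i j; rewrite mxE; exact: Py.
have -> : A = [set trmx x | x in [set x : 'rV[R]_n | A x^T]].
  apply/seteqP; split => [x Ax|_ [x Ax <-]//]; exists x^T => /=; rewrite ?trmxK//.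
apply: continuous_compact; first by apply: continuous_subspaceT => x; exact: ctr.
apply: bounded_closed_compact.
  case: bA => M [Mr AM]; exists M; split => // N MN x Ax.
  apply: le_trans (AM N MN _ Ax).
  rewrite [leLHS]/Num.Def.normr/= mx_normrE; apply: bigmax_le => // -[i j] _ /=.
  have -> : x i j = x^T j i by rewrite mxE.
  rewrite [leRHS]/Num.Def.normr/= mx_normrE.
  exact: (le_bigmax _ (fun ij : 'I_n * 'I_1 => `|x^T ij.1 ij.2|) (j, i)).
by apply: closed_comp => // x _; exact: ctr.
Qed.

Lemma box_compact n (a b : 'cV[R]_n) : compact (box a b).
Proof.
apply: cV_compact; last exact: box_closed.
exists (`|a| + `|b|); split; first exact: num_real.
move=> N abN x xab; apply: ltW; apply: le_lt_trans abN.
rewrite [leLHS]/Num.Def.normr/= mx_normrE; apply: bigmax_le => [|[i j] _ /=].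
  by rewrite addr_ge0.
rewrite ord1; have := xab i; rewrite in_itv/= => /andP[ax xb].
have := coord_le_norm a i; have := coord_le_norm b i.
rewrite !ler_norml => /andP[b1 b2] /andP[a1 a2].
have := normr_ge0 a; have := normr_ge0 b; lra.
Qed.

End cont_on.

(** * Uniform witnesses, periodic time and mean values *)

Section finite_witness.
Context {R : realType} (I : finType).

Lemma fin_small_witness (P : I -> R -> Prop) :
  (forall i, exists2 r : R, 0 < r & P i r) ->
  (forall i (r s : R), 0 < s -> s <= r -> P i r -> P i s) ->
  exists2 r : R, 0 < r & forall i, P i r.
Proof.
move=> /(_ _)/cid2-/all_sig2[r r0 Pr] mono.
exists (\big[Num.min/(1:R)]_i (r i : R)); first by apply: lt_bigmin => // ; exact: ltr01.
move=> i; apply: mono (Pr i); last exact: bigmin_le.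
by apply: lt_bigmin => // ; exact: ltr01.
Qed.

Lemma fin_large_witness (P : I -> R -> Prop) :
  (forall i, exists2 r : R, 0 < r & P i r) ->
  (forall i (r s : R), r <= s -> P i r -> P i s) ->
  exists2 r : R, 0 < r & forall i, P i r.
Proof.
move=> /(_ _)/cid2-/all_sig2[r r0 Pr] mono.
exists (\sum_i r i + 1); first by rewrite ltr_wpDl// sumr_ge0// => i _; exact: ltW.
move=> i; apply: mono (Pr i); rewrite (bigD1 i)//= -addrA lerDl.
by rewrite addr_ge0// sumr_ge0// => k _; exact: ltW.
Qed.
End finite_witness.

Section time_shift.
Context {R : realType}.

Lemma time_ind (T : R) (P : R -> Prop) : 0 < T ->
  (forall t, P (t + T) <-> P t) -> (forall t, 0 <= t <= T -> P t) -> forall t, P t.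
Proof.
move=> T0 PT P0 t; set k := Num.floor (t / T).
have Pn (j : nat) s : P (s + j%:R * T) <-> P s.
  elim: j => [|j IH]; first by rewrite mul0r addr0.
  by rewrite -natr1 mulrDl mul1r addrA PT.
have : P (t - k%:~R * T).
  apply: P0; have /andP[h1 h2] := floor_itv (t / T).
  rewrite ler_pdivlMr// in h1; rewrite ltr_pdivrMr// intrD mulrDl mul1r in h2.
  by rewrite subr_ge0 h1/= lerBlDl ltW.
case: k => j.
  by move=> H; rewrite -(subrK (j%:R * T) t); apply/Pn.
by rewrite NegzE mulrNz mulNr opprK => /Pn.
Qed.

Lemma mvt_between (f f' : R -> R) (a b : R) :
  (forall s : R, is_derive s 1 f (f' s)) ->
  exists s, [/\ Num.min a b <= s, s <= Num.max a b & f b - f a = f' s * (b - a)].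
Proof.
move=> df.
have cf p q : {within `[p, q], continuous f}.
  by apply: derivable_within_continuous => t _; have [] := df t.
have [ab|ba|->] := ltgtP a b.
- have [s + H] := MVT ab (fun s _ => df s) (cf a b); rewrite in_itv/= => /andP[h1 h2].
  by exists s; rewrite !ltW.
- have [s + H] := MVT ba (fun s _ => df s) (cf b a); rewrite in_itv/= => /andP[h1 h2].
  by exists s; rewrite !ltW//; split=> //; rewrite -opprB H; ring.
- by exists b; rewrite !subrr mulr0 lexx.
Qed.

Lemma derive_line (V : normedModType R) (f : V -> R) (y e : V) :
  (forall a, derivable f a e) ->
  forall s : R, is_derive s 1 (fun s => f (y + s *: e)) ('D_e f (y + s *: e)).
Proof.
move=> df s.
have E : (fun h : R => h^-1 *: (f (y + (h *: 1 + s) *: e) - f (y + s *: e))) =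
         (fun h : R => h^-1 *: (f (h *: e + (y + s *: e)) - f (y + s *: e))).
  apply/funext => h; congr (_ *: (f _ - _)).
  by rewrite scalerDl [h *: 1]mulr1 addrCA.
apply: DeriveDef.
- by rewrite /derivable E; exact: df.
- by rewrite /derive/= E.
Qed.

(** Mean value theorem one coordinate at a time, because only the partial
    derivatives of f are at hand. *)
Lemma mvt_coord m (f : 'cV[R]_m -> R) (u w : 'cV[R]_m) :
  (forall a j, derivable f a (delta_mx j 0)) ->
  exists xi : 'I_m -> 'cV[R]_m,
    (forall j k, Num.min (u k 0) (w k 0) <= xi j k 0 <= Num.max (u k 0) (w k 0)) /\
    f w - f u = \sum_j 'D_(delta_mx j 0) f (xi j) * (w j 0 - u j 0).
Proof.
move=> df; pose y (l : nat) : 'cV[R]_m := \col_k (if (k < l)%N then w k 0 else u k 0).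
have step (j : 'I_m) : exists xi : 'cV[R]_m,
    (forall k, Num.min (u k 0) (w k 0) <= xi k 0 <= Num.max (u k 0) (w k 0)) /\
    f (y j.+1) - f (y j) = 'D_(delta_mx j 0) f xi * (w j 0 - u j 0).
  have [s [h1 h2 E]] := mvt_between 0 (w j 0 - u j 0)
    (derive_line (y j) (fun a => df a j)).
  exists (y j + s *: delta_mx j 0); split; last first.
    rewrite -[w j 0 - u j 0 in RHS]subr0 -E scale0r addr0; congr (f _ - _).
    apply/colP => k; rewrite !mxE eqxx andbT ltnS leq_eqVlt.
    have [->|kj]/= := eqVneq k j; first by rewrite eqxx ltnn mulr1; ring.
    by rewrite (_ : (k == j :> nat) = false) ?mulr0 ?addr0//; exact: negbTE.
  move=> k; rewrite !mxE eqxx andbT.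
  have [->|kj] := eqVneq k j.
    rewrite ltnn mulr1; move: h1 h2; rewrite ge_min le_max => h1 h2.
    rewrite ge_min le_max; apply/andP; split; apply/orP.
      by case/orP: h1 => h; [left|right]; lra.
    by case/orP: h2 => h; [left|right]; lra.
  by rewrite mulr0 addr0; case: ifP => _; rewrite ge_min le_max !lexx ?orbT.
have [xi Hxi] := choice step; exists xi; split=> [j|]; first by case: (Hxi j).
transitivity (\sum_(j < m) (f (y j.+1) - f (y j))); last first.
  by apply: eq_bigr => j _; case: (Hxi j).
rewrite -(big_mkord xpredT (fun j => f (y j.+1) - f (y j))) telescope_sumr//.
congr (f _ - f _); apply/colP => k; rewrite mxE ?ltn_ord//.
Qed.
End time_shift.

(** * The hypotheses and the Jacobian *)

(** Bundles the data of the problem, so that each part of the proof is a section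
    over a single hypothesis. *)
Record standing (R : realType) (m n : nat) (Omega : set 'cV[R]_n) (d : 'rV[R]_m)
    (v : 'cV[R]_m) (K : 'I_m -> R -> 'cV[R]_n -> R)
    (g : R -> 'cV[R]_n -> 'cV[R]_m -> 'cV[R]_m) (T : R) : Prop := Standing {
  st_open : open Omega;
  st_connected : connected Omega;
  st_nonempty : Omega !=set0;
  st_bounded : bounded_set Omega;
  st_d : forall i, 0 < d 0 i;
  st_v : forall i, 0 < v i 0;
  st_T : 0 < T;
  st_K_ge0 : forall i t x, 0 <= K i t x;
  st_K_cont : forall i, continuous (fun p : R * 'cV[R]_n => K i p.1 p.2);
  st_K_pos : forall i t, 0 < K i t 0;
  st_K_mass : forall i t, (\int[lebesgue_n n]_x (K i t x)%:E = 1)%E;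
  st_g_C001 : class_C001 Omega g;
  st_g_coop : forall t x u, 0 <= t -> closure Omega x -> order_box v u ->
       cooperative (jacobian_u g t x u) /\
       irreducible_mx (jacobian_u g t x u);
  st_g_zero : forall i t x, closure Omega x -> g t x 0 i 0 = 0;
  st_g_upper : forall i t x u, closure Omega x -> order_box v u ->
       u i 0 = v i 0 -> g t x u i 0 <= 0;
  st_g_sub : forall t x u (alpha : R), 0 <= t -> closure Omega x ->
       order_box v u -> interior Rplus u -> 0 < alpha < 1 ->
       vlt (alpha *: g t x u) (g t x (alpha *: u));
  st_K_per : forall i t x, K i (t + T) x = K i t x;
  st_g_per : forall i t x u, closure Omega x ->
       g (t + T) x u i 0 = g t x u i 0 }.

Section order.
Context {R : realType} {m : nat}.
Implicit Types (a b u : 'cV[R]_m).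

Lemma vleP a b : vle a b <-> forall i, a i 0 <= b i 0.
Proof.
by split=> H i; have := H i; rewrite !mxE subr_ge0.
Qed.

Lemma order_boxE v u : order_box v u <-> box 0 v u.
Proof.
split=> [[/vleP h1 /vleP h2] i|H].
  by rewrite in_itv/= h2 andbT; have := h1 i; rewrite mxE.
split; apply/vleP => i; have := H i; rewrite in_itv/= => /andP[h1 h2] //.
Qed.

Lemma interior_RplusP a : interior Rplus a <-> forall i, 0 < a i 0.
Proof.
split=> [/nbhs_ballP[e /= e0 H] i|H].
  have : Rplus (a - const_mx (e / 2)).
    apply: H; split=> // j k; rewrite /ball/= !mxE opprB addrC subrK.
    by rewrite gtr0_norm ?divr_gt0//; lra.
  by move=> /(_ i); rewrite !mxE => h; apply: lt_le_trans (_ : e / 2 <= _); lra.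
have [e e0 He] : exists2 e : R, 0 < e & forall i, e <= a i 0.
  apply: (@fin_small_witness R 'I_m (fun i e => e <= a i 0)).
    by move=> i; exists (a i 0).
  by move=> i r s _; exact: le_trans.
apply/nbhs_ballP; exists e => //= b [_ ab] i.
have := ab i 0; rewrite /ball/= ltr_norml => /andP[_]; have := He i; lra.
Qed.

Lemma vltP a b : vlt a b -> (forall i, a i 0 <= b i 0) /\ exists i, a i 0 < b i 0.
Proof.
move=> [/vleP ab nab]; split=> //; apply: contrapT => H; apply: nab.
apply/colP => i; apply/eqP; rewrite eq_le ab /= leNgt; apply/negP => h.
by apply: H; exists i.
Qed.

Lemma vllP a b : vll a b <-> forall i, a i 0 < b i 0.
Proof.
by rewrite /vll interior_RplusP; split=> H i; have := H i; rewrite !mxE subr_gt0.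
Qed.
End order.

Section reaction.
Context {R : realType} {m n : nat} {Omega : set 'cV[R]_n} {d : 'rV[R]_m}
  {v : 'cV[R]_m} {K : 'I_m -> R -> 'cV[R]_n -> R}
  {g : R -> 'cV[R]_n -> 'cV[R]_m -> 'cV[R]_m} {T : R}.
Hypothesis H : standing Omega d v K g T.
Implicit Types (u w a b : 'cV[R]_m) (x y : 'cV[R]_n) (t s : R) (i k : 'I_m).
Local Notation M := (box 0 v).
Local Notation Oc := (closure Omega).
Local Notation J := (fun t x a => jacobian_u g t x a).
Let T0 : 0 < T := st_T H.

Lemma gT t x : Oc x -> g (t + T) x = g t x.
Proof. by move=> xO; apply/funext => u; apply/colP => i; exact: st_g_per H _ _ _ _ xO. Qed.

Lemma jacobianT t x a : Oc x -> jacobian_u g (t + T) x a = jacobian_u g t x a.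
Proof. by move=> xO; rewrite /jacobian_u gT. Qed.

Lemma M_ge0 u : M u -> forall i, 0 <= u i 0.
Proof. by move=> Mu i; have := Mu i; rewrite in_itv/= mxE => /andP[]. Qed.

Lemma M_le u : M u -> forall i, u i 0 <= v i 0.
Proof. by move=> Mu i; have := Mu i; rewrite in_itv/= mxE => /andP[]. Qed.

Lemma M_intro u : (forall i, 0 <= u i 0) -> (forall i, u i 0 <= v i 0) -> M u.
Proof. by move=> h1 h2 i; rewrite in_itv/= mxE h1 h2. Qed.

Lemma Oc_bounded : bounded_set Oc.
Proof.
have [N [Nr HN]] := st_bounded H; exists (N + 1); split; first exact: num_real.
move=> B NB x /(_ (ball x (B - (N + 1))))[|y [/HN Oy xy]].
  by apply: nbhsx_ballx; rewrite subr_gt0.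
have yN : `|y| <= N + 1 by apply: Oy; rewrite ltrDl.
rewrite mx_norm_ball/ball_/= in xy.
rewrite -(subrK y x); apply: (le_trans (ler_normD _ _)); lra.
Qed.

Lemma Oc_compact : compact Oc.
Proof. by apply: cV_compact; [exact: Oc_bounded|exact: closed_closure]. Qed.

Definition cylinder (S : R) : set (R * 'cV[R]_n * 'cV[R]_m) := (`[0, S]%classic `*` Oc) `*` M.

Lemma cylinder_compact S : compact (cylinder S).
Proof.
apply: compact_setX; last exact: box_compact.
by apply: compact_setX; [exact: segment_compact|exact: Oc_compact].
Qed.

Lemma g_cont S i : cont_on (cylinder S) (fun p => g p.1.1 p.1.2 p.2 i 0).
Proof.
have [cg _] := st_g_C001 H.
have : cont_on [set p : R * 'cV[R]_n * 'cV[R]_m | Oc p.1.2] (fun p => g p.1.1 p.1.2 p.2 i 0).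
  apply/within_cont_on; apply/subspace_continuousP => p Op.
  move/subspace_continuousP : cg => /(_ p Op) cg.
  apply: (@cvg_comp _ _ _ _ (fun u : 'cV[R]_m => u i 0) _ _ _ cg).
  exact: coord_continuous.
by apply: cont_onS => p [[_ ?] _].
Qed.

Lemma jacobian_cont S i k : cont_on (cylinder S) (fun p => J p.1.1 p.1.2 p.2 i k).
Proof.
have [_ /(_ i k)[_ cJ]] := st_g_C001 H.
have : cont_on [set p : R * 'cV[R]_n * 'cV[R]_m | Oc p.1.2] (fun p => J p.1.1 p.1.2 p.2 i k).
  exact/within_cont_on.
by apply: cont_onS => p [[_ ?] _].
Qed.

Lemma jacobian_coop t x u : Oc x -> M u -> forall i k, i != k -> 0 <= J t x u i k.
Proof.
move=> xO Mu i k ik; move: t; apply: (time_ind T0) => t; first by rewrite jacobianT.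
move=> /andP[t0 _]; have [|c _] := st_g_coop H t0 xO (u := u); last exact: c.
exact/order_boxE.
Qed.

Lemma jacobian_bound : exists2 C : R, 0 < C & forall t x u i k, Oc x -> M u -> `|J t x u i k| <= C.
Proof.
have [||C C0 HC] := @fin_large_witness R ('I_m * 'I_m)%type
    (fun ik C => forall p, cylinder T p -> `|J p.1.1 p.1.2 p.2 ik.1 ik.2| <= C).
- by move=> [i k]; apply: (compact_bound (@cylinder_compact T)); exact: jacobian_cont.
- by move=> ik r s rs h p /h/le_trans; apply.
exists C => // t x u i k xO Mu; move: t; apply: (time_ind T0) => t; first by rewrite jacobianT.
move=> tT; apply: (HC (i, k) (t, x, u)); split=> //; split=> //=; rewrite in_itv//.
Qed.

Lemma jacobian_modulus e : 0 < e -> exists2 r, 0 < r &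
  forall t x u w i k, Oc x -> M u -> M w -> (forall l, `|u l 0 - w l 0| < r) ->
    `|J t x u i k - J t x w i k| < e.
Proof.
move=> e0; have [||r r0 Hr] := @fin_small_witness R ('I_m * 'I_m)%type
    (fun ik r => forall p q, cylinder T p -> cylinder T q -> ball p r q ->
        `|J p.1.1 p.1.2 p.2 ik.1 ik.2 - J q.1.1 q.1.2 q.2 ik.1 ik.2| < e).
- by move=> [i k]; apply: (compact_unif_cont (@cylinder_compact T)) => //; exact: jacobian_cont.
- move=> ik r s s0 sr h p q cp cq pq; apply: h => //; exact: le_ball pq.
exists r => // t x u w i k xO Mu Mw uw; move: t; apply: (time_ind T0) => t.
  by rewrite !jacobianT.
move=> tT; apply: (Hr (i, k) (t, x, u) (t, x, w)).
- by split=> //; split=> //=; rewrite in_itv.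
- by split=> //; split=> //=; rewrite in_itv.
- split; first by split; exact: ballxx.
  by split=> // l c; rewrite !ord1; exact: uw.
Qed.

(** For each splitting of the indices the sum of the coupling entries is positive
    and continuous on a compact cylinder; there are finitely many splittings. *)
Lemma jacobian_irr : exists2 e, 0 < e & forall t x u (S : {set 'I_m}), Oc x -> M u ->
  S != finset.set0 -> S != [set: 'I_m]%SET ->
  exists i k, [/\ i \in S, k \notin S & e <= J t x u i k].
Proof.
pose f (S : {set 'I_m}) (p : R * 'cV[R]_n * 'cV[R]_m) :=
  \sum_(i in S) \sum_(k | k \notin S) J p.1.1 p.1.2 p.2 i k.
have [||e e0 He] := @fin_small_witness R {set 'I_m}
  (fun S e => S != finset.set0 -> S != [set: 'I_m]%SET -> forall p, cylinder T p -> e <= f S p).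
- move=> S; have [S0|S0] := eqVneq S finset.set0; first by exists 1.
  have [ST|ST] := eqVneq S [set: 'I_m]%SET; first by exists 1.
  have [||e e0 He] := compact_pos_lower (@cylinder_compact T) (f := f S).
  + by apply: cont_on_sum => i; apply: cont_on_sum => k; exact: jacobian_cont.
  + move=> [[t x] u] [[/= t0T xO] Mu]; rewrite in_itv/= in t0T.
    have [t0 _] := andP t0T.
    have [|_ /(_ S S0 ST)[i [k [iS kS ik0]]]] := st_g_coop H t0 xO (u := u).
      exact/order_boxE.
    have nn l q : l \in S -> q \notin S -> 0 <= J t x u l q.
      move=> lS qS; apply: jacobian_coop => //; apply: contraNneq qS => <- //.
    rewrite /f (bigD1 i)//= (bigD1 k)//=.
    apply: (@lt_le_trans _ _ (J t x u i k)); first by rewrite lt_def ik0 nn.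
    rewrite -addrA lerDl addr_ge0//; first by apply: sumr_ge0 => q /andP[qS _]; exact: nn.
    by apply: sumr_ge0 => l /andP[lS _]; apply: sumr_ge0 => q qS; exact: nn.
  by exists e.
- by move=> S r s _ sr h S0 ST p cp; apply: le_trans (h S0 ST p cp).
have mm0 : 0 < (m * m).+1%:R :> R by rewrite ltr0n.
exists (e / (m * m).+1%:R); first by rewrite divr_gt0.
move=> t x u S xO Mu S0 ST; move: t; apply: (time_ind T0) => t.
  by split=> -[i [k ik]]; exists i, k; move: ik; rewrite jacobianT.
move=> tT; have fe : e <= f S (t, x, u).
  by apply: He => //; split=> //; split=> //=; rewrite in_itv.
have [/existsP[i /existsP[k /and3P[iS kS ik]]]|] := boolP [exists i, exists k,
   [&& i \in S, k \notin S & e / (m * m).+1%:R <= J t x u i k]].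
  by exists i, k.
rewrite negb_exists => /forallP no.
have : f S (t, x, u) <= \sum_(i in S) \sum_(k | k \notin S) (e / (m * m).+1%:R).
  apply: ler_sum => i iS; apply: ler_sum => k kS; apply: ltW; rewrite ltNge; apply/negP => h.
  by have := no i; rewrite negb_exists => /forallP/(_ k); rewrite iS kS h.
have : \sum_(i in S) \sum_(k | k \notin S) (e / (m * m).+1%:R) < e.
  apply: (@le_lt_trans _ _ (\sum_(i < m) \sum_(k < m) (e / (m * m).+1%:R))).
    rewrite big_mkcond/=; apply: ler_sum => i _; rewrite big_mkcond/=.
    case: ifP => _; last by apply: sumr_ge0 => k _; rewrite divr_ge0// ltW.
    by apply: ler_sum => k _; case: ifP => _ //; rewrite divr_ge0// ltW.
  rewrite !sumr_const card_ord -mulrnA -[X in X < _]mulr_natr mulrAC ltr_pdivrMr//.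
  by rewrite ltr_pM2l// ltr_nat.
by move=> h1 h2; exfalso; lra.
Qed.

End reaction.

(** * The reaction term on the order box *)

Section reaction2.
Context {R : realType} {m n : nat} {Omega : set 'cV[R]_n} {d : 'rV[R]_m}
  {v : 'cV[R]_m} {K : 'I_m -> R -> 'cV[R]_n -> R}
  {g : R -> 'cV[R]_n -> 'cV[R]_m -> 'cV[R]_m} {T : R}.
Hypothesis H : standing Omega d v K g T.
Implicit Types (u w a b : 'cV[R]_m) (x y : 'cV[R]_n) (t s : R) (i k : 'I_m).
Local Notation M := (box 0 v).
Local Notation Oc := (closure Omega).
Local Notation J := (fun t x a => jacobian_u g t x a).
Let T0 : 0 < T := st_T H.

Lemma M0 : M 0.
Proof. by apply: M_intro => l; rewrite mxE// ltW// (st_v H). Qed.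

(** Three periods leave room to translate two nearby times simultaneously into the
    middle one. *)
Lemma periodic_modulus (f : R -> 'cV[R]_n -> 'cV[R]_m -> R) :
  (forall t x u, Oc x -> f (t + T) x u = f t x u) ->
  cont_on (@cylinder R m n Omega v (3 * T)) (fun p => f p.1.1 p.1.2 p.2) ->
  forall e, 0 < e -> exists2 r, 0 < r &
    forall t s x y u w, Oc x -> Oc y -> M u -> M w -> `|t - s| < r ->
      ball x r y -> (forall l, `|u l 0 - w l 0| < r) -> `|f t x u - f s y w| < e.
Proof.
move=> fT cf e e0; have [r r0 Hr] := compact_unif_cont (@cylinder_compact _ _ _ _ _ _ _ _ _ H (3 * T)) cf e0.
exists (Num.min r T); first by rewrite lt_min r0.
move=> t s x y u w xO yO Mu Mw; rewrite lt_min => /andP[tsr tsT] xy uw.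
have xyr : ball x r y by apply: le_ball xy; rewrite ge_min lexx.
have uwr l : `|u l 0 - w l 0| < r by have := uw l; rewrite lt_min => /andP[].
move: t s tsr tsT; apply: (time_ind T0) => t.
  split=> h s ts1 ts2.
    by rewrite -(fT t)// -(fT s)//; apply: h; rewrite (_ : t + T - (s + T) = t - s)//; ring.
  by rewrite fT// -(subrK T s) fT//; apply: h; rewrite (_ : t - (s - T) = t + T - s)//; ring.
move=> /andP[t0 tT] s ts1 ts2; rewrite -(fT t)// -(fT s)//.
have := ts2; rewrite ltr_norml => /andP[s1 s2].
apply: (Hr (t + T, x, u) (s + T, y, w)).
- by split=> //; split=> //=; rewrite in_itv/=; lra.
- by split=> //; split=> //=; rewrite in_itv/=; lra.
- split; first by split=> //=; rewrite /ball/= (_ : t + T - (s + T) = t - s)//; ring.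
  by split=> // l c; rewrite !ord1; exact: uwr.
Qed.

Lemma g_modulus e : 0 < e -> exists2 r, 0 < r &
  forall t s x y u i, Oc x -> Oc y -> M u -> `|t - s| < r -> ball x r y ->
    `|g t x u i 0 - g s y u i 0| < e.
Proof.
move=> e0; have [||r r0 Hr] := @fin_small_witness R 'I_m (fun i r =>
  forall t s x y u, Oc x -> Oc y -> M u -> `|t - s| < r -> ball x r y ->
    `|g t x u i 0 - g s y u i 0| < e).
- move=> i; have gp t x u : Oc x -> g (t + T) x u i 0 = g t x u i 0 by move=> xO; rewrite (gT H).
  have [r r0 Hr] := periodic_modulus gp (@g_cont _ _ _ _ _ _ _ _ _ H _ i) e0.
  by exists r => // t s x y u xO yO Mu ts xy; apply: Hr => // l; rewrite subrr normr0.
- move=> i r s s0 sr h t q x y u xO yO Mu tq xy; apply: h => //.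
    exact: lt_le_trans sr.
  exact: le_ball xy.
by exists r => // t s x y u i; exact: Hr.
Qed.

Lemma jacobian0_modulus e : 0 < e -> exists2 r, 0 < r &
  forall t x y i k, Oc x -> Oc y -> ball x r y ->
    `|J t x 0 i k - J t y 0 i k| < e.
Proof.
move=> e0; have [||r r0 Hr] := @fin_small_witness R ('I_m * 'I_m)%type (fun ik r =>
  forall t x y, Oc x -> Oc y -> ball x r y ->
    `|J t x 0 ik.1 ik.2 - J t y 0 ik.1 ik.2| < e).
- move=> [i k]; have Jp t x u : Oc x -> J (t + T) x u i k = J t x u i k by move=> xO; rewrite (jacobianT H).
  have [r r0 Hr] := periodic_modulus Jp (@jacobian_cont _ _ _ _ _ _ _ _ _ H _ i k) e0.
  exists r => // t x y xO yO xy; apply: Hr => //; rewrite ?subrr ?normr0//; try exact: M0.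
  by move=> l; rewrite subrr normr0.
- move=> i r s s0 sr h t x y xO yO xy; apply: h => //; exact: le_ball xy.
by exists r => // t x y i k; exact: (Hr (i, k)).
Qed.

Lemma M_between u w (xi : 'cV[R]_m) : M u -> M w ->
  (forall k, Num.min (u k 0) (w k 0) <= xi k 0 <= Num.max (u k 0) (w k 0)) -> M xi.
Proof.
move=> Mu Mw Hxi; apply: M_intro => k; have /andP[] := Hxi k; rewrite ge_min le_max.
  by move=> /orP[h|h] _; [exact: le_trans (M_ge0 Mu k) h|exact: le_trans (M_ge0 Mw k) h].
by move=> _ /orP[h|h]; [exact: le_trans h (M_le Mu k)|exact: le_trans h (M_le Mw k)].
Qed.

Lemma g_mvt t x u w i : Oc x -> M u -> M w ->
  exists xi : 'I_m -> 'cV[R]_m, [/\ forall j, M (xi j),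
    forall j k, Num.min (u k 0) (w k 0) <= xi j k 0 <= Num.max (u k 0) (w k 0) &
    g t x w i 0 - g t x u i 0 = \sum_j J t x (xi j) i j * (w j 0 - u j 0)].
Proof.
move=> xO Mu Mw; have [_ dg] := st_g_C001 H.
have [xi [Hxi E]] := @mvt_coord R m (fun b => g t x b i 0) u w
  (fun a j => (dg i j).1 t x a xO).
exists xi; split=> // [j|]; first exact: M_between (Hxi j).
by rewrite E; apply: eq_bigr => j _; rewrite mxE.
Qed.

Lemma g_lipschitz C t x u w i : (forall t x u i k, Oc x -> M u -> `|J t x u i k| <= C) ->
  Oc x -> M u -> M w -> `|g t x w i 0 - g t x u i 0| <= C * \sum_j `|w j 0 - u j 0|.
Proof.
move=> HC xO Mu Mw; have [xi [Mxi _ ->]] := g_mvt t i xO Mu Mw.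
apply: (le_trans (ler_norm_sum _ _ _)); rewrite mulr_sumr; apply: ler_sum => j _.
by rewrite normrM ler_wpM2r// HC.
Qed.

Lemma M_scale u (al : R) : M u -> 0 <= al <= 1 -> M (al *: u).
Proof.
move=> Mu /andP[a0 a1]; apply: M_intro => k; rewrite mxE.
  by rewrite mulr_ge0// (M_ge0 Mu).
by rewrite (le_trans _ (M_le Mu k))// ler_piMl// (M_ge0 Mu).
Qed.

Lemma small_scale r : 0 < r -> exists al : R, [/\ 0 < al, al < 1 & forall k, al * v k 0 < r].
Proof.
move=> r0; have vs k : v k 0 <= \sum_l v l 0.
  by rewrite (bigD1 k)//= lerDl sumr_ge0// => l _; rewrite ltW// (st_v H).
have V0 : 0 <= \sum_l v l 0 by rewrite sumr_ge0// => l _; rewrite ltW// (st_v H).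
have D0 : 0 < \sum_l v l 0 + r + 1 by lra.
exists (r / (\sum_l v l 0 + r + 1)); split; first exact: divr_gt0.
  by rewrite ltr_pdivrMr// mul1r; lra.
move=> k; rewrite mulrAC ltr_pdivrMr// ltr_pM2l//; have := vs k; lra.
Qed.

(** Splitting b -> b + al p -> b + p with al small: on the first piece the
    Jacobian is close to the one at b, so the increment of g is at least
    al (J - e/2)^+ p off the diagonal, and this coupling is still irreducible because
    each splitting of the indices has an entry at least e; on the second piece
    cooperativity leaves only the diagonal loss. The coupling beta thus depends on
    the lower point b alone. *)
Lemma reaction_constants : exists C b0 : R, exists beta : R -> 'cV[R]_n -> 'cV[R]_m -> 'I_m -> 'I_m -> R,
  [/\ 0 < C, 0 < b0, (forall t x u i k, Oc x -> M u -> `|J t x u i k| <= C) &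
  [/\ forall t x b, Oc x -> M b -> irreducible_at b0 (beta t x b),
  forall t x b i k, Oc x -> M b -> i != k -> beta t x b i k <= J t x b i k &
  forall t x b (p : 'cV[R]_m) i, Oc x -> M b -> (forall k, 0 <= p k 0) -> M (b + p) ->
    - (C * p i 0) + \sum_(k | k != i) beta t x b i k * p k 0 <=
      g t x (b + p) i 0 - g t x b i 0]].
Proof.
have [C C0 HC] := jacobian_bound H; have [e e0 He] := jacobian_irr H.
have e20 : 0 < e / 2 by rewrite divr_gt0.
have [r r0 Hr] := jacobian_modulus H e20.
have [al [al0 al1 alr]] := small_scale r0.
pose beta t x b i k := al * Num.max (J t x b i k - e / 2) 0.
exists C, (al * (e / 2)), beta; split=> //; first exact: mulr_gt0.
split.
- move=> t x b xO Mb; split=> [i k ik|S S0 ST].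
    by rewrite mulr_ge0 ?(ltW al0)// le_max lexx orbT.
  have [i [k [iS kS ik]]] := He t x b S xO Mb S0 ST.
  exists i, k; split=> //; rewrite ler_pM2l// le_max; apply/orP; left; lra.
- move=> t x b i k xO Mb ik; rewrite /beta.
  have J0 := jacobian_coop H t xO Mb ik.
  apply: (@le_trans _ _ (1 * J t x b i k)); last by rewrite mul1r.
  apply: ler_pM => //; [exact: ltW|by rewrite le_max lexx orbT|exact: ltW|].
  by rewrite ge_max J0 andbT; lra.
- move=> t x b p i xO Mb p0 Mbp.
  have Mq : M (b + al *: p).
    apply: M_intro => k; rewrite !mxE.
      by rewrite addr_ge0 ?(M_ge0 Mb)// mulr_ge0// ltW.
    have := M_le Mbp k; rewrite !mxE => h; apply: le_trans h; rewrite lerD2l.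
    by rewrite ler_piMl// ltW.
  have [xi [Mxi Hxi E1]] := g_mvt t i xO Mb Mq.
  have [et [Met _ E2]] := g_mvt t i xO Mq Mbp.
  have -> : g t x (b + p) i 0 - g t x b i 0 =
    (g t x (b + p) i 0 - g t x (b + al *: p) i 0) +
    (g t x (b + al *: p) i 0 - g t x b i 0) by ring.
  rewrite E1 E2 [X in _ <= X + _](bigD1 i)//= [X in _ <= _ + X](bigD1 i)//=.
  have pv k : p k 0 <= v k 0.
    by have := M_le Mbp k; rewrite mxE; have := M_ge0 Mb k; lra.
  have JC u : M u -> - C <= J t x u i i.
    by move=> Mu; have := HC t x u i i xO Mu; rewrite ler_norml => /andP[].
  have d1 k : (b + p) k 0 - (b + al *: p) k 0 = (1 - al) * p k 0.
    by rewrite !mxE; ring.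
  have d2 k : (b + al *: p) k 0 - b k 0 = al * p k 0 by rewrite !mxE; ring.
  have n1 k : 0 <= (1 - al) * p k 0 by rewrite mulr_ge0// subr_ge0 ltW.
  have n2 k : 0 <= al * p k 0 by rewrite mulr_ge0// ltW.
  have h1 : - (C * ((1 - al) * p i 0)) <= J t x (et i) i i * ((b + p) i 0 - (b + al *: p) i 0).
    by rewrite d1 -mulNr; apply: ler_wpM2r => //; exact: JC (Met i).
  have h2 : - (C * (al * p i 0)) <= J t x (xi i) i i * ((b + al *: p) i 0 - b i 0).
    by rewrite d2 -mulNr; apply: ler_wpM2r => //; exact: JC (Mxi i).
  have h3 : 0 <= \sum_(k | k != i) J t x (et k) i k * ((b + p) k 0 - (b + al *: p) k 0).
    apply: sumr_ge0 => k ki; rewrite d1 mulr_ge0//.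
    by apply: (jacobian_coop H t xO (Met k)); rewrite eq_sym.
  have h4 : \sum_(k | k != i) beta t x b i k * p k 0 <=
      \sum_(k | k != i) J t x (xi k) i k * ((b + al *: p) k 0 - b k 0).
    apply: ler_sum => k ki; rewrite d2 /beta.
    have -> : al * Num.max (J t x b i k - e / 2) 0 * p k 0 = Num.max (J t x b i k - e / 2) 0 * (al * p k 0) by ring.
    rewrite ler_wpM2r//.
    rewrite ge_max; apply/andP; split; last first.
      by apply: (jacobian_coop H t xO (Mxi k)); rewrite eq_sym.
    have : `|J t x b i k - J t x (xi k) i k| < e / 2.
      apply: Hr => // l; have := Hxi k l; rewrite !mxE ge_min le_max => h.
      have ap : 0 <= al * p l 0 by rewrite mulr_ge0// ltW.
      have apr : al * p l 0 < r.
        by apply: le_lt_trans (alr l); rewrite ler_wpM2l ?(ltW al0)// pv.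
      rewrite ltr_norml; apply/andP; split.
        case/andP: h => [/orP[] ? /orP[] ?]; lra.
      case/andP: h => [/orP[] ? /orP[] ?]; lra.
    by rewrite ltr_norml => /andP[_]; lra.
  have -> : C * p i 0 = C * ((1 - al) * p i 0) + C * (al * p i 0) by ring.
  lra.
Qed.

Lemma g_sub_all t x u (al : R) i : Oc x -> M u -> (forall k, 0 < u k 0) -> 0 < al < 1 ->
  al * g t x u i 0 <= g t x (al *: u) i 0.
Proof.
move=> xO Mu u0 al01; move: t; apply: (time_ind T0) => t; first by rewrite (gT H).
move=> /andP[t0 _]; have /vltP[h _] : vlt (al *: g t x u) (g t x (al *: u)).
  by apply: (st_g_sub H) => //; [exact/order_boxE|exact/interior_RplusP].
by have := h i; rewrite mxE.
Qed.

(** Subhomogeneity is assumed at interior points only; it extends to the box by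
    approximating u by u + e (v - u) and the Lipschitz bound. *)
Lemma g_sub_le t x u (al : R) i : Oc x -> M u -> 0 < al < 1 ->
  al * g t x u i 0 <= g t x (al *: u) i 0.
Proof.
move=> xO Mu al01; have /andP[al0 al1] := al01.
have [C C0 HC] := jacobian_bound H.
pose V := \sum_l v l 0.
have V0 : 0 <= V by rewrite sumr_ge0// => l _; rewrite ltW// (st_v H).
have CV : 0 <= C * V by rewrite mulr_ge0// ltW.
have key e : 0 < e -> e < 1 -> al * g t x u i 0 <= g t x (al *: u) i 0 + 2 * (C * V) * e.
  move=> e0 e1; pose w := u + e *: (v - u).
  have wE k : w k 0 = u k 0 + e * (v k 0 - u k 0) by rewrite !mxE.
  have vu k : 0 <= v k 0 - u k 0 by rewrite subr_ge0; exact: M_le Mu k.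
  have w0 k : 0 < w k 0.
    have := M_ge0 Mu k; have := st_v H k; rewrite wE => h1 h2.
    have : 0 < e * v k 0 by exact: mulr_gt0.
    have : 0 <= (1 - e) * u k 0 by rewrite mulr_ge0// subr_ge0 ltW.
    lra.
  have Mw : M w.
    apply: M_intro => k; first exact: ltW.
    have : e * (v k 0 - u k 0) <= 1 * (v k 0 - u k 0) by rewrite ler_wpM2r// ltW.
    rewrite wE; lra.
  have dist k : `|w k 0 - u k 0| <= e * v k 0.
    rewrite wE addrC addKr ger0_norm; last by rewrite mulr_ge0// ltW.
    by rewrite ler_pM2l// gerBl; exact: M_ge0 Mu k.
  have a01 : 0 <= al <= 1 by rewrite !ltW.
  have d1 : `|g t x w i 0 - g t x u i 0| <= C * V * e.
    apply: (le_trans (g_lipschitz t i HC xO Mu Mw)); rewrite -mulrA ler_pM2l//.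
    by rewrite mulrC mulr_sumr; apply: ler_sum => k _.
  have d2 : `|g t x (al *: w) i 0 - g t x (al *: u) i 0| <= C * V * e.
    apply: (le_trans (g_lipschitz t i HC xO (M_scale Mu a01) (M_scale Mw a01))).
    rewrite -mulrA ler_pM2l// mulrC mulr_sumr; apply: ler_sum => k _.
    rewrite !mxE -mulrBr normrM gtr0_norm//; apply: le_trans (dist k).
    by have := dist k; rewrite !mxE => _; rewrite ler_piMl// ltW.
  have h := g_sub_all t i xO Mw w0 al01.
  move: d1 d2; rewrite !ler_norml => /andP[a1 a2] /andP[b1 b2].
  have : al * (g t x w i 0 - g t x u i 0) >= al * - (C * V * e) by rewrite ler_pM2l.
  have : al * (C * V * e) <= 1 * (C * V * e) by rewrite ler_wpM2r ?(ltW al1)// mulr_ge0// ltW.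
  nra.
rewrite leNgt; apply/negP => gap.
set G := al * g t x u i 0 - g t x (al *: u) i 0.
have G0 : 0 < G by rewrite subr_gt0.
have D0 : 0 < 2 * (C * V) + G + 1 by lra.
pose e := G / (2 * (2 * (C * V) + G + 1)).
have e0 : 0 < e by rewrite divr_gt0// mulr_gt0.
have e1 : e < 1 by rewrite ltr_pdivrMr ?mulr_gt0//; lra.
have := key e e0 e1.
have : 2 * (C * V) * e < G.
  rewrite /e mulrA ltr_pdivrMr ?mulr_gt0//.
  have : 2 * (C * V) * G <= G * (2 * (C * V) + G + 1) by nra.
  nra.
by rewrite /G; lra.
Qed.

(** Divide g(al u) >= al g(u) by al and let al tend to 0. *)
Lemma g_le_linear t x u i : Oc x -> M u ->
  g t x u i 0 <= \sum_k J t x 0 i k * u k 0.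
Proof.
move=> xO Mu; have U0 : 0 <= \sum_k u k 0 by rewrite sumr_ge0// => k _; exact: M_ge0 Mu k.
have key e : 0 < e -> g t x u i 0 <= \sum_k J t x 0 i k * u k 0 + e * \sum_k u k 0.
  move=> e0; have [r r0 Hr] := jacobian_modulus H e0.
  have [al [al0 al1 alr]] := small_scale r0.
  have al01 : 0 < al < 1 by rewrite al0.
  have a01 : 0 <= al <= 1 by rewrite !ltW.
  have h := g_sub_le t i xO Mu al01.
  have [xi [Mxi Hxi E]] := g_mvt t i xO M0 (M_scale Mu a01).
  rewrite (st_g_zero H)// subr0 in E.
  rewrite -(ler_pM2l al0); apply: (le_trans h); rewrite E mulrDr mulrCA !mulr_sumr -big_split/=.
  apply: ler_sum => k _; rewrite !mxE subr0.
  have uk := M_ge0 Mu k.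
  have hJ : `|J t x (xi k) i k - J t x 0 i k| < e.
    apply: Hr => // [|l]; first exact: M0.
    have := Hxi k l; rewrite !mxE subr0 ge_min le_max.
    have := M_ge0 (Mxi k) l; have := M_ge0 Mu l => m1 m2.
    have ul : al * u l 0 < r.
      by apply: le_lt_trans (alr l); rewrite ler_pM2l//; exact: M_le Mu l.
    move=> /andP[_ /orP[] h2]; rewrite ger0_norm//; lra.
  move: hJ; rewrite ltr_norml /jacobian_u !mxE => /andP[_ hJ].
  have : 0 <= al * u k 0 by rewrite mulr_ge0// ltW.
  nra.
rewrite leNgt; apply/negP => gap.
set G := g t x u i 0 - \sum_k J t x 0 i k * u k 0.
have G0 : 0 < G by rewrite subr_gt0.
have D0 : 0 < \sum_k u k 0 + 1 by lra.
have := key (G / (2 * (\sum_k u k 0 + 1))) _; rewrite divr_gt0 ?mulr_gt0// => /(_ isT).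
have : G / (2 * (\sum_k u k 0 + 1)) * \sum_k u k 0 <= G / 2.
  rewrite mulrAC ler_pdivrMr ?mulr_gt0//; nra.
by rewrite /G; lra.
Qed.

Lemma g_ge_linear e : 0 < e -> exists2 r, 0 < r &
  forall t x u i, Oc x -> M u -> (forall k, u k 0 < r) ->
    \sum_k J t x 0 i k * u k 0 - e * \sum_k u k 0 <= g t x u i 0.
Proof.
move=> e0; have [r r0 Hr] := jacobian_modulus H e0.
exists r => // t x u i xO Mu ur.
have [xi [Mxi Hxi E]] := g_mvt t i xO M0 Mu.
rewrite (st_g_zero H)// subr0 in E.
rewrite E mulr_sumr -sumrB; apply: ler_sum => k _; rewrite [(0 : 'cV[R]_m) k 0]mxE subr0.
have uk := M_ge0 Mu k.
have hJ : `|J t x (xi k) i k - J t x 0 i k| < e.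
  apply: Hr => // [|l]; first exact: M0.
  have := Hxi k l; rewrite !mxE subr0 ge_min le_max.
  have := M_ge0 (Mxi k) l; have := M_ge0 Mu l; have := ur l => u1 m1 m2.
  by move=> /andP[_ /orP[] h2]; rewrite ger0_norm//; lra.
move: hJ; rewrite ltr_norml => /andP[hJ _].
by rewrite -mulrBl ler_wpM2r//; lra.
Qed.

Lemma cylinder_lower (f : R -> 'cV[R]_n -> 'cV[R]_m -> R) (del : R) :
  (forall t x u, Oc x -> f (t + T) x u = f t x u) ->
  cont_on (@cylinder R m n Omega v T) (fun p => f p.1.1 p.1.2 p.2) ->
  0 < del ->
  (forall t x u, 0 <= t -> Oc x -> M u -> (forall k, del <= u k 0) -> 0 < f t x u) ->
  exists2 e0, 0 < e0 & forall t x u, Oc x -> M u -> (forall k, del <= u k 0) -> e0 <= f t x u.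
Proof.
move=> fT cf del0 f0.
pose A : set (R * 'cV[R]_n * 'cV[R]_m) := (`[0, T]%classic `*` Oc) `*` box (const_mx del) v.
have AM p : A p -> @cylinder R m n Omega v T p.
  move=> [p1 p2]; split=> // i; have := p2 i; rewrite !in_itv/= !mxE => /andP[h ->].
  by rewrite andbT (le_trans _ h)// ltW.
have cA : compact A.
  apply: compact_setX; last exact: box_compact.
  by apply: compact_setX; [exact: segment_compact|exact: (Oc_compact H)].
have fA p : A p -> 0 < f p.1.1 p.1.2 p.2.
  move=> Ap; have [[p1 pO] pM] := AM _ Ap; apply: f0 => //.
    by move: p1; rewrite /= in_itv/= => /andP[].
  by case: Ap => _ p2 k; have := p2 k; rewrite in_itv/= mxE => /andP[].
have [e e0 He] := compact_pos_lower cA (cont_onS AM cf) fA.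
exists e => // t x u xO Mu ud; move: t; apply: (time_ind T0) => t; first by rewrite fT.
move=> tT; apply: (He (t, x, u)); split; first by split=> //=; rewrite in_itv.
by move=> i; rewrite in_itv/= mxE ud/=; exact: M_le Mu i.
Qed.

Lemma g_scaled_cont (be : R) i : 0 < be < 1 ->
  cont_on (@cylinder R m n Omega v T)
    (fun p => g p.1.1 p.1.2 (be *: p.2) i 0 - be * g p.1.1 p.1.2 p.2 i 0).
Proof.
move=> /andP[b0 b1].
have c1 := @g_cont _ _ _ _ _ _ _ _ _ H T i.
pose phi (p : R * 'cV[R]_n * 'cV[R]_m) := (p.1, be *: p.2).
have cphi : continuous phi.
  move=> p B /nbhs_ballP[e /= e0 HB]; apply/nbhs_ballP; exists e => //= q [h1 [_ h2]].
  apply: HB; split=> //; split=> // k l; have := h2 k l; rewrite /ball/= !mxE -mulrBr normrM gtr0_norm//.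
  by apply: le_lt_trans; rewrite ler_piMl// ltW.
apply: cont_onD; last first.
  by under [X in cont_on _ X]eq_fun do rewrite -mulNr; exact: cont_onZ.
apply: (@cont_on_comp _ _ _ (@cylinder R m n Omega v T) _ _ phi _ cphi c1).
move=> [[t x] u] [h1 h2]; split=> //; apply: M_scale => //; by rewrite !ltW.
Qed.

(** The strict inequality at each point becomes uniform on the compact set
    { u in M, u >= del } over one period; only the sum over the components is
    strictly positive, because the order on vectors is strict in some component
    only. *)
Lemma g_strict (be del : R) : 0 < be < 1 -> 0 < del ->
  exists2 e0, 0 < e0 & forall t x u, Oc x -> M u -> (forall k, del <= u k 0) ->
    e0 <= \sum_i (g t x (be *: u) i 0 - be * g t x u i 0).
Proof.
move=> be01 del0.
apply: (@cylinder_lower (fun t x u => \sum_i (g t x (be *: u) i 0 - be * g t x u i 0)) del) => //.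
- by move=> t x u xO; rewrite (gT H).
- by apply: cont_on_sum => i; exact: g_scaled_cont.
- move=> t x u t0 xO Mu ud.
  have u0 k : 0 < u k 0 by apply: lt_le_trans (ud k).
  have /vltP[h [j hj]] : vlt (be *: g t x u) (g t x (be *: u)).
    by apply: (st_g_sub H) => //; [exact/order_boxE|exact/interior_RplusP].
  rewrite (bigD1 j)//=; rewrite mxE in hj; apply: ltr_wpDr; last by rewrite subr_gt0.
  by apply: sumr_ge0 => i _; have := h i; rewrite mxE subr_ge0.
Qed.

(** Same compactness argument as for [g_strict], now in each component. *)
Lemma g_strong (be del : R) : 0 < be < 1 -> 0 < del ->
  (forall t x u (alpha : R), 0 <= t -> closure Omega x ->
     order_box v u -> interior Rplus u -> 0 < alpha < 1 ->
     vll (alpha *: g t x u) (g t x (alpha *: u))) ->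
  exists2 e0, 0 < e0 & forall t x u i, Oc x -> M u -> (forall k, del <= u k 0) ->
    e0 <= g t x (be *: u) i 0 - be * g t x u i 0.
Proof.
move=> be01 del0 str.
have [i|i r s s0 sr h t x u xO Mu ud|e0 e00 He] := @fin_small_witness R 'I_m (fun i e0 =>
  forall t x u, Oc x -> M u -> (forall k, del <= u k 0) ->
    e0 <= g t x (be *: u) i 0 - be * g t x u i 0).
- apply: (@cylinder_lower (fun t x u => g t x (be *: u) i 0 - be * g t x u i 0) del) => //.
  + by move=> t x u xO; rewrite (gT H).
  + exact: g_scaled_cont.
  + move=> t x u t0 xO Mu ud.
    have u0 k : 0 < u k 0 by apply: lt_le_trans (ud k).
    have /vllP/(_ i) : vll (be *: g t x u) (g t x (be *: u)).
      by apply: str => //; [exact/order_boxE|exact/interior_RplusP].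
    by rewrite mxE subr_gt0.
- by apply: (le_trans sr); exact: h.
by exists e0 => // t x u i; exact: He.
Qed.

End reaction2.

(** * The nonlocal term *)

Section cont_measurable.
Context {R : realType}.

Lemma cont_on_open (X : pseudoMetricType R) (A : set X) f (a : R) : cont_on A f ->
  exists2 U, open U & A `&` f @^-1` `]a, +oo[ = A `&` U.
Proof.
move=> cf; exists ([set p | exists2 q, A q & exists2 r, 0 < r &
    (forall z, A z -> ball q r z -> a < f z) /\ ball q r p]°).
  exact: open_interior.
apply/seteqP; split => p [Ap].
  rewrite /= in_itv/= andbT => afp; split=> //; have fa0 : 0 < f p - a by rewrite subr_gt0.
  have [r r0 Hr] := cf p Ap _ fa0.
  apply/nbhs_ballP; exists r => //= q pq; exists p => //; exists r => //; split=> // z Az pz.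
  by have := Hr z Az pz; rewrite ltr_norml; lra.
move=> /interior_subset[q Aq [r r0 [h qp]]]; split=> //.
by rewrite /= in_itv/= andbT; exact: h.
Qed.

Lemma cont_on_measurable_cV n (A : set 'cV[R]_n) f : measurable A ->
  cont_on A f -> measurable_fun A f.
Proof.
move=> mA cf; apply: (measurability _ (measurable_realfun.RGenOInfty.measurableE R)) => //.
move=> _ [_ [a ->] <-]; have [U oU ->] := cont_on_open a cf.
by apply: measurableI => //; exact: open_cV_measurable.
Qed.

Lemma cont_on_measurable_prod n (A : set (R * 'cV[R]_n)) f : measurable A ->
  cont_on A f -> measurable_fun A f.
Proof.
move=> mA cf; apply: (measurability _ (measurable_realfun.RGenOInfty.measurableE R)) => //.
move=> _ [_ [a ->] <-]; have [U oU ->] := cont_on_open a cf.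
by apply: measurableI => //; exact: open_prod_measurable.
Qed.
End cont_measurable.

Section kernel.
Context {R : realType} {m n : nat} {Omega : set 'cV[R]_n} {d : 'rV[R]_m}
  {v : 'cV[R]_m} {K : 'I_m -> R -> 'cV[R]_n -> R}
  {g : R -> 'cV[R]_n -> 'cV[R]_m -> 'cV[R]_m} {T : R}.
Hypothesis H : standing Omega d v K g T.
Implicit Types (u w a b : 'cV[R]_m) (x y : 'cV[R]_n) (t s : R).
Local Notation Oc := (closure Omega).
Let T0 : 0 < T := st_T H.

Local Notation mu := (lebesgue_n n).

Lemma Omega_measurable : measurable Omega.
Proof. exact: open_cV_measurable (st_open H). Qed.

Lemma Omega_finite : (lebesgue_n n Omega < +oo)%E.
Proof. exact: lebesgue_n_bounded (st_bounded H) Omega_measurable. Qed.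

Lemma Omega_sub : Omega `<=` Oc.
Proof. exact: subset_closure. Qed.

Lemma diff_bound : exists2 N : R, 0 < N & forall x y, Oc x -> Oc y -> box (const_mx (- N)) (const_mx N) (x - y).
Proof.
have [N [_ HN]] := Oc_bounded H.
exists (2 * (`|N| + 1)); first by rewrite mulr_gt0// ltr_wpDl.
have hN x : Oc x -> `|x| <= `|N| + 1.
  by apply: HN; rewrite (le_lt_trans (ler_norm N))// ltrDl.
move=> x y /hN xN /hN yN i; rewrite !mxE in_itv/= -ler_norml.
have := ler_normB (x i 0) (y i 0); have := coord_le_norm x i; have := coord_le_norm y i; lra.
Qed.

Lemma K_periodic_modulus (N : R) i e : 0 < e -> exists2 r, 0 < r &
  forall t s (z w : 'cV[R]_n), box (const_mx (- N)) (const_mx N) z ->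
    box (const_mx (- N)) (const_mx N) w -> `|t - s| < r -> ball z r w ->
    `|K i t z - K i s w| < e.
Proof.
move=> e0; pose A : set (R * 'cV[R]_n) := `[0, 3 * T]%classic `*` box (const_mx (- N)) (const_mx N).
have cA : compact A by apply: compact_setX; [exact: segment_compact|exact: box_compact].
have cK : cont_on A (fun p => K i p.1 p.2).
  apply/within_cont_on; apply: continuous_subspaceT; exact: (st_K_cont H).
have [r r0 Hr] := compact_unif_cont cA cK e0.
exists (Num.min r T); first by rewrite lt_min r0.
move=> t s z w zN wN; rewrite lt_min => /andP[tsr tsT] zw.
have zwr : ball z r w by apply: le_ball zw; rewrite ge_min lexx.
have KT := st_K_per H.
move: t s tsr tsT; apply: (time_ind T0) => t.
  split=> h s ts1 ts2.
    by rewrite -(KT i t) -(KT i s); apply: h; rewrite (_ : t + T - (s + T) = t - s)//; ring.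
  by rewrite KT -(subrK T s) KT; apply: h; rewrite (_ : t - (s - T) = t + T - s)//; ring.
move=> /andP[t0 tT] s ts1 ts2; rewrite -(KT i t) -(KT i s).
have := ts2; rewrite ltr_norml => /andP[s1 s2].
apply: (Hr (t + T, z) (s + T, w)).
- by split=> //=; rewrite in_itv/=; lra.
- by split=> //=; rewrite in_itv/=; lra.
- by split=> //=; rewrite /ball/= (_ : t + T - (s + T) = t - s)//; ring.
Qed.

Lemma K_modulus e : 0 < e -> exists2 r, 0 < r &
  forall i t s x y z, Oc x -> Oc y -> Oc z -> `|t - s| < r -> ball x r y ->
    `|K i t (x - z) - K i s (y - z)| < e.
Proof.
move=> e0; have [N N0 HN] := diff_bound.
have [i|i r s s0 sr h|r r0 Hr] := @fin_small_witness R 'I_m (fun i r =>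
  forall t s (z w : 'cV[R]_n), box (const_mx (- N)) (const_mx N) z ->
    box (const_mx (- N)) (const_mx N) w -> `|t - s| < r -> ball z r w ->
    `|K i t z - K i s w| < e).
- exact: K_periodic_modulus.
- move=> t q z w zN wN tq zw; apply: h => //; first exact: lt_le_trans sr.
  exact: le_ball zw.
exists r => // i t s x y z xO yO zO ts xy; apply: Hr => //; try exact: HN.
case: xy => _ xy; split=> // k l; have := xy k l.
by rewrite /ball/= !mxE (_ : x k l - z k l - (y k l - z k l) = x k l - y k l)//; ring.
Qed.

Lemma K_bound : exists2 B : R, 0 < B & forall i t x y, Oc x -> Oc y -> K i t (x - y) <= B.
Proof.
have [N N0 HN] := diff_bound.
have [i|i r s rs h t z z1 z2|B B0 HB] := @fin_large_witness R 'I_m (fun i B =>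
  forall t (z : 'cV[R]_n), 0 <= t <= T -> box (const_mx (- N)) (const_mx N) z -> K i t z <= B).
- pose A : set (R * 'cV[R]_n) := `[0, T]%classic `*` box (const_mx (- N)) (const_mx N).
  have cA : compact A by apply: compact_setX; [exact: segment_compact|exact: box_compact].
  have cK : cont_on A (fun p => K i p.1 p.2).
    apply/within_cont_on; apply: continuous_subspaceT; exact: (st_K_cont H).
  have [B B0 HB] := compact_bound cA cK.
  exists B => // t z tT zN; apply: le_trans (ler_norm _) _.
  by apply: (HB (t, z)); split=> //=; rewrite in_itv.
- exact: le_trans (h t z z1 z2) rs.
exists B => // i t x y xO yO; move: t; apply: (time_ind T0) => t.
  by rewrite (st_K_per H).
by move=> tT; apply: HB => //; exact: HN.
Qed.

Lemma K_near0 : exists kap r : R, [/\ 0 < kap, 0 < r & forall i t x y, ball x r y -> kap <= K i t (x - y)].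
Proof.
have [i|i r s s0 sr h t t01|k k0 Hk] := @fin_small_witness R 'I_m (fun i e =>
  forall t, 0 <= t <= T -> e <= K i t 0).
- have cK : cont_on `[0, T]%classic (fun t => K i t 0).
    apply/within_cont_on; apply: continuous_subspaceT => t.
    apply: (@continuous_comp _ _ _ (fun t : R => (t, 0 : 'cV[R]_n)) (fun p => K i p.1 p.2)).
      move=> B /nbhs_ballP[e /= e0 HB]; apply/nbhs_ballP; exists e => //= q tq.
      by apply: HB; split=> //; exact: ballxx.
    exact: (st_K_cont H).
  have Kp t : `[0, T]%classic t -> 0 < K i t 0 by move=> _; exact: (st_K_pos H).
  have [k k0 Hk] := compact_pos_lower (@segment_compact R 0 T) cK Kp.
  by exists k => // t tT; apply: Hk; rewrite /= in_itv.
- exact: le_trans sr (h t t01).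
have k20 : 0 < k / 2 by rewrite divr_gt0.
have [i|i r s s0 sr h|r r0 Hr] := @fin_small_witness R 'I_m (fun i r =>
  forall t s (z w : 'cV[R]_n), box (const_mx (- 1)) (const_mx 1) z ->
    box (const_mx (- 1)) (const_mx 1) w -> `|t - s| < r -> ball z r w ->
    `|K i t z - K i s w| < k / 2).
- exact: K_periodic_modulus.
- move=> t q z w zN wN tq zw; apply: h => //; first exact: lt_le_trans sr.
  exact: le_ball zw.
exists (k / 2), (Num.min r 1); split=> //; first by rewrite lt_min r0 ltr01.
move=> i t x y xy.
have Kt0 : k <= K i t 0.
  move: t; apply: (time_ind T0) => t; first by rewrite (st_K_per H).
  exact: Hk.
have : `|K i t 0 - K i t (x - y)| < k / 2.
  apply: Hr; rewrite ?subrr ?normr0//.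
  - by move=> l; rewrite !mxE in_itv/=; lra.
  - move=> l; case: xy => _ /(_ l 0); rewrite /ball/= lt_min => /andP[_].
    by rewrite !mxE in_itv/= ltr_norml; lra.
  - case: xy => _ xy; split=> // l c; have := xy l c; rewrite /ball/= !mxE lt_min => /andP[h _].
    by rewrite sub0r normrN.
by rewrite ltr_norml => /andP[_]; lra.
Qed.

Lemma K_measurable i t x : measurable_fun setT (fun y => K i t (x - y)).
Proof.
have cK : continuous (fun y : 'cV[R]_n => K i t (x - y)).
  move=> y; apply: (@continuous_comp _ _ _ (fun y : 'cV[R]_n => (t, x - y)) (fun p => K i p.1 p.2)).
    move=> B /nbhs_ballP[e /= e0 HB]; apply/nbhs_ballP; exists e => //= z [_ yz].
    apply: HB; split=> /=; first exact: ballxx.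
    by split=> // k l; have := yz k l; rewrite /ball/= !mxE !ltr_norml; lra.
  exact: (st_K_cont H).
apply: cont_on_measurable_cV => //; apply/within_cont_on.
exact: continuous_subspaceT.
Qed.

Lemma K_bounded_meas i t x : Oc x -> bounded_meas Omega (fun y => K i t (x - y)).
Proof.
move=> xO; split; first by apply: measurable_funTS; exact: K_measurable.
have [B B0 HB] := K_bound; exists B => y yO.
by rewrite ger0_norm ?(st_K_ge0 H)//; apply: HB => //; exact: Omega_sub.
Qed.

(** Component i of the dispersal term, as a function of a scalar density. *)
Definition nl i t x (f : 'cV[R]_n -> R) : R :=
  \int[mu]_(y in Omega) (K i t (x - y) * f y).

Lemma Kf_bounded_meas i t x f : Oc x -> bounded_meas Omega f ->
  bounded_meas Omega (fun y => K i t (x - y) * f y).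
Proof. by move=> xO bf; apply: bounded_measM => //; exact: K_bounded_meas. Qed.

Lemma nl_lin i t x f h (a : R) : Oc x -> bounded_meas Omega f -> bounded_meas Omega h ->
  nl i t x (fun y => f y + a * h y) = nl i t x f + a * nl i t x h.
Proof.
move=> xO bf bh; have mO := Omega_measurable; have fO := Omega_finite.
have iK q : bounded_meas Omega q -> mu.-integrable Omega (EFin \o (fun y => K i t (x - y) * q y)).
  by move=> bq; apply: bounded_meas_integrable => //; exact: Kf_bounded_meas.
rewrite /nl -RintegralZl ?iK//.
rewrite -RintegralD ?iK//; last first.
  apply: bounded_meas_integrable => //; apply: bounded_measM; first exact: bounded_meas_cst.
  exact: Kf_bounded_meas.
by apply: eq_Rintegral => y _; ring.
Qed.

Lemma nl_scale (al : R) i t x f : Oc x -> bounded_meas Omega f ->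
  nl i t x (fun y => al * f y) = al * nl i t x f.
Proof.
move=> xO bf; rewrite /nl -RintegralZl; first by apply: eq_Rintegral => y _; ring.
  exact: Omega_measurable.
apply: bounded_meas_integrable; [exact: Omega_measurable|exact: Omega_finite|].
exact: Kf_bounded_meas.
Qed.

Lemma nl_ge0 i t x f : (forall y, Omega y -> 0 <= f y) -> 0 <= nl i t x f.
Proof. by move=> f0; apply: Rintegral_ge0 => y yO; rewrite mulr_ge0 ?(st_K_ge0 H)// f0. Qed.

Lemma nl_le i t x f h (B : R) : Oc x -> (forall y, Omega y -> 0 <= f y <= h y) ->
  (forall y, Omega y -> h y <= B) -> nl i t x f <= nl i t x h.
Proof.
move=> xO fh hB; have [B' B'0 HB'] := K_bound.
apply: (@ge0_le_Rintegral R n Omega Omega_measurable Omega_finite _ _ (B' * B)).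
  move=> y yO; have /andP[f0 fhy] := fh y yO; have K0 := st_K_ge0 H i t (x - y).
  by rewrite mulr_ge0//= ler_wpM2l.
move=> y yO; have /andP[f0 fhy] := fh y yO; have K0 := st_K_ge0 H i t (x - y).
apply: ler_pM => //; [exact: le_trans fhy|by apply: HB' => //; exact: Omega_sub|exact: hB].
Qed.

(** The kernel has total mass 1, and integrating over Omega only loses mass. *)
Lemma nl_cst i t x (a : R) : Oc x -> 0 <= a -> nl i t x (fun=> a) <= a.
Proof.
move=> xO a0; have mO := Omega_measurable; have fO := Omega_finite.
have iK : mu.-integrable Omega (EFin \o (fun y => K i t (x - y))).
  by apply: bounded_meas_integrable => //; exact: K_bounded_meas.
rewrite /nl RintegralZr// ler_piMl//.
rewrite -lee_fin /Rintegral fineK; last exact: integrable_fin_num.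
have -> : 1%E = (\int[mu]_y (K i t (x - y))%:E)%E :> \bar R.
  rewrite (@integral_reflect R n x (fun z => (K i t z)%:E)) ?(st_K_mass H)//.
    apply/measurable_EFinP; have := K_measurable i t 0.
    have := sub_cV_measurable (0 : 'cV[R]_n) => m1 m2.
    have := measurableT_comp m2 m1; apply: eq_measurable_fun => z _ /=.
    by rewrite !sub0r opprK.
  by move=> y; rewrite lee_fin (st_K_ge0 H).
apply: ge0_subset_integral => //; last by move=> y _; rewrite lee_fin (st_K_ge0 H).
by apply/measurable_EFinP; exact: K_measurable.
Qed.

Lemma nl_bound i t x f (a : R) : Oc x -> 0 <= a -> (forall y, Omega y -> 0 <= f y <= a) ->
  nl i t x f <= a.
Proof.
move=> xO a0 fa; apply: le_trans (nl_cst i t xO a0).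
exact: (@nl_le i t x f (fun=> a) a xO).
Qed.

Lemma nl_ball kap r i t x f h (B : R) : 0 < kap ->
  (forall i t x y, ball x r y -> kap <= K i t (x - y)) ->
  Oc x -> bounded_meas Omega h -> (forall y, Omega y -> 0 <= h y <= f y) ->
  (forall y, Omega y -> f y <= B) ->
  kap * \int[mu]_(y in Omega) (\1_(ball x r) y * h y) <= nl i t x f.
Proof.
move=> k0 Kk xO bh hf fB; have mO := Omega_measurable; have fO := Omega_finite.
have b1 : bounded_meas Omega (fun y => \1_(ball x r) y * h y).
  apply: bounded_measM => //; split.
    apply: measurable_indic; apply: open_cV_measurable; exact: ball_open.
  by exists 1 => y _; rewrite indicE; case: (_ \in _); rewrite ?normr1 ?normr0.
rewrite -RintegralZl//; last exact: bounded_meas_integrable.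
apply: le_trans (@nl_le i t x h f B xO hf fB).
apply: le_Rintegral => //.
- by apply: bounded_meas_integrable => //; apply: bounded_measM => //; exact: bounded_meas_cst.
- by apply: bounded_meas_integrable => //; exact: Kf_bounded_meas.
move=> y yO; have /andP[h0 _] := hf y yO; rewrite mulrA ler_wpM2r// indicE.
case: (boolP (y \in (ball x r : set 'cV[R]_n))) => [|_]; last by rewrite mulr0 (st_K_ge0 H).
by rewrite inE mulr1 => /Kk.
Qed.

(** A finite cover of the closure of Omega such that any two complementary groups
    of balls overlap inside Omega; otherwise they would separate the connected set
    Omega. *)
Lemma ball_chain r : 0 < r -> exists (I : finType) (p : I -> 'cV[R]_n),
  [/\ Oc `<=` \bigcup_i ball (p i) r,
      forall i, Omega `&` ball (p i) r !=set0 &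
      forall S : {set I}, S != finset.set0 -> S != [set: I]%SET ->
        exists k l, [/\ k \in S, l \notin S & Omega `&` ball (p k) r `&` ball (p l) r !=set0]].
Proof.
move=> r0; have := Oc_compact H; rewrite compact_cover => /(_ _ Oc (fun x => ball x r)).
move=> [i _|x xO|D DO Dc]; first exact: ball_open.
  by exists x => //; exact: ballxx.
pose p (k : D) := val k.
have pO k : Oc (p k) by have := DO (val k) (valP k); rewrite inE.
have Vn k : Omega `&` ball (p k) r !=set0.
  have [] := pO k (ball (p k) r); first exact: nbhsx_ballx.
  by move=> z [zO zb]; exists z.
have cov : Oc `<=` \bigcup_k ball (p k) r.
  by move=> x /Dc[y /= yD xy]; exists [` yD]%fset.
exists D, p; split=> // S S0 ST.
apply: contrapT => no.
pose A := \bigcup_(k in [set k | k \in S]) ball (p k) r.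
pose B := \bigcup_(k in [set k | k \notin S]) ball (p k) r.
have AB z : Omega z -> A z -> B z -> False.
  move=> zO [k kS zk] [l lS zl]; apply: no; exists k, l; split=> //.
  by exists z.
have oA : open A by apply: bigcup_open => k _; exact: ball_open.
have oB : open B by apply: bigcup_open => k _; exact: ball_open.
have OAB z : Omega z -> A z \/ B z.
  move=> zO; have [k _ zk] := cov z (Omega_sub zO).
  by have [kS|kS] := boolP (k \in S); [left|right]; exists k.
have [k kS] : exists k, k \in S by apply/set0Pn.
have [l lS] : exists l, l \notin S.
  by apply/existsP; rewrite -negb_forall; apply: contra ST => /forallP SS; apply/eqP/setP => q; rewrite SS finset.inE.
have E : Omega `&` A = Omega.
  apply: (st_connected H).
  - by have [z [zO zk]] := Vn k; exists z; split=> //; exists k.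
  - by exists A => //.
  - exists (~` B); first exact: open_closedC.
    apply/seteqP; split=> z [zO hz]; split=> //; first by move=> hB; exact: AB zO hz hB.
    by case: (OAB z zO).
have [z [zO zl]] := Vn l.
by apply: (AB z zO); [by move: zO; rewrite -{1}E => -[]|exists l].
Qed.

(** Let h be a measurable minorant at time s. Some ball of a fine cover contains a
    fixed fraction of the mass of h, and since the kernel is positive near the
    diagonal, after one time step u is bounded below on the ball. Each further step
    carries the bound to a ball that overlaps, inside Omega, a ball already
    reached. *)
Lemma spread (c kap r tau : R) : 0 < c -> 0 < kap -> 0 < r -> 0 < tau ->
  exists2 rho : R, 0 < rho & forall (u u' N : R -> 'cV[R]_n -> R) s h,
  (forall x, Oc x -> traj s (s + tau) (u ^~ x) (u' ^~ x)) ->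
  (forall t x, s <= t <= s + tau -> Oc x -> 0 <= u t x) ->
  (forall t x, s < t < s + tau -> Oc x -> - (c * u t x) + N t x <= u' t x) ->
  (forall t x, s < t < s + tau -> Oc x -> 0 <= N t x) ->
  (forall t x f, s < t < s + tau -> Oc x -> bounded_meas Omega f ->
     (forall y, Omega y -> 0 <= f y <= u t y) ->
     kap * \int[mu]_(y in Omega) (\1_(ball x r) y * f y) <= N t x) ->
  bounded_meas Omega h -> (forall y, Omega y -> 0 <= h y <= u s y) ->
  forall x, Oc x -> rho * \int[mu]_(y in Omega) h y <= u (s + tau) x.
Proof.
move=> c0 kap0 r0 tau0; have mO := Omega_measurable; have fO := Omega_finite.
have r40 : 0 < r / 4 by rewrite divr_gt0.
have [I [p [cov Vn chain]]] := ball_chain r40.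
pose V k : set 'cV[R]_n := ball (p k) (r / 4).
have mV k : measurable (V k) by apply: open_cV_measurable; exact: ball_open.
have b1 (A : set 'cV[R]_n) : measurable A -> bounded_meas Omega (\1_A : _ -> R).
  move=> mA; split; first exact: measurable_indic.
  by exists 1 => y _; rewrite indicE; case: (_ \in _); rewrite ?normr1 ?normr0.
have iI f : bounded_meas Omega f -> mu.-integrable Omega (EFin \o f) by exact: bounded_meas_integrable.
have [k|k e e' e0 ee h|mu0 mu00 Hmu0] := @fin_small_witness R I
    (fun k e => e <= \int[mu]_(y in Omega) (\1_(V k) y)).
- exists (\int[mu]_(y in Omega) (\1_(V k) y)) => //.
  rewrite /Rintegral integral_indic// fine_gt0//; apply/andP; split.
    apply: lebesgue_n_open_gt0; last by have [z [zO zk]] := Vn k; exists z.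
    by apply: openI; [exact: ball_open|exact: (st_open H)].
  apply: le_lt_trans fO; apply: le_measure; rewrite ?inE//.
  exact: measurableI.
- exact: le_trans ee h.
have I0 : (0 < #|I|)%N.
  have [z zO] := st_nonempty H; have [k _ _] := cov z (Omega_sub zO).
  by apply/card_gt0P; exists k.
have In0 : 0 < #|I|%:R :> R by rewrite ltr0n.
pose h1 := tau / #|I|.+1%:R.
have h10 : 0 < h1 by rewrite divr_gt0// ltr0n.
pose E := expR (- (c * h1)).
have E0 : 0 < E by exact: expR_gt0.
have E1 : E < 1 by rewrite expR_lt1// mulr_gt0.
pose gain := kap * E * (1 - E) / c.
have gain0 : 0 < gain by rewrite divr_gt0// !mulr_gt0// subr_gt0.
pose rho1 := Num.min E (gain * mu0).
have rho10 : 0 < rho1 by rewrite lt_min E0 mulr_gt0.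
pose rho0 := gain / #|I|%:R.
have rho00 : 0 < rho0 by rewrite divr_gt0.
exists (rho1 ^+ #|I| * rho0); first by rewrite mulr_gt0// exprn_gt0.
move=> u u' N s h tu u0 Hu N0 HN bh hu.
pose time (l : nat) := s + l%:R * h1.
have timeS l : time l.+1 = time l + h1 by rewrite /time -natr1; ring.
have time_end : time #|I|.+1 = s + tau.
  by rewrite /time /h1 mulrC divfK// pnatr_eq0.
have time_in l t : (l <= #|I|)%N -> time l <= t <= time l.+1 -> s <= t <= s + tau.
  move=> lI; rewrite -time_end.
  have : 0 <= l%:R * h1 by rewrite mulr_ge0// ltW.
  have : l.+1%:R * h1 <= #|I|.+1%:R * h1 by rewrite ler_pM2r// ler_nat.
  by rewrite /time; lra.
have time_in' l t : (l <= #|I|)%N -> time l < t < time l.+1 -> s < t < s + tau.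
  move=> lI; rewrite -time_end.
  have : 0 <= l%:R * h1 by rewrite mulr_ge0// ltW.
  have : l.+1%:R * h1 <= #|I|.+1%:R * h1 by rewrite ler_pM2r// ler_nat.
  by rewrite /time; lra.
have sub_traj l x : (l <= #|I|)%N -> Oc x -> traj (time l) (time l.+1) (u ^~ x) (u' ^~ x).
  move=> lI xO; have lt : time l <= time l.+1 by rewrite timeS lerDl ltW.
  apply: traj_sub (tu x xO).
    by have /andP[] := time_in l (time l) lI (introT andP (conj (lexx _) lt)).
  by have /andP[] := time_in l (time l.+1) lI (introT andP (conj lt (lexx _))).
(* decay over one step *)
have keep l t x : (l <= #|I|)%N -> Oc x -> time l <= t <= time l.+1 -> E * u (time l) x <= u t x.
  move=> lI xO /andP[lt tl].
  have tr := traj_sub (lexx _) tl (sub_traj l x lI xO).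
  have Hd q : time l < q < t -> 0 <= u' q x + c * u q x.
    move=> /andP[q1 q2]; have q3 : s < q < s + tau by apply: (time_in' l) => //; rewrite q1 (lt_le_trans q2).
    by have := Hu q x q3 xO; have := N0 q x q3 xO; lra.
  have := exp_lower lt c0 tr Hd; rewrite mul0r subr0 add0r; apply: le_trans.
  rewrite ler_wpM2r//; last by rewrite ler_expR lerN2 ler_pM2l//; move: tl; rewrite timeS; lra.
  apply: u0 => //; apply: (time_in l) => //; rewrite lexx /= timeS lerDl; exact: ltW.
(* gain over one step from a minorant f at its beginning *)
have feed l x f (a : R) : (l <= #|I|)%N -> Oc x -> bounded_meas Omega f ->
    (forall y, Omega y -> 0 <= f y <= u (time l) y) ->
    a <= \int[mu]_(y in Omega) (\1_(ball x r) y * f y) ->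
    gain * a <= u (time l.+1) x.
  move=> lI xO bf fu af.
  have Hd q : time l < q < time l.+1 -> kap * (E * a) <= u' q x + c * u q x.
    move=> q12; have q3 := time_in' l q lI q12.
    have bEf : bounded_meas Omega (fun y => E * f y) by apply: bounded_measM => //; exact: bounded_meas_cst.
    have hE y : Omega y -> 0 <= E * f y <= u q y.
      move=> yO; have /andP[f0 fuy] := fu y yO.
      rewrite mulr_ge0 ?(ltW E0)//=.
      have q12' : time l <= q <= time l.+1 by case/andP: q12 => *; rewrite !ltW.
      by apply: le_trans (keep l q y lI (Omega_sub yO) q12'); rewrite ler_pM2l.
    have hN := HN q x (fun y => E * f y) q3 xO bEf hE.
    have HuN := Hu q x q3 xO.
    apply: (@le_trans _ _ (N q x)); last by lra.
    apply: le_trans hN.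
    have -> : \int[mu]_(y in Omega) (\1_(ball x r) y * (E * f y)) =
       E * \int[mu]_(y in Omega) (\1_(ball x r) y * f y).
      rewrite -RintegralZl//; first by apply: eq_Rintegral => y _; ring.
      apply: iI; apply: bounded_measM => //; apply: b1.
      by apply: open_cV_measurable; exact: ball_open.
    by rewrite !ler_pM2l.
  have lt : time l <= time l.+1 by rewrite timeS lerDl ltW.
  have := exp_lower lt c0 (sub_traj l x lI xO) Hd.
  have -> : time l.+1 - time l = h1 by rewrite timeS; ring.
  rewrite -/E; apply: le_trans.
  have u00 : 0 <= u (time l) x.
    by apply: u0 => //; apply: (time_in l) => //; rewrite lexx.
  have : 0 <= E * u (time l) x by rewrite mulr_ge0// ltW.
  have -> : gain * a = kap * (E * a) / c * (1 - E) by rewrite /gain; ring.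
  lra.
have ind01 (A : set 'cV[R]_n) y : 0 <= (\1_A y : R) <= 1.
  by rewrite indicE; case: (_ \in _); rewrite /= ?lexx ?ler01.
have ind1 (A : set 'cV[R]_n) y : A y -> \1_A y = 1 :> R by move=> Ay; rewrite indicE mem_set.
have ind0 (A : set 'cV[R]_n) y : ~ A y -> \1_A y = 0 :> R by move=> Ay; rewrite indicE memNset.
have mball x : measurable (ball x r : set 'cV[R]_n) by apply: open_cV_measurable; exact: ball_open.
set h0 := \int[mu]_(y in Omega) h y.
have h00 : 0 <= h0 by apply: Rintegral_ge0 => y /hu/andP[].
have hpos y : Omega y -> 0 <= h y by move=> /hu/andP[].
have [k0 Hk0] : exists k0, h0 / #|I|%:R <= \int[mu]_(y in Omega) (\1_(V k0) y * h y).
  apply: contrapT => no.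
  have lt k : \int[mu]_(y in Omega) (\1_(V k) y * h y) < h0 / #|I|%:R.
    by rewrite ltNge; apply/negP => hk; apply: no; exists k.
  have sumE (l : seq I) : bounded_meas Omega (fun y => \sum_(k <- l) \1_(V k) y * h y) /\
      \int[mu]_(y in Omega) (\sum_(k <- l) \1_(V k) y * h y) =
      \sum_(k <- l) \int[mu]_(y in Omega) (\1_(V k) y * h y).
    elim: l => [|k l [IH1 IH2]].
      under [X in bounded_meas _ X]eq_fun do rewrite big_nil.
      split; first exact: bounded_meas_cst.
      by rewrite big_nil; under eq_Rintegral do rewrite big_nil; rewrite Rintegral_cst// mul0r.
    have bk : bounded_meas Omega (fun y => \1_(V k) y * h y) by apply: bounded_measM => //; exact: b1.
    under [X in bounded_meas _ X]eq_fun do rewrite big_cons.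
    split; first exact: bounded_measD.
    rewrite big_cons -IH2 -RintegralD ?iI//.
    by apply: eq_Rintegral => y _; rewrite big_cons.
  have [bs Es] := sumE (index_enum I).
  have : h0 <= \sum_k \int[mu]_(y in Omega) (\1_(V k) y * h y).
    rewrite -Es; apply: le_Rintegral; rewrite ?iI// => y yO.
    have [k _ yk] := cov y (Omega_sub yO).
    rewrite (bigD1 k)//= ind1// mul1r lerDl sumr_ge0// => l _.
    by rewrite mulr_ge0 ?hpos//; have /andP[] := ind01 (V l) y.
  have : \sum_k \int[mu]_(y in Omega) (\1_(V k) y * h y) < \sum_(k in I) (h0 / #|I|%:R).
    have [k kI] := card_gt0P I0.
    rewrite (bigD1 k)//= [X in _ < X](bigD1 k)//=; apply: ltr_leD; first exact: lt.
    by apply: ler_sum => l _; exact: ltW (lt l).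
  move=> hlt hle; have := le_lt_trans hle hlt.
  by rewrite sumr_const -[X in _ < X]mulr_natr mulfVK ?gt_eqF// ltxx.
pose a0 := rho0 * h0.
have a00 : 0 <= a0 by rewrite mulr_ge0// ltW.
have inball k x y : V k x -> V k y -> ball x r y.
  move=> kx ky; apply: (@le_ball _ _ _ (r / 4 + r / 4)); first by lra.
  by apply: ball_triangle ky; exact: ball_sym.
pose P l (A : {set I}) := (l <= #|I|)%N -> forall k x, k \in A -> Oc x -> V k x ->
  rho1 ^+ l * a0 <= u (time l.+1) x.
suff PT : P #|I| [set: I]%SET.
  move=> x xO; have [k _ xk] := cov x xO.
  have := PT (leqnn _) k x (finset.in_setT k) xO xk.
  by rewrite time_end /a0 mulrA.
apply: infection.
  exists [set k0]%SET; split; last by rewrite -finset.card_gt0 finset.cards1.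
  move=> _ k x; rewrite finset.in_set1 => /eqP-> xO xk; rewrite expr0 mul1r.
  have -> : a0 = gain * (h0 / #|I|%:R) by rewrite /a0 /rho0; ring.
  apply: (feed 0%N x h) => //; first by rewrite /time mul0r addr0.
  apply: (le_trans Hk0); apply: le_Rintegral => //.
  - by apply: iI; apply: bounded_measM => //; exact: b1.
  - by apply: iI; apply: bounded_measM => //; exact: b1.
  move=> y yO; rewrite ler_wpM2r ?hpos//.
  have [yk|yk] := pselect (V k0 y); last by rewrite (ind0 _ _ yk); have /andP[] := ind01 (ball x r) y.
  by rewrite (ind1 _ _ yk) ind1//; exact: inball yk.
move=> l A PA An.
have a_l : 0 <= rho1 ^+ l * a0 by rewrite mulr_ge0// exprn_ge0// ltW.
have stay : forall k x, (l.+1 <= #|I|)%N -> k \in A -> Oc x -> V k x ->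
    rho1 ^+ l.+1 * a0 <= u (time l.+2) x.
  move=> k x lI kA xO xk; have := PA (ltnW lI) k x kA xO xk => ua.
  apply: le_trans (keep l.+1 (time l.+2) x lI xO _); last by rewrite lexx (timeS l.+1) lerDl ltW.
  rewrite exprS -mulrA; apply: ler_pM => //; [exact: ltW|by rewrite ge_min lexx].
have [AT|AT] := eqVneq A [set: I]%SET.
  by exists A; split=> // lI k x; exact: stay.
have [k [q [kA qA [z [[zO zk] zq]]]]] := chain A An AT.
exists (q |: A); split; last 2 first.
- exact: finset.subsetUr.
- by move=> _; apply: contraNneq qA => ->; rewrite finset.setU11.
move=> lI k' x; rewrite finset.in_setU1 => /orP[/eqP->|kA'] xO xk'; last exact: (stay k').
pose a := rho1 ^+ l * a0.
have Vball y : V k y -> ball x r y.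
  move=> ky; apply: (@le_ball _ _ _ ((r / 4 + r / 4) + (r / 4 + r / 4))); first by lra.
  apply: (@ball_triangle _ _ z).
    by apply: ball_triangle zq; exact: ball_sym.
  by apply: ball_triangle ky; exact: ball_sym.
have /(_ (fun y => a * \1_(V k) y) (a * mu0)) := feed l.+1 x _ _ lI xO.
have -> : rho1 ^+ l.+1 * a0 = rho1 * a by rewrite /a exprS mulrA.
move=> F; apply: (@le_trans _ _ (gain * (a * mu0))).
  have -> : gain * (a * mu0) = gain * mu0 * a by ring.
  by rewrite ler_wpM2r// ge_min lexx orbT.
apply: F.
- by apply: bounded_measM; [exact: bounded_meas_cst|exact: b1].
- move=> y yO; have /andP[i0 _] := ind01 (V k) y; rewrite mulr_ge0//=.
  have [yk|yk] := pselect (V k y).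
    by rewrite ind1// mulr1; exact: (PA (ltnW lI) k y kA (Omega_sub yO) yk).
  rewrite ind0// mulr0; apply: u0 => //; last exact: Omega_sub.
  by apply: (time_in l.+1) => //; rewrite lexx (timeS l.+1) lerDl ltW.
- have -> : \int[mu]_(y in Omega) (\1_(ball x r) y * (a * \1_(V k) y)) = a * \int[mu]_(y in Omega) (\1_(V k) y).
    rewrite -RintegralZl//; last by apply: iI; exact: b1.
    apply: eq_Rintegral => y _; have [yk|yk] := pselect (V k y).
      by rewrite (ind1 _ _ (Vball _ yk)) mul1r.
    by rewrite ind0// !mulr0.
  by rewrite ler_wpM2l.
Qed.

End kernel.

(** * Spatial Harnack inequality and linear comparison *)

Section system.
Context {R : realType} {m n : nat} {Omega : set 'cV[R]_n} {d : 'rV[R]_m}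
  {v : 'cV[R]_m} {K : 'I_m -> R -> 'cV[R]_n -> R}
  {g : R -> 'cV[R]_n -> 'cV[R]_m -> 'cV[R]_m} {T : R}.
Hypothesis H : standing Omega d v K g T.
Implicit Types (u w : R -> 'cV[R]_n -> 'cV[R]_m) (x y : 'cV[R]_n) (t s : R).
Local Notation Oc := (closure Omega).
Local Notation J := (fun t x a => jacobian_u g t x a).
Let T0 : 0 < T := st_T H.

Local Notation mu := (lebesgue_n n).
Implicit Types (phi psi : 'cV[R]_n -> 'cV[R]_m).

(** What a nonnegative solution of the linear or of the nonlinear problem satisfies
    at (t,x): a coupling beta between the components and a nonlocal gain N that sees
    the mass near x of any measurable minorant. Both Harnack inequalities apply to
    such systems. *)
Definition lower_at (c b0 kap r : R) (u u' : R -> 'cV[R]_n -> 'cV[R]_m)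
    (beta : R -> 'cV[R]_n -> 'I_m -> 'I_m -> R) (N : R -> 'cV[R]_n -> 'I_m -> R) t x :=
  [/\ irreducible_at b0 (beta t x),
      forall i, - (c * u t x i 0) + \sum_(k | k != i) beta t x i k * u t x k 0 + N t x i <= u' t x i 0,
      forall i, 0 <= N t x i &
      forall i f, bounded_meas Omega f -> (forall y, Omega y -> 0 <= f y <= u t y i 0) ->
        kap * \int[mu]_(y in Omega) (\1_(ball x r) y * f y) <= N t x i].

Definition lower_system (c b0 kap r a b : R) (u u' : R -> 'cV[R]_n -> 'cV[R]_m) :=
  [/\ forall x i, Oc x -> traj a b (fun t => u t x i 0) (fun t => u' t x i 0),
      forall t x i, a <= t <= b -> Oc x -> 0 <= u t x i 0 &
      exists beta N, forall t x, a < t < b -> Oc x -> lower_at c b0 kap r u u' beta N t x].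

Lemma lower_system_decay c b0 kap r a b u u' x i : 0 < c -> a <= b -> Oc x ->
  lower_system c b0 kap r a b u u' -> expR (- (c * (b - a))) * u a x i 0 <= u b x i 0.
Proof.
move=> c0 ab xO [tu u0 [beta [N HN]]].
have h q : a < q < b -> 0 <= u' q x i 0 + c * u q x i 0.
  move=> tq; have [[beta0 _] /(_ i) + /(_ i) + _] := HN q x tq xO.
  have : 0 <= \sum_(k | k != i) beta q x i k * u q x k 0.
    apply: sumr_ge0 => k ki; rewrite mulr_ge0//; first by apply: beta0; rewrite eq_sym.
    by apply: u0 => //; case/andP: tq => /ltW-> /ltW->.
  move: (\sum_(k | k != i) _) (N q x i) => A B; lra.
by have := exp_lower ab c0 (tu x i xO) h; rewrite mul0r add0r subr0.
Qed.

(** Half of the bound is [local_harnack] at the point x; for the other half,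
    [spread] moves the mass of the component j over the closure of Omega during half
    a period, and [local_harnack] passes it to the other components during the
    second half. *)
Lemma harnack (c b0 kap r : R) : 0 < c -> 0 < b0 -> 0 < kap -> 0 < r ->
  exists2 rho : R, 0 < rho & forall u u' s h j, lower_system c b0 kap r s (s + T) u u' ->
    bounded_meas Omega h -> (forall y, Omega y -> 0 <= h y <= u s y j 0) ->
    forall x i, Oc x -> rho * (u s x j 0 + \int[mu]_(y in Omega) h y) <= u (s + T) x i 0.
Proof.
move=> c0 b00 kap0 r0; have T20 : 0 < T / 2 by rewrite divr_gt0.
have [r1 [k1 [r10 k10 LH1]]] := @local_harnack R m c b0 T c0 b00 T0.
have [r2 [k2 [r20 k20 LH2]]] := @local_harnack R m c b0 (T / 2) c0 b00 T20.
have [r3 r30 SP] := spread H c0 kap0 r0 T20.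
exists (Num.min r1 (r2 * r3) / 2); first by rewrite divr_gt0// lt_min r10 mulr_gt0.
move=> u u' s h j [tu u0 [beta [N HN]]] bh hu x i xO.
have sT t : s <= t <= s + T -> s <= t <= s + T by [].
have h1 : r1 * u s x j 0 <= u (s + T) x i 0.
  apply: (LH1 (fun t i => u t x i 0) (fun t i => u' t x i 0) (fun t => beta t x) s 0 _ j) => //.
  - by move=> k; exact: tu.
  - by move=> t k st; exact: u0.
  - move=> t k st; have {HN}[_ Hu N0 _] := HN t x st xO.
    by have := Hu k; have := N0 k; lra.
  - by move=> t st; have {HN}[] := HN t x st xO.
  - by rewrite lexx/= mulr_ge0 ?(ltW k10)// u0// lexx lerDl ltW.
  - by rewrite u0// lexx lerDl ltW.
have sT2 : s + T / 2 + T / 2 = s + T by field.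
have h2 : r3 * \int[mu]_(y in Omega) h y <= u (s + T / 2) x j 0.
  apply: (SP (fun t x => u t x j 0) (fun t x => u' t x j 0) (fun t x => N t x j)) => //.
  - move=> y yO; apply: traj_sub (tu y j yO) => //; lra.
  - by move=> t y st yO; apply: u0 => //; lra.
  - move=> t y st yO; have st' : s < t < s + T by lra.
    have {HN}[[b0p _] Hu N0 _] := HN t y st' yO.
    have : 0 <= \sum_(k | k != j) beta t y j k * u t y k 0.
      apply: sumr_ge0 => k kj; rewrite mulr_ge0//; first by apply: b0p; rewrite eq_sym.
      by apply: u0 => //; lra.
    by have := Hu j; lra.
  - by move=> t y st yO; have [|_ _ N0 _] := HN t y _ yO => //; clear HN; lra.
  - move=> t y f st yO; have st' : s < t < s + T by lra.
    by have [_ _ _ hb] := HN t y st' yO; exact: hb.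
have I0 : 0 <= \int[mu]_(y in Omega) h y by apply: Rintegral_ge0 => y /hu/andP[].
move: h2 I0; move: (\int[mu]_(y in Omega) h y) => I h2 I0.
have h3 : r2 * (r3 * I) <= u (s + T) x i 0.
  rewrite -sT2.
  apply: (LH2 (fun t i => u t x i 0) (fun t i => u' t x i 0) (fun t => beta t x) (s + T / 2) 0 _ j) => //.
  - by move=> k; apply: traj_sub (tu x k xO); lra.
  - by move=> t k st; apply: u0 => //; lra.
  - move=> t k st; have st' : s < t < s + T by lra.
    have {HN}[_ Hu N0 _] := HN t x st' xO.
    by have := Hu k; have := N0 k; lra.
  - by move=> t st; have [|] := HN t x _ xO => //; clear HN; lra.
  - by rewrite lexx/= !mulr_ge0// ltW.
  - by rewrite mulr_ge0// ltW.
have us0 : 0 <= u s x j 0 by rewrite u0// lexx lerDl ltW.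
have : Num.min r1 (r2 * r3) * u s x j 0 <= r1 * u s x j 0.
  by rewrite ler_wpM2r// ge_min lexx.
have : Num.min r1 (r2 * r3) * I <= r2 * r3 * I.
  by rewrite ler_wpM2r// ge_min lexx orbT.
by lra.
Qed.

Lemma rhsE t phi x i :
  rhs Omega d K g t phi x i 0 =
  d 0 i * nl (Omega := Omega) (K := K) i t x (fun y => phi y i 0) - d 0 i * phi x i 0 + g t x (phi x) i 0.
Proof. by rewrite /rhs !mul_diag_mx !mxE. Qed.

Lemma linear_partE t phi x i :
  linear_part Omega d K g t phi x i 0 =
  d 0 i * nl (Omega := Omega) (K := K) i t x (fun y => phi y i 0) - d 0 i * phi x i 0
    + \sum_k J t x 0 i k * phi x k 0.
Proof.
rewrite /linear_part !mul_diag_mx !mxE; congr (_ + _).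
Qed.

Lemma is_derive_comp (f : R -> 'cV[R]_m) t (l : 'cV[R]_m) i :
  is_derive t 1 f l -> is_derive t 1 (fun s => f s i 0) (l i 0).
Proof.
move=> [df <-]; apply: DeriveDef; first by have := (derivable_mxP f t 1).1 df i 0.
by rewrite derive_mx// mxE.
Qed.

Lemma is_derive_col (f : R -> 'cV[R]_m) t (l : 'cV[R]_m) :
  (forall i, is_derive t 1 (fun s => f s i 0) (l i 0)) -> is_derive t 1 f l.
Proof.
move=> df; have dv : derivable f t 1.
  by apply/derivable_mxP => i j; rewrite ord1; have [] := df i.
apply: DeriveDef => //; rewrite derive_mx//; apply/colP => i; rewrite mxE.
by have [] := df i.
Qed.

Lemma solves_comp u t x i : solves_P Omega d K g T u -> Oc x ->
  is_derive t 1 (fun s => u s x i 0)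
    (d 0 i * nl (Omega := Omega) (K := K) i t x (fun y => u t y i 0) - d 0 i * u t x i 0 + g t x (u t x) i 0).
Proof. by move=> [_ su] xO; have := is_derive_comp i (su t x xO); rewrite rhsE. Qed.

Definition dsum : R := \sum_i d 0 i.

Lemma d_le_dsum i : d 0 i <= dsum.
Proof. by rewrite /dsum (bigD1 i)//= lerDl sumr_ge0// => k _; rewrite ltW// (st_d H). Qed.

Lemma dsum_ge0 : 0 <= dsum.
Proof. by apply: sumr_ge0 => i _; rewrite ltW// (st_d H). Qed.

Lemma d_min : exists2 q : R, 0 < q & forall i, q <= d 0 i.
Proof.
apply: (@fin_small_witness R 'I_m (fun i q => q <= d 0 i)).
  by move=> i; exists (d 0 i) => //; exact: (st_d H).
by move=> i r s _; exact: le_trans.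
Qed.

(** The set E and the damping eps serve the two situations of zero growth: E is
    the closure of Omega or a single point. The last hypothesis has -N in place of
    the nonlocal term because only a lower bound of p is known on E. *)
Lemma linear_comparison (E : set 'cV[R]_n) (eps : R) a b (p p' : R -> 'cV[R]_n -> 'cV[R]_m) (B : R) :
  E `<=` Oc -> 0 <= eps ->
  (forall x i, E x -> traj a b (fun t => p t x i 0) (fun t => p' t x i 0)) ->
  (forall x i, E x -> 0 <= p a x i 0) ->
  (forall t x i, a <= t <= b -> E x -> - B <= p t x i 0) ->
  (forall t N, a < t < b -> 0 <= N -> (forall x i, E x -> - N <= p t x i 0) ->
    forall x i, E x -> - (d 0 i * N) - (d 0 i + eps) * p t x i 0 + \sum_k J t x 0 i k * p t x k 0 <= p' t x i 0) ->
  forall t x i, a <= t <= b -> E x -> 0 <= p t x i 0.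
Proof.
move=> EO eps0 tp pa pB Hp; have [C C0 HC] := jacobian_bound H.
have HJ t x i k : Oc x -> `|J t x 0 i k| <= C by move=> xO; apply: HC => //; exact: (M0 H).
have D0 := dsum_ge0.
pose JJ := ({x : 'cV[R]_n | E x} * 'I_m)%type.
pose L : R := 3 * dsum + 2 * C + m%:R * C + 1.
have mC : 0 <= m%:R * C by rewrite mulr_ge0// ltW.
have L0 : 0 < L by rewrite /L; lra.
have cmp := @comparison R JJ a b (fun t j => p t (sval j.1) j.2 0) (fun t j => p' t (sval j.1) j.2 0) (C + dsum + eps) L B L0.
move=> t x i tab xO; have := cmp _ _ _ _ t (exist _ x xO, i) tab; apply.
- by move=> [[y yO] k]; exact: tp.
- by move=> [[y yO] k]; exact: pa.
- by move=> q [[y yO] k] qab; exact: pB.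
move=> q N qab N0 pN [[y yO] k] /=.
have pN' z l : E z -> - N <= p q z l 0 by move=> zO; exact: (pN (exist _ z zO, l)).
have := Hp q N qab N0 pN' y k yO; have yE := yO; have {}yO := EO y yO.
rewrite (bigD1 k)//=.
have dk0 : 0 <= d 0 k by rewrite ltW// (st_d H).
have dk := d_le_dsum k.
have h1 : d 0 k * N <= dsum * N by rewrite ler_wpM2r.
have h2 : - (m%:R * C * N) <= \sum_(l | l != k) J q y 0 k l * p q y l 0.
  apply: (@le_trans _ _ (\sum_(l | l != k) - (C * N))).
    rewrite sumrN lerN2 sumr_const -[X in X <= _]mulr_natl -mulrA ler_wpM2r//.
      by rewrite mulr_ge0// ltW.
    by rewrite ler_nat (leq_trans (max_card _))// card_ord.
  apply: ler_sum => l lk; have J0 : 0 <= J q y 0 k l.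
    by apply: (jacobian_coop H) => //; [exact: (M0 H)|rewrite eq_sym].
  have JC : J q y 0 k l <= C by have := HJ q y k l yO; rewrite ger0_norm.
  have := pN' y l yE => pl.
  have : J q y 0 k l * - N <= J q y 0 k l * p q y l 0 by rewrite ler_wpM2l.
  have : J q y 0 k l * N <= C * N by rewrite ler_wpM2r.
  lra.
have JCk := HJ q y k k yO; rewrite ler_norml in JCk; have /andP[J1 J2] := JCk.
have h3 : - ((2 * C + 2 * dsum) * N) <= (C + dsum - d 0 k + J q y 0 k k) * p q y k 0.
  have w0 : 0 <= C + dsum - d 0 k + J q y 0 k k by lra.
  have w1 : C + dsum - d 0 k + J q y 0 k k <= 2 * C + 2 * dsum by lra.
  have : (C + dsum - d 0 k + J q y 0 k k) * - N <= (C + dsum - d 0 k + J q y 0 k k) * p q y k 0.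
    by rewrite ler_wpM2l// pN'.
  have : (C + dsum - d 0 k + J q y 0 k k) * N <= (2 * C + 2 * dsum) * N by rewrite ler_wpM2r.
  lra.
rewrite /L; set S := \sum_(l | l != k) _ in h2 *; lra.
Qed.

End system.

(** * The evolution family *)

Section evolution.
Context {R : realType} {m n : nat} {Omega : set 'cV[R]_n} {d : 'rV[R]_m}
  {v : 'cV[R]_m} {K : 'I_m -> R -> 'cV[R]_n -> R}
  {g : R -> 'cV[R]_n -> 'cV[R]_m -> 'cV[R]_m} {T : R}.
Hypothesis H : standing Omega d v K g T.
Implicit Types (u w : R -> 'cV[R]_n -> 'cV[R]_m) (x y : 'cV[R]_n) (t s : R).
Local Notation Oc := (closure Omega).
Local Notation J := (fun t x a => jacobian_u g t x a).

Implicit Types (phi psi : 'cV[R]_n -> 'cV[R]_m).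
Local Notation nlO := (@nl R m n Omega K).

Lemma nl_geN i t x f (N : R) : Oc x -> bounded_meas Omega f -> 0 <= N ->
  (forall y, Omega y -> - N <= f y) -> - N <= nlO i t x f.
Proof.
move=> xO bf N0 fN; have := nl_lin H i t N xO bf (bounded_meas_cst Omega 1).
have n1 : nlO i t x (fun=> 1) <= 1 by apply: (nl_cst H).
have : 0 <= nlO i t x (fun y => f y + N * 1).
  by apply: (nl_ge0 H) => y /fN h; rewrite mulr1; lra.
move: (nlO i t x (fun=> 1)) n1 (nlO i t x (fun y => f y + N * 1)) (nlO i t x f) => p p1 q r q0 E.
have : N * p <= N * 1 by rewrite ler_wpM2l.
lra.
Qed.

Lemma bounded_meas_X phi i : space_X Omega phi -> bounded_meas Omega (fun y => phi y i 0).
Proof.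
move=> cphi.
have cc : cont_on Oc (fun y => phi y i 0).
  apply/within_cont_on; apply/subspace_continuousP => p Op.
  move/subspace_continuousP : cphi => /(_ p Op) cphi.
  apply: (@cvg_comp _ _ _ _ (fun a : 'cV[R]_m => a i 0) _ _ _ cphi).
  exact: coord_continuous.
split.
  apply: cont_on_measurable_cV; first exact: (Omega_measurable H).
  by apply: cont_onS cc; exact: (Omega_sub (Omega := Omega)).
have [C C0 HC] := compact_bound (Oc_compact H) cc.
by exists C => y yO; apply: HC; exact: (Omega_sub (Omega := Omega)).
Qed.

Lemma X_bound phi : space_X Omega phi -> exists2 C : R, 0 < C & forall x i, Oc x -> `|phi x i 0| <= C.
Proof.
move=> cphi; have [i|i r s rs h x xO|C C0 HC] := @fin_large_witness R 'I_m (fun i C => forall x, Oc x -> `|phi x i 0| <= C).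
- apply: (compact_bound (Oc_compact H)).
  apply/within_cont_on; apply/subspace_continuousP => p Op.
  move/subspace_continuousP : cphi => /(_ p Op) cphi.
  apply: (@cvg_comp _ _ _ _ (fun a : 'cV[R]_m => a i 0) _ _ _ cphi).
  exact: coord_continuous.
- exact: le_trans (h x xO) rs.
by exists C => // x i; exact: HC.
Qed.

Lemma normX_lt (E : Type) (A : set E) (f : E -> 'cV[R]_m) (e : R) :
  (supnorm A f < e%:E)%E -> forall z, A z -> `|f z| < e.
Proof.
move=> fe z Az; rewrite -lte_fin; apply: le_lt_trans fe.
by apply: ereal_sup_ubound; exists z.
Qed.

Variable Phi : R -> R -> ('cV[R]_n -> 'cV[R]_m) -> ('cV[R]_n -> 'cV[R]_m).
Hypothesis evol : is_evolution_family Omega d K g Phi.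

(** Norm differentiability in X implies differentiability at each point; the
    two-sided quotient is available because t > s. *)
Lemma Phi_derive s t phi x i : s < t -> space_X Omega phi -> Oc x ->
  is_derive t 1 (fun t => Phi t s phi x i 0) (linear_part Omega d K g t (Phi t s phi) x i 0).
Proof.
move=> st Xphi xO.
apply: (@is_derive_comp _ _ (fun t => Phi t s phi x)).
have cv : (fun h : R => h^-1 *: (Phi (h *: 1 + t) s phi x - Phi t s phi x)) @ (0 : R)^' -->
    linear_part Omega d K g t (Phi t s phi) x.
  apply/cvgrPdist_lt => e e0.
  have := evol_generated evol (ltW st) Xphi e0 => gen.
  have near_s : \forall h \near (0 : R)^', s <= t + h.
    have ts0 : 0 < t - s by rewrite subr_gt0.
    by near=> h; have : `|h| < t - s by [near: h; exact: dnbhs0_lt]; rewrite ltr_norml; lra.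
  near=> h.
  have sh : s <= t + h by near: h.
  have : s <= t + h -> (normX Omega (fun x => (h^-1 *: (Phi (t + h)%R s phi x - Phi t s phi x)
          - linear_part Omega d K g t (Phi t s phi) x)%R) < e%:E)%E by near: h.
  move=> /(_ sh)/normX_lt/(_ x xO) hh; rewrite distrC.
  by rewrite [h *: 1]mulr1 [h + t]addrC.
apply: DeriveDef; first exact: cvgP cv.
exact: cvg_lim cv.
Unshelve. all: by end_near. Qed.

Lemma Phi_traj s b phi x i : space_X Omega phi -> Oc x ->
  traj s b (fun t => Phi t s phi x i 0) (fun t => linear_part Omega d K g t (Phi t s phi) x i 0).
Proof.
move=> Xphi xO; split; last by move=> t /andP[st _]; exact: Phi_derive.
apply/within_cont_on => t; rewrite /= in_itv/= => /andP[st tb] e e0.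
have := evol_continuous evol st Xphi e0; rewrite near_withinE => /nbhs_ballP[r /= r0 Hr].
exists r => // q; rewrite /= in_itv/= => /andP[sq _] tq.
have /normX_lt/(_ x xO) : (normX Omega (fun x => (Phi q s phi x - Phi t s phi x)%R) < e%:E)%E.
  by apply: (Hr (q, s)) => //=; split=> //=; exact: ballxx.
move=> hh; rewrite distrC; apply: le_lt_trans hh.
by have := coord_le_norm (Phi q s phi x - Phi t s phi x) i; rewrite !mxE.
Qed.

Lemma Phi_loc_bound s b phi : s <= b -> space_X Omega phi ->
  exists2 C : R, 0 < C & forall t x i, s <= t <= b -> Oc x -> `|Phi t s phi x i 0| <= C.
Proof.
move=> sb Xphi; have := @segment_compact R s b; move=> /compact_near_coveringP cA.
have : \forall C \near +oo, `[s, b]%classic `<=` (fun t => s <= t <= b -> forall x i, Oc x -> `|Phi t s phi x i 0| <= C).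
  apply: cA => t; rewrite /= in_itv/= => /andP[st tb].
  have := evol_continuous evol st Xphi ltr01; rewrite near_withinE => /nbhs_ballP[r /= r0 Hr].
  have [C C0 HC] := X_bound (evol_X evol st Xphi).
  exists (ball t r, [set D : R | C + 1 < D]) => /=.
    by split; [exact: nbhsx_ballx|apply: nbhs_pinfty_gt; exact: num_real].
  move=> [q D] [/= tq CD] /andP[sq _] x i xO.
  have /normX_lt/(_ x xO) : (normX Omega (fun x => (Phi q s phi x - Phi t s phi x)%R) < 1%:E)%E.
    by apply: (Hr (q, s)) => //=; split=> //=; exact: ballxx.
  have := coord_le_norm (Phi q s phi x - Phi t s phi x) i; rewrite !mxE => h1 h2.
  have := HC x i xO; have := ler_normD (Phi q s phi x i 0 - Phi t s phi x i 0) (Phi t s phi x i 0).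
  by rewrite subrK; lra.
move=> HH; have [C [HC C0]] : exists C : R, (`[s, b]%classic `<=` (fun t => s <= t <= b -> forall x i, Oc x -> `|Phi t s phi x i 0| <= C)) /\ 0 < C.
  by apply: (@filter_ex _ (+oo : set_system R)); apply: filterI => //; exact: nbhs_pinfty_gt.
by exists C => // t x i stb xO; apply: HC => //=; rewrite in_itv.
Qed.

Lemma Phi_bm s t phi i : s <= t -> space_X Omega phi -> bounded_meas Omega (fun y => Phi t s phi y i 0).
Proof. by move=> st Xphi; apply: bounded_meas_X; exact: (evol_X evol). Qed.

Lemma subZ_coord (A B : 'cV[R]_m) (a : R) i : (A - a *: B) i 0 = A i 0 + (- a) * B i 0.
Proof. by rewrite !mxE mulNr. Qed.

(** The difference of the two sides satisfies [linear_comparison]; the factor a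
    gives two-sided bounds such as |Phi phi| <= Phi 1. *)
Lemma Phi_dominates s t phi psi (a : R) : s <= t -> space_X Omega phi -> space_X Omega psi ->
  (forall x i, Oc x -> a * phi x i 0 <= psi x i 0) ->
  forall x i, Oc x -> a * Phi t s phi x i 0 <= Phi t s psi x i 0.
Proof.
move=> st Xp Xq pq x i xO.
pose p r y := Phi r s psi y - a *: Phi r s phi y.
pose p' r y := linear_part Omega d K g r (Phi r s psi) y - a *: linear_part Omega d K g r (Phi r s phi) y.
suff : 0 <= p t x i 0 by rewrite /p subZ_coord mulNr subr_ge0.
have [C1 C10 H1] := Phi_loc_bound st Xp; have [C2 C20 H2] := Phi_loc_bound st Xq.
apply: (@linear_comparison _ _ _ _ _ _ _ _ _ H Oc 0 s t p p' (C2 + `|a| * C1)) => //; last by rewrite st lexx.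
- move=> y k yO; have := traj_lin (- a) (Phi_traj s t k Xq yO) (Phi_traj s t k Xp yO).
  by congr (traj _ _ _ _); apply/funext => r; rewrite /p /p' subZ_coord.
- move=> y k yO; rewrite /p subZ_coord !(evol_id evol)// mulNr subr_ge0; exact: pq.
- move=> r y k /[dup] sr /andP[s_r _] yO; rewrite /p subZ_coord mulNr.
  have := H1 r y k sr yO; have := H2 r y k sr yO.
  move=> h2 h1; have : `|a * Phi r s phi y k 0| <= `|a| * C1 by rewrite normrM ler_wpM2l.
  move: h2; rewrite !ler_norml; lra.
move=> r N /andP[sr rt] N0 pN y k yO.
have sr' := ltW sr.
have b1 := Phi_bm k sr' Xp; have b2 := Phi_bm k sr' Xq.
have E : nlO k r y (fun z => p r z k 0) = nlO k r y (fun z => Phi r s psi z k 0) + (- a) * nlO k r y (fun z => Phi r s phi z k 0).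
  by rewrite -(nl_lin H)//; apply: eq_Rintegral => z _; rewrite /p subZ_coord.
have bp : bounded_meas Omega (fun z => p r z k 0).
  have := bounded_measD b2 (bounded_measM (bounded_meas_cst Omega (- a)) b1).
  by congr (bounded_meas _ _); apply/funext => z; rewrite /p subZ_coord.
have := @nl_geN k r y _ N yO bp N0 (fun z zO => pN z k (subset_closure zO)).
rewrite E.
have -> : p' r y k 0 = linear_part Omega d K g r (Phi r s psi) y k 0
    + - a * linear_part Omega d K g r (Phi r s phi) y k 0 by rewrite /p' subZ_coord.
rewrite !linear_partE.
have dk : 0 < d 0 k := st_d H k; rewrite addr0.
have -> : \sum_l J r y 0 k l * p r y l 0 = \sum_l J r y 0 k l * Phi r s psi y l 0 - a * \sum_l J r y 0 k l * Phi r s phi y l 0.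
  rewrite mulr_sumr -sumrB; apply: eq_bigr => l _; rewrite /p subZ_coord; ring.
have -> : p r y k 0 = Phi r s psi y k 0 - a * Phi r s phi y k 0 by rewrite /p subZ_coord mulNr.
move: (\sum_l J r y 0 k l * Phi r s psi y l 0) (\sum_l J r y 0 k l * Phi r s phi y l 0) => S1 S2.
move: (nlO k r y (fun z => Phi r s psi z k 0)) (nlO k r y (fun z => Phi r s phi z k 0)) => n1 n2 hN.
clear - dk hN; have : d 0 k * - N <= d 0 k * (n1 + - a * n2) by rewrite ler_wpM2l// ltW.
lra.
Qed.

End evolution.

(** * Growth of positive linear solutions *)

Section growth.
Context {R : realType} {m n : nat} {Omega : set 'cV[R]_n} {d : 'rV[R]_m}
  {v : 'cV[R]_m} {K : 'I_m -> R -> 'cV[R]_n -> R}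
  {g : R -> 'cV[R]_n -> 'cV[R]_m -> 'cV[R]_m} {T : R}.
Hypothesis H : standing Omega d v K g T.
Implicit Types (u w : R -> 'cV[R]_n -> 'cV[R]_m) (x y : 'cV[R]_n) (t s : R).
Local Notation M := (box 0 v).
Local Notation Oc := (closure Omega).
Local Notation J := (fun t x a => jacobian_u g t x a).
Let T0 : 0 < T := st_T H.

Local Notation mu := (lebesgue_n n).
Implicit Types (phi psi : 'cV[R]_n -> 'cV[R]_m).
Local Notation nlO := (@nl R m n Omega K).
Local Notation dS := (@dsum R m d).
Local Notation lin := (linear_part Omega d K g).

Variable Phi : R -> R -> ('cV[R]_n -> 'cV[R]_m) -> ('cV[R]_n -> 'cV[R]_m).
Hypothesis evol : is_evolution_family Omega d K g Phi.

Lemma bounded_meas_sum (I : Type) (l : seq I) (f : I -> 'cV[R]_n -> R) :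
  (forall k, bounded_meas Omega (f k)) ->
  bounded_meas Omega (fun y => \sum_(k <- l) f k y) /\
  \int[mu]_(y in Omega) (\sum_(k <- l) f k y) = \sum_(k <- l) \int[mu]_(y in Omega) f k y.
Proof.
move=> bf; have mO := Omega_measurable H; have fO := Omega_finite H.
elim: l => [|k l [IH1 IH2]].
  under [X in bounded_meas _ X]eq_fun do rewrite big_nil.
  split; first exact: bounded_meas_cst.
  by rewrite big_nil; under eq_Rintegral do rewrite big_nil; rewrite Rintegral_cst// mul0r.
under [X in bounded_meas _ X]eq_fun do rewrite big_cons.
split; first exact: bounded_measD.
rewrite big_cons -IH2 -RintegralD//; try exact: bounded_meas_integrable.
by apply: eq_Rintegral => y _; rewrite big_cons.
Qed.

(** Controls a positive linear solution at x at later times: the local part and the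
    part fed by the nonlocal term. *)
Definition mass phi x : R := \sum_k phi x k 0 + \int[mu]_(y in Omega) (\sum_k phi y k 0).

Lemma Phi_ge0 s t phi : s <= t -> space_X Omega phi -> (forall x i, Oc x -> 0 <= phi x i 0) ->
  forall x i, Oc x -> 0 <= Phi t s phi x i 0.
Proof.
move=> st Xp p0 x i xO; have := Phi_dominates H evol (a := 0) st Xp Xp _ i xO.
by rewrite mul0r; apply=> y k yO; rewrite mul0r p0.
Qed.

(** The function e^{La (t-s)} (sum phi(x) + total mass) is a supersolution for La
    large: the kernel is bounded, so the nonlocal term is controlled by the total
    mass alone. *)
Lemma Phi_upper : exists2 La : R, 0 < La & forall s t phi, s <= t -> space_X Omega phi ->
  (forall x i, Oc x -> 0 <= phi x i 0) ->
  forall x i, Oc x -> Phi t s phi x i 0 <= expR (La * (t - s)) * mass phi x.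
Proof.
have [C C0 HC] := jacobian_bound H; have [B B0 HB] := K_bound H.
have D0 := dsum_ge0 H.
have mC0 : 0 <= m%:R * C by rewrite mulr_ge0// ltW.
have DB0 : 0 <= dS * (B + 1) by rewrite mulr_ge0//; lra.
pose La := dS * (B + 1) + m%:R * C + 1.
have La0 : 0 < La by rewrite /La; lra.
exists La => // s t phi st Xp p0 x i xO.
have mO := Omega_measurable H; have fO := Omega_finite H.
pose S y := \sum_k phi y k 0; pose JJ := \int[mu]_(y in Omega) S y.
have [bS _] := bounded_meas_sum (index_enum 'I_m) (fun k => bounded_meas_X H k Xp).
have S0 y : Oc y -> 0 <= S y by move=> yO; apply: sumr_ge0 => k _; exact: p0.
have J0 : 0 <= JJ by apply: Rintegral_ge0 => y yO; apply: S0; exact: subset_closure.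
pose Q r y := expR (La * (r - s)) * (S y + JJ).
have QE r y : Oc y -> expR (La * (r - s)) * JJ <= Q r y.
  by move=> yO; rewrite ler_pM2l ?expR_gt0// lerDr S0.
have Q0 r y : Oc y -> 0 <= Q r y.
  by move=> yO; rewrite mulr_ge0 ?expR_ge0// addr_ge0// S0.
pose p r y : 'cV[R]_m := const_mx (Q r y) - 1 *: Phi r s phi y.
pose p' r y : 'cV[R]_m := const_mx (La * Q r y) - 1 *: lin r (Phi r s phi) y.
have pE r y k : p r y k 0 = Q r y - Phi r s phi y k 0.
  by rewrite /p subZ_coord mxE mulNr mul1r.
have p'E r y k : p' r y k 0 = La * Q r y - lin r (Phi r s phi) y k 0.
  by rewrite /p' subZ_coord mxE mulNr mul1r.
suff : 0 <= p t x i 0 by rewrite pE subr_ge0.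
have [C1 C10 H1] := Phi_loc_bound H evol st Xp.
apply: (@linear_comparison _ _ _ _ _ _ _ _ _ H Oc 0 s t p p' C1) => //; last by rewrite st lexx.
- move=> y k yO; have := traj_lin (-1) (traj_exp s t (S y + JJ) La s) (Phi_traj evol s t k Xp yO).
  congr (traj _ _ _ _); apply/funext => r.
    by rewrite pE /Q mulN1r [_ * expR _]mulrC.
  by rewrite p'E /Q mulN1r [_ * expR _]mulrC.
- move=> y k yO; rewrite pE (evol_id evol)// /Q subrr mulr0 expR0 mul1r.
  have : phi y k 0 <= S y.
    by rewrite /S (bigD1 k)//= lerDl sumr_ge0// => l _; exact: p0.
  lra.
- move=> r y k sr yO; rewrite pE; have := H1 r y k sr yO; have := Q0 r y yO.
  rewrite ler_norml; lra.
move=> r N /andP[sr rt] N0 pN y k yO; have sr' := ltW sr.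
have bQ : bounded_meas Omega (Q r).
  apply: bounded_measM; first exact: bounded_meas_cst.
  by apply: bounded_measD => //; exact: bounded_meas_cst.
have bz l : bounded_meas Omega (fun z => Phi r s phi z l 0) by exact: (Phi_bm H evol).
have E : nlO k r y (fun z => p r z k 0) = nlO k r y (Q r) + (- 1) * nlO k r y (fun z => Phi r s phi z k 0).
  by rewrite -(nl_lin H)//; apply: eq_Rintegral => z _; rewrite pE mulN1r.
have bp : bounded_meas Omega (fun z => p r z k 0).
  have := bounded_measD bQ (bounded_measM (bounded_meas_cst Omega (- 1)) (bz k)).
  by congr (bounded_meas _ _); apply/funext => z; rewrite pE mulN1r.
have hN := nl_geN H k r yO bp N0 (fun z zO => pN z k (subset_closure zO)).
rewrite E in hN.
(* the kernel is bounded, so the nonlocal term sees only the total mass *)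
have nQ : nlO k r y (Q r) <= (B + 1) * (expR (La * (r - s)) * JJ).
  have -> : nlO k r y (Q r) = nlO k r y (fun z => 0 + expR (La * (r - s)) * (S z + JJ)).
    by apply: eq_Rintegral => z _; rewrite add0r.
  have bSJ : bounded_meas Omega (fun z => S z + JJ) by apply: bounded_measD => //; exact: bounded_meas_cst.
  rewrite (nl_lin H k r (expR (La * (r - s))) yO (bounded_meas_cst Omega 0) bSJ).
  have -> : nlO k r y (fun=> 0) = 0.
    by rewrite /nl; under eq_Rintegral do rewrite mulr0; rewrite Rintegral_cst// mul0r.
  have -> : nlO k r y (fun z => S z + JJ) = nlO k r y S + JJ * nlO k r y (fun=> 1).
    rewrite -(nl_lin H)//; last exact: bounded_meas_cst.
    by apply: eq_Rintegral => z _; rewrite mulr1.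
  have n1 : nlO k r y (fun=> 1) <= 1 by exact: (nl_cst H).
  have nS : nlO k r y S <= B * JJ.
    rewrite /JJ -RintegralZl//; last exact: bounded_meas_integrable.
    apply: le_Rintegral => //.
    + by apply: bounded_meas_integrable => //; exact: (Kf_bounded_meas H).
    + by apply: bounded_meas_integrable => //; apply: bounded_measM => //; exact: bounded_meas_cst.
    + move=> z zO; rewrite ler_wpM2r ?S0//; first exact: subset_closure.
      by apply: HB => //; exact: subset_closure.
  move: (nlO k r y (fun=> 1)) n1 (nlO k r y S) nS (expR (La * (r - s))) (expR_ge0 (La * (r - s))) => a a1 b b1 e e0.
  have Ja : JJ * a <= JJ * 1 by rewrite ler_wpM2l.
  rewrite add0r mulrCA ler_wpM2l//; apply: (le_trans (lerD b1 Ja)).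
  by rewrite mulrDl mul1r mulr1.
rewrite p'E linear_partE pE.
have JQ : \sum_l J r y 0 k l * p r y l 0 <= m%:R * C * Q r y - \sum_l J r y 0 k l * Phi r s phi y l 0.
  have -> : \sum_l J r y 0 k l * p r y l 0 = \sum_l J r y 0 k l * Q r y - \sum_l J r y 0 k l * Phi r s phi y l 0.
    by rewrite -sumrB; apply: eq_bigr => l _; rewrite pE mulrBr.
  rewrite lerD2r; apply: (@le_trans _ _ (\sum_(l < m) C * Q r y)).
    apply: ler_sum => l _; rewrite ler_wpM2r ?Q0//.
    by apply: le_trans (ler_norm _) _; apply: HC => //; exact: (M0 H).
  by rewrite sumr_const card_ord -[X in X <= _]mulr_natl mulrA.
have dk : 0 < d 0 k := st_d H k; have dD := d_le_dsum H k.
have Qk := QE r y yO; have Q0y := Q0 r y yO.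
move: (Q r y) Qk Q0y JQ => q Qk Q0y JQ.
move: (\sum_l J r y 0 k l * p r y l 0) JQ => S1; move: (\sum_l J r y 0 k l * Phi r s phi y l 0) => S2 JQ.
move: (nlO k r y (Q r)) nQ hN; move: (nlO k r y (fun z => Phi r s phi z k 0)) => n2 n1 nQ hN.
move: (expR (La * (r - s)) * JJ) Qk nQ => ej Qk nQ.
rewrite addr0 /La.
have h1 : d 0 k * - N <= d 0 k * (n1 + -1 * n2) by rewrite ler_wpM2l// ltW.
have h2 : (B + 1) * ej <= (B + 1) * q by rewrite ler_wpM2l//; lra.
have h3 : d 0 k * n1 <= d 0 k * ((B + 1) * q) by apply: (ler_wpM2l (ltW dk)); exact: le_trans nQ h2.
have h4 : d 0 k * ((B + 1) * q) <= dS * ((B + 1) * q) by rewrite ler_wpM2r// mulr_ge0//; lra.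
have h5 : 0 <= d 0 k * q by rewrite mulr_ge0// ltW.
clear - h1 h3 h4 h5 JQ Q0y dk; lra.
Qed.

(* Constants as in [reaction_constants], [K_near0] and [d_min]. *)
Variables (C b0 kap0 dm r : R) (beta : R -> 'cV[R]_n -> 'cV[R]_m -> 'I_m -> 'I_m -> R).
Hypotheses (C0 : 0 < C) (b00 : 0 < b0) (kap00 : 0 < kap0) (dm0 : 0 < dm) (r0 : 0 < r)
  (HC : forall t x (a : 'cV[R]_m) i k, Oc x -> M a -> `|J t x a i k| <= C)
  (beta_irr : forall t x b, Oc x -> M b -> irreducible_at b0 (beta t x b))
  (beta_le : forall t x b i k, Oc x -> M b -> i != k -> beta t x b i k <= J t x b i k)
  (beta_low : forall t x b (p : 'cV[R]_m) i, Oc x -> M b -> (forall k, 0 <= p k 0) -> M (b + p) ->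
    - (C * p i 0) + \sum_(k | k != i) beta t x b i k * p k 0 <=
      g t x (b + p) i 0 - g t x b i 0)
  (Kk : forall i t x y, ball x r y -> kap0 <= K i t (x - y))
  (dmd : forall i, dm <= d 0 i).

Local Notation cc := (C + dS).
Local Notation kk := (dm * kap0).

Lemma nl_gain i t x f h (B : R) : Oc x -> bounded_meas Omega h -> (forall y, Omega y -> 0 <= h y <= f y) ->
  (forall y, Omega y -> f y <= B) ->
  kk * \int[mu]_(y in Omega) (\1_(ball x r) y * h y) <= d 0 i * nlO i t x f.
Proof.
move=> xO bh hf fB; have := nl_ball H i t kap00 Kk xO bh hf fB.
have I0 : 0 <= \int[mu]_(y in Omega) (\1_(ball x r) y * h y).
  apply: Rintegral_ge0 => y /hf/andP[h0 _]; rewrite mulr_ge0// indicE; case: (_ \in _) => //.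
move: (\int[mu]_(y in Omega) (\1_(ball x r) y * h y)) (nlO i t x f) I0 => I q I0 Iq.
rewrite -mulrA; apply: ler_pM => //; [exact: ltW|by rewrite mulr_ge0// ltW].
Qed.

(** At u = 0 the coupling of [reaction_constants] lies below the Jacobian. *)
Lemma lower_system_linear s b phi : space_X Omega phi ->
  (forall x i, Oc x -> 0 <= phi x i 0) ->
  lower_system (Omega := Omega) cc b0 kk r s b (fun t => Phi t s phi) (fun t => lin t (Phi t s phi)).
Proof.
move=> Xp p0; split.
- by move=> x i xO; exact: (Phi_traj evol).
- by move=> t x i /andP[st _] xO; exact: Phi_ge0.
exists (fun t x => beta t x 0), (fun t x i => d 0 i * nlO i t x (fun y => Phi t s phi y i 0)).
move=> t x /andP[st _] xO; have st' := ltW st.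
have z0 y i : Oc y -> 0 <= Phi t s phi y i 0 by exact: Phi_ge0.
split.
- by apply: beta_irr => //; exact: (M0 H).
- move=> i; rewrite linear_partE [X in _ <= _ + X](bigD1 i)//=.
  have : \sum_(k | k != i) beta t x 0 i k * Phi t s phi x k 0 <= \sum_(k | k != i) J t x 0 i k * Phi t s phi x k 0.
    apply: ler_sum => k ki; rewrite ler_wpM2r ?z0// beta_le//; first exact: (M0 H).
    by rewrite eq_sym.
  have Jii : - C <= J t x 0 i i.
    by have := HC t i i xO (M0 H); rewrite ler_norml => /andP[].
  have zi := z0 x i xO; have di := d_le_dsum H i; have D0 := dsum_ge0 H.
  move: (\sum_(k | k != i) beta t x 0 i k * Phi t s phi x k 0) => S1.
  move: (\sum_(k | k != i) J t x 0 i k * Phi t s phi x k 0) => S2 S12.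
  move: (nlO i t x (fun y => Phi t s phi y i 0)) => q.
  have : - C * Phi t s phi x i 0 <= J t x 0 i i * Phi t s phi x i 0 by rewrite ler_wpM2r.
  have : d 0 i * Phi t s phi x i 0 <= dS * Phi t s phi x i 0 by rewrite ler_wpM2r.
  lra.
- move=> i; apply: mulr_ge0; first exact: ltW (st_d H i).
  apply: (nl_ge0 H) => y yO.
  by apply: z0; exact: subset_closure.
- move=> i f bf fz; have [B _ HB] := X_bound H (evol_X evol st' Xp).
  apply: (@nl_gain i t x _ f B) => // y yO.
  by apply: le_trans (ler_norm _) (HB y i _); exact: subset_closure.
Qed.

(** For a solution u of the nonlinear problem use the coupling at the base point
    b = 0 and the increment p = u(t,x). *)
Lemma lower_system_solution u u' a b :
  (forall t x, Oc x -> M (u t x)) ->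
  (forall t x i, Oc x -> is_derive t 1 (fun s => u s x i 0) (u' t x i 0)) ->
  (forall t x i, Oc x -> u' t x i 0 = d 0 i * nlO i t x (fun y => u t y i 0) - d 0 i * u t x i 0 + g t x (u t x) i 0) ->
  lower_system (Omega := Omega) cc b0 kk r a b u u'.
Proof.
move=> Mu du u'E; split.
- by move=> x i xO; apply: derive_traj => t _; exact: du.
- by move=> t x i _ xO; exact: M_ge0 (Mu t x xO) i.
exists (fun t x => beta t x 0), (fun t x i => d 0 i * nlO i t x (fun y => u t y i 0)).
move=> t x _ xO; split.
- by apply: beta_irr => //; exact: (M0 H).
- move=> i; rewrite u'E//.
  have := beta_low t i xO (M0 H) (M_ge0 (Mu t x xO)).
  rewrite add0r (st_g_zero H)// => /(_ (Mu t x xO)).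
  have zi := M_ge0 (Mu t x xO) i; have di := d_le_dsum H i; have D0 := dsum_ge0 H.
  move: (\sum_(k | k != i) beta t x 0 i k * u t x k 0) => S1.
  move: (nlO i t x (fun y => u t y i 0)) => q.
  have : d 0 i * u t x i 0 <= dS * u t x i 0 by rewrite ler_wpM2r.
  lra.
- move=> i; apply: mulr_ge0; first exact: ltW (st_d H i).
  apply: (nl_ge0 H) => y yO.
  by apply: M_ge0; apply: Mu; exact: subset_closure.
- move=> i f bf fz; apply: (@nl_gain i t x _ f (v i 0)) => // y yO.
  by apply: M_le; apply: Mu; exact: subset_closure.
Qed.

(** The Harnack inequality bounds every component below by the mass one period
    earlier, and [Phi_upper] bounds them above by the same mass. *)
Lemma Phi_comparable : exists2 U : R, 0 < U & forall s t phi, s + T <= t -> space_X Omega phi ->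
  (forall x i, Oc x -> 0 <= phi x i 0) ->
  forall x i k, Oc x -> Phi t s phi x k 0 <= U * Phi t s phi x i 0.
Proof.
have D0 := dsum_ge0 H.
have c0 : 0 < cc by rewrite ltr_pwDl.
have [rho rho0 Hrho] := @harnack _ _ _ _ _ _ _ _ _ H cc b0 kk r c0 b00 (mulr_gt0 dm0 kap00) r0.
have [La La0 HLa] := Phi_upper.
exists (m.+1%:R * expR (La * T) / rho); first by rewrite divr_gt0// mulr_gt0// expR_gt0.
move=> s t phi stT Xp p0 x i k xO.
have st : s <= t - T by lra.
have tt : t - T <= t by rewrite gerBl; exact: ltW T0.
pose psi := Phi (t - T) s phi.
have Xq : space_X Omega psi by exact: (evol_X evol).
have q0 y l : Oc y -> 0 <= psi y l 0 by exact: Phi_ge0.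
have E y : Oc y -> Phi t s phi y = Phi t (t - T) psi y.
  by move=> yO; rewrite (evol_comp evol).
rewrite !E//; have := HLa _ _ psi tt Xq q0 x k xO.
have -> : t - (t - T) = T by ring.
have low l : rho * (psi x l 0 + \int[mu]_(y in Omega) psi y l 0) <= Phi t (t - T) psi x i 0.
  have := lower_system_linear (t - T) (t - T + T) Xq q0 => ls.
  have := Hrho _ _ _ (fun y => psi y l 0) l ls (bounded_meas_X H l Xq) _ x i xO.
  rewrite subrK (evol_id evol)//; apply=> y yO; rewrite (evol_id evol) ?lexx ?andbT//.
    by apply: q0; exact: subset_closure.
  exact: subset_closure.
have mass_le : rho * mass psi x <= m%:R * Phi t (t - T) psi x i 0.
  have [_ Es] := bounded_meas_sum (index_enum 'I_m) (fun k => bounded_meas_X H k Xq).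
  rewrite /mass Es -big_split/= mulr_sumr.
  apply: (@le_trans _ _ (\sum_(l < m) Phi t (t - T) psi x i 0)); first by apply: ler_sum => l _; exact: low.
  by rewrite sumr_const card_ord mulr_natl.
have z0 : 0 <= Phi t (t - T) psi x i 0 by exact: Phi_ge0.
move: (Phi t (t - T) psi x i 0) mass_le z0 => z; move: (mass psi x) => q qz z0.
move/le_trans; apply.
have e0 := expR_gt0 (La * T); move: (expR (La * T)) e0 => e e0.
rewrite -(ler_pM2l rho0) mulrCA.
have -> : rho * (m.+1%:R * e / rho * z) = e * (m.+1%:R * z) by field; rewrite gt_eqF.
rewrite ler_pM2l//; apply: (le_trans qz); rewrite ler_wpM2r// ler_nat; exact: leqnSn.
Qed.

End growth.

(** * Negative growth bound *)

Section decay.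
Context {R : realType} {m n : nat} {Omega : set 'cV[R]_n} {d : 'rV[R]_m}
  {v : 'cV[R]_m} {K : 'I_m -> R -> 'cV[R]_n -> R}
  {g : R -> 'cV[R]_n -> 'cV[R]_m -> 'cV[R]_m} {T : R}.
Hypothesis H : standing Omega d v K g T.
Implicit Types (u w : R -> 'cV[R]_n -> 'cV[R]_m) (x y : 'cV[R]_n) (t s : R).
Local Notation M := (box 0 v).
Local Notation Oc := (closure Omega).
Local Notation J := (fun t x a => jacobian_u g t x a).
Let T0 : 0 < T := st_T H.

Implicit Types (phi psi : 'cV[R]_n -> 'cV[R]_m).
Local Notation nlO := (@nl R m n Omega K).
Local Notation dS := (@dsum R m d).
Local Notation lin := (linear_part Omega d K g).

Variable Phi : R -> R -> ('cV[R]_n -> 'cV[R]_m) -> ('cV[R]_n -> 'cV[R]_m).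
Hypothesis evol : is_evolution_family Omega d K g Phi.

Definition one : 'cV[R]_n -> 'cV[R]_m := fun=> const_mx 1.

Lemma X_one : space_X Omega one.
Proof. by move=> x; exact: cvg_cst. Qed.

Lemma oneE x i : one x i 0 = 1. Proof. by rewrite mxE. Qed.

Lemma one_ge0 x i : Oc x -> 0 <= one x i 0. Proof. by rewrite oneE. Qed.

Lemma norm_le_coord (a : 'cV[R]_m) (B : R) : 0 <= B -> (forall i, `|a i 0| <= B) -> `|a| <= B.
Proof.
move=> B0 aB; rewrite [leLHS]/Num.Def.normr/= mx_normrE; apply: bigmax_le => // -[i j] _ /=.
by rewrite ord1.
Qed.

Lemma growth_small (w : R) : (growth_bound Omega Phi < w%:E)%E ->
  exists2 B : R, 0 < B & forall s t x i, s <= t -> Oc x -> Phi t s one x i 0 <= B * expR (w * (t - s)).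
Proof.
move=> /ereal_inf_lt[_ [w' [B [B1 HB]] <-]]; rewrite lte_fin => ww.
exists B; first exact: lt_le_trans B1.
move=> s t x i st xO.
have : (normX Omega (Phi t s one) <= (B * expR (w' * (t - s)))%:E)%E.
  apply: le_trans (HB s t st); apply: ereal_sup_ubound; exists one => //.
  split; first exact: X_one.
  apply: ge_ereal_sup => _ [y yO <-]; rewrite lee_fin; apply: norm_le_coord => // k.
  by rewrite oneE normr1.
move=> h; have : (`|Phi t s one x|%:E <= (B * expR (w' * (t - s)))%:E)%E.
  by apply: le_trans h; apply: ereal_sup_ubound; exists x.
rewrite lee_fin => {}h; apply: le_trans (ler_norm _) _.
apply: (le_trans (coord_le_norm _ i)); apply: (le_trans h).
rewrite ler_wpM2l//; first exact: le_trans B1.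
by rewrite ler_expR ler_wpM2r ?subr_ge0// ltW.
Qed.

(** By positivity the operator norm of Phi(t,s) is attained at the constant
    function 1. *)
Lemma growth_large (w : R) : (w%:E < growth_bound Omega Phi)%E -> forall B : R, 1 <= B ->
  exists s t x i, [/\ s <= t, Oc x & B * expR (w * (t - s)) < Phi t s one x i 0].
Proof.
move=> wg B B1; apply: contrapT => no.
suff : (growth_bound Omega Phi <= w%:E)%E by rewrite leNgt wg.
apply: ereal_inf_lbound; exists w => //; exists B; split=> // s t st.
have B0 : 0 <= B * expR (w * (t - s)) by rewrite mulr_ge0 ?expR_ge0//; exact: le_trans B1.
have H1 x i : Oc x -> Phi t s one x i 0 <= B * expR (w * (t - s)).
  by move=> xO; rewrite leNgt; apply/negP => h; apply: no; exists s, t, x, i.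
apply: ge_ereal_sup => _ [phi [Xp p1] <-]; apply: ge_ereal_sup => _ [x xO <-].
have p1c y k : Oc y -> `|phi y k 0| <= 1.
  move=> yO; apply: le_trans (coord_le_norm (phi y) k) _.
  rewrite -lee_fin; apply: le_trans p1; apply: ereal_sup_ubound; by exists y.
rewrite lee_fin; apply: norm_le_coord => // i.
apply: le_trans (H1 x i xO); rewrite ler_norml lerNl.
have h1 := Phi_dominates H evol (a := 1) st Xp X_one _ i xO.
have h2 := Phi_dominates H evol (a := -1) st Xp X_one _ i xO.
rewrite -mulN1r h2 ?andTb; first by move: h1; rewrite mul1r; apply=> y k yO;
  rewrite mul1r oneE; apply: le_trans (ler_norm _) (p1c y k yO).
move=> y k yO; rewrite mulN1r oneE lerNl.
by have := p1c y k yO; rewrite ler_norml => /andP[].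
Qed.

Lemma exp_decay_zero (a B kap : R) : 0 < kap ->
  (forall k : nat, a <= B * expR (- (kap * k%:R))) -> a <= 0.
Proof.
move=> kap00 Ha; rewrite leNgt; apply/negP => a0.
pose k := (Num.trunc (B / (a * kap))).+1.
have := Ha k; rewrite expRN ler_pdivlMr ?expR_gt0// => h.
have e1 : 1 + kap * k%:R <= expR (kap * k%:R) by exact: expR_ge1Dx.
have : a * (1 + kap * k%:R) <= B by apply: le_trans h; rewrite ler_pM2l.
have : B / (a * kap) < k%:R by exact: truncnS_gt.
rewrite ltr_pdivrMr ?mulr_gt0//; nra.
Qed.

(** The damping eps is absorbed by the factor e^{-eps (t-s)} in front of the linear
    flow. NU stands for the nonlocal term of u; on a single point E it is 0. *)
Lemma damped_comparison (E : set 'cV[R]_n) (eps V : R) s t u u' (NU : R -> 'cV[R]_n -> 'I_m -> R) :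
  E `<=` Oc -> 0 <= eps -> 0 <= V -> s <= t ->
  (forall (r : R) x i, E x -> is_derive r 1 (fun q => u q x i 0) (u' r x i 0)) ->
  (forall (r : R) x i, E x -> 0 <= u r x i 0 <= V) ->
  (forall (r : R) x i, E x -> u' r x i 0 <= d 0 i * NU r x i - (d 0 i + eps) * u r x i 0 + \sum_k J r x 0 i k * u r x k 0) ->
  (forall (r : R) i (N : R) (f : 'cV[R]_n -> R), bounded_meas Omega f -> 0 <= N -> (forall x, Oc x -> 0 <= f x) ->
     (forall x, E x -> u r x i 0 <= f x + N) -> forall x, E x -> NU r x i <= nlO i r x f + N) ->
  forall x i, E x -> u t x i 0 <= V * expR (- eps * (t - s)) * Phi t s one x i 0.
Proof.
move=> EO eps0 V0 st du uV Hu HN x i xE.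
have mO := Omega_measurable H; have fO := Omega_finite H.
pose e q := V * expR (- eps * (q - s)).
have e0 q : 0 <= e q by rewrite mulr_ge0// expR_ge0.
pose p q y : 'cV[R]_m := \col_k (e q * Phi q s one y k 0 - u q y k 0).
pose p' q y : 'cV[R]_m := \col_k (- eps * e q * Phi q s one y k 0 + e q * lin q (Phi q s one) y k 0 - u' q y k 0).
suff : 0 <= p t x i 0 by rewrite mxE subr_ge0.
have z0 q y k : s <= q -> Oc y -> 0 <= Phi q s one y k 0 by move=> sq; apply: (Phi_ge0 H evol) => //; [exact: X_one|exact: one_ge0].
apply: (@linear_comparison _ _ _ _ _ _ _ _ _ H E eps s t p p' V) => //; last by rewrite st lexx.
- move=> y k yE.
  have tz := traj_mul (traj_exp s t V (- eps) s) (Phi_traj evol s t k X_one (EO y yE)).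
  apply: (traj_ext _ _ (traj_lin (-1) tz (derive_traj (fun r _ => du r y k yE)))) => r.
    by rewrite mxE mulN1r.
  by rewrite [p' r y k 0]mxE mulN1r.
- move=> y k yE; rewrite mxE /e subrr mulr0 expR0 mulr1 (evol_id evol) ?oneE ?mulr1//.
  - by have /andP[] := uV s y k yE; rewrite subr_ge0.
  - exact: X_one.
  - exact: EO.
- move=> q y k /andP[sq _] yE; rewrite mxE.
  have /andP[_] := uV q y k yE; have : 0 <= e q * Phi q s one y k 0 by rewrite mulr_ge0// z0//; exact: EO.
  lra.
move=> q N /andP[sq qt] N0 pN y k yE; have sq' := ltW sq.
have bz l : bounded_meas Omega (fun z => Phi q s one z l 0) by apply: (Phi_bm H evol) => //; exact: X_one.
have bez : bounded_meas Omega (fun z => e q * Phi q s one z k 0) by apply: bounded_measM => //; exact: bounded_meas_cst.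
have hNU : NU q y k <= nlO k q y (fun z => e q * Phi q s one z k 0) + N.
  apply: HN => // [z zO|z zE]; first by rewrite mulr_ge0// z0.
  by have := pN z k zE; rewrite mxE; lra.
have nE : nlO k q y (fun z => e q * Phi q s one z k 0) = e q * nlO k q y (fun z => Phi q s one z k 0).
  by rewrite (nl_scale H)//; exact: EO.
rewrite nE in hNU.
have -> : \sum_l J q y 0 k l * p q y l 0 =
   e q * (\sum_l J q y 0 k l * Phi q s one y l 0) - \sum_l J q y 0 k l * u q y l 0.
  rewrite mulr_sumr -sumrB; apply: eq_bigr => l _; rewrite [p q y l 0]mxE; ring.
rewrite [p q y k 0]mxE [p' q y k 0]mxE linear_partE.
have := Hu q y k yE.
move: (\sum_l J q y 0 k l * Phi q s one y l 0) (\sum_l J q y 0 k l * u q y l 0) => S1 S2.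
move: (nlO k q y (fun z => Phi q s one z k 0)) hNU => n1 hNU; move: (NU q y k) hNU => nu hNU.
have dk : 0 < d 0 k := st_d H k.
have : d 0 k * nu <= d 0 k * (e q * n1 + N) by rewrite ler_pM2l.
move: (e q) (u q y k 0) (u' q y k 0) (Phi q s one y k 0) (d 0 k) => a b0' c0' d0' e0'.
clear; lra.
Qed.

(** The comparison over k periods bounds u(t) = u(t + kT) by
    e^{-(eps - w) k T}. *)
Lemma periodic_vanish (E : set 'cV[R]_n) (eps w V : R) u u' (NU : R -> 'cV[R]_n -> 'I_m -> R) :
  E `<=` Oc -> 0 <= eps -> 0 <= V -> (growth_bound Omega Phi < w%:E)%E -> w < eps ->
  (forall t x, E x -> u (t + T) x = u t x) ->
  (forall (r : R) x i, E x -> is_derive r 1 (fun q => u q x i 0) (u' r x i 0)) ->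
  (forall (r : R) x i, E x -> 0 <= u r x i 0 <= V) ->
  (forall (r : R) x i, E x -> u' r x i 0 <= d 0 i * NU r x i - (d 0 i + eps) * u r x i 0 + \sum_k J r x 0 i k * u r x k 0) ->
  (forall (r : R) i (N : R) (f : 'cV[R]_n -> R), bounded_meas Omega f -> 0 <= N -> (forall x, Oc x -> 0 <= f x) ->
     (forall x, E x -> u r x i 0 <= f x + N) -> forall x, E x -> NU r x i <= nlO i r x f + N) ->
  forall t x i, E x -> u t x i 0 = 0.
Proof.
move=> EO eps0 V0 gw we uT du uV Hu HN t x i xE.
have [B B0 HB] := growth_small gw.
apply/eqP; rewrite eq_le; have /andP[-> _] := uV t x i xE; rewrite andbT.
apply: (@exp_decay_zero _ (V * B) ((eps - w) * T)); first by rewrite mulr_gt0 ?subr_gt0.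
move=> k; have ukT : u (t + k%:R * T) x = u t x.
  elim: k => [|k IH]; first by rewrite mul0r addr0.
  by rewrite -natr1 mulrDl mul1r addrA uT.
have tk : t <= t + k%:R * T by rewrite lerDl mulr_ge0// ltW.
rewrite -ukT; apply: le_trans (damped_comparison EO eps0 V0 tk du uV Hu HN i xE) _.
have := HB t (t + k%:R * T) x i tk (EO x xE).
have -> : t + k%:R * T - t = k%:R * T by ring.
have -> : expR (- ((eps - w) * T * k%:R)) = expR (- eps * (k%:R * T)) * expR (w * (k%:R * T)).
  by rewrite -expRD; congr expR; ring.
have := expR_ge0 (- eps * (k%:R * T)).
move: (expR (- eps * (k%:R * T))) (expR (w * (k%:R * T))) (Phi _ _ _ _ _ _) => a b z a0 zb.
have : V * a * z <= V * a * (B * b) by rewrite ler_wpM2l// mulr_ge0.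
by move/le_trans; apply; rewrite le_eqVlt; apply/orP; left; apply/eqP; ring.
Qed.

Lemma box_solution_M u : X_tilde_box Omega T v u -> forall t x, Oc x -> M (u t x).
Proof.
move=> [_ ub] t x xO; have [/vleP h1 /vleP h2] := ub t x xO.
by apply: M_intro => k //; have := h1 k; rewrite mxE.
Qed.

Definition vsum : R := \sum_k v k 0.

Lemma v_le_vsum i : v i 0 <= vsum.
Proof. by rewrite /vsum (bigD1 i)//= lerDl sumr_ge0// => k _; rewrite ltW// (st_v H). Qed.

Lemma vsum_ge0 : 0 <= vsum.
Proof. by apply: sumr_ge0 => k _; rewrite ltW// (st_v H). Qed.

Lemma nl_upper_condition u (E : set 'cV[R]_n) (r : R) i (N : R) (f : 'cV[R]_n -> R) : (forall t x, Oc x -> M (u t x)) -> E `<=` Oc ->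
  Oc `<=` E -> bounded_meas Omega f -> 0 <= N -> (forall x, Oc x -> 0 <= f x) ->
  (forall x, E x -> u r x i 0 <= f x + N) -> forall x, E x -> nlO i r x (fun y => u r y i 0) <= nlO i r x f + N.
Proof.
move=> Mu EO OE bf N0 f0 uf x xE; have xO := EO x xE.
have [B HB] := bf.2.
have h1 : nlO i r x (fun y => u r y i 0) <= nlO i r x (fun y => f y + N * 1).
  apply: (@nl_le _ _ _ _ _ _ _ _ _ H i r x _ _ (B + N)) => // y yO.
    have yO' := subset_closure yO.
    by rewrite mulr1 (M_ge0 (Mu r y yO'))/=; apply: uf; exact: OE.
  by rewrite mulr1 lerD2r; apply: le_trans (ler_norm _) (HB y yO).
rewrite (nl_lin H) ?(bounded_meas_cst)// in h1; last exact: bounded_meas_cst.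
have n1 : nlO i r x (fun=> 1) <= 1 by exact: (nl_cst H).
apply: (le_trans h1); rewrite lerD2l -[X in _ <= X]mulr1; exact: ler_wpM2l.
Qed.

(** Choose w between the growth bound and 0; there is no damping and E is the
    closure of Omega. *)
Lemma negative_growth_zero u : (growth_bound Omega Phi < 0)%E ->
  X_tilde_box Omega T v u -> solves_P Omega d K g T u -> forall t x, Oc x -> u t x = 0.
Proof.
move=> /ereal_inf_lt[_ [w Hw <-]]; rewrite lte_fin => w0 ub su t x xO.
have Mu := box_solution_M ub.
have gw : (growth_bound Omega Phi < (w / 2)%:E)%E.
  apply: (@le_lt_trans _ _ w%:E); last by rewrite lte_fin; lra.
  by apply: ereal_inf_lbound; exists w.
have w20 : w / 2 < 0 by lra.
apply/colP => i; rewrite [RHS]mxE.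
apply: (@periodic_vanish Oc 0 (w / 2) vsum u (fun t x => rhs Omega d K g t (u t) x) (fun t x i => nlO i t x (fun y => u t y i 0))) => //.
- exact: vsum_ge0.
- by move=> r y yO; rewrite (su.1 r y yO).
- by move=> r y k yO; rewrite rhsE; exact: (solves_comp r k su yO).
- move=> r y k yO; rewrite (M_ge0 (Mu r y yO))/=.
  exact: le_trans (M_le (Mu r y yO) k) (v_le_vsum k).
- move=> r y k yO; rewrite rhsE addr0 lerD2l.
  by apply: (g_le_linear H) => //; exact: Mu.
- by move=> r k N f bf N0 f0 uf y yO; exact: (nl_upper_condition (E := Oc) Mu _ _ bf).
Qed.

(* Constants as in [reaction_constants], [K_near0] and [d_min]. *)
Variables (C b0 kap0 dm r : R) (beta : R -> 'cV[R]_n -> 'cV[R]_m -> 'I_m -> 'I_m -> R).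
Hypotheses (kap00 : 0 < kap0) (dm0 : 0 < dm)
  (beta_irr : forall t x b, Oc x -> M b -> irreducible_at b0 (beta t x b))
  (beta_low : forall t x b (p : 'cV[R]_m) i, Oc x -> M b -> (forall k, 0 <= p k 0) -> M (b + p) ->
    - (C * p i 0) + \sum_(k | k != i) beta t x b i k * p k 0 <=
      g t x (b + p) i 0 - g t x b i 0)
  (Kk : forall i t x y, ball x r y -> kap0 <= K i t (x - y)) (dmd : forall i, dm <= d 0 i).

Local Notation cc := (C + dS).
Local Notation kk := (dm * kap0).

Lemma solution_lower u : (forall t x, Oc x -> M (u t x)) -> solves_P Omega d K g T u ->
  forall a b, lower_system (Omega := Omega) cc b0 kk r a b u (fun t x => rhs Omega d K g t (u t) x).
Proof.
move=> Mu su a b; apply: (lower_system_solution H kap00 dm0 beta_irr beta_low Kk dmd) => //.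
  by move=> t x i xO; rewrite rhsE; exact: (solves_comp t i su xO).
by move=> t x i xO; rewrite rhsE.
Qed.

End decay.

(** * Zero growth bound *)

Section system.
Context {R : realType} {m n : nat} {Omega : set 'cV[R]_n} {d : 'rV[R]_m}
  {v : 'cV[R]_m} {K : 'I_m -> R -> 'cV[R]_n -> R}
  {g : R -> 'cV[R]_n -> 'cV[R]_m -> 'cV[R]_m} {T : R}.
Hypothesis H : standing Omega d v K g T.
Implicit Types (u w : R -> 'cV[R]_n -> 'cV[R]_m) (x y : 'cV[R]_n) (t s : R).
Local Notation M := (box 0 v).
Local Notation Oc := (closure Omega).
Local Notation J := (fun t x a => jacobian_u g t x a).
Let T0 : 0 < T := st_T H.

Local Notation mu := (lebesgue_n n).
Implicit Types (phi psi : 'cV[R]_n -> 'cV[R]_m).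
Local Notation nlO := (@nl R m n Omega K).
Local Notation dS := (@dsum R m d).
Local Notation lin := (linear_part Omega d K g).

Variable Phi : R -> R -> ('cV[R]_n -> 'cV[R]_m) -> ('cV[R]_n -> 'cV[R]_m).
Hypothesis evol : is_evolution_family Omega d K g Phi.

(* Constants as in [reaction_constants], [K_near0] and [d_min]. *)
Variables (C b0 kap0 dm r : R) (beta : R -> 'cV[R]_n -> 'cV[R]_m -> 'I_m -> 'I_m -> R).
Hypotheses (C0 : 0 < C) (b00 : 0 < b0) (kap00 : 0 < kap0) (dm0 : 0 < dm) (r0 : 0 < r)
  (HC : forall t x (a : 'cV[R]_m) i k, Oc x -> M a -> `|J t x a i k| <= C)
  (beta_irr : forall t x b, Oc x -> M b -> irreducible_at b0 (beta t x b))
  (beta_le : forall t x b i k, Oc x -> M b -> i != k -> beta t x b i k <= J t x b i k)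
  (beta_low : forall t x b (p : 'cV[R]_m) i, Oc x -> M b -> (forall k, 0 <= p k 0) -> M (b + p) ->
    - (C * p i 0) + \sum_(k | k != i) beta t x b i k * p k 0 <=
      g t x (b + p) i 0 - g t x b i 0)
  (Kk : forall i t x y, ball x r y -> kap0 <= K i t (x - y)) (dmd : forall i, dm <= d 0 i).

Local Notation cc := (C + dS).
Local Notation kk := (dm * kap0).

Let cc0 : 0 < cc. Proof. by rewrite ltr_pwDl// (dsum_ge0 H). Qed.
Let kk0 : 0 < kk. Proof. by rewrite mulr_gt0. Qed.

(** Decay is at most exponential, and periodicity reduces any later time to one
    within a period. *)
Lemma persist u x (e : R) t : (forall t x, Oc x -> M (u t x)) -> solves_P Omega d K g T u ->
  Oc x -> 0 <= e -> (forall i, e <= u t x i 0) ->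
  forall s i, expR (- (cc * T)) * e <= u s x i 0.
Proof.
move=> Mu su xO e0 eu.
suff h s : forall i, expR (- (cc * T)) * e <= u (t + s) x i 0.
  by move=> s i; have -> : s = t + (s - t) by ring.
move: s; apply: (time_ind T0).
  by move=> s; rewrite addrA su.1.
move=> s /andP[s0 sT] i.
have Ls := solution_lower H kap00 dm0 beta_irr beta_low Kk dmd Mu su t (t + s).
have ts : t <= t + s by rewrite lerDl.
apply: le_trans (lower_system_decay i cc0 ts xO Ls).
apply: (@le_trans _ _ (expR (- (cc * (t + s - t))) * e)).
  rewrite ler_wpM2r// ler_expR lerN2 ler_wpM2l//; first exact: ltW.
  by rewrite addrAC subrr add0r.
by rewrite ler_wpM2l ?expR_ge0.
Qed.

Lemma mass_positive u t i (h : 'cV[R]_n -> R) : (forall t x, Oc x -> M (u t x)) ->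
  solves_P Omega d K g T u -> bounded_meas Omega h ->
  (forall y, Omega y -> 0 <= h y <= u t y i 0) -> 0 < \int[mu]_(y in Omega) h y ->
  exists2 del : R, 0 < del & forall s x k, Oc x -> del <= u s x k 0.
Proof.
move=> Mu su bh hu I0; have [rho rho0 HR] := harnack H cc0 b00 kk0 r0.
set I := (\int[mu]_(y in Omega) h y) in I0 *.
exists (expR (- (cc * T)) * (rho * I)); first by rewrite mulr_gt0 ?expR_gt0// mulr_gt0.
move=> s x k xO; apply: (@persist u x _ (t + T)) => //; first by rewrite mulr_ge0// ltW.
move=> l; have Ls := solution_lower H kap00 dm0 beta_irr beta_low Kk dmd Mu su t (t + T).
apply: le_trans (HR _ _ _ _ _ Ls bh hu x l xO).
by rewrite ler_wpM2l ?(ltW rho0)// lerDr (M_ge0 (Mu t x xO)).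
Qed.

Lemma point_positive : exists2 rho : R, 0 < rho & forall u t x i, (forall t x, Oc x -> M (u t x)) ->
  solves_P Omega d K g T u -> Oc x -> forall s k, rho * u t x i 0 <= u s x k 0.
Proof.
have [rho rho0 HR] := harnack H cc0 b00 kk0 r0.
exists (expR (- (cc * T)) * rho); first by rewrite mulr_gt0 ?expR_gt0.
move=> u t x i Mu su xO s k; rewrite -mulrA; apply: (@persist u x _ (t + T)) => //.
  by rewrite mulr_ge0 ?(ltW rho0)// (M_ge0 (Mu t x xO)).
move=> l; have Ls := solution_lower H kap00 dm0 beta_irr beta_low Kk dmd Mu su t (t + T).
have := HR _ _ _ _ i Ls (bounded_meas_cst Omega 0) _ x l xO.
rewrite (_ : \int[mu]_(y in Omega) 0 = 0) ?addr0; last by rewrite /Rintegral integral0.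
by apply=> y yO; rewrite lexx (M_ge0 (Mu t y (subset_closure yO))).
Qed.

(** The kernel is bounded, so a minorant of K u with mass would give one of
    u. *)
Lemma nl_no_mass u : (forall t x, Oc x -> M (u t x)) ->
  (forall t i (h : 'cV[R]_n -> R), bounded_meas Omega h ->
     (forall y, Omega y -> 0 <= h y <= u t y i 0) -> \int[mu]_(y in Omega) h y <= 0) ->
  forall t i x, Oc x -> nlO i t x (fun y => u t y i 0) = 0.
Proof.
move=> Mu no t i x xO; have [B B0 HB] := K_bound H.
have u0 y : Omega y -> 0 <= u t y i 0 <= v i 0.
  by move=> yO; rewrite (M_ge0 (Mu t y (subset_closure yO))) (M_le (Mu t y (subset_closure yO))).
apply: (@Rintegral_no_minorant _ _ _ (Omega_measurable H) (Omega_finite H) _ (B * v i 0)) => [y yO|h bh hu].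
  have /andP[a b] := u0 y yO; rewrite mulr_ge0 ?(st_K_ge0 H)//=.
  by apply: ler_pM => //; [exact: (st_K_ge0 H)|apply: HB => //; exact: subset_closure].
have bB : bounded_meas Omega (fun y => B^-1 * h y) by apply: bounded_measM => //; exact: bounded_meas_cst.
have := no t i _ bB; rewrite RintegralZl//; last first.
- by apply: bounded_meas_integrable => //; [exact: (Omega_measurable H)|exact: (Omega_finite H)].
- exact: (Omega_measurable H).
rewrite pmulr_rle0 ?invr_gt0//; apply=> y yO; have /andP[h0 h1] := hu y yO; have /andP[a b] := u0 y yO.
rewrite mulr_ge0 ?invr_ge0 ?(ltW B0)//= ler_pdivrMl//; apply: (le_trans h1).
by rewrite ler_wpM2r//; apply: HB => //; exact: subset_closure.
Qed.

(** With be = 1/2, strong subhomogeneity gives g(u) <= 2 g(u/2) - 2 e0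
    <= Ju - 2 e0 where u >= del, and 2 e0 >= eps u on the box. The linear growth bound
    0 lies below this eps. *)
Lemma strong_decay u (E : set 'cV[R]_n) (del : R) : (growth_bound Omega Phi <= 0)%E ->
  (forall t x (u : 'cV[R]_m) (alpha : R), 0 <= t -> closure Omega x ->
     order_box v u -> interior Rplus u -> 0 < alpha < 1 ->
     vll (alpha *: g t x u) (g t x (alpha *: u))) ->
  (forall t x, Oc x -> M (u t x)) -> solves_P Omega d K g T u -> E `<=` Oc -> 0 < del ->
  (forall t x i, E x -> del <= u t x i 0) ->
  (forall (r : R) i (N : R) (f : 'cV[R]_n -> R), bounded_meas Omega f -> 0 <= N -> (forall x, Oc x -> 0 <= f x) ->
     (forall x, E x -> u r x i 0 <= f x + N) ->
     forall x, E x -> nlO i r x (fun y => u r y i 0) <= nlO i r x f + N) ->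
  forall t x i, E x -> u t x i 0 = 0.
Proof.
move=> g0 strong Mu su EO del0 du HN.
have be2 : 0 < (2^-1 : R) < 1 by lra.
have [e0 e00 He] := g_strong H be2 del0 strong.
have V0 : 0 < @vsum _ _ v + 1 by rewrite ltr_wpDl// (vsum_ge0 H).
set V := @vsum _ _ v + 1 in V0.
have uV t x i : Oc x -> u t x i 0 <= V.
  by move=> xO; rewrite /V; have := M_le (Mu t x xO) i; have := v_le_vsum H i; lra.
have eps0 : 0 < 2 * e0 / V by rewrite divr_gt0 ?mulr_gt0.
apply: (@periodic_vanish _ _ _ _ _ _ _ _ _ H Phi evol E (2 * e0 / V) (e0 / V) V u
  (fun t x => rhs Omega d K g t (u t) x) (fun t x i => nlO i t x (fun y => u t y i 0))) => //.
- exact: ltW.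
- exact: ltW.
- by apply: le_lt_trans g0 _; rewrite lte_fin divr_gt0.
- by rewrite ltr_pM2r ?invr_gt0//; lra.
- by move=> t x xE; rewrite su.1//; exact: EO.
- by move=> s x i xE; rewrite rhsE; apply: (solves_comp s i su); exact: EO.
- by move=> s x i xE; rewrite (M_ge0 (Mu s x (EO x xE))) uV//; exact: EO.
- move=> s x i xE; have xO := EO x xE; rewrite rhsE.
  have h1 := He s x (u s x) i xO (Mu s x xO) (fun k => du s x k xE).
  have be01 : 0 <= (2^-1 : R) <= 1 by lra.
  have := g_le_linear H s i xO (M_scale (Mu s x xO) be01).
  rewrite (_ : \sum_k J s x 0 i k * (2^-1 *: u s x) k 0 = 2^-1 * \sum_k J s x 0 i k * u s x k 0); last first.
    by rewrite mulr_sumr; apply: eq_bigr => k _; rewrite [(2^-1 *: u s x) k 0]mxE; ring.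
  have : 2 * e0 / V * u s x i 0 <= 2 * e0.
    rewrite mulrAC ler_pdivrMr// ler_pM2l//; first exact: uV.
    by rewrite mulr_gt0.
  move: (\sum_k _) (nlO _ _ _ _) (2 * e0 / V) h1 => S n1 q h1.
  move: (g s x (2^-1 *: u s x) i 0) (g s x (u s x) i 0) h1 => g1 g2 h1; move: (u s x i 0) (d 0 i) => a b; lra.
Qed.

(** Either some slice has mass, and u is bounded below on the closure of Omega, or
    the nonlocal term of u vanishes identically, and the argument is made at one point
    where u is positive. *)
Lemma zero_growth_strong u : (growth_bound Omega Phi <= 0)%E ->
  (forall t x (u : 'cV[R]_m) (alpha : R), 0 <= t -> closure Omega x ->
     order_box v u -> interior Rplus u -> 0 < alpha < 1 ->
     vll (alpha *: g t x u) (g t x (alpha *: u))) ->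
  X_tilde_box Omega T v u -> solves_P Omega d K g T u -> forall t x, Oc x -> u t x = 0.
Proof.
move=> g0 strong /box_solution_M Mu su t x xO; apply/colP => i; rewrite [RHS]mxE.
have [[s [k [h [bh hu I0]]]]|no] := pselect (exists s k (h : 'cV[R]_n -> R), [/\ bounded_meas Omega h,
    forall y, Omega y -> 0 <= h y <= u s y k 0 & 0 < \int[mu]_(y in Omega) h y]).
  have [del del0 Hd] := mass_positive Mu su bh hu I0.
  apply: (@strong_decay u Oc del) => //; move=> q l N f bf N0 f0 uf y yO.
  exact: (nl_upper_condition H (E := Oc) Mu _ _ bf).
have nl0 := nl_no_mass Mu _; have {}nl0 : forall t i x, Oc x -> nlO i t x (fun y => u t y i 0) = 0.
  apply: nl_no_mass => // s k h bh hu; rewrite leNgt; apply/negP => I0; apply: no.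
  by exists s, k, h.
have [rho rho0 HR] := point_positive.
have u0 := M_ge0 (Mu t x xO) i.
have [//|u1] := eqVneq (u t x i 0) 0.
have up : 0 < u t x i 0 by rewrite lt_def u1.
apply: (@strong_decay u [set x] (rho * u t x i 0)) => //.
- by move=> y ->.
- by rewrite mulr_gt0.
- by move=> s y k ->; exact: HR.
- by move=> q l N f bf N0 f0 uf y ->; rewrite nl0// addr_ge0// (nl_ge0 H)// => z zO; apply: f0; exact: subset_closure.
Qed.

(** Subtract a small constant function from u. *)
Lemma int_C_T_plus_lower u : int_C_T_plus Omega T u ->
  exists2 e : R, 0 < e & forall t x i, Oc x -> e <= u t x i 0.
Proof.
move=> [[cu uT] [e [e0 He]]]; have e20 : 0 < e / 2 by rewrite divr_gt0.
exists (e / 2) => // t x i xO.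
pose w t x := u t x - const_mx (e / 2).
have Cw : C_T Omega T w.
  split; last by move=> s y yO; rewrite /w uT.
  by move=> p; apply: cvgB; [exact: cu|exact: cvg_cst].
suff wlt : (normT Omega (fun t x => (w t x - u t x)%R) < e%:E)%E.
  have [_ h] := He w Cw wlt.
  by have /vleP /(_ i) := h t x xO; rewrite !mxE subr_ge0.
apply: (@le_lt_trans _ _ (e / 2)%:E); last by rewrite lte_fin; lra.
apply: ge_ereal_sup => _ [p pO <-]; rewrite lee_fin; apply: norm_le_coord => [|k].
  exact: ltW.
by rewrite /w !mxE addrAC subrr add0r normrN gtr0_norm.
Qed.

Lemma C_T_cont_on u i : C_T Omega T u -> cont_on (cyl Omega) (fun p => u p.1 p.2 i 0).
Proof.
move=> [cu _]; apply/within_cont_on; apply/subspace_continuousP => p Op.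
move/subspace_continuousP : cu => /(_ p Op) cu.
apply: (@cvg_comp _ _ _ _ (fun a : 'cV[R]_m => a i 0) _ _ _ cu).
exact: coord_continuous.
Qed.

Lemma periodic_cont_bound u : (forall i, cont_on (cyl Omega) (fun p => u p.1 p.2 i 0)) ->
  periodic_in_time Omega T u -> exists2 B : R, 0 < B & forall t x i, Oc x -> `|u t x i 0| <= B.
Proof.
move=> cu uT.
pose A : set (R * 'cV[R]_n) := `[0, T]%classic `*` Oc.
have cA : compact A by apply: compact_setX; [exact: segment_compact|exact: (Oc_compact H)].
have [B B0 HB] : exists2 B : R, 0 < B & forall i, forall p, A p -> `|u p.1 p.2 i 0| <= B.
  apply: (@fin_large_witness R 'I_m (fun i B => forall p, A p -> `|u p.1 p.2 i 0| <= B)).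
    move=> i; have cuA : cont_on A (fun p => u p.1 p.2 i 0) by apply: cont_onS (cu i) => -[q y] [].
    by have [B B0 HB] := compact_bound cA cuA; exists B.
  by move=> i B B' BB h p pA; apply: le_trans (h p pA) BB.
exists B => // t x i xO; move: t; apply: (time_ind T0) => [t|t tT]; first by rewrite uT.
by apply: (HB i (t, x)); split=> //=; rewrite in_itv.
Qed.

Lemma C_T_bound u : C_T Omega T u -> exists2 B : R, 0 < B & forall t x i, Oc x -> `|u t x i 0| <= B.
Proof. by move=> Cu; apply: periodic_cont_bound => [i|]; [exact: C_T_cont_on|case: Cu]. Qed.

Lemma C_T_meas u t i : C_T Omega T u -> bounded_meas Omega (fun y => u t y i 0).
Proof.
move=> Cu; split.
  apply: cont_on_measurable_cV; first exact: (Omega_measurable H).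
  move=> x xO e e0; have [|q q0 Hq] := C_T_cont_on i Cu (_ : cyl Omega (t, x)) e0.
    exact: subset_closure.
  exists q => // y yO xy; apply: (Hq (t, y)); first exact: subset_closure.
  by split=> //=; exact: ballxx.
have [B _ HB] := C_T_bound Cu; exists B => y yO; apply: HB; exact: subset_closure.
Qed.

(** Let kap be the least constant with u <= kap phi and suppose kap > 0. Points at
    which u stays below (kap/2) phi leave room. At any other point u is bounded below,
    so that Ju - g(u) has a uniformly positive sum, and [periodic_harnack] applied to
    kap phi - u gives a uniform gap. Either way kap could be decreased. *)
Lemma zero_growth_eigen u : is_principal_eigenvalue Omega d K g T 0 ->
  X_tilde_box Omega T v u -> solves_P Omega d K g T u -> forall t x, Oc x -> u t x = 0.
Proof.
move=> [_ [phi [[Cphi dphi _] Iphi Lphi]]] /box_solution_M Mu su.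
have [df df0 Hdf] := int_C_T_plus_lower Iphi.
have [B B0 HB] := C_T_bound Cphi.
have phiB t x i : Oc x -> phi t x i 0 <= B by move=> xO; apply: le_trans (ler_norm _) (HB t x i xO).
have phi0 t x i : Oc x -> 0 < phi t x i 0 by move=> xO; exact: lt_le_trans (Hdf t x i xO).
have dphiE t x i : Oc x -> is_derive t 1 (fun s => phi s x i 0) (lin t (phi t) x i 0).
  move=> xO; apply: is_derive_comp; apply: DeriveDef; first exact: dphi.
  have := Lphi t x xO; rewrite /L_T derive1E scale0r => /eqP.
  by rewrite addrC subr_eq0 => /eqP.
have [rho rho0 HR] := point_positive.
have [rp [kp [rp0 kp0 PH]]] := @periodic_harnack R m cc b0 T cc0 b00 T0.
pose S : set R := [set k | 0 <= k /\ forall t x i, Oc x -> u t x i 0 <= k * phi t x i 0].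
have S0 : S (@vsum _ _ v / df).
  split=> [|t x i xO]; first by rewrite divr_ge0 ?(ltW df0)// (vsum_ge0 H).
  apply: (le_trans (M_le (Mu t x xO) i)); apply: (le_trans (v_le_vsum H i)).
  rewrite -mulrA ler_peMr ?(vsum_ge0 H)// mulrC ler_pdivlMr// mul1r; exact: Hdf.
have Sinf : has_inf S by split; [exists (@vsum _ _ v / df)|exists 0 => k []].
pose kap := inf S.
have kap_ge0 : 0 <= kap by apply: lb_le_inf; [exists (@vsum _ _ v / df)|move=> k []].
have ukap t x i : Oc x -> u t x i 0 <= kap * phi t x i 0.
  move=> xO; rewrite -ler_pdivrMr ?phi0//; apply: lb_le_inf; first by exists (@vsum _ _ v / df).
  by move=> k [_ Hk]; rewrite ler_pdivrMr ?phi0//; exact: Hk.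
suff kap0' : kap <= 0.
  move=> t x xO; apply/colP => i; rewrite [RHS]mxE; apply/eqP; rewrite eq_le (M_ge0 (Mu t x xO)) andbT.
  by apply: (le_trans (ukap t x i xO)); rewrite mulr_le0_ge0 ?(ltW (phi0 _ _ _ xO)).
rewrite leNgt; apply/negP => kp1.
have kd0 : 0 < kap / 2 * df by rewrite !mulr_gt0// invr_gt0.
have be2 : 0 < (2^-1 : R) < 1 by lra.
have [e0 e00 He] := g_strict H be2 (mulr_gt0 rho0 kd0).
suff [c c0 Hc] : exists2 c : R, 0 < c & forall t x i, Oc x -> u t x i 0 <= kap * phi t x i 0 - c.
  pose k := Num.max 0 (kap - c / B).
  have Sk : S k.
    split=> [|t x i xO]; first by rewrite /k le_max lexx.
    apply: (le_trans (Hc t x i xO)); apply: (@le_trans _ _ ((kap - c / B) * phi t x i 0)).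
      rewrite mulrBl lerD2l lerN2 -mulrA ler_piMr ?(ltW c0)// mulrC ler_pdivrMr// mul1r; exact: phiB.
    by rewrite ler_wpM2r ?(ltW (phi0 _ _ _ xO))// /k le_max lexx orbT.
  have : kap <= k by apply: ge_inf => //; exists 0 => q [].
  have : 0 < c / B by rewrite divr_gt0.
  by rewrite /k le_max => cB /orP[]; lra.
exists (Num.min (rp * (2 * e0)) (kap / 2 * df)); first by rewrite lt_min kd0 !mulr_gt0.
move=> t0 x i0 xO; rewrite lerBrDr addrC -lerBrDr ge_min.
have [[t1 [j uj]]|no] := pselect (exists t j, kap / 2 * phi t x j 0 <= u t x j 0); last first.
  apply/orP; right.
  have : u t0 x i0 0 <= kap / 2 * phi t0 x i0 0.
    by rewrite leNgt; apply/negP => h; apply: no; exists t0, i0; exact: ltW.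
  have : kap / 2 * df <= kap / 2 * phi t0 x i0 0 by rewrite ler_pM2l ?divr_gt0//; exact: Hdf.
  lra.
apply/orP; left.
have del s k : rho * (kap / 2 * df) <= u s x k 0.
  apply: le_trans (HR u t1 x j Mu su xO s k); rewrite ler_pM2l//; apply: le_trans uj.
  by rewrite ler_pM2l ?divr_gt0//; exact: Hdf.
pose p t i := kap * phi t x i 0 - u t x i 0.
pose p' t i := kap * lin t (phi t) x i 0 - rhs Omega d K g t (u t) x i 0.
have p0 t i : 0 <= p t i by rewrite subr_ge0; exact: ukap.
have key t i : \sum_(k | k != i) beta t x 0 i k * p t k +
    (\sum_k J t x 0 i k * u t x k 0 - g t x (u t x) i 0) <= p' t i + cc * p t i.
  rewrite /p' linear_partE rhsE.
  have h1 : nlO i t x (fun y => u t y i 0) <= kap * nlO i t x (fun y => phi t y i 0).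
    have -> : kap * nlO i t x (fun y => phi t y i 0) = nlO i t x (fun y => kap * phi t y i 0).
      by rewrite (nl_scale H)//; exact: C_T_meas.
    apply: (@nl_le _ _ _ _ _ _ _ _ _ H i t x _ _ (kap * B)) => // y yO; have yO' := subset_closure yO.
      by rewrite (M_ge0 (Mu t y yO'))/= ukap.
    by rewrite ler_pM2l// phiB.
  have h2 : d 0 i * nlO i t x (fun y => u t y i 0) <= d 0 i * (kap * nlO i t x (fun y => phi t y i 0)).
    by rewrite ler_pM2l// (st_d H).
  have h3 : - (C * p t i) + \sum_(k | k != i) beta t x 0 i k * p t k <= \sum_k J t x 0 i k * p t k.
    rewrite [leRHS](bigD1 i)//=; apply: lerD.
      rewrite -mulNr ler_wpM2r//; have := HC t i i xO (M0 H); rewrite ler_norml => /andP[]; lra.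
    by apply: ler_sum => k ki; rewrite ler_wpM2r// beta_le//; [exact: (M0 H)|rewrite eq_sym].
  have h4 : \sum_k J t x 0 i k * p t k = kap * (\sum_k J t x 0 i k * phi t x k 0) - \sum_k J t x 0 i k * u t x k 0.
    by rewrite mulr_sumr -sumrB; apply: eq_bigr => k _; rewrite /p; ring.
  rewrite h4 in h3.
  have h5 : d 0 i * p t i <= dS * p t i by rewrite ler_wpM2r//; exact: d_le_dsum H i.
  have pE : p t i = kap * phi t x i 0 - u t x i 0 by [].
  move: h2 h3 h5; rewrite !pE.
  move: (nlO i t x (fun y => u t y i 0)) (nlO i t x (fun y => phi t y i 0)) (\sum_k _) (\sum_k _) (\sum_(k | _) _) (g t x (u t x) i 0).
  move: (d 0 i) (dS) (phi t x i 0) (u t x i 0); clear h1 h4 => q1 q2 q3 q4 q5 q6 q7 q8 q9 q10 h2 h3 h5; lra.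
have e_ge0 t i : 0 <= \sum_k J t x 0 i k * u t x k 0 - g t x (u t x) i 0.
  by rewrite subr_ge0; exact: (g_le_linear H t i xO (Mu t x xO)).
have bp0 t i : 0 <= \sum_(k | k != i) beta t x 0 i k * p t k.
  apply: sumr_ge0 => k ki; rewrite mulr_ge0//; have [b0' _] := beta_irr t xO (M0 H).
  by apply: b0'; rewrite eq_sym.
apply: (PH p p' (fun t => beta t x 0) 0 (2 * e0)) => //.
- by move=> t i; rewrite /p (su.1 t x xO) (Cphi.2 t x xO).
- move=> t i; have h1 := dphiE t x i xO; have := solves_comp t i su xO; rewrite -rhsE => h2.
  by apply: is_derive_eq; rewrite /p' /GRing.scale/=; ring.
- move=> t i; have := key t i; have := e_ge0 t i; move: (\sum_k _ - _) => E1; lra.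
- by move=> t; apply: beta_irr => //; exact: (M0 H).
- move=> t; apply: (@le_trans _ _ (2 * \sum_i (g t x (2^-1 *: u t x) i 0 - 2^-1 * g t x (u t x) i 0))).
    by rewrite ler_pM2l//; apply: He => //; exact: Mu.
  rewrite mulr_sumr; apply: ler_sum => i _; apply: le_trans (key t i).
  have be01 : 0 <= (2^-1 : R) <= 1 by lra.
  have := g_le_linear H t i xO (M_scale (Mu t x xO) be01).
  rewrite (_ : \sum_k J t x 0 i k * (2^-1 *: u t x) k 0 = 2^-1 * \sum_k J t x 0 i k * u t x k 0); last first.
    by rewrite mulr_sumr; apply: eq_bigr => k _; rewrite [(2^-1 *: u t x) k 0]mxE; ring.
  have := bp0 t i; move: (\sum_(k | _) _) (\sum_k _) (g _ _ _ _ _) (g _ _ _ _ _) => q1 q2 q3 q4; lra.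
- by rewrite lexx/=; apply: mulr_ge0; [exact: ltW|apply: mulr_ge0 => //; exact: ltW].
- by rewrite mulr_ge0// ltW.
Qed.

End system.

(** * Periodic linear equations and limits of derivatives *)

Section real_functions.
Context {R : realType}.
Implicit Types (f : R -> R) (a b c t s : R).

Lemma traj_constant a b f : a <= b -> traj a b f (fun=> 0) -> f a = f b.
Proof.
move=> ab tf; apply/eqP; rewrite eq_le (traj_nondecr ab tf)//=.
have tN : traj a b (fun t => 0 + (-1) * f t) (fun t => 0 + (-1) * 0).
  by apply: traj_lin => //; apply: derive_traj => t _; exact: is_derive_cst.
have := traj_nondecr ab tN; rewrite !add0r !mulN1r lerN2; apply=> t _.
by rewrite oppr0.
Qed.

Lemma positive_primitive f : continuous f ->
  exists F : R -> R, forall t, 0 < t -> is_derive t 1 F (f t).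
Proof.
move=> cf; exists (fun x => \int[lebesgue_measure]_(t in [set` `[0, x]]) f t)%R => t t0.
have [] := @continuous_FTC1_closed R f 0 t (t + 1) _ _ t0 (cf t).
- by rewrite ltrDl.
- by apply: continuous_compact_integrable; [exact: segment_compact|exact: continuous_subspaceT].
by move=> dF <-; rewrite derive1E; exact: DeriveDef.
Qed.

(** Any solution on (0, oo) differs from its translate by a multiple of
    e^{-c t}; adjust the initial value so that this multiple is 0, and extend by
    periodicity. *)
Lemma periodic_linear_solution f c T : continuous f -> 0 < c -> 0 < T ->
  (forall t, f (t + T) = f t) ->
  exists u : R -> R, (forall t, u (t + T) = u t) /\
    forall t, is_derive t 1 u (f t - c * u t).
Proof.
move=> cf c0 T0 fT.
have [F HF] : exists F : R -> R, forall t, 0 < t -> is_derive t 1 F (expR (c * t) * f t).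
  apply: positive_primitive => t; apply: cvgM; last exact: cf.
  apply: (@continuous_comp _ _ _ (fun s : R => c * s) expR); last exact: continuous_expR.
  exact: mulrl_continuous.
pose u1 t := expR (- c * t) * F t.
have du1 t : 0 < t -> is_derive t 1 u1 (f t - c * u1 t).
  move=> t0; have ? := HF t t0; apply: is_derive_eq; rewrite /GRing.scale/= /u1.
  have : expR (- c * t) * expR (c * t) = 1 by rewrite -expRD mulNr addNr expR0.
  set A := expR (- c * t); set B := expR (c * t) => AB.
  transitivity ((A * B) * f t - c * (A * F t)); first by ring.
  by rewrite AB mul1r.
have sh t : is_derive t 1 (fun s => s + T) (1 : R).
  by apply: is_derive_eq; rewrite addr0.
have du2 t : 0 < t -> is_derive t 1 (fun s => u1 (s + T)) (f t - c * u1 (t + T)).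
  move=> t0; have tT : 0 < t + T by rewrite addr_gt0.
  have h1 := du1 _ tT; rewrite fT in h1.
  have := @is_derive1_comp R u1 (fun s => s + T) t _ 1 h1 (sh t).
  by rewrite /= mulr1.
pose W t := expR (c * t) * (u1 (t + T) - u1 t).
have dW t : 0 < t -> is_derive t 1 W 0.
  move=> t0; have h1 := du1 t t0; have h2 := du2 t t0.
  apply: is_derive_eq; rewrite /GRing.scale/=; ring.
pose w0 := W 1.
have WE t : 0 < t -> W t = w0.
  move=> t0; have [t1|t1] := leP t 1.
    by apply: (traj_constant t1); apply: derive_traj => s /andP[ts _]; apply: dW; exact: lt_le_trans ts.
  by apply/esym; apply: (traj_constant (ltW t1)); apply: derive_traj => s /andP[ts _]; apply: dW; exact: lt_le_trans ts.
have eT : 0 < 1 - expR (- c * T) by rewrite subr_gt0 mulNr expR_lt1// mulr_gt0.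
pose A := w0 / (1 - expR (- c * T)).
pose u0 t := u1 t + A * expR (- c * t).
have du0 t : 0 < t -> is_derive t 1 u0 (f t - c * u0 t).
  move=> t0; have ? := du1 t t0; apply: is_derive_eq; rewrite /GRing.scale/= /u0; ring.
have u0T t : 0 < t -> u0 (t + T) = u0 t.
  move=> t0; have := WE t t0; rewrite /W /u0 => h; apply/eqP; rewrite -subr_eq0; apply/eqP.
  have E1 : u1 (t + T) - u1 t = expR (- c * t) * w0.
    by rewrite -h mulrA -expRD mulNr addNr expR0 mul1r.
  have E2 : expR (- c * (t + T)) = expR (- c * t) * expR (- c * T) by rewrite -expRD mulrDr.
  transitivity (u1 (t + T) - u1 t + A * (expR (- c * (t + T)) - expR (- c * t))); first by ring.
  rewrite E1 E2 /A; field; exact: lt0r_neq0.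
have u0kT t (k : nat) : 0 < t -> u0 (t + k%:R * T) = u0 t.
  move=> t0; elim: k => [|k IH]; first by rewrite mul0r addr0.
  by rewrite -natr1 mulrDl mul1r addrA u0T// ltr_wpDr// mulr_ge0// ltW.
have indep t (j k : nat) : 0 < t + j%:R * T -> 0 < t + k%:R * T -> u0 (t + j%:R * T) = u0 (t + k%:R * T).
  wlog jk : j k / (j <= k)%N.
    by move=> h tj tk; have [jk|/ltnW kj] := leqP j k; [exact: h|exact/esym/h].
  move=> tj _; rewrite -(u0kT _ (k - j)%N tj) natrB//; congr u0; ring.
pose N t := (Num.trunc (`|t| / T)).+1.
have NP t : `|t| < (N t)%:R * T by rewrite -ltr_pdivrMr//; exact: truncnS_gt.
have Npos t s : `|s| <= `|t| + 1 -> 0 < s + (N (`|t| + 1))%:R * T.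
  move=> st; have := NP (`|t| + 1); rewrite (ger0_norm (x := `|t| + 1)) ?addr_ge0// => h.
  have := le_lt_trans st h; rewrite ltr_norml => /andP[]; lra.
have Npos' t : 0 < t + (N t)%:R * T by have := NP t; rewrite ltr_norml => /andP[]; lra.
exists (fun t => u0 (t + (N t)%:R * T)); split=> t.
  have -> : t + T + (N (t + T))%:R * T = t + (N (t + T)).+1%:R * T by rewrite -[in RHS]natr1; ring.
  apply: indep => //; have := Npos' (t + T); rewrite -natr1; lra.
pose k := N (`|t| + 1).
have sk : is_derive t 1 (fun s => s + k%:R * T) (1 : R).
  by apply: is_derive_eq; rewrite addr0.
have tk : 0 < t + k%:R * T by apply: Npos; rewrite lerDl.
have := @is_derive1_comp R u0 (fun s => s + k%:R * T) t _ 1 (du0 _ tk) sk.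
have fkT : f (t + k%:R * T) = f t.
  by elim: (k) => [|l IH]; rewrite ?mul0r ?addr0// -natr1 mulrDl mul1r addrA fT.
rewrite /= mulr1 fkT (indep _ _ (N t) tk (Npos' t)); apply: near_eq_is_derive.
near=> s; apply: indep; last exact: Npos'.
apply: Npos; have : `|t - s| < 1 by near: s; exact: (@cvgr_dist_lt _ _ _ _ _ id t cvg_id 1 ltr01).
have := ler_normB t (t - s); rewrite opprB addrC subrK; lra.
Unshelve. all: by end_near.
Qed.

(** Equicontinuity of the derivatives at t makes the mean value estimate uniform
    in k. *)
Lemma derive_limit (f h : nat -> R -> R) (F : R -> R) t (l : R) :
  (forall k s, is_derive s 1 (f k) (h k s)) ->
  (forall s, f ^~ s @ \oo --> F s) -> h ^~ t @ \oo --> l ->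
  (forall e : R, 0 < e -> exists2 r : R, 0 < r & forall k s, `|s - t| < r -> `|h k s - h k t| <= e) ->
  is_derive t 1 F l.
Proof.
move=> df fF hl eq.
suff lim : (fun q : R => q^-1 *: (F (q *: (1 : R) + t) - F t)) @ 0^' --> l.
  by apply: DeriveDef; [apply/cvg_ex; exists l|exact: cvg_lim lim].
apply/cvgrPdist_le => e e0; have [r r0 Hr] := eq e e0.
near=> q.
have q0 : q != 0 by near: q; exact: nbhs_dnbhs_neq.
have qr : `|q| < r by near: q; exact: dnbhs0_lt.
have bound k : `|f k (q + t) - f k t - q * h k t| <= e * `|q|.
  have [s [s1 s2 ->]] := mvt_between t (q + t) (df k).
  have -> : h k s * (q + t - t) - q * h k t = (h k s - h k t) * q by ring.
  rewrite normrM ler_wpM2r//; apply: Hr; apply: le_lt_trans qr.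
  move: s1 s2; rewrite ge_min le_max ler_norml => /orP s1 /orP s2.
  by have := ler_norm q; have := ler_norm (- q); rewrite normrN; case: s1 => s1; case: s2 => s2; lra.
have : `|F (q + t) - F t - q * l| <= e * `|q|.
  have cv : (fun k => `|f k (q + t) - f k t - q * h k t|) @ \oo --> `|F (q + t) - F t - q * l|.
    by apply: cvg_norm; apply: cvgB; [apply: cvgB; exact: fF|apply: cvgM; [exact: cvg_cst|exact: hl]].
  by apply: (cvgr_to_le cv); near=> k; exact: bound.
have -> : l - q^-1 *: (F (q *: (1 : R) + t) - F t) = - (q^-1 * (F (q + t) - F t - q * l)).
  by rewrite /GRing.scale/= mulr1; field.
rewrite normrN normrM normfV ler_pdivrMl ?normr_gt0// [e * _]mulrC //.
Unshelve. all: by end_near.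
Qed.

End real_functions.

(** * The shifted right-hand side *)

Section system.
Context {R : realType} {m n : nat} {Omega : set 'cV[R]_n} {d : 'rV[R]_m}
  {v : 'cV[R]_m} {K : 'I_m -> R -> 'cV[R]_n -> R}
  {g : R -> 'cV[R]_n -> 'cV[R]_m -> 'cV[R]_m} {T : R}.
Hypothesis H : standing Omega d v K g T.
Implicit Types (u w : R -> 'cV[R]_n -> 'cV[R]_m) (x y : 'cV[R]_n) (t s : R).
Local Notation M := (box 0 v).
Local Notation Oc := (closure Omega).
Local Notation J := (fun t x a => jacobian_u g t x a).

Local Notation mu := (lebesgue_n n).
Local Notation nlO := (@nl R m n Omega K).
Local Notation dS := (@dsum R m d).

(* Constants as in [reaction_constants]. *)
Variables (C b0 : R) (beta : R -> 'cV[R]_n -> 'cV[R]_m -> 'I_m -> 'I_m -> R).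
Hypotheses (C0 : 0 < C)
  (HC : forall t x (a : 'cV[R]_m) i k, Oc x -> M a -> `|J t x a i k| <= C)
  (beta_irr : forall t x b, Oc x -> M b -> irreducible_at b0 (beta t x b))
  (beta_low : forall t x b (p : 'cV[R]_m) i, Oc x -> M b -> (forall k, 0 <= p k 0) -> M (b + p) ->
    - (C * p i 0) + \sum_(k | k != i) beta t x b i k * p k 0 <=
      g t x (b + p) i 0 - g t x b i 0).
Local Notation cc := (C + dS).

Let cc0 : 0 < cc. Proof. by rewrite ltr_pwDl// (dsum_ge0 H). Qed.

Lemma vM : M v.
Proof. by apply: M_intro => // k; exact: ltW (st_v H k). Qed.

Lemma g_quasi_mono t x (a b : 'cV[R]_m) i : Oc x -> M a -> M b -> (forall k, a k 0 <= b k 0) ->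
  g t x a i 0 + C * a i 0 <= g t x b i 0 + C * b i 0.
Proof.
move=> xO Ma Mb ab; pose p := b - a.
have p0 k : 0 <= p k 0 by rewrite !mxE subr_ge0.
have bE : b = a + p by rewrite /p addrC subrK.
have Mp : M (a + p) by rewrite -bE.
have := beta_low t i xO Ma p0 Mp; rewrite -bE.
have : 0 <= \sum_(k | k != i) beta t x a i k * p k 0.
  apply: sumr_ge0 => k ki; rewrite mulr_ge0//; have [h _] := beta_irr t xO Ma.
  by apply: h; rewrite eq_sym.
rewrite (_ : p i 0 = b i 0 - a i 0); last by rewrite !mxE.
move: (\sum_(k | _) _) (g t x a i 0) (g t x b i 0) (a i 0) (b i 0) => S ga gb a1 b1; lra.
Qed.

(** The right-hand side plus (C + sum d) u, which is nondecreasing in u on the box;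
    C bounds the Jacobian. *)
Definition shifted u t x i : R :=
  d 0 i * nlO i t x (fun y => u t y i 0) + (cc - d 0 i) * u t x i 0 + g t x (u t x) i 0.

Lemma shifted_mono u w t x i : (forall y, Oc y -> M (u t y)) -> (forall y, Oc y -> M (w t y)) ->
  (forall y k, Oc y -> u t y k 0 <= w t y k 0) -> Oc x -> shifted u t x i <= shifted w t x i.
Proof.
move=> Mu Mw uw xO; rewrite /shifted.
have h1 : nlO i t x (fun y => u t y i 0) <= nlO i t x (fun y => w t y i 0).
  apply: (@nl_le _ _ _ _ _ _ _ _ _ H i t x _ _ (v i 0)) => // y yO; have yO' := subset_closure yO.
    by rewrite (M_ge0 (Mu y yO'))/= uw.
  exact: M_le (Mw y yO') i.
have dk : 0 < d 0 i := st_d H i.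
have h2 : d 0 i * nlO i t x (fun y => u t y i 0) <= d 0 i * nlO i t x (fun y => w t y i 0) by rewrite ler_pM2l.
have h3 := g_quasi_mono t i xO (Mu x xO) (Mw x xO) (fun k => uw x k xO).
have h4 : (dS - d 0 i) * u t x i 0 <= (dS - d 0 i) * w t x i 0.
  by rewrite ler_wpM2l ?uw// subr_ge0; exact: d_le_dsum H i.
move: h2 h3 h4; clear h1; move: (nlO _ _ _ _) (nlO _ _ _ _) (g _ _ _ _ _) (g _ _ _ _ _) (u t x i 0) (w t x i 0) (dS) => q1 q2 q3 q4 q5 q6 q7; lra.
Qed.

Lemma shifted_rhs u t x i : shifted u t x i = rhs Omega d K g t (u t) x i 0 + cc * u t x i 0.
Proof. rewrite /shifted rhsE; move: (nlO _ _ _ _) => q; ring. Qed.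

Lemma shifted_ge0 u t x i : (forall y, Oc y -> M (u t y)) -> Oc x -> 0 <= shifted u t x i.
Proof.
move=> Mu xO; apply: le_trans (_ : shifted (fun _ _ => 0) t x i <= _).
  rewrite /shifted (st_g_zero H)// mxE mulr0 !addr0 mulr_ge0 ?(ltW (st_d H i))//.
  exact: (nl_ge0 H).
apply: shifted_mono => // [y yO|y k yO]; first exact: M0 H.
by rewrite /= mxE (M_ge0 (Mu y yO)).
Qed.

(** The constant v is a supersolution. *)
Lemma shifted_le_v u t x i : (forall y, Oc y -> M (u t y)) -> Oc x -> shifted u t x i <= cc * v i 0.
Proof.
move=> Mu xO; apply: (@le_trans _ _ (shifted (fun _ _ => v) t x i)).
  apply: shifted_mono => // [y yO|y k yO]; first exact: vM.
  exact: M_le (Mu y yO) k.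
rewrite /shifted; have h1 : nlO i t x (fun=> v i 0) <= v i 0 by apply: (nl_cst H) => //; exact: ltW (st_v H i).
have h2 : g t x v i 0 <= 0 by apply: (st_g_upper H) => //; apply/order_boxE; exact: vM.
have : d 0 i * nlO i t x (fun=> v i 0) <= d 0 i * v i 0 by rewrite ler_pM2l// (st_d H).
move: h2; clear h1; move: (nlO _ _ _ _) => q1; lra.
Qed.

Lemma shiftedT u t x i : periodic_in_time Omega T u -> Oc x -> shifted u (t + T) x i = shifted u t x i.
Proof.
move=> uT xO; rewrite /shifted uT// (gT H)//; congr (_ * _ + _ + _).
apply: eq_Rintegral => y; rewrite inE => yO; rewrite (st_K_per H) uT//; exact: subset_closure.
Qed.

Let lam : R := \int[mu]_(z in Omega) 1.

Let lam0 : 0 <= lam.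
Proof. by apply: Rintegral_ge0. Qed.

Lemma nl_close i t s x y f h (e : R) : Oc x -> Oc y -> bounded_meas Omega f -> bounded_meas Omega h ->
  (forall z, Omega z -> `|K i t (x - z) * f z - K i s (y - z) * h z| <= e) ->
  `|nlO i t x f - nlO i s y h| <= e * lam.
Proof.
have mO := Omega_measurable H; have fO := Omega_finite H.
suff key t1 s1 x1 y1 f1 h1 : Oc x1 -> Oc y1 -> bounded_meas Omega f1 -> bounded_meas Omega h1 ->
    (forall z, Omega z -> K i t1 (x1 - z) * f1 z <= K i s1 (y1 - z) * h1 z + e) ->
    nlO i t1 x1 f1 <= nlO i s1 y1 h1 + e * lam.
  move=> xO yO bf bh Hz.
  have h1 : nlO i t x f <= nlO i s y h + e * lam.
    apply: key => // z zO.
    by have := Hz z zO; rewrite ler_norml => /andP[]; move: (K i t _ * _) (K i s _ * _) => a b; lra.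
  have h2 : nlO i s y h <= nlO i t x f + e * lam.
    apply: key => // z zO.
    by have := Hz z zO; rewrite ler_norml => /andP[]; move: (K i t _ * _) (K i s _ * _) => a b; lra.
  by move: h1 h2; rewrite ler_norml; move: (nlO _ _ _ _) (nlO _ _ _ _) => a b; lra.
move=> xO yO bf bh Hz.
have bK := Kf_bounded_meas H i s1 yO bh.
have be : bounded_meas Omega (fun=> e) := bounded_meas_cst Omega e.
have -> : e * lam = \int[mu]_(z in Omega) e.
  rewrite /lam -RintegralZl//; first by apply: eq_Rintegral => z _; rewrite mulr1.
  by apply: bounded_meas_integrable => //; exact: bounded_meas_cst.
rewrite /nl -RintegralD//; last 2 first.
- exact: bounded_meas_integrable.
- exact: bounded_meas_integrable.
apply: le_Rintegral => //.
- by apply: bounded_meas_integrable => //; exact: (Kf_bounded_meas H).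
- by apply: bounded_meas_integrable => //; exact: bounded_measD.
Qed.

Lemma nl_modulus (V e : R) : 0 <= V -> 0 < e -> exists2 q : R, 0 < q &
  forall i t s x y f h, Oc x -> Oc y -> bounded_meas Omega f -> bounded_meas Omega h ->
  `|t - s| < q -> ball x q y -> (forall z, Omega z -> `|h z| <= V) ->
  (forall z, Omega z -> `|f z - h z| <= q) ->
  `|nlO i t x f - nlO i s y h| <= e.
Proof.
move=> V0 e0; have [B B0 HB] := K_bound H.
have l1 : 0 < lam + 1 by rewrite ltr_wpDl.
have e10 : 0 < e / (2 * (V + 1) * (lam + 1)) by rewrite divr_gt0// !mulr_gt0// ltr_wpDl.
have [q1 q10 Hq] := K_modulus H e10.
have q20 : 0 < e / (2 * B * (lam + 1)) by rewrite divr_gt0// !mulr_gt0.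
exists (Num.min q1 (e / (2 * B * (lam + 1)))); first by rewrite lt_min q10.
move=> i t s x y f h xO yO bf bh; rewrite lt_min => /andP[ts _] xy hV fh.
have xy' : ball x q1 y by apply: le_ball xy; rewrite ge_min lexx.
have el : e / (lam + 1) * lam <= e.
  by rewrite mulrAC ler_pdivrMr// ler_pM2l// lerDl.
apply: le_trans el; apply: nl_close => // z zO; have zO' := subset_closure zO.
have -> : K i t (x - z) * f z - K i s (y - z) * h z =
  (K i t (x - z) - K i s (y - z)) * h z + K i t (x - z) * (f z - h z) by ring.
apply: (le_trans (ler_normD _ _)); rewrite !normrM.
have h1 : `|K i t (x - z) - K i s (y - z)| * `|h z| <= e / (2 * (V + 1) * (lam + 1)) * (V + 1).
  apply: ler_pM => //; first exact/ltW/Hq.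
  by apply: le_trans (hV z zO) _; rewrite lerDl.
have h2 : `|K i t (x - z)| * `|f z - h z| <= B * (e / (2 * B * (lam + 1))).
  apply: ler_pM => //; first by rewrite ger0_norm ?(st_K_ge0 H)// HB.
  by apply: (le_trans (fh z zO)); rewrite ge_min lexx orbT.
apply: (le_trans (lerD h1 h2)); rewrite le_eqVlt; apply/orP; left; apply/eqP.
have V1 : V + 1 != 0 by rewrite gt_eqF// ltr_wpDl.
have l2 : lam + 1 != 0 by rewrite gt_eqF.
by field; rewrite l2 V1 gt_eqF.
Qed.

(** A common modulus for all functions with values in the box: it yields the
    continuity of one iterate in (t,x) and the equicontinuity in t of all of
    them. *)
Lemma shifted_modulus e : 0 < e -> exists2 q : R, 0 < q &
  forall u w t s x y i, Oc x -> Oc y -> (forall z, Oc z -> M (u t z)) -> (forall z, Oc z -> M (w s z)) ->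
  (forall k, bounded_meas Omega (fun z => u t z k 0)) -> (forall k, bounded_meas Omega (fun z => w s z k 0)) ->
  `|t - s| < q -> ball x q y -> (forall z k, Omega z -> `|u t z k 0 - w s z k 0| <= q) ->
  (forall k, `|u t x k 0 - w s y k 0| <= q) ->
  `|shifted u t x i - shifted w s y i| <= e.
Proof.
move=> e0; have D0 := @dsum_ge0 _ _ _ _ _ _ _ _ _ H.
have m0 : 0 <= m%:R :> R by [].
have V0 : 0 <= @vsum _ _ v := vsum_ge0 H.
have e10 : 0 < e / (3 * (dS + 1)) by rewrite divr_gt0// mulr_gt0// ltr_wpDl.
have [q1 q10 H1] := nl_modulus V0 e10.
have e30 : 0 < e / 3 by rewrite divr_gt0.
have [q2 q20 H2] := g_modulus H e30.
pose q3 := e / (3 * (cc + C * m%:R)).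
have q3d : 0 < cc + C * m%:R by rewrite ltr_wpDr// mulr_ge0// ltW.
have q30 : 0 < q3 by rewrite /q3 divr_gt0// mulr_gt0.
exists (Num.min q1 (Num.min q2 q3)); first by rewrite !lt_min q10 q20 q30.
move=> u w t s x y i xO yO Mu Mw bu bw; rewrite !lt_min => /and3P[ts1 ts2 _] xy uw uwx.
have xy1 : ball x q1 y by apply: le_ball xy; rewrite ge_min lexx.
have xy2 : ball x q2 y by apply: le_ball xy; rewrite !ge_min lexx orbT.
have uwx3 k : `|u t x k 0 - w s y k 0| <= q3 by apply: (le_trans (uwx k)); rewrite !ge_min lexx !orbT.
have n1 : `|nlO i t x (fun z => u t z i 0) - nlO i s y (fun z => w s z i 0)| <= e / (3 * (dS + 1)).
  apply: H1 => // z zO.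
    have zO' := subset_closure zO.
    rewrite ger0_norm ?(M_ge0 (Mw z zO'))//; apply: (le_trans (M_le (Mw z zO') i)); exact: v_le_vsum H i.
  by apply: (le_trans (uw z i zO)); rewrite ge_min lexx.
have n2 : `|g t x (u t x) i 0 - g s y (u t x) i 0| < e / 3 by apply: H2 => //; exact: Mu.
have n3 : `|g s y (u t x) i 0 - g s y (w s y) i 0| <= C * m%:R * q3.
  rewrite distrC; apply: le_trans (g_lipschitz H s i HC yO (Mu x xO) (Mw y yO)) _.
  rewrite -mulrA ler_pM2l//; apply: (@le_trans _ _ (\sum_(j < m) q3)).
    by apply: ler_sum => k _; rewrite distrC.
  by rewrite sumr_const card_ord -[X in X <= _]mulr_natl.
have dk : 0 < d 0 i := st_d H i.
have dkD := @d_le_dsum _ _ _ _ _ _ _ _ _ H i.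
have dkc : d 0 i <= cc by apply: (le_trans dkD); rewrite lerDr ltW.
have n4 : d 0 i * `|nlO i t x (fun z => u t z i 0) - nlO i s y (fun z => w s z i 0)| <= e / 3.
  apply: (@le_trans _ _ ((dS + 1) * (e / (3 * (dS + 1))))).
    by apply: ler_pM => //; [exact: ltW|lra].
  rewrite le_eqVlt; apply/orP; left; apply/eqP; field; rewrite gt_eqF//; lra.
have n5 : (cc - d 0 i) * `|u t x i 0 - w s y i 0| <= cc * q3.
  by apply: ler_pM => //; [rewrite subr_ge0|rewrite gerBl ltW].
have n6 : cc * q3 + C * m%:R * q3 = e / 3.
  rewrite -mulrDl /q3; field; exact: lt0r_neq0.
have -> : shifted u t x i - shifted w s y i =
  d 0 i * (nlO i t x (fun z => u t z i 0) - nlO i s y (fun z => w s z i 0)) +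
  (cc - d 0 i) * (u t x i 0 - w s y i 0) +
  ((g t x (u t x) i 0 - g s y (u t x) i 0) + (g s y (u t x) i 0 - g s y (w s y) i 0)).
  rewrite /shifted; move: (nlO _ _ _ _) (nlO _ _ _ _) => a b; ring.
apply: (le_trans (ler_normD _ _)); apply: (le_trans (lerD (ler_normD _ _) (ler_normD _ _))).
rewrite !normrM (ger0_norm (ltW dk)) (ger0_norm (x := cc - d 0 i)); last by rewrite subr_ge0.
apply: (le_trans (lerD (lerD n4 n5) (lerD (ltW n2) n3))).
move: n6; move: (cc * q3) (C * m%:R * q3) => f1 f2 n6.
have -> : e / 3 + f1 + (e / 3 + f2) = 2 * (e / 3) + (f1 + f2) by ring.
by rewrite n6 le_eqVlt; apply/orP; left; apply/eqP; field.
Qed.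

End system.

(** * Monotone iteration *)

Lemma periodic_compare {R : realType} (T c e : R) (f1 f2 U1 U2 : R -> R) : 0 < T -> 0 < c ->
  (forall t, U1 (t + T) = U1 t) -> (forall t, U2 (t + T) = U2 t) ->
  (forall t : R, is_derive t 1 U1 (f1 t - c * U1 t)) ->
  (forall t : R, is_derive t 1 U2 (f2 t - c * U2 t)) ->
  (forall t, f1 t <= f2 t + c * e) -> forall t, U1 t <= U2 t + e.
Proof.
move=> T0 c0 p1 p2 d1 d2 f12 t.
have dd (s : R) : is_derive s 1 (fun s => U2 s - U1 s) (f2 s - c * U2 s - (f1 s - c * U1 s)).
  by have ? := d1 s; have ? := d2 s; exact: is_deriveB.
have pp s : U2 (s + T) - U1 (s + T) = U2 s - U1 s by rewrite p1 p2.
have := @periodic_lower R T _ _ c (- (c * e)) T0 c0 pp dd _ t.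
rewrite mulNr mulrAC divff ?mul1r ?gt_eqF// => h.
have : - e <= U2 t - U1 t by apply: h => s; have := f12 s; lra.
lra.
Qed.

Section system.
Context {R : realType} {m n : nat} {Omega : set 'cV[R]_n} {d : 'rV[R]_m}
  {v : 'cV[R]_m} {K : 'I_m -> R -> 'cV[R]_n -> R}
  {g : R -> 'cV[R]_n -> 'cV[R]_m -> 'cV[R]_m} {T : R}.
Hypothesis H : standing Omega d v K g T.
Implicit Types (u w : R -> 'cV[R]_n -> 'cV[R]_m) (x y : 'cV[R]_n) (t s : R).
Local Notation M := (box 0 v).
Local Notation Oc := (closure Omega).
Local Notation J := (fun t x a => jacobian_u g t x a).
Let T0 : 0 < T := st_T H.

Local Notation dS := (@dsum R m d).

(* Constants as in [reaction_constants]. *)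
Variables (C b0 : R) (beta : R -> 'cV[R]_n -> 'cV[R]_m -> 'I_m -> 'I_m -> R).
Hypotheses (C0 : 0 < C)
  (HC : forall t x (a : 'cV[R]_m) i k, Oc x -> M a -> `|J t x a i k| <= C)
  (beta_irr : forall t x b, Oc x -> M b -> irreducible_at b0 (beta t x b))
  (beta_low : forall t x b (p : 'cV[R]_m) i, Oc x -> M b -> (forall k, 0 <= p k 0) -> M (b + p) ->
    - (C * p i 0) + \sum_(k | k != i) beta t x b i k * p k 0 <=
      g t x (b + p) i 0 - g t x b i 0).
Local Notation cc := (C + dS).

Let cc0 : 0 < cc. Proof. by rewrite ltr_pwDl// (dsum_ge0 H). Qed.

Local Notation V := (@vsum _ _ v).
Local Notation F := (@shifted R m n Omega d K g C).

(** The class preserved by the iteration. Uniform continuity makes the slices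
    measurable and the next right-hand side continuous in t. *)
Definition good w :=
  [/\ forall t x, Oc x -> M (w t x), periodic_in_time Omega T w &
    forall e, 0 < e -> exists2 q : R, 0 < q & forall t s x y i, Oc x -> Oc y -> `|t - s| < q ->
      ball x q y -> `|w t x i 0 - w s y i 0| <= e].

Definition next w w' := forall t x i, Oc x ->
  is_derive t 1 (fun s => w' s x i 0) (F w t x i - cc * w' t x i 0).

Lemma good_meas w t i : good w -> bounded_meas Omega (fun z => w t z i 0).
Proof.
move=> [Mw _ cw]; split.
  apply: cont_on_measurable_cV; first exact: (Omega_measurable H).
  move=> x xO e e0; have e20 : 0 < e / 2 by rewrite divr_gt0.
  have [q q0 Hq] := cw _ e20; exists q => // y yO xy.
  apply: (@le_lt_trans _ _ (e / 2)); last by lra.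
  by apply: Hq => //; [exact: subset_closure|exact: subset_closure|rewrite subrr normr0].
exists V => z zO; have Mz := Mw t z (subset_closure zO).
by rewrite ger0_norm ?(M_ge0 Mz)//; apply: (le_trans (M_le Mz i)); exact: v_le_vsum H i.
Qed.

Lemma good_shifted w : good w -> forall e, 0 < e -> exists2 q : R, 0 < q & forall t s x y i, Oc x -> Oc y ->
  `|t - s| < q -> ball x q y -> `|F w t x i - F w s y i| <= e.
Proof.
move=> gw e e0; have [q q0 Hq] := shifted_modulus H C0 HC e0.
have [Mw _ cw] := gw; have [q' q'0 Hq'] := cw q q0.
exists (Num.min q q'); first by rewrite lt_min q0.
move=> t s x y i xO yO; rewrite lt_min => /andP[ts ts'] xy.
have xyq : ball x q y by apply: le_ball xy; rewrite ge_min lexx.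
have xyq' : ball x q' y by apply: le_ball xy; rewrite ge_min lexx orbT.
apply: Hq => //; try by move=> *; exact: Mw.
- by move=> k; exact: good_meas.
- by move=> k; exact: good_meas.
- by move=> z k zO; have zO' := subset_closure zO; apply: Hq' => //; exact: ballxx.
- by move=> k; exact: Hq'.
Qed.

Lemma slope_bound w w' t x i : (forall t x, Oc x -> M (w t x)) -> Oc x -> M (w' t x) ->
  `|F w t x i - cc * w' t x i 0| <= cc * V.
Proof.
move=> Mw xO Mx.
have h1 := shifted_ge0 H beta_irr beta_low i (fun y yO => Mw t y yO) xO.
have h2 := shifted_le_v H beta_irr beta_low i (fun y yO => Mw t y yO) xO.
have h3 : cc * v i 0 <= cc * V by rewrite ler_pM2l//; exact: v_le_vsum H i.
have h4 : 0 <= cc * w' t x i 0 by rewrite mulr_ge0 ?(ltW cc0)// (M_ge0 Mx).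
have h5 : cc * w' t x i 0 <= cc * v i 0 by rewrite ler_pM2l//; exact: M_le Mx i.
move: (F w t x i) (cc * w' t x i 0) (cc * V) (cc * v i 0) h1 h2 h3 h4 h5 => a b c' e'.
rewrite ler_norml; lra.
Qed.

Lemma next_lip w w' : (forall t x, Oc x -> M (w t x)) -> next w w' -> (forall t x, Oc x -> M (w' t x)) ->
  forall t s x i, Oc x -> `|w' t x i 0 - w' s x i 0| <= cc * V * `|t - s|.
Proof.
move=> gw nw Mw' t s x i xO.
have [q [_ _ ->]] := mvt_between s t (fun q => nw q x i xO).
by rewrite normrM ler_wpM2r//; apply: slope_bound => //; exact: Mw'.
Qed.

(** At each x the iterate solves a scalar periodic equation; its modulus in x is
    that of the right-hand side divided by the rate, its modulus in t follows from the
    bound on the slope. *)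
Lemma step w : good w -> exists w', good w' /\ next w w'.
Proof.
move=> gw; have [Mw wT cw] := gw.
have [U HU] : exists U : 'cV[R]_n * 'I_m -> R -> R, forall p, Oc p.1 ->
    (forall t, U p (t + T) = U p t) /\ forall t : R, is_derive t 1 (U p) (F w t p.1 p.2 - cc * U p t).
  suff : forall p : 'cV[R]_n * 'I_m, exists U : R -> R, Oc p.1 ->
    (forall t, U (t + T) = U t) /\ forall t : R, is_derive t 1 U (F w t p.1 p.2 - cc * U t).
    by move=> /choice[U HU]; exists U => p; exact: HU.
  move=> [x i]; have [xO|nO] := pselect (Oc x); last by exists (fun=> 0).
  have [|U HU] := @periodic_linear_solution R (fun t => F w t x i) cc T _ cc0 T0 (fun t => shiftedT H C t i wT xO).
    move=> t; apply/cvgrPdist_le => e e0; have [q q0 Hq] := good_shifted gw e0.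
    by apply/nbhs_ballP; exists q => //= s ts; apply: Hq => //; exact: ballxx.
  by exists U.
pose w' t x : 'cV[R]_m := \col_i U (x, i) t.
have wE t x i : w' t x i 0 = U (x, i) t by rewrite mxE.
have nw : next w w'.
  move=> t x i xO; have [_ /(_ t)] := HU (x, i) xO; rewrite wE /=.
  by under [X in _ -> is_derive _ _ X _]eq_fun do rewrite wE.
have M' t x : Oc x -> M (w' t x).
  move=> xO; apply: M_intro => i; rewrite wE; have [pU dU] := HU (x, i) xO.
    have d0 (s : R) : is_derive s 1 (fun _ : R => 0 : R) (0 - cc * 0).
      by rewrite mulr0 subrr; exact: is_derive_cst.
    have := @periodic_compare R T cc 0 (fun=> 0) _ (fun=> 0) _ T0 cc0 (fun _ => erefl) pU d0 dU _ t; rewrite addr0; apply=> s.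
    by rewrite mulr0 addr0; exact: (shifted_ge0 H beta_irr beta_low i (fun y yO => Mw s y yO) xO).
  have dv (s : R) : is_derive s 1 (fun _ : R => v i 0) (cc * v i 0 - cc * v i 0).
    by rewrite subrr; exact: is_derive_cst.
  have := @periodic_compare R T cc 0 _ (fun=> cc * v i 0) _ (fun=> v i 0) T0 cc0 pU (fun _ => erefl) dU dv _ t; rewrite addr0; apply=> s.
  by rewrite mulr0 addr0; exact: (shifted_le_v H beta_irr beta_low i (fun y yO => Mw s y yO) xO).
exists w'; split=> //; split=> //.
  by move=> t x xO; apply/colP => i; rewrite !wE; have [-> _] := HU (x, i) xO.
move=> e e0; have e10 : 0 < cc * (e / 2) by rewrite mulr_gt0// divr_gt0.
have [q q0 Hq] := good_shifted gw e10.
have L0 : 0 < cc * V + 1 by rewrite ltr_wpDl// mulr_ge0 ?(ltW cc0)// (vsum_ge0 H).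
exists (Num.min q (e / (2 * (cc * V + 1)))).
  by rewrite lt_min q0 divr_gt0// mulr_gt0.
move=> t s x y i xO yO; rewrite lt_min => /andP[_ ts2] xy.
have xyq : ball x q y by apply: le_ball xy; rewrite ge_min lexx.
have h1 : `|w' t x i 0 - w' s x i 0| <= e / 2.
  apply: (le_trans (next_lip Mw nw M' t s i xO)).
  apply: (@le_trans _ _ ((cc * V + 1) * (e / (2 * (cc * V + 1))))).
    by apply: ler_pM => //; [rewrite mulr_ge0 ?(ltW cc0)// (vsum_ge0 H)|rewrite lerDl|exact: ltW].
  by rewrite le_eqVlt; apply/orP; left; apply/eqP; field; rewrite gt_eqF.
have h2 : `|w' s x i 0 - w' s y i 0| <= e / 2.
  rewrite !wE; have [pU dU] := HU (x, i) xO; have [pU' dU'] := HU (y, i) yO.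
  have c1 r : `|F w r x i - F w r y i| <= cc * (e / 2) by apply: Hq => //; rewrite subrr normr0.
  have A := periodic_compare (e := e / 2) T0 cc0 pU pU' dU dU' _ s.
  have B := periodic_compare (e := e / 2) T0 cc0 pU' pU dU' dU _ s.
  rewrite ler_norml; apply/andP; split.
    rewrite lerBrDl lerBlDr; apply: B => r.
    have := c1 r; rewrite ler_norml => /andP[]; move: (F w r x i) (F w r y i) => a b /=; lra.
  rewrite lerBlDl; apply: A => r.
  have := c1 r; rewrite ler_norml => /andP[]; move: (F w r x i) (F w r y i) => a b /=; lra.
apply: (le_trans (ler_distD (w' s x i 0) _ _)); apply: (le_trans (lerD h1 h2)); lra.
Qed.

Lemma iteration : exists W : nat -> R -> 'cV[R]_n -> 'cV[R]_m,
  [/\ W 0%N = (fun _ _ => v), forall k, good (W k) & forall k, next (W k) (W k.+1)].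
Proof.
have [nx Hnx] : exists nx : (R -> 'cV[R]_n -> 'cV[R]_m) -> R -> 'cV[R]_n -> 'cV[R]_m,
    forall w, good w -> good (nx w) /\ next w (nx w).
  suff : forall w, exists w', good w -> good w' /\ next w w' by move=> /choice[nx Hnx]; exists nx => w; exact: Hnx.
  move=> w; have [gw|ngw] := pselect (good w); last by exists w.
  by have [w' Hw'] := step gw; exists w'.
have gv : good (fun _ _ => v).
  split=> [t x xO|t x xO|e e0] //; first exact: vM H.
  by exists 1 => // *; rewrite subrr normr0 ltW.
exists (fun k => iter k nx (fun _ _ => v)).
have gW k : good (iter k nx (fun _ _ => v)).
  by elim: k => //= k IH; have [] := Hnx _ IH.
by split=> // k /=; have [] := Hnx _ (gW k).
Qed.

End system.

(** * The maximal solution *)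

Lemma cvg_finite_sum {R : realType} (I : Type) (s : seq I) (f : I -> nat -> R) (l : I -> R) :
  (forall i, f i @ \oo --> l i) -> (fun k => \sum_(i <- s) f i k) @ \oo --> \sum_(i <- s) l i.
Proof.
move=> fl; elim: s => [|i s IH].
  by rewrite big_nil; under eq_fun do rewrite big_nil; exact: cvg_cst.
by rewrite big_cons; under eq_fun do rewrite big_cons; exact: cvgD.
Qed.
Section system.
Context {R : realType} {m n : nat} {Omega : set 'cV[R]_n} {d : 'rV[R]_m}
  {v : 'cV[R]_m} {K : 'I_m -> R -> 'cV[R]_n -> R}
  {g : R -> 'cV[R]_n -> 'cV[R]_m -> 'cV[R]_m} {T : R}.
Hypothesis H : standing Omega d v K g T.
Implicit Types (u w : R -> 'cV[R]_n -> 'cV[R]_m) (x y : 'cV[R]_n) (t s : R).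
Local Notation M := (box 0 v).
Local Notation Oc := (closure Omega).
Local Notation J := (fun t x a => jacobian_u g t x a).
Let T0 : 0 < T := st_T H.

Local Notation nlO := (@nl R m n Omega K).
Local Notation dS := (@dsum R m d).

(* Constants as in [reaction_constants]. *)
Variables (C b0 : R) (beta : R -> 'cV[R]_n -> 'cV[R]_m -> 'I_m -> 'I_m -> R).
Hypotheses (C0 : 0 < C)
  (HC : forall t x (a : 'cV[R]_m) i k, Oc x -> M a -> `|J t x a i k| <= C)
  (beta_irr : forall t x b, Oc x -> M b -> irreducible_at b0 (beta t x b))
  (beta_low : forall t x b (p : 'cV[R]_m) i, Oc x -> M b -> (forall k, 0 <= p k 0) -> M (b + p) ->
    - (C * p i 0) + \sum_(k | k != i) beta t x b i k * p k 0 <=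
      g t x (b + p) i 0 - g t x b i 0).
Local Notation cc := (C + dS).

Let cc0 : 0 < cc. Proof. by rewrite ltr_pwDl// (dsum_ge0 H). Qed.

Local Notation V := (@vsum _ _ v).
Local Notation F := (@shifted R m n Omega d K g C).
Local Notation good := (@good R m n Omega v T).
Local Notation next := (@next R m n Omega d K g C).

(** The last condition is the subsolution inequality in the monotone form of the
    iteration; it quantifies over all w above q, so the nonlocal term of q itself does
    not enter. *)
Definition returning_subsolution a b (q q' : R -> 'cV[R]_n -> 'cV[R]_m) :=
  [/\ forall x i, Oc x -> traj a b (fun t => q t x i 0) (fun t => q' t x i 0),
    forall t x i, a <= t <= b -> Oc x -> q t x i 0 <= v i 0,
    forall x i, Oc x -> q a x i 0 <= q b x i 0 &
    forall w t x i, (forall y, Oc y -> M (w t y)) ->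
      (forall y k, Oc y -> q t y k 0 <= w t y k 0) -> a < t < b -> Oc x ->
      q' t x i 0 + cc * q t x i 0 <= F w t x i].

Section limit.
Variable W : nat -> R -> 'cV[R]_n -> 'cV[R]_m.
Hypotheses (W0 : W 0%N = fun _ _ => v) (gW : forall k, good (W k)) (nW : forall k, next (W k) (W k.+1)).

Let MW k t x : Oc x -> M (W k t x). Proof. by have [h _ _] := gW k; exact: h. Qed.
Let WT k t x : Oc x -> W k (t + T) x = W k t x. Proof. by have [_ h _] := gW k; exact: h. Qed.
Let WTi k i x : Oc x -> forall t, W k (t + T) x i 0 = W k t x i 0. Proof. by move=> xO t; rewrite WT. Qed.

Lemma W_below k t x i u : (forall t x, Oc x -> M (u t x)) -> solves_P Omega d K g T u ->
  Oc x -> u t x i 0 <= W k t x i 0.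
Proof.
move=> Mu su; elim: k t x i => [|k IH] t x i xO; first by rewrite W0; exact: M_le (Mu t x xO) i.
have du (s : R) : is_derive s 1 (fun s => u s x i 0) (F u s x i - cc * u s x i 0).
  by rewrite shifted_rhs addrK rhsE; exact: (solves_comp s i su xO).
have uT s : u (s + T) x i 0 = u s x i 0 by rewrite su.1.
have := periodic_compare (e := 0) T0 cc0 uT (WTi k.+1 i xO) du (fun s => nW k s i xO) _ t.
rewrite addr0; apply=> s; rewrite mulr0 addr0.
apply: (shifted_mono H beta_irr beta_low) => // [y yO|y yO|y l yO]; [exact: Mu|exact: MW|exact: IH].
Qed.

Lemma W_decr k t x i : Oc x -> W k.+1 t x i 0 <= W k t x i 0.
Proof.
elim: k t x i => [|k IH] t x i xO; first by rewrite [in leRHS]W0; exact: M_le (MW _ _ xO) i.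
have := periodic_compare (e := 0) T0 cc0 (WTi k.+2 i xO) (WTi k.+1 i xO) (fun s => nW k.+1 s i xO) (fun s => nW k s i xO) _ t.
rewrite addr0; apply=> s; rewrite mulr0 addr0.
apply: (shifted_mono H beta_irr beta_low) => // [y yO|y yO|y l yO]; [exact: MW|exact: MW|exact: IH].
Qed.

(** Over a whole number of periods W_(k+1) returns to its initial value while q
    returns above its own, so W_(k+1) - q at the start is at least a contracted copy of
    itself, hence nonnegative. *)
Lemma W_lift a b q q' k : a < b -> (exists N : nat, b = a + N%:R * T) -> returning_subsolution a b q q' ->
  forall t x i, a <= t <= b -> Oc x -> q t x i 0 <= W k t x i 0.
Proof.
move=> ab [N bE] [tq qv qab qF]; elim: k => [|k IH] t x i tab xO; first by rewrite W0; exact: qv.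
have WN : W k.+1 b x i 0 = W k.+1 a x i 0.
  by rewrite bE; elim: (N) => [|l IHl]; rewrite ?mul0r ?addr0// -natr1 mulrDl mul1r addrA WTi.
have tp : traj a b (fun s => W k.+1 s x i 0 + (-1) * q s x i 0) (fun s => F (W k) s x i - cc * W k.+1 s x i 0 + (-1) * q' s x i 0).
  by apply: traj_lin; [apply: derive_traj => s _; exact: nW|exact: tq].
have pF s : a < s < b -> 0 <= F (W k) s x i - cc * W k.+1 s x i 0 + (-1) * q' s x i 0 + cc * (W k.+1 s x i 0 + (-1) * q s x i 0).
  move=> sab; have sab' : a <= s <= b by case/andP: sab => /ltW-> /ltW->.
  have : q' s x i 0 + cc * q s x i 0 <= F (W k) s x i.
    by apply: qF => // [y yO|y l yO]; [exact: MW|exact: IH].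
  rewrite -subr_ge0; move: (F (W k) s x i) (q' s x i 0) (q s x i 0) (W k.+1 s x i 0) => f f1 f2 f3.
  by have -> : f - cc * f3 + -1 * f1 + cc * (f3 + -1 * f2) = f - (f1 + cc * f2) by ring.
have low s : a <= s <= b -> expR (- (cc * (s - a))) * (W k.+1 a x i 0 + (-1) * q a x i 0) <= W k.+1 s x i 0 + (-1) * q s x i 0.
  move=> /andP[as_ sb].
  have tp' := traj_sub (lexx a) sb tp.
  have := exp_lower as_ cc0 tp' (e := 0) _; rewrite mul0r add0r subr0; apply=> r /andP[ar rs].
  by apply: pF; rewrite ar (lt_le_trans rs).
have := low b; rewrite WN lexx (ltW ab) => /(_ isT) hb.
have ha : 0 <= W k.+1 a x i 0 + (-1) * q a x i 0.
  have e1 : expR (- (cc * (b - a))) < 1 by apply: expR_lt1; rewrite mulr_gt0// subr_gt0.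
  have hP : expR (- (cc * (b - a))) * (W k.+1 a x i 0 + -1 * q a x i 0) <= W k.+1 a x i 0 + -1 * q a x i 0.
    by apply: (le_trans hb); rewrite lerD2l !mulN1r lerN2; exact: qab.
  rewrite -(@pmulr_rge0 _ (1 - expR (- (cc * (b - a))))) ?subr_gt0//.
  by rewrite mulrBl mul1r subr_ge0.
have := low t tab; have : 0 <= expR (- (cc * (t - a))) * (W k.+1 a x i 0 + (-1) * q a x i 0) by rewrite mulr_ge0 ?expR_ge0.
lra.
Qed.

Definition wlim t x : 'cV[R]_m := \col_i lim ((fun k => W k t x i 0) @ \oo).

Lemma W_cvg t x i : Oc x -> (fun k => W k t x i 0) @ \oo --> wlim t x i 0.
Proof.
move=> xO; rewrite mxE; apply: nonincreasing_is_cvgn.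
  by apply/nonincreasing_seqP => k; exact: W_decr.
by exists 0 => _ [k _ <-]; exact: M_ge0 (MW k t xO) i.
Qed.

Lemma wlim_le t x i (a : R) : Oc x -> (forall k, a <= W k t x i 0) -> a <= wlim t x i 0.
Proof. by move=> xO h; apply: (cvgr_to_ge (W_cvg (t := t) (i := i) xO)); near=> k; exact: h. Unshelve. all: by end_near. Qed.

Lemma wlim_M t x : Oc x -> M (wlim t x).
Proof.
move=> xO; apply: M_intro => i; first by apply: wlim_le => // k; exact: M_ge0 (MW k t xO) i.
by apply: (cvgr_to_le (W_cvg (t := t) (i := i) xO)); near=> k; exact: M_le (MW k t xO) i.
Unshelve. all: by end_near.
Qed.

Lemma wlim_T : periodic_in_time Omega T wlim.
Proof. by move=> t x xO; apply/colP => i; rewrite !mxE; under eq_fun do rewrite WT//. Qed.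

Lemma Kw_limit i t x : Oc x -> bounded_meas Omega (fun y => K i t (x - y) * wlim t y i 0) /\
  (fun k => nlO i t x (fun y => W k t y i 0)) @ \oo --> nlO i t x (fun y => wlim t y i 0).
Proof.
move=> xO; have [B B0 HB] := K_bound H.
apply: (@bounded_meas_limit _ _ _ (Omega_measurable H) (Omega_finite H) (fun k y => K i t (x - y) * W k t y i 0) _ (B * V)).
- by move=> k; have [] := Kf_bounded_meas H i t xO (good_meas H t i (gW k)).
- move=> k y yO; have yO' := subset_closure yO; rewrite normrM; apply: ler_pM => //.
    by rewrite ger0_norm ?(st_K_ge0 H)// HB.
  by rewrite ger0_norm ?(M_ge0 (MW k t yO'))//; apply: le_trans (M_le (MW k t yO') i) (v_le_vsum H i).
- by move=> y yO; apply: cvgM; [exact: cvg_cst|exact: W_cvg (subset_closure yO)].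
Qed.

Lemma wlim_meas t i : bounded_meas Omega (fun y => wlim t y i 0).
Proof.
have [k|k y yO|y yO|//] := @bounded_meas_limit _ _ _ (Omega_measurable H) (Omega_finite H)
    (fun k y => W k t y i 0) (fun y => wlim t y i 0) V.
- by have [] := good_meas H t i (gW k).
- have yO' := subset_closure yO.
  by rewrite ger0_norm ?(M_ge0 (MW k t yO'))//; apply: le_trans (M_le (MW k t yO') i) (v_le_vsum H i).
- exact: W_cvg (subset_closure yO).
Qed.

Lemma F_limit t x i : Oc x -> (fun k => F (W k) t x i) @ \oo --> F wlim t x i.
Proof.
move=> xO; apply: cvgD; [apply: cvgD|].
- by apply: cvgM; [exact: cvg_cst|have [] := Kw_limit i t xO].
- by apply: cvgM; [exact: cvg_cst|exact: W_cvg].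
apply/cvgrPdist_le => e e0.
have S0 : (fun k => C * \sum_(j < m) `|wlim t x j 0 - W k t x j 0|) @ \oo --> C * \sum_(j < m) (0 : R).
  apply: cvgM; first exact: cvg_cst.
  apply: (@cvg_finite_sum R 'I_m (index_enum 'I_m) (fun j k => `|wlim t x j 0 - W k t x j 0|) (fun=> 0)) => j.
  rewrite -(normr0 R) -(subrr (wlim t x j 0)).
  by apply: cvg_norm; apply: cvgB; [exact: cvg_cst|exact: W_cvg].
rewrite big1 ?mulr0 // in S0.
near=> k; apply: le_trans (g_lipschitz H t i HC xO (MW k t xO) (wlim_M t xO)) _.
by near: k; apply: (@cvgr_le _ _ _ _ _ 0 S0).
Unshelve. all: by end_near.
Qed.

Lemma W_lip k t s x i : Oc x -> `|W k t x i 0 - W k s x i 0| <= cc * V * `|t - s|.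
Proof.
move=> xO; case: k => [|k].
  by rewrite W0 subrr normr0 !mulr_ge0 ?(ltW cc0)// (vsum_ge0 H).
exact: (next_lip H C0 beta_irr beta_low (fun t x => @MW k t x) (nW k) (fun t x => @MW k.+1 t x) t s i xO).
Qed.

(** The iterates are equi-Lipschitz in t, hence so are, up to a common modulus,
    their derivatives. *)
Lemma wlim_derive t x i : Oc x -> is_derive t 1 (fun s => wlim s x i 0) (F wlim t x i - cc * wlim t x i 0).
Proof.
move=> xO; apply: (@derive_limit R (fun k s => W k.+1 s x i 0) (fun k s => F (W k) s x i - cc * W k.+1 s x i 0)).
- by move=> k s; exact: nW.
- move=> s; have := W_cvg (t := s) (i := i) xO; rewrite -(cvg_shiftS (fun k => W k s x i 0)).
  exact.
- apply: cvgB; first exact: F_limit.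
  apply: cvgM; first exact: cvg_cst.
  by have := W_cvg (t := t) (i := i) xO; rewrite -(cvg_shiftS (fun k => W k t x i 0)).
move=> e e0; have e20 : 0 < e / 2 by rewrite divr_gt0.
have [q q0 Hq] := shifted_modulus H C0 HC e20.
have L0 : 0 <= cc * V by rewrite mulr_ge0 ?(ltW cc0)// (vsum_ge0 H).
have L1 : 0 < cc * V + 1 by rewrite ltr_wpDl.
pose q' := Num.min q (Num.min (q / (cc * V + 1)) (e / (2 * cc * (cc * V + 1)))).
exists q'; first by rewrite !lt_min q0 !divr_gt0 ?mulr_gt0.
move=> k s; rewrite !lt_min => /and3P[s1 s2 s3].
have lipq l y j : Oc y -> `|W l s y j 0 - W l t y j 0| <= q.
  move=> yO; apply: (le_trans (W_lip l s t j yO)).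
  rewrite ltr_pdivlMr// in s2; apply/ltW; apply: le_lt_trans s2.
  by rewrite mulrC ler_wpM2l// lerDl.
have h1 : `|F (W k) s x i - F (W k) t x i| <= e / 2.
  apply: Hq => //; try by move=> *; exact: MW.
  + by move=> l; exact: (good_meas H s l (gW k)).
  + by move=> l; exact: (good_meas H t l (gW k)).
  + exact: ballxx.
  + by move=> z l zO; apply: lipq; exact: subset_closure.
  + by move=> l; exact: lipq.
have h2 : cc * `|W k.+1 s x i 0 - W k.+1 t x i 0| <= e / 2.
  apply: (@le_trans _ _ (cc * ((cc * V + 1) * (e / (2 * cc * (cc * V + 1)))))).
    rewrite ler_pM2l//; apply: (le_trans (W_lip k.+1 s t i xO)).
    by apply: ler_pM => //; [rewrite lerDl|exact: ltW].
  by rewrite le_eqVlt; apply/orP; left; apply/eqP; field; rewrite !gt_eqF.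
have -> : F (W k) s x i - cc * W k.+1 s x i 0 - (F (W k) t x i - cc * W k.+1 t x i 0) =
  (F (W k) s x i - F (W k) t x i) - cc * (W k.+1 s x i 0 - W k.+1 t x i 0).
  by move: (F _ _ _ _) (F _ _ _ _) => f1 f2; ring.
apply: (le_trans (ler_normB _ _)); rewrite [X in _ + X]normrM (gtr0_norm cc0).
apply: (le_trans (lerD h1 h2)); lra.
Qed.

Lemma wlim_solves : solves_P Omega d K g T wlim.
Proof.
split=> [|t x xO]; first exact: wlim_T.
by apply: is_derive_col => i; have := wlim_derive t i xO; rewrite shifted_rhs addrK.
Qed.

End limit.

Lemma maximal_solution : exists w, [/\ forall t x, Oc x -> M (w t x), solves_P Omega d K g T w,
  forall t i, bounded_meas Omega (fun y => w t y i 0),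
  forall u, (forall t x, Oc x -> M (u t x)) -> solves_P Omega d K g T u ->
    forall t x i, Oc x -> u t x i 0 <= w t x i 0 &
  forall a b q q', a < b -> (exists N : nat, b = a + N%:R * T) -> returning_subsolution a b q q' ->
    forall t x i, a <= t <= b -> Oc x -> q t x i 0 <= w t x i 0].
Proof.
have [W [W0 gW nW]] := iteration H C0 HC beta_irr beta_low.
exists (wlim W); split.
- by move=> t x xO; exact: wlim_M.
- exact: wlim_solves.
- by move=> t i; exact: wlim_meas.
- by move=> u Mu su t x i xO; apply: wlim_le => // k; exact: W_below.
- by move=> a b q q' ab bE sub t x i tab xO; apply: wlim_le => // k; exact: (W_lift W0 gW nW k ab bE sub).
Qed.

End system.

(** * Positivity of the maximal solution *)

Section system.
Context {R : realType} {m n : nat} {Omega : set 'cV[R]_n} {d : 'rV[R]_m}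
  {v : 'cV[R]_m} {K : 'I_m -> R -> 'cV[R]_n -> R}
  {g : R -> 'cV[R]_n -> 'cV[R]_m -> 'cV[R]_m} {T : R}.
Hypothesis H : standing Omega d v K g T.
Implicit Types (u w : R -> 'cV[R]_n -> 'cV[R]_m) (x y : 'cV[R]_n) (t s : R).
Local Notation M := (box 0 v).
Local Notation Oc := (closure Omega).
Local Notation J := (fun t x a => jacobian_u g t x a).
Let T0 : 0 < T := st_T H.

Local Notation mu := (lebesgue_n n).
Local Notation nlO := (@nl R m n Omega K).
Local Notation dS := (@dsum R m d).
Local Notation lin := (linear_part Omega d K g).

Variable Phi : R -> R -> ('cV[R]_n -> 'cV[R]_m) -> ('cV[R]_n -> 'cV[R]_m).
Hypothesis evol : is_evolution_family Omega d K g Phi.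

(* Constants as in [reaction_constants], [K_near0] and [d_min]. *)
Variables (C b0 kap0 dm r : R) (beta : R -> 'cV[R]_n -> 'cV[R]_m -> 'I_m -> 'I_m -> R).
Hypotheses (C0 : 0 < C) (b00 : 0 < b0) (kap00 : 0 < kap0) (dm0 : 0 < dm) (r0 : 0 < r)
  (HC : forall t x (a : 'cV[R]_m) i k, Oc x -> M a -> `|J t x a i k| <= C)
  (beta_irr : forall t x b, Oc x -> M b -> irreducible_at b0 (beta t x b))
  (beta_le : forall t x b i k, Oc x -> M b -> i != k -> beta t x b i k <= J t x b i k)
  (beta_low : forall t x b (p : 'cV[R]_m) i, Oc x -> M b -> (forall k, 0 <= p k 0) -> M (b + p) ->
    - (C * p i 0) + \sum_(k | k != i) beta t x b i k * p k 0 <=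
      g t x (b + p) i 0 - g t x b i 0)
  (Kk : forall i t x y, ball x r y -> kap0 <= K i t (x - y)) (dmd : forall i, dm <= d 0 i).

Local Notation cc := (C + dS).
Local Notation kk := (dm * kap0).

Let cc0 : 0 < cc. Proof. by rewrite ltr_pwDl// (dsum_ge0 H). Qed.
Let kk0 : 0 < kk. Proof. by rewrite mulr_gt0. Qed.
Local Notation F := (@shifted R m n Omega d K g C).
Local Notation one := (@one R m n).

Variables (th : R) (w : R -> 'cV[R]_n -> 'cV[R]_m).
Hypotheses (th0 : 0 < th) (Mw : forall t x, Oc x -> M (w t x)) (sw : solves_P Omega d K g T w)
  (lift : forall a b q q', a < b -> (exists N : nat, b = a + N%:R * T) ->
    returning_subsolution (Omega := Omega) (d := d) (v := v) (K := K) (g := g) C a b q q' ->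
    forall t x i, a <= t <= b -> Oc x -> q t x i 0 <= w t x i 0).

Lemma v_min : exists2 e : R, 0 < e & forall i, e <= v i 0.
Proof.
apply: (@fin_small_witness R 'I_m (fun i e => e <= v i 0)).
  by move=> i; exists (v i 0) => //; exact: (st_v H).
by move=> i e e' _; exact: le_trans.
Qed.

Let z0 s t x i : s <= t -> Oc x -> 0 <= Phi t s one x i 0.
Proof. by move=> st; apply: (Phi_ge0 H evol) => //; [exact: X_one|by move=> y k _; rewrite oneE]. Qed.

Lemma Phi_restart s t q x : s <= t -> t <= q -> Oc x -> Phi q s one x = Phi q t (Phi t s one) x.
Proof. by move=> st tq xO; rewrite (evol_comp evol)//; exact: X_one. Qed.

Lemma Phi_system s t b : s <= t ->
  lower_system (Omega := Omega) cc b0 kk r t b (fun q => Phi q t (Phi t s one)) (fun q => lin q (Phi q t (Phi t s one))).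
Proof.
move=> st; apply: (lower_system_linear H evol kap00 dm0 HC beta_irr beta_le Kk dmd).
  by apply: (evol_X evol) => //; exact: X_one.
by move=> x i xO; exact: z0.
Qed.

Lemma Phi_decay s t q x i : s <= t -> t <= q -> Oc x ->
  expR (- (cc * (q - t))) * Phi t s one x i 0 <= Phi q s one x i 0.
Proof.
move=> st tq xO; have := lower_system_decay i cc0 tq xO (Phi_system q st).
rewrite (Phi_restart st tq xO) (evol_id evol)//; apply: (evol_X evol) => //; exact: X_one.
Qed.

Lemma Phi_harnack : exists2 rho : R, 0 < rho & forall s t x i j, s <= t -> Oc x ->
  rho * \int[mu]_(y in Omega) Phi t s one y j 0 <= Phi (t + T) s one x i 0.
Proof.
have [rho rho0 HR] := harnack H cc0 b00 kk0 r0.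
exists rho => // s t x i j st xO; have tT : t <= t + T by rewrite lerDl; exact: ltW T0.
have Xt : space_X Omega (Phi t s one) by apply: (evol_X evol) => //; exact: X_one.
rewrite (Phi_restart st tT xO).
apply: le_trans (HR _ _ _ (fun y => Phi t s one y j 0) j (Phi_system (t + T) st) _ _ x i xO).
- by rewrite ler_pM2l// lerDr (evol_id evol)// z0.
- by apply: (Phi_bm H evol) => //; exact: X_one.
by move=> y yO; have yO' := subset_closure yO; rewrite (evol_id evol)// lexx z0.
Qed.

(** The linear solution with initial value eta at time s, discounted at the rate
    th. *)
Definition zq eta s t x : 'cV[R]_m := \col_i (eta * expR (- th * (t - s)) * Phi t s one x i 0).
Definition zq' eta s t x : 'cV[R]_m := \col_i
  (- th * (eta * expR (- th * (t - s))) * Phi t s one x i 0 + eta * expR (- th * (t - s)) * lin t (Phi t s one) x i 0).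

Lemma zqE eta s t x i : zq eta s t x i 0 = eta * expR (- th * (t - s)) * Phi t s one x i 0.
Proof. by rewrite mxE. Qed.

Lemma zq_scale eta s t x i : zq eta s t x i 0 = eta * zq 1 s t x i 0.
Proof. by rewrite !zqE mul1r mulrA. Qed.

Lemma zq_traj eta s b x i : Oc x -> traj s b (fun t => zq eta s t x i 0) (fun t => zq' eta s t x i 0).
Proof.
move=> xO; apply: (traj_ext _ _ (traj_mul (traj_exp s b eta (- th) s) (Phi_traj evol s b i X_one xO))) => q.
  by rewrite zqE.
by rewrite [zq' eta s q x i 0]mxE.
Qed.

Lemma zq_bm eta s t i : s <= t -> bounded_meas Omega (fun y => zq eta s t y i 0).
Proof.
move=> st; have -> : (fun y => zq eta s t y i 0) = (fun y => (eta * expR (- th * (t - s))) * Phi t s one y i 0).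
  by apply/funext => y; rewrite zqE.
apply: bounded_measM; first exact: bounded_meas_cst.
by apply: (Phi_bm H evol) => //; exact: X_one.
Qed.

Lemma zq_ge0 eta s t x i : 0 <= eta -> s <= t -> Oc x -> 0 <= zq eta s t x i 0.
Proof. by move=> e0 st xO; rewrite zqE !mulr_ge0 ?expR_ge0 ?z0. Qed.

Lemma zq'E eta s t x i : s <= t -> Oc x ->
  zq' eta s t x i 0 = d 0 i * nlO i t x (fun y => zq eta s t y i 0) - (d 0 i + th) * zq eta s t x i 0
    + \sum_k J t x 0 i k * zq eta s t x k 0.
Proof.
move=> st xO; rewrite [zq' eta s t x i 0]mxE linear_partE zqE.
set E := eta * expR _.
have -> : nlO i t x (fun y => zq eta s t y i 0) = E * nlO i t x (fun y => Phi t s one y i 0).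
  rewrite -(nl_scale H)//; last by apply: (Phi_bm H evol) => //; exact: X_one.
  by apply: eq_Rintegral => y _; rewrite zqE.
have -> : \sum_k J t x 0 i k * zq eta s t x k 0 = E * \sum_k J t x 0 i k * Phi t s one x k 0.
  by rewrite mulr_sumr; apply: eq_bigr => k _; rewrite zqE -/E; ring.
move: (nlO _ _ _ _) => q; ring.
Qed.

Lemma zq_comparable : exists2 U : R, 1 <= U & forall eta s t x i, 0 <= eta -> s + T <= t -> Oc x ->
  \sum_k zq eta s t x k 0 <= U * zq eta s t x i 0.
Proof.
have [U U0 HU] := Phi_comparable H evol C0 b00 kap00 dm0 r0 HC beta_irr beta_le Kk dmd.
exists (m%:R * U + 1); first by rewrite lerDr mulr_ge0// ltW.
move=> eta s t x i e0 st xO.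
have st' : s <= t by have := T0; lra.
apply: (@le_trans _ _ (m%:R * U * zq eta s t x i 0)); last first.
  by rewrite mulrDl lerDl mul1r zq_ge0.
apply: (@le_trans _ _ (\sum_(k < m) U * zq eta s t x i 0)).
  apply: ler_sum => k _; rewrite !zqE mulrCA ler_wpM2l ?mulr_ge0 ?expR_ge0//.
  by apply: (HU s t one st (X_one (Omega := Omega))) => // y l _; rewrite oneE.
by rewrite sumr_const card_ord -[X in X <= _]mulr_natl mulrA.
Qed.

Lemma zq_upper : exists2 Z : R, 0 < Z & forall eta s t x i, 0 <= eta -> s <= t -> t <= s + 2 * T -> Oc x ->
  zq eta s t x i 0 <= eta * Z.
Proof.
have [La La0 HL] := Phi_upper H evol.
pose Zm := mass (Omega := Omega) one 0.
have ms x : mass (Omega := Omega) one x = Zm.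
  by rewrite /Zm /mass; congr (_ + _); apply: eq_bigr => k _; rewrite !oneE.
have Zm0 : 0 <= Zm.
  rewrite /Zm /mass addr_ge0 ?sumr_ge0// => [k _|]; first by rewrite oneE.
  by apply: Rintegral_ge0 => y _; apply: sumr_ge0 => k _; rewrite oneE.
exists (expR (La * (2 * T)) * Zm + 1); first by rewrite ltr_wpDl// mulr_ge0 ?expR_ge0.
move=> eta s t x i e0 st ts xO; rewrite zqE -mulrA ler_wpM2l//.
have h := HL s t one st (X_one (Omega := Omega)) (fun y k yO => one_ge0 k yO) x i xO.
have e1 : expR (- th * (t - s)) <= 1.
  by rewrite -expR0 ler_expR mulNr oppr_le0 mulr_ge0 ?subr_ge0// ltW.
apply: (@le_trans _ _ (Phi t s one x i 0)); first by rewrite ler_piMl ?z0.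
apply: (le_trans h); rewrite ms; apply: (@le_trans _ _ (expR (La * (2 * T)) * Zm)); last by rewrite lerDl.
rewrite ler_wpM2r// ler_expR ler_wpM2l ?(ltW La0)//; lra.
Qed.

(** Discounting leaves a margin th z in the linear equation. After one period the
    components of z are comparable, so the margin absorbs the relative error between g
    and its linearization when z is small. *)
Lemma small_subsolution : exists2 rs : R, 0 < rs & forall eta s t (u : R -> 'cV[R]_n -> 'cV[R]_m) x i, 0 <= eta -> s + T <= t ->
  (forall y k, Oc y -> zq eta s t y k 0 < rs /\ zq eta s t y k 0 <= v k 0) ->
  (forall y, Oc y -> M (u t y)) -> (forall y k, Oc y -> zq eta s t y k 0 <= u t y k 0) -> Oc x ->
  zq' eta s t x i 0 + cc * zq eta s t x i 0 <= F u t x i.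
Proof.
have [U U1 HU] := zq_comparable; have U0 : 0 < U := lt_le_trans ltr01 U1.
have e0 : 0 < th / U by rewrite divr_gt0.
have [rs rs0 Hrs] := g_ge_linear H e0; exists rs => // eta s t u x i eta0 st zr Mu zu xO.
have st' : s <= t by have := T0; lra.
have Mz y : Oc y -> M (zq eta s t y).
  by move=> yO; apply: M_intro => k; [exact: zq_ge0|have [] := zr y k yO].
apply: (@le_trans _ _ (F (zq eta s) t x i)); last exact: (shifted_mono H beta_irr beta_low).
rewrite shifted_rhs rhsE zq'E//.
have h1 := Hrs t x (zq eta s t x) i xO (Mz x xO) (fun k => (zr x k xO).1).
have h2 : th / U * \sum_k zq eta s t x k 0 <= th * zq eta s t x i 0.
  by rewrite -mulrA ler_pM2l// ler_pdivrMl//; exact: HU.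
move: h1 h2; move: (\sum_k _) (\sum_k _) (nlO _ _ _ _) (g _ _ _ _ _) (cc * _) => S1 S2 q1 q2 q3; lra.
Qed.

Lemma zq_small eta s b : 0 < eta -> s <= b -> exists2 e : R, 0 < e & forall t y k, s <= t <= b -> Oc y ->
  zq e s t y k 0 < eta /\ zq e s t y k 0 <= v k 0.
Proof.
move=> eta0 sb; have [B B0 HB] := Phi_loc_bound H evol sb (X_one (Omega := Omega)).
have [vm vm0 Hv] := v_min.
have m0 : 0 < Num.min eta vm by rewrite lt_min eta0.
exists (Num.min eta vm / (2 * B)); first by rewrite divr_gt0// mulr_gt0.
move=> t y k /andP[st tb] yO.
suff h : zq (Num.min eta vm / (2 * B)) s t y k 0 <= Num.min eta vm / 2.
  have h1 : Num.min eta vm <= eta by rewrite ge_min lexx.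
  have h2 : Num.min eta vm <= vm by rewrite ge_min lexx orbT.
  have := Hv k; move: (zq (Num.min eta vm / (2 * B)) s t y k 0) h => q1 h; move: (Num.min eta vm) m0 h1 h2 h => q2; lra.
rewrite zqE -mulrA.
have h : expR (- th * (t - s)) * Phi t s one y k 0 <= B.
  have h1 : Phi t s one y k 0 <= B by apply: le_trans (ler_norm _) (HB t y k _ yO); rewrite st.
  apply: le_trans h1; rewrite ler_piMl ?z0// -expR0 ler_expR mulNr oppr_le0 mulr_ge0 ?subr_ge0//; exact: ltW.
apply: (@le_trans _ _ (Num.min eta vm / (2 * B) * B)).
  by rewrite ler_wpM2l// divr_ge0 ?mulr_ge0 ?(ltW m0) ?(ltW B0).
by rewrite le_eqVlt; apply/orP; left; apply/eqP; field; rewrite gt_eqF.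
Qed.

(** Within [s, s + 2T] z is at most Z. A mass KA of one component at time t makes z
    at least Z everywhere at the end b of the next full period, so a small multiple
    of z returns above its value at s + T. *)
Lemma large_mass_positive : exists2 KA : R, 0 < KA & forall s t j, s <= t ->
  KA <= \int[mu]_(y in Omega) zq 1 s t y j 0 ->
  exists2 del : R, 0 < del & forall t x i, Oc x -> del <= w t x i 0.
Proof.
have [rho rho0 HR] := Phi_harnack; have [Z Z0 HZ] := zq_upper.
have [rs rs0 Hrs] := small_subsolution.
pose c1 := expR (- (th * (2 * T))) * (expR (- (cc * T)) * rho).
have c10 : 0 < c1 by rewrite !mulr_gt0// expR_gt0.
exists (Z / c1); first by rewrite divr_gt0.
move=> s t j st hK; have TT := T0.
pose l := Num.trunc ((t - s) / T).
have lT : l%:R * T <= t - s < l.+1%:R * T.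
  rewrite -ler_pdivlMr// -ltr_pdivrMr//; apply: truncn_itv.
  by rewrite divr_ge0 ?subr_ge0// ltW.
pose a := s + T; pose b := a + l.+1%:R * T.
have bE : b = s + l%:R * T + 2 * T by rewrite /b /a -natr1; ring.
have tb : t + T <= b by move: lT; rewrite /b /a -natr1; lra.
have bt : b <= t + 2 * T by move: lT; rewrite bE; lra.
have ab : a < b by rewrite /b ltrDl mulr_gt0.
have sb : s <= b by rewrite (le_trans _ (ltW ab))// /a lerDl ltW.
have zb x i : Oc x -> Z <= zq 1 s b x i 0.
  move=> xO; apply: (@le_trans _ _ (c1 * \int[mu]_(y in Omega) zq 1 s t y j 0)).
    by move: hK; rewrite ler_pdivrMr// mulrC.
  have -> : \int[mu]_(y in Omega) zq 1 s t y j 0 = expR (- th * (t - s)) * \int[mu]_(y in Omega) Phi t s one y j 0.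
    rewrite -RintegralZl; first by apply: eq_Rintegral => y _; rewrite zqE mul1r.
      exact: (Omega_measurable H).
    apply: bounded_meas_integrable; [exact: (Omega_measurable H)|exact: (Omega_finite H)|].
    by apply: (Phi_bm H evol) => //; exact: X_one.
  rewrite zqE mul1r.
  have tT : s <= t + T by lra.
  have h1 := Phi_decay i tT tb xO; have h2 := HR s t x i j st xO.
  have h3 : expR (- (cc * T)) * (rho * \int[mu]_(y in Omega) Phi t s one y j 0) <= Phi b s one x i 0.
    apply: le_trans h1; apply: ler_pM; [exact: expR_ge0| | |done].
      rewrite mulr_ge0 ?(ltW rho0)//; apply: Rintegral_ge0 => y yO; apply: z0 => //; exact: subset_closure.
    by rewrite ler_expR lerN2 ler_pM2l//; lra.
  have e3 : expR (- (th * (2 * T))) * expR (- th * (t - s)) <= expR (- th * (b - s)).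
    rewrite -expRD ler_expR (_ : - (th * (2 * T)) + - th * (t - s) = - th * (t + 2 * T - s)); last by ring.
    by rewrite !mulNr lerN2 ler_pM2l//; lra.
  apply: (@le_trans _ _ (expR (- (th * (2 * T))) * expR (- th * (t - s)) * (expR (- (cc * T)) * (rho * \int[mu]_(y in Omega) Phi t s one y j 0)))).
    by rewrite le_eqVlt; apply/orP; left; apply/eqP; rewrite /c1; move: (\int[mu]_(y in Omega) _) => q; ring.
  apply: ler_pM; [by rewrite mulr_ge0 ?expR_ge0| |done|done].
  rewrite !mulr_ge0 ?expR_ge0 ?(ltW rho0)//; apply: Rintegral_ge0 => y yO; apply: z0 => //; exact: subset_closure.
have [eta eta0 Heta] := zq_small rs0 sb.
have aq q : a <= q -> s <= q by rewrite /a; lra.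
have low x i : Oc x -> zq eta s b x i 0 <= w b x i 0.
  have sub : returning_subsolution (Omega := Omega) (d := d) (v := v) (K := K) (g := g) C a b (zq eta s) (zq' eta s).
    split.
    - by move=> y k yO; apply: traj_sub (zq_traj eta s b k yO); [exact: aq|].
    - by move=> q y k /andP[aq' qb] yO; have [|_ //] := Heta q y k _ yO; rewrite aq.
    - move=> y k yO; rewrite [leLHS]zq_scale [leRHS]zq_scale ler_pM2l//; apply: le_trans (zb y k yO).
      by rewrite -[leRHS]mul1r; apply: HZ => //; [exact: aq|rewrite /a; lra].
    - move=> u q y k Mu qu /andP[aq' qb] yO; apply: Hrs => //; [exact: ltW|exact: ltW|].
      by move=> y' k' yO'; apply: Heta => //; rewrite aq ?ltW.
  by move=> xO; apply: (lift ab _ sub i _ xO); [exists l.+1|rewrite lexx ltW].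
exists (expR (- (cc * T)) * (eta * Z)); first by rewrite !mulr_gt0 ?expR_gt0.
move=> q x i xO; apply: (persist H C0 kap00 dm0 beta_irr beta_low Kk dmd Mw sw xO (t := b)).
  by rewrite mulr_ge0 ?ltW.
move=> k; apply: le_trans (low x k xO); rewrite zq_scale ler_pM2l//; exact: zb.
Qed.

Lemma ball_minorant x0 (rho c : R) : Oc x0 -> 0 < rho -> 0 < c -> exists h : 'cV[R]_n -> R,
  [/\ bounded_meas Omega h, forall y, 0 <= h y <= c, forall y, ~ ball x0 rho y -> h y = 0 &
      0 < \int[mu]_(y in Omega) h y].
Proof.
move=> xO rho0 c0; have mO := Omega_measurable H; have fO := Omega_finite H.
pose A : set 'cV[R]_n := ball x0 rho.
have oA : open A by exact: ball_open.
have mA : measurable A by exact: open_cV_measurable.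
have b1 : bounded_meas Omega (\1_A : 'cV[R]_n -> R).
  split; first exact: measurable_indic.
  by exists 1 => y _; rewrite indicE; case: (_ \in _); rewrite ?normr1 ?normr0.
exists (fun y => c * \1_A y); split.
- by apply: bounded_measM => //; exact: bounded_meas_cst.
- by move=> y; rewrite indicE; case: (_ \in _); rewrite ?mulr1 ?mulr0 ?lexx ?(ltW c0).
- by move=> y nA; rewrite indicE memNset ?mulr0.
rewrite RintegralZl//; last exact: bounded_meas_integrable.
rewrite mulr_gt0// /Rintegral integral_indic// fine_gt0//; apply/andP; split.
  apply: lebesgue_n_open_gt0; first by apply: openI => //; exact: st_open H.
  have [z [zO zA]] := xO A (open_nbhs_nbhs (conj oA (ballxx x0 rho0))).
  by exists z.
apply: le_lt_trans fO; apply: le_measure; rewrite ?inE//.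
exact: measurableI.
Qed.

(** Growth over at most one period at a point, in terms of the values at this
    point and of the bound on the mass. *)
Lemma zq_growth : exists2 G : R, 0 < G & forall KA s a b x,
  (forall t j, s <= t -> \int[mu]_(y in Omega) zq 1 s t y j 0 <= KA) ->
  s <= a -> a <= b -> b <= a + T -> Oc x ->
  \sum_k zq 1 s b x k 0 <= G * (\sum_k zq 1 s a x k 0 + m%:R * KA).
Proof.
have [La La0 HL] := Phi_upper H evol.
have G0 : 0 < m.+1%:R * expR (La * T) by rewrite mulr_gt0 ?expR_gt0.
exists (m.+1%:R * expR (La * T)) => // KA s a b x HK sa ab bT xO.
have sb : s <= b by exact: le_trans ab.
set E := expR (La * T).
have Xa : space_X Omega (Phi a s one) by apply: (evol_X evol) => //; exact: X_one.
have I0 : 0 <= mass (Omega := Omega) (Phi a s one) x.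
  rewrite /mass addr_ge0 ?sumr_ge0// => [k _|]; first exact: z0.
  by apply: Rintegral_ge0 => y yO; apply: sumr_ge0 => k _; apply: z0 => //; exact: subset_closure.
have mE : expR (- th * (a - s)) * mass (Omega := Omega) (Phi a s one) x <= \sum_k zq 1 s a x k 0 + m%:R * KA.
  have [_ Es] := bounded_meas_sum H (index_enum 'I_m) (fun k => bounded_meas_X H k Xa).
  rewrite /mass Es mulrDr; apply: lerD.
    by rewrite mulr_sumr; apply: ler_sum => k _; rewrite zqE mul1r.
  rewrite mulr_sumr; apply: (@le_trans _ _ (\sum_(k < m) KA)).
    apply: ler_sum => k _; apply: le_trans (HK a k sa).
    rewrite le_eqVlt; apply/orP; left; apply/eqP; rewrite -RintegralZl.
    - by apply: eq_Rintegral => y _; rewrite zqE mul1r.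
    - exact: (Omega_measurable H).
    apply: bounded_meas_integrable; [exact: (Omega_measurable H)|exact: (Omega_finite H)|].
    exact: (bounded_meas_X H).
  by rewrite sumr_const card_ord -[X in X <= _]mulr_natl.
have key k : zq 1 s b x k 0 <= E * (\sum_k zq 1 s a x k 0 + m%:R * KA).
  rewrite zqE mul1r (Phi_restart sa ab xO).
  have h := HL a b (Phi a s one) ab Xa (fun y k yO => z0 k sa yO) x k xO.
  apply: (@le_trans _ _ (E * (expR (- th * (a - s)) * mass (Omega := Omega) (Phi a s one) x))).
    rewrite mulrCA; apply: ler_pM; [exact: expR_ge0| | |].
    - by rewrite -(Phi_restart sa ab xO) z0.
    - by rewrite ler_expR !mulNr lerN2 ler_pM2l//; lra.
    apply: (le_trans h); rewrite ler_wpM2r// ler_expR ler_pM2l//; lra.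
  by rewrite ler_wpM2l ?expR_ge0.
apply: (@le_trans _ _ (\sum_(k < m) (E * (\sum_k zq 1 s a x k 0 + m%:R * KA)))).
  by apply: ler_sum => k _; exact: key.
have S0 : 0 <= E * (\sum_k zq 1 s a x k 0 + m%:R * KA).
  rewrite mulr_ge0 ?expR_ge0//; apply: le_trans mE; by rewrite mulr_ge0 ?expR_ge0.
rewrite sumr_const card_ord -[X in X <= _]mulr_natl -mulrA ler_wpM2r// ler_nat; exact: leqnSn.
Qed.

(** Going back from t by whole periods, let t - NT be the first time at which Y has
    dropped by the factor U. Since Y is at most Z near s this happens after s + T, and
    until then Y is large at the times t - lT, hence, by the bound on its growth over
    one period, also in between. *)
Lemma large_stretch (Y : R -> R) (U Z G L P s t : R) : 1 <= U -> 0 <= Z -> 0 < G ->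
  (forall q, s <= q -> q <= s + 2 * T -> Y q <= Z) ->
  (forall a b, s <= a -> a <= b -> b <= a + T -> Y b <= G * (Y a + P)) ->
  s <= t -> U * Z < Y t -> U * (G * (L + P)) <= Y t ->
  exists a, [/\ s + T <= a, a < t, exists N : nat, t = a + N%:R * T,
    U * Y a <= Y t & forall q, a < q -> q < t -> L <= Y q].
Proof.
move=> U1 Z0 G0 HZ HG st YZ YL; have TT := T0; have U0 : 0 < U := lt_le_trans ltr01 U1.
have t2 : s + 2 * T < t.
  rewrite ltNge; apply/negP => h; have := HZ t st h.
  have : Z <= U * Z by rewrite ler_peMl.
  lra.
pose l := Num.trunc ((t - s) / T).
have /andP[l1 l2] : l%:R * T <= t - s < l.+1%:R * T.
  rewrite -ler_pdivlMr// -ltr_pdivrMr//; apply: truncn_itv.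
  by rewrite divr_ge0 ?subr_ge0// ltW.
have l1' : (1 < l)%N.
  rewrite ltnNge; apply/negP => h; have : l.+1%:R <= 2 :> R by rewrite ler_nat.
  move=> h'; have : l.+1%:R * T <= 2 * T by rewrite ler_pM2r.
  lra.
pose P' N := (0 < N)%N && (U * Y (t - N%:R * T) <= Y t).
have exP : exists N, P' N.
  exists l.-1; rewrite /P' -subn1 subn_gt0 l1'/=.
  have lE : (l - 1)%:R = l%:R - 1 :> R by rewrite natrB// ltnW.
  rewrite lE; apply: (@le_trans _ _ (U * Z)); last exact: ltW.
  by rewrite ler_pM2l//; apply: HZ; move: l2; rewrite -natr1; lra.
have lP : (ex_minn exP <= l.-1)%N.
  case: ex_minnP => N _; apply; rewrite /P' -subn1 subn_gt0 l1'/=.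
  have lE : (l - 1)%:R = l%:R - 1 :> R by rewrite natrB// ltnW.
  rewrite lE; apply: (@le_trans _ _ (U * Z)); last exact: ltW.
  by rewrite ler_pM2l//; apply: HZ; move: l2; rewrite -natr1; lra.
move: lP; case: ex_minnP => N /andP[N0 YN] Nmin Nl.
have Nl' : N%:R <= l%:R - 1 :> R.
  have : N.+1%:R <= l%:R :> R by rewrite ler_nat; apply: (leq_trans (n := l.-1.+1)); rewrite ?ltnS// prednK// ltnW.
  rewrite -natr1; lra.
have NT : N%:R * T <= (l%:R - 1) * T by rewrite ler_pM2r.
have NT0 : 0 < N%:R * T by rewrite mulr_gt0// ltr0n.
exists (t - N%:R * T); split => //; first by lra.
- by rewrite gtrBl.
- by exists N; rewrite subrK.
move=> q aq qt.
pose k := Num.trunc ((t - q) / T).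
have tq0 : 0 <= (t - q) / T by rewrite divr_ge0 ?subr_ge0 ?ltW.
have /andP[k1 k2] : k%:R * T <= t - q < k.+1%:R * T.
  by rewrite -ler_pdivlMr// -ltr_pdivrMr//; exact: truncn_itv.
have kN : (k < N)%N.
  rewrite -(ltr_nat R) -(ltr_pM2r TT); apply: (le_lt_trans k1); lra.
have Yk : Y t <= U * Y (t - k%:R * T).
  case: (posnP k) => [->|k0]; last first.
    rewrite leNgt; apply/negP => /ltW h; have : P' k by rewrite /P' k0.
    by move/Nmin; rewrite leqNgt kN.
  rewrite mul0r subr0 ler_peMl//; apply: le_trans (ltW YZ); rewrite mulr_ge0//; exact: ltW.
have := HG q (t - k%:R * T) _ _ _; rewrite -natr1 in k2.
have h1 : s <= q by lra.
have h2 : q <= t - k%:R * T by lra.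
have h3 : t - k%:R * T <= q + T by lra.
move=> /(_ h1 h2 h3) h4.
have : U * (G * (L + P)) <= U * (G * (Y q + P)).
  by apply: (le_trans YL); apply: (le_trans Yk); rewrite ler_pM2l.
by rewrite !ler_pM2l// lerD2r.
Qed.

Lemma zq_nl_bound KA eta s t x i : 0 <= eta -> s <= t -> Oc x ->
  (forall t j, s <= t -> \int[mu]_(y in Omega) zq 1 s t y j 0 <= KA) ->
  forall B, (forall i t x y, Oc x -> Oc y -> K i t (x - y) <= B) -> 0 <= B ->
  d 0 i * nlO i t x (fun y => zq eta s t y i 0) <= eta * (dS * B * KA).
Proof.
move=> eta0 st xO HK B HB B0; have mO := Omega_measurable H; have fO := Omega_finite H.
have I0 : 0 <= \int[mu]_(y in Omega) zq 1 s t y i 0.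
  by apply: Rintegral_ge0 => y yO; apply: zq_ge0 => //; exact: subset_closure.
have h1 : nlO i t x (fun y => zq eta s t y i 0) <= eta * B * \int[mu]_(y in Omega) zq 1 s t y i 0.
  rewrite -RintegralZl//; last by apply: bounded_meas_integrable => //; exact: zq_bm.
  apply: le_Rintegral => //.
  - by apply: bounded_meas_integrable => //; apply: (Kf_bounded_meas H) => //; exact: zq_bm.
  - by apply: bounded_meas_integrable => //; apply: bounded_measM; [exact: bounded_meas_cst|exact: zq_bm].
  move=> y yO; have yO' := subset_closure yO; rewrite zq_scale mulrCA -mulrA ler_wpM2l//.
  by rewrite ler_wpM2r ?HB// zq_ge0.
have h2 : eta * B * \int[mu]_(y in Omega) zq 1 s t y i 0 <= eta * B * KA.
  by rewrite ler_wpM2l ?mulr_ge0// HK.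
have n0 : 0 <= nlO i t x (fun y => zq eta s t y i 0).
  by apply: (nl_ge0 H) => y yO; apply: zq_ge0 => //; exact: subset_closure.
apply: (@le_trans _ _ (dS * (eta * B * KA))).
  apply: ler_pM => //; [exact: ltW (st_d H i)|exact: d_le_dsum H i|exact: le_trans h2].
by rewrite le_eqVlt; apply/orP; left; apply/eqP; ring.
Qed.

(** At x0 the nonlocal term is at most P, which is at most (th/2) z when z >= L. There z
    satisfies a purely local differential inequality, and freezing it over a ball
    where the Jacobian varies little gives a subsolution, since the nonlocal term of
    any function above it is nonnegative. *)
Lemma bounded_mass_positive KA : 0 < KA ->
  (forall s t j, s <= t -> \int[mu]_(y in Omega) zq 1 s t y j 0 <= KA) ->
  (forall B : R, exists s t x i, [/\ s <= t, Oc x & B < zq 1 s t x i 0]) ->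
  exists2 del : R, 0 < del & forall t x i, Oc x -> del <= w t x i 0.
Proof.
move=> KA0 HK unb; have TT := T0.
have [U U1 HU] := zq_comparable; have U0 : 0 < U := lt_le_trans ltr01 U1.
have [Z Z0 HZ] := zq_upper; have [G G0 HG] := zq_growth.
have [B B0 HB] := K_bound H.
have D0 := @dsum_ge0 _ _ _ _ _ _ _ _ _ H.
pose P := dS * B * KA; have P0 : 0 <= P by rewrite !mulr_ge0 ?(ltW B0) ?(ltW KA0).
pose L := 2 * P / th; have L0 : 0 <= L by apply: divr_ge0; [exact: mulr_ge0|exact: ltW].
have e0 : 0 < th / (4 * U) by rewrite divr_gt0// mulr_gt0.
have [rs rs0 Hrs] := g_ge_linear H e0; have [rj rj0 Hrj] := jacobian0_modulus H e0.
have mK0 : 0 <= m%:R * KA by rewrite mulr_ge0// ltW.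
have [s [t [x0 [i0 [st x0O big]]]]] := unb (U * (m%:R * Z) + U * (G * (U * L + m%:R * KA))).
pose Y q := \sum_k zq 1 s q x0 k 0.
have zY q k : s <= q -> zq 1 s q x0 k 0 <= Y q.
  by move=> sq; rewrite /Y (bigD1 k)//= lerDl sumr_ge0// => l _; exact: zq_ge0.
have UZ0 : 0 <= U * (m%:R * Z) by rewrite !mulr_ge0 ?(ltW U0) ?(ltW Z0).
have UG0 : 0 <= U * (G * (U * L + m%:R * KA)) by rewrite !mulr_ge0 ?(ltW U0) ?(ltW G0) ?addr_ge0// mulr_ge0 ?(ltW U0).
have Yt := zY t i0 st.
have mZ0 : 0 <= m%:R * Z by rewrite mulr_ge0// ltW.
have YZ q : s <= q -> q <= s + 2 * T -> Y q <= m%:R * Z.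
  move=> sq qs; apply: (@le_trans _ _ (\sum_(k < m) Z)).
    by apply: ler_sum => k _; rewrite -[leRHS]mul1r; exact: HZ.
  by rewrite sumr_const card_ord -[X in X <= _]mulr_natl.
have YG p q : s <= p -> p <= q -> q <= p + T -> Y q <= G * (Y p + m%:R * KA).
  by move=> sp pq qT; apply: (HG KA s p q x0 (HK s)).
have Y1 : U * (m%:R * Z) < Y t.
  by apply: lt_le_trans Yt; apply: le_lt_trans big; rewrite lerDl.
have Y2 : U * (G * (U * L + m%:R * KA)) <= Y t.
  by apply: le_trans Yt; apply: le_trans (ltW big); rewrite lerDr.
have [a [sa at_ [N tE] Ya Yq]] := large_stretch U1 mZ0 G0 YZ YG st Y1 Y2.
have sa' : s <= a by apply: le_trans sa; rewrite lerDl ltW.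
have [eta eta0 Heta] := zq_small rs0 st.
pose bl x : R := \1_(ball x0 rj) x.
pose qf q x := bl x *: zq eta s q x0.
pose qf' q x := bl x *: zq' eta s q x0.
have bl01 x : 0 <= bl x <= 1 by rewrite /bl indicE; case: (_ \in _); rewrite ?lexx ?ler01.
have qfE q x k : qf q x k 0 = bl x * zq eta s q x0 k 0 by rewrite [qf q x k 0]mxE.
have qf'E q x k : qf' q x k 0 = bl x * zq' eta s q x0 k 0 by rewrite [qf' q x k 0]mxE.
have low x k : Oc x -> bl x * zq eta s t x0 k 0 <= w t x k 0.
  have sub : returning_subsolution (Omega := Omega) (d := d) (v := v) (K := K) (g := g) C a t qf qf'.
    split.
    - move=> y l yO.
      have t0 : traj a t (fun=> 0 : R) (fun=> 0) by apply: derive_traj => q _; exact: is_derive_cst.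
      have tz := traj_sub sa' (lexx t) (zq_traj eta s t l x0O).
      by apply: (traj_ext _ _ (traj_lin (bl y) t0 tz)) => q; rewrite add0r ?qfE ?qf'E.
    - move=> q y l /andP[aq qt] yO; rewrite qfE; have sq : s <= q := le_trans sa' aq.
      have [|_ h] := Heta q x0 l _ x0O; first by rewrite sq.
      have z00 := zq_ge0 l (ltW eta0) sq x0O; have /andP[b0' b1] := bl01 y.
      by apply: le_trans h; rewrite ler_piMl.
    - move=> y l yO; rewrite !qfE; have /andP[b0' b1] := bl01 y; rewrite ler_wpM2l//.
      rewrite [leLHS]zq_scale [leRHS]zq_scale ler_pM2l//.
      apply: (le_trans (zY a l sa')); rewrite -(ler_pM2l U0); apply: (le_trans Ya).
      by apply: HU => //; exact: le_trans sa (ltW at_).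
    move=> u q y l Mu qu /andP[aq qt] yO; have sq : s <= q := le_trans sa' (ltW aq).
    rewrite qfE qf'E /bl indicE.
    case: (boolP (y \in (ball x0 rj : set 'cV[R]_n))) => yb; last first.
      by rewrite !mul0r mulr0 addr0; exact: (shifted_ge0 H beta_irr beta_low).
    rewrite !mul1r.
    have bly : bl y = 1 by rewrite /bl indicE yb.
    rewrite inE in yb.
    have sTq : s + T <= q := le_trans sa (ltW aq).
    have small j : zq eta s q x0 j 0 < rs /\ zq eta s q x0 j 0 <= v j 0 by apply: Heta => //; rewrite sq ltW.
    have z00 j : 0 <= zq eta s q x0 j 0 by exact: zq_ge0 (ltW eta0) sq x0O.
    have Mz : M (zq eta s q x0) by apply: M_intro => j //; have [] := small j.
    have zu j : zq eta s q x0 j 0 <= u q y j 0 by have := qu y j yO; rewrite qfE bly mul1r.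
    have h1 := Hrs q y (zq eta s q x0) l yO Mz (fun j => (small j).1).
    have h2 : \sum_k J q x0 0 l k * zq eta s q x0 k 0 - th / (4 * U) * \sum_k zq eta s q x0 k 0 <=
        \sum_k J q y 0 l k * zq eta s q x0 k 0.
      rewrite mulr_sumr -sumrB; apply: ler_sum => j _.
      have := Hrj q x0 y l j x0O yO yb; rewrite ltr_norml => /andP[_ hj].
      have : (J q x0 0 l j - J q y 0 l j) * zq eta s q x0 j 0 <= th / (4 * U) * zq eta s q x0 j 0.
        by rewrite ler_wpM2r// ltW.
      rewrite mulrBl; move: (J q x0 0 l j * zq eta s q x0 j 0) (J q y 0 l j * zq eta s q x0 j 0) (th / (4 * U) * zq eta s q x0 j 0) => A1 A2 A3; lra.
    have h3 : th / (4 * U) * \sum_k zq eta s q x0 k 0 <= th / 4 * zq eta s q x0 l 0.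
      apply: (@le_trans _ _ (th / (4 * U) * (U * zq eta s q x0 l 0))).
        by rewrite ler_pM2l//; apply: HU => //; exact: ltW.
      by rewrite le_eqVlt; apply/orP; left; apply/eqP; field; rewrite gt_eqF.
    have h4 : eta * P <= th / 2 * zq eta s q x0 l 0.
      have zl : L <= zq 1 s q x0 l 0.
        rewrite -(ler_pM2l U0); apply: (le_trans (Yq q aq qt)); apply: HU => //.
      rewrite zq_scale; apply: (@le_trans _ _ (th / 2 * (eta * L))); last first.
        by rewrite ler_wpM2l ?divr_ge0 ?(ltW th0)// ler_pM2l.
      by rewrite le_eqVlt; apply/orP; left; apply/eqP; rewrite /L; field; rewrite gt_eqF.
    have h5 := zq_nl_bound (eta := eta) l (ltW eta0) sq x0O (HK s) HB (ltW B0).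
    have h6 := g_quasi_mono beta_irr beta_low q l yO Mz (Mu y yO) zu.
    have h7 : (dS - d 0 l) * zq eta s q x0 l 0 <= (dS - d 0 l) * u q y l 0.
      by rewrite ler_wpM2l// subr_ge0; exact: d_le_dsum H l.
    have h8 : 0 <= d 0 l * nlO l q y (fun z => u q z l 0).
      rewrite mulr_ge0 ?(ltW (st_d H l))//; apply: (nl_ge0 H) => z zO; have zO' := subset_closure zO.
      exact: M_ge0 (Mu z zO') l.
    rewrite zq'E// /shifted.
    move: h1 h2 h3 h4 h5 h6 h7 h8; rewrite -/P.
    move: (nlO l q x0 _) (nlO l q y _) (\sum_k J q x0 0 l k * zq eta s q x0 k 0) (\sum_k J q y 0 l k * zq eta s q x0 k 0) (th / (4 * U) * _) (eta * P) (g q y _ l 0) (g q y _ l 0).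
    move: (u q y l 0) (zq eta s q x0 l 0) => u1 z1 n1 n2 S1 S2 S3 P1 g1 g2; lra.
  have at' : a <= t <= t by rewrite ltW/=.
  move=> xO; rewrite -qfE.
  exact: (lift at_ (ex_intro _ N tE) sub k at' xO).
have c0 : 0 < zq eta s t x0 i0 0.
  rewrite zq_scale mulr_gt0//; lra.
have [h [bh h01 hb I0]] := ball_minorant x0O rj0 c0.
apply: (mass_positive H C0 b00 kap00 dm0 r0 beta_irr beta_low Kk dmd Mw sw bh (i := i0) (t := t) _ I0).
move=> y yO; have /andP[h0 h1] := h01 y; rewrite h0/=.
have [yb|nb] := pselect (ball x0 rj y); last first.
  by rewrite hb//; exact: M_ge0 (Mw t (subset_closure yO)) i0.
apply: (le_trans h1); apply: le_trans (low y i0 (subset_closure yO)).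
by rewrite /bl indicE mem_set// mul1r.
Qed.

End system.

(** * Ratios of solutions *)

Lemma ratio_sup {R : realType} (I : Type) (a b : I -> R) (V c al0 be : R) :
  0 < V -> 0 < c -> 0 < al0 -> al0 <= be -> (forall j, 0 <= b j <= V) ->
  (forall j, al0 * b j <= a j) ->
  (forall al, al0 <= al -> al <= be -> (forall j, al * b j <= a j) -> forall j, al * b j + c <= a j) ->
  forall j, be * b j <= a j.
Proof.
move=> V0 c0 al00 albe bV h0 step.
pose S : set R := [set al | al0 <= al <= be /\ forall j, al * b j <= a j].
have S0 : S al0 by split; rewrite ?lexx.
have supS : has_sup S by split; [exists al0|exists be => al [/andP[]]].
pose s := sup S.
have s0 : al0 <= s by apply: ub_le_sup => //; exact: supS.2.
have s1 : s <= be by apply: ge_sup; [exists al0|move=> al [/andP[]]].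
have Ss j : s * b j <= a j.
  have /andP[b0 _] := bV j; have [bj|bj] := eqVneq (b j) 0.
    by have := h0 j; rewrite bj !mulr0.
  have bp : 0 < b j by rewrite lt_def bj.
  rewrite -ler_pdivlMr//; apply: ge_sup; first by exists al0.
  by move=> al [_ h]; rewrite ler_pdivlMr.
have [bs|sb] := leP be s; first by have -> : be = s by apply/eqP; rewrite eq_le s1 bs.
have cV : 0 < c / V by rewrite divr_gt0.
pose al := Num.min be (s + c / V).
have : S al.
  split=> [|j].
    apply/andP; split; last by rewrite /al ge_min lexx.
    by rewrite /al le_min albe (le_trans s0)// lerDl ltW.
  apply: le_trans (step s s0 s1 Ss j); have /andP[b0 bV'] := bV j.
  apply: (@le_trans _ _ ((s + c / V) * b j)); first by rewrite ler_wpM2r// ge_min lexx orbT.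
  rewrite mulrDl lerD2l mulrAC ler_pdivrMr//; exact: ler_wpM2l (ltW c0) _ _ bV'.
move=> Sal; have : al <= s by apply: ub_le_sup => //; exact: supS.2.
by rewrite /al ge_min => /orP[|]; lra.
Qed.

Section system.
Context {R : realType} {m n : nat} {Omega : set 'cV[R]_n} {d : 'rV[R]_m}
  {v : 'cV[R]_m} {K : 'I_m -> R -> 'cV[R]_n -> R}
  {g : R -> 'cV[R]_n -> 'cV[R]_m -> 'cV[R]_m} {T : R}.
Hypothesis H : standing Omega d v K g T.
Implicit Types (u w : R -> 'cV[R]_n -> 'cV[R]_m) (x y : 'cV[R]_n) (t s : R).
Local Notation M := (box 0 v).
Local Notation Oc := (closure Omega).
Local Notation J := (fun t x a => jacobian_u g t x a).
Let T0 : 0 < T := st_T H.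

Local Notation dS := (@dsum R m d).

(* Constants as in [reaction_constants]. *)
Variables (C b0 : R) (beta : R -> 'cV[R]_n -> 'cV[R]_m -> 'I_m -> 'I_m -> R).
Hypotheses (C0 : 0 < C) (b00 : 0 < b0)
  (beta_irr : forall t x b, Oc x -> M b -> irreducible_at b0 (beta t x b))
  (beta_low : forall t x b (p : 'cV[R]_m) i, Oc x -> M b -> (forall k, 0 <= p k 0) -> M (b + p) ->
    - (C * p i 0) + \sum_(k | k != i) beta t x b i k * p k 0 <=
      g t x (b + p) i 0 - g t x b i 0).

Local Notation cc := (C + dS).

Let cc0 : 0 < cc. Proof. by rewrite ltr_pwDl// (dsum_ge0 H). Qed.

(** The difference p = u1 - al u2 is forced by g(al u2) - al g(u2), whose sum over the
    components is bounded below for al between al0 and be: subhomogeneity compares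
    it with its value at al = be. The parameter eps measures the mismatch between
    the points x and y and between the nonlocal terms N1 and N2. *)
Lemma ratio_step (del al0 be : R) : 0 < del -> 0 < al0 -> 0 < be < 1 ->
  exists c kap : R, [/\ 0 < c, 0 < kap & forall x y (u1 u2 : R -> 'cV[R]_m) (N1 N2 : R -> 'I_m -> R) (al eps : R),
    Oc x -> Oc y -> (forall t, u1 (t + T) = u1 t) -> (forall t, u2 (t + T) = u2 t) ->
    (forall t, M (u1 t)) -> (forall t, M (u2 t)) -> (forall t i, del <= u2 t i 0) ->
    (forall (t : R) i, is_derive t 1 (fun s => u1 s i 0) (d 0 i * N1 t i - d 0 i * u1 t i 0 + g t y (u1 t) i 0)) ->
    (forall (t : R) i, is_derive t 1 (fun s => u2 s i 0) (d 0 i * N2 t i - d 0 i * u2 t i 0 + g t x (u2 t) i 0)) ->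
    al0 <= al -> al <= be -> (forall t i, al * u2 t i 0 <= u1 t i 0) ->
    0 <= eps <= kap -> (forall t i, al * N2 t i <= N1 t i + eps) ->
    (forall t i, g t x (u2 t) i 0 <= g t y (u2 t) i 0 + eps) ->
    forall t i, al * u2 t i 0 + c <= u1 t i 0].
Proof.
move=> del0 al00 be01; have [e0 e00 He] := g_strict H be01 del0.
have [rp [kp [rp0 kp0 PH]]] := @periodic_harnack R m cc b0 T cc0 b00 T0.
have D1 : 0 < dS + 1 by rewrite ltr_wpDl// (dsum_ge0 H).
pose E := al0 * e0 / 2.
have E0 : 0 < E by rewrite /E divr_gt0// mulr_gt0.
exists (rp * E), (Num.min (kp * E) (E / m.+1%:R) / (dS + 1)); split; first exact: mulr_gt0.
  by rewrite divr_gt0// lt_min mulr_gt0//= divr_gt0.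
move=> x y u1 u2 N1 N2 al eps xO yO T1 T2 M1 M2 du2 d1 d2 al0al albe alu /andP[eps0 epsk] HN Hg t0 i0.
have al_gt0 : 0 < al by exact: lt_le_trans al0al.
have /andP[be0 be1] := be01; have al1 : al < 1 by exact: le_lt_trans be1.
pose ee := (dS + 1) * eps.
have ee0 : 0 <= ee by rewrite mulr_ge0// ltW.
have eek : ee <= Num.min (kp * E) (E / m.+1%:R) by rewrite /ee mulrC -ler_pdivlMr.
have Ma t : M (al *: u2 t) by apply: M_scale => //; rewrite (ltW al_gt0) ltW.
pose p t i := u1 t i 0 - al * u2 t i 0.
have p0 t i : 0 <= p t i by rewrite subr_ge0.
pose p' t i := (d 0 i * N1 t i - d 0 i * u1 t i 0 + g t y (u1 t) i 0) -
  al * (d 0 i * N2 t i - d 0 i * u2 t i 0 + g t x (u2 t) i 0).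
pose gain t i := g t y (al *: u2 t) i 0 - al * g t y (u2 t) i 0.
have gain_low t i : al / be * (g t y (be *: u2 t) i 0 - be * g t y (u2 t) i 0) <= gain t i.
  have [alE|alb] := eqVneq al be; first by rewrite /gain alE divff ?mul1r// gt_eqF.
  have ab : 0 < al / be < 1 by rewrite divr_gt0//= ltr_pdivrMr// mul1r lt_def eq_sym alb.
  have Mb : M (be *: u2 t) by apply: M_scale => //; rewrite !ltW.
  have := g_sub_le H t i yO Mb ab.
  rewrite scalerA divfK ?gt_eqF// /gain.
  have : al / be * (be * g t y (u2 t) i 0) = al * g t y (u2 t) i 0 by field; rewrite gt_eqF.
  by rewrite mulrBr => ->; rewrite lerD2r.
have gain0 t i : 0 <= gain t i.
  by rewrite /gain subr_ge0; apply: (g_sub_le H) => //; rewrite al_gt0.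
have gainS t : 2 * E <= \sum_i gain t i.
  apply: (@le_trans _ _ (\sum_i al / be * (g t y (be *: u2 t) i 0 - be * g t y (u2 t) i 0))); last by apply: ler_sum.
  rewrite -mulr_sumr /E mulrC divfK//; apply: ler_pM; [exact: ltW|exact: ltW| |exact: He].
  by apply: (le_trans al0al); rewrite ler_pdivlMr// ler_piMr// ltW.
have key t i : \sum_(k | k != i) beta t y (al *: u2 t) i k * p t k + gain t i - ee <= p' t i + cc * p t i.
  pose pv := u1 t - al *: u2 t.
  have pvE k : pv k 0 = p t k by rewrite /pv /p !mxE.
  have pv0 k : 0 <= pv k 0 by rewrite pvE.
  have bE : al *: u2 t + pv = u1 t by rewrite /pv addrC subrK.
  have Mp : M (al *: u2 t + pv) by rewrite bE.
  have := beta_low t i yO (Ma t) pv0 Mp; rewrite bE pvE.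
  have -> : \sum_(k | k != i) beta t y (al *: u2 t) i k * pv k 0 = \sum_(k | k != i) beta t y (al *: u2 t) i k * p t k.
    by apply: eq_bigr => k _; rewrite pvE.
  have h1 : d 0 i * (al * N2 t i) <= d 0 i * (N1 t i + eps) by rewrite ler_pM2l ?(st_d H).
  have dk := @d_le_dsum _ _ _ _ _ _ _ _ _ H i.
  have h2 : d 0 i * eps <= dS * eps by rewrite ler_wpM2r.
  have h3 : d 0 i * p t i <= dS * p t i by rewrite ler_wpM2r.
  have h4 : al * g t x (u2 t) i 0 <= al * g t y (u2 t) i 0 + eps.
    apply: (@le_trans _ _ (al * (g t y (u2 t) i 0 + eps))); first by rewrite ler_pM2l.
    by rewrite mulrDr lerD2l ler_piMl// ltW.
  have pE : p t i = u1 t i 0 - al * u2 t i 0 by [].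
  rewrite /p' /gain /ee; move: h1 h2 h3 h4; rewrite pE.
  move: (\sum_(k | _) _) (g t x (u2 t) i 0) (g t y (u2 t) i 0) (g t y (al *: u2 t) i 0) (g t y (u1 t) i 0).
  move: (N1 t i) (N2 t i) (u1 t i 0) (u2 t i 0) => n1 n2 w1 w2 S g1 g2 g3 g4; lra.
have bp0 t i : 0 <= \sum_(k | k != i) beta t y (al *: u2 t) i k * p t k.
  apply: sumr_ge0 => k ki; rewrite mulr_ge0//; have [b0' _] := beta_irr t yO (Ma t).
  by apply: b0'; rewrite eq_sym.
have mee : m%:R * ee <= E.
  apply: (@le_trans _ _ (m.+1%:R * (E / m.+1%:R))).
    apply: ler_pM => //; first by rewrite ler_nat leqnSn.
    by apply: (le_trans eek); rewrite ge_min lexx orbT.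
  by rewrite mulrC divfK// pnatr_eq0.
have : rp * E <= p t0 i0; last by rewrite /p lerBrDr addrC.
apply: (PH p p' (fun t => beta t y (al *: u2 t)) ee E) => //.
- by move=> t i; rewrite /p T1 T2.
- by move=> t i; have := key t i; have := gain0 t i; move: (\sum_(k | _) _) => S; lra.
- by move=> t; apply: beta_irr.
- move=> t; apply: (@le_trans _ _ (\sum_i (gain t i - ee))).
    rewrite sumrB sumr_const card_ord -[X in _ - X]mulr_natl; have := gainS t; move: (\sum_i gain t i) => S; lra.
  by apply: ler_sum => i _; have := key t i; have := bp0 t i; move: (\sum_(k | _) _) => S; lra.
- by rewrite ee0 (le_trans eek)// ge_min lexx.
- exact: ltW.
Qed.

End system.

(** * Comparison with positive solutions and continuity *)

Section system.
Context {R : realType} {m n : nat} {Omega : set 'cV[R]_n} {d : 'rV[R]_m}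
  {v : 'cV[R]_m} {K : 'I_m -> R -> 'cV[R]_n -> R}
  {g : R -> 'cV[R]_n -> 'cV[R]_m -> 'cV[R]_m} {T : R}.
Hypothesis H : standing Omega d v K g T.
Implicit Types (u w : R -> 'cV[R]_n -> 'cV[R]_m) (x y : 'cV[R]_n) (t s : R).
Local Notation M := (box 0 v).
Local Notation Oc := (closure Omega).
Local Notation J := (fun t x a => jacobian_u g t x a).

Local Notation mu := (lebesgue_n n).
Local Notation nlO := (@nl R m n Omega K).
Local Notation dS := (@dsum R m d).

Variable Phi : R -> R -> ('cV[R]_n -> 'cV[R]_m) -> ('cV[R]_n -> 'cV[R]_m).
Hypothesis evol : is_evolution_family Omega d K g Phi.

(* Constants as in [reaction_constants], [K_near0] and [d_min]. *)
Variables (C b0 kap0 dm r : R) (beta : R -> 'cV[R]_n -> 'cV[R]_m -> 'I_m -> 'I_m -> R).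
Hypotheses (C0 : 0 < C) (b00 : 0 < b0) (kap00 : 0 < kap0) (dm0 : 0 < dm) (r0 : 0 < r)
  (HC : forall t x (a : 'cV[R]_m) i k, Oc x -> M a -> `|J t x a i k| <= C)
  (beta_irr : forall t x b, Oc x -> M b -> irreducible_at b0 (beta t x b))
  (beta_le : forall t x b i k, Oc x -> M b -> i != k -> beta t x b i k <= J t x b i k)
  (beta_low : forall t x b (p : 'cV[R]_m) i, Oc x -> M b -> (forall k, 0 <= p k 0) -> M (b + p) ->
    - (C * p i 0) + \sum_(k | k != i) beta t x b i k * p k 0 <=
      g t x (b + p) i 0 - g t x b i 0)
  (Kk : forall i t x y, ball x r y -> kap0 <= K i t (x - y)) (dmd : forall i, dm <= d 0 i).

Local Notation cc := (C + dS).
Local Notation kk := (dm * kap0).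

Let cc0 : 0 < cc. Proof. by rewrite ltr_pwDl// (dsum_ge0 H). Qed.
Let kk0 : 0 < kk. Proof. by rewrite mulr_gt0. Qed.
Local Notation V := (@vsum _ _ v).

Let V1 : 0 < V + 1. Proof. by rewrite ltr_wpDl// (vsum_ge0 H). Qed.
Let MV (a : 'cV[R]_m) i : M a -> a i 0 <= V + 1.
Proof. by move=> Ma; have := M_le Ma i; have := v_le_vsum H i; lra. Qed.

Lemma maximal_positive w : (0 < growth_bound Omega Phi)%E ->
  (forall t x, Oc x -> M (w t x)) -> solves_P Omega d K g T w ->
  (forall a b q q', a < b -> (exists N : nat, b = a + N%:R * T) ->
    returning_subsolution (Omega := Omega) (d := d) (v := v) (K := K) (g := g) C a b q q' ->
    forall t x i, a <= t <= b -> Oc x -> q t x i 0 <= w t x i 0) ->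
  exists2 del : R, 0 < del & forall t x i, Oc x -> del <= w t x i 0.
Proof.
move=> g0 Mw sw lift.
have [th th0 thg] : exists2 th : R, 0 < th & (th%:E < growth_bound Omega Phi)%E.
  case: (growth_bound Omega Phi) g0 => [a|_|//]; last by exists 1; rewrite ?ltry.
  by rewrite lte_fin => a0; exists (a / 2); rewrite ?lte_fin; lra.
have [KA KA0 HA] := large_mass_positive H evol C0 b00 kap00 dm0 r0 HC beta_irr beta_le beta_low Kk dmd th0 Mw sw lift.
have [[s [t [j [st hK]]]]|no] := pselect (exists s t j, s <= t /\ KA <= \int[mu]_(y in Omega) zq Phi th 1 s t y j 0).
  exact: (HA s t j).
apply: (bounded_mass_positive H evol C0 b00 kap00 dm0 r0 HC beta_irr beta_le beta_low Kk dmd th0 Mw sw lift KA0).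
  by move=> s t j st; rewrite leNgt; apply/negP => h; apply: no; exists s, t, j; split=> //; exact: ltW.
move=> B; have B1 : 1 <= Num.max 1 B by rewrite le_max lexx.
have [s [t [x [i [st xO h]]]]] := growth_large H evol thg B1.
exists s, t, x, i; split=> //; rewrite zqE mul1r; apply: (@le_lt_trans _ _ (Num.max 1 B)).
  by rewrite le_max lexx orbT.
move: h; rewrite mulNr expRN -ltr_pdivlMr ?expR_gt0// mulrC //.
Qed.

(** Every ratio be < 1 is admissible, by [ratio_step] at x = y with no
    mismatch. *)
Lemma positive_le (del del' : R) u w : 0 < del -> 0 < del' ->
  (forall t x, Oc x -> M (u t x)) -> solves_P Omega d K g T u ->
  (forall t x, Oc x -> M (w t x)) -> solves_P Omega d K g T w ->
  (forall t i, bounded_meas Omega (fun y => w t y i 0)) ->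
  (forall t x i, Oc x -> del <= w t x i 0) -> (forall t x i, Oc x -> del' <= u t x i 0) ->
  forall t x i, Oc x -> w t x i 0 <= u t x i 0.
Proof.
move=> del0 del0' Mu su Mw sw bw wd ud t x i xO.
suff h be : 0 < be < 1 -> be * w t x i 0 <= u t x i 0.
  rewrite leNgt; apply/negP => uw; have w0 : 0 < w t x i 0 by exact: lt_le_trans (wd t x i xO).
  have u0 : 0 < u t x i 0 by exact: lt_le_trans (ud t x i xO).
  pose be := (1 + u t x i 0 / w t x i 0) / 2.
  have q1 : u t x i 0 / w t x i 0 < 1 by rewrite ltr_pdivrMr// mul1r.
  have q0 : 0 < u t x i 0 / w t x i 0 by rewrite divr_gt0.
  have be01 : 0 < be < 1 by rewrite /be; lra.
  have := h be be01; rewrite -ler_pdivlMr// /be; lra.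
move=> be01; have /andP[be0 be1] := be01.
pose al0 := Num.min be (del' / (V + 1)).
have al00 : 0 < al0 by rewrite lt_min be0 divr_gt0.
have [c [kap [c0 kap0' RS]]] := ratio_step H C0 b00 beta_irr beta_low del0 al00 be01.
pose I := (R * {x : 'cV[R]_n | Oc x} * 'I_m)%type.
apply: (@ratio_sup R I (fun j => u j.1.1 (sval j.1.2) j.2 0) (fun j => w j.1.1 (sval j.1.2) j.2 0) (V + 1) c al0 be V1 c0 al00 _ _ _ _ (t, exist _ x xO, i)).
- by rewrite /al0 ge_min lexx.
- by move=> [[q [y yO]] k] /=; rewrite (M_ge0 (Mw q y yO))/= MV//; exact: Mw.
- move=> [[q [y yO]] k] /=; apply: le_trans (ud q y k yO); apply: (@le_trans _ _ (del' / (V + 1) * (V + 1))).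
    apply: ler_pM => //; [exact: ltW|exact: M_ge0 (Mw q y yO) k|by rewrite ge_min lexx orbT|by apply: MV; exact: Mw].
  by rewrite divfK// gt_eqF.
move=> al al0al albe Hal [[q [y yO]] k] /=.
have al_ge0 : 0 <= al by apply: le_trans al0al; exact: ltW.
apply: (RS y y (fun t => u t y) (fun t => w t y) (fun t i => nlO i t y (fun z => u t z i 0)) (fun t i => nlO i t y (fun z => w t z i 0)) al 0) => //.
- by move=> p; rewrite su.1.
- by move=> p; rewrite sw.1.
- by move=> p; exact: Mu.
- by move=> p; exact: Mw.
- by move=> p l; exact: wd.
- by move=> p l; exact: (solves_comp p l su yO).
- by move=> p l; exact: (solves_comp p l sw yO).
- by move=> p l; exact: (Hal (p, exist _ y yO, l)).
- by rewrite lexx ltW.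
- move=> p l; rewrite addr0 -(nl_scale H)//.
  apply: (@nl_le _ _ _ _ _ _ _ _ _ H l p y _ _ (V + 1)) => // z zO; have zO' := subset_closure zO.
    by rewrite (Hal (p, exist _ z zO', l)) andbT mulr_ge0// (M_ge0 (Mw p z zO')).
  by apply: MV; exact: Mu.
- by move=> p l; rewrite addr0.
Qed.

Lemma solution_lip u : (forall t x, Oc x -> M (u t x)) -> solves_P Omega d K g T u ->
  forall t s x i, Oc x -> `|u t x i 0 - u s x i 0| <= cc * V * `|t - s|.
Proof.
move=> Mu su; apply: (next_lip H C0 beta_irr beta_low Mu _ Mu) => t x i xO.
by rewrite shifted_rhs addrK rhsE; exact: (solves_comp t i su xO).
Qed.

(** [ratio_step] with u1, u2 the values of w at two nearby points; the mismatch is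
    small by the moduli of the kernel and of g, and a ratio close to 1 in both
    directions bounds the difference. *)
Lemma solution_space_modulus (del : R) w : 0 < del ->
  (forall t x, Oc x -> M (w t x)) -> solves_P Omega d K g T w ->
  (forall t i, bounded_meas Omega (fun y => w t y i 0)) ->
  (forall t x i, Oc x -> del <= w t x i 0) ->
  forall e, 0 < e -> exists2 q : R, 0 < q & forall t x y i, Oc x -> Oc y -> ball x q y ->
    `|w t x i 0 - w t y i 0| <= e.
Proof.
move=> del0 Mw sw bw wd e e0.
pose eta := Num.min 2^-1 (e / (V + 1)).
have eta0 : 0 < eta by rewrite lt_min invr_gt0 divr_gt0// andbT.
have eta1 : eta <= 2^-1 by rewrite ge_min lexx.
have be01 : 0 < 1 - eta < 1 by lra.
pose al0 := Num.min (1 - eta) (del / (V + 1)).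
have al00 : 0 < al0 by rewrite lt_min divr_gt0// andbT; lra.
have [c [kap [c0 kap0' RS]]] := ratio_step H C0 b00 beta_irr beta_low del0 al00 be01.
have [q1 q10 H1] := nl_modulus H (vsum_ge0 H) kap0'.
have [q2 q20 H2] := g_modulus H kap0'.
exists (Num.min q1 q2); first by rewrite lt_min q10.
suff key t x y i : Oc x -> Oc y -> ball x (Num.min q1 q2) y -> w t x i 0 - w t y i 0 <= e.
  move=> t x y i xO yO xy; rewrite ler_norml; apply/andP; split; last exact: key.
  by rewrite lerNl opprB; apply: key => //; exact: ball_sym.
move=> xO yO xy.
have xy1 : ball x q1 y by apply: le_ball xy; rewrite ge_min lexx.
have xy2 : ball x q2 y by apply: le_ball xy; rewrite ge_min lexx orbT.
suff h : (1 - eta) * w t x i 0 <= w t y i 0.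
  have h1 : eta * w t x i 0 <= e.
    apply: (@le_trans _ _ (e / (V + 1) * (V + 1))); last by rewrite divfK// gt_eqF.
    apply: ler_pM => //; [exact: ltW|exact: M_ge0 (Mw t x xO) i|by rewrite ge_min lexx orbT|by apply: MV; exact: Mw].
  lra.
apply: (@ratio_sup R (R * 'I_m)%type (fun j => w j.1 y j.2 0) (fun j => w j.1 x j.2 0) (V + 1) c al0 (1 - eta) V1 c0 al00 _ _ _ _ (t, i)).
- by rewrite /al0 ge_min lexx.
- by move=> [p k] /=; rewrite (M_ge0 (Mw p x xO))/= MV//; exact: Mw.
- move=> [p k] /=; apply: le_trans (wd p y k yO); apply: (@le_trans _ _ (del / (V + 1) * (V + 1))).
    apply: ler_pM => //; [exact: ltW|exact: M_ge0 (Mw p x xO) k|by rewrite ge_min lexx orbT|by apply: MV; exact: Mw].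
  by rewrite divfK// gt_eqF.
move=> al al0al albe Hal [p k] /=.
have al_ge0 : 0 <= al by apply: le_trans al0al; exact: ltW.
have al_le1 : al <= 1 by lra.
apply: (RS x y (fun t => w t y) (fun t => w t x) (fun t i => nlO i t y (fun z => w t z i 0)) (fun t i => nlO i t x (fun z => w t z i 0)) al kap) => //.
- by move=> s; rewrite sw.1.
- by move=> s; rewrite sw.1.
- by move=> s; exact: Mw.
- by move=> s; exact: Mw.
- by move=> s l; exact: wd.
- by move=> s l; exact: (solves_comp s l sw yO).
- by move=> s l; exact: (solves_comp s l sw xO).
- by move=> s l; exact: (Hal (s, l)).
- by rewrite lexx andbT ltW.
- move=> s l; have n0 : 0 <= nlO l s x (fun z => w s z l 0).
    by apply: (nl_ge0 H) => z zO; exact: M_ge0 (Mw s z (subset_closure zO)) l.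
  have : `|nlO l s x (fun z => w s z l 0) - nlO l s y (fun z => w s z l 0)| <= kap.
    apply: H1 => //; first by rewrite subrr normr0.
      move=> z zO; have Mz := Mw s z (subset_closure zO).
      by rewrite ger0_norm ?(M_ge0 Mz)//; apply: le_trans (M_le Mz l) (v_le_vsum H l).
    by move=> z zO; rewrite subrr normr0 ltW.
  rewrite ler_norml => /andP[_].
  have : al * nlO l s x (fun z => w s z l 0) <= nlO l s x (fun z => w s z l 0) by rewrite ler_piMl.
  move: (nlO l s x _) (nlO l s y _) => a b; lra.
move=> s l; have := H2 s s x y (w s x) l xO yO (Mw s x xO) _ xy2; rewrite subrr normr0 => /(_ q20).
by rewrite ltr_norml => /andP[_]; move: (g s x _ l 0) (g s y _ l 0) => a b; lra.
Qed.

End system.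

(** * Measurability and function spaces *)

Section system.
Context {R : realType} {m n : nat} {Omega : set 'cV[R]_n} {d : 'rV[R]_m}
  {v : 'cV[R]_m} {K : 'I_m -> R -> 'cV[R]_n -> R}
  {g : R -> 'cV[R]_n -> 'cV[R]_m -> 'cV[R]_m} {T : R}.
Hypothesis H : standing Omega d v K g T.
Implicit Types (u w : R -> 'cV[R]_n -> 'cV[R]_m) (x y : 'cV[R]_n) (t s : R).
Local Notation M := (box 0 v).
Local Notation Oc := (closure Omega).

Local Notation mu := (lebesgue_n n).
Local Notation nlO := (@nl R m n Omega K).

Local Notation V := (@vsum _ _ v).
Local Notation mu2 := (lebesgue_measure \x lebesgue_n n)%E.

Lemma cyl_measurable : measurable (cyl Omega).
Proof.
have -> : cyl Omega = ~` [set p : R * 'cV[R]_n | (~` Oc) p.2].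
  by apply/seteqP; split=> p /= h; [move=> nh; exact: nh|exact: contrapT].
apply: measurableC; apply: open_prod_measurable.
have oO : open (~` Oc) by apply: closed_openC; exact: closed_closure.
by move: oO; apply: (continuousP _).1 => p; exact: cvg_snd.
Qed.

Lemma cont_on_lebesgue_measurable (f : R * 'cV[R]_n -> R) : cont_on (cyl Omega) f ->
  lebesgue_measurable_fun (cyl Omega) f.
Proof.
move=> cf Y mY; exists (cyl Omega `&` f @^-1` Y).
  exact: (cont_on_measurable_prod cyl_measurable cf cyl_measurable mY).
by exists set0; [exact: negligible_set0|rewrite setU0].
Qed.

Lemma continuous_X_tilde_box u : (forall t x, Oc x -> M (u t x)) ->
  (forall i, cont_on (cyl Omega) (fun p => u p.1 p.2 i 0)) -> periodic_in_time Omega T u ->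
  X_tilde_box Omega T v u.
Proof.
move=> Mu cu uT; split; last first.
  by move=> t x xO; split; apply/vleP => i; rewrite ?mxE; [exact: M_ge0 (Mu t x xO) i|exact: M_le (Mu t x xO) i].
split=> //; last by move=> i; exact: cont_on_lebesgue_measurable.
apply: (@le_lt_trans _ _ V%:E); last exact: ltry.
apply: ge_ereal_sup => _ [p pO <-]; rewrite lee_fin; apply: norm_le_coord => [|i]; first exact: vsum_ge0 H.
have Mp := Mu p.1 p.2 pO; rewrite ger0_norm ?(M_ge0 Mp)//.
exact: le_trans (M_le Mp i) (v_le_vsum H i).
Qed.

Lemma zero_X_tilde_box : X_tilde_box Omega T v (fun _ _ => 0).
Proof.
apply: continuous_X_tilde_box => // [t x xO|i]; first exact: M0 H.
exact: cont_on_cst.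
Qed.

Lemma zero_solves : solves_P Omega d K g T (fun _ _ => 0).
Proof.
split=> // t x xO; apply: is_derive_col => i; rewrite rhsE (st_g_zero H)//.
have -> : nlO i t x (fun=> (0 : 'cV[R]_m) i 0) = 0.
  apply/eqP; rewrite eq_le; apply/andP; split.
    by apply: (nl_bound H) => // y yO; rewrite mxE lexx.
  by apply: (nl_ge0 H) => y yO; rewrite mxE.
by rewrite mxE mulr0 subrr addr0; exact: is_derive_cst.
Qed.

(** The sets where u_i >= 1/(k+1) cover the cylinder and each differs from a Borel
    set by a null set, so one of these Borel sets has positive measure over
    [0,1] x Omega, and so has one of its sections. *)
Lemma positive_section u i : X_tilde_box Omega T v u -> (forall t x, Oc x -> 0 < u t x i 0) ->
  exists t (h : 'cV[R]_n -> R), [/\ bounded_meas Omega h, forall y, Omega y -> 0 <= h y <= u t y i 0 &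
    0 < \int[mu]_(y in Omega) h y].
Proof.
move=> [[_ mu_ _] _] u0; have mO := Omega_measurable H; have fO := Omega_finite H.
pose f (p : R * 'cV[R]_n) := u p.1 p.2 i 0.
have /choice[B HB] (k : nat) : exists B : set (R * 'cV[R]_n), measurable B /\
    exists N, mu2.-negligible N /\ B `|` N = cyl Omega `&` f @^-1` `[k.+1%:R^-1, +oo[%classic.
  by have [B mB [N nN BN]] := mu_ i `[k.+1%:R^-1, +oo[%classic (measurable_itv _); exists B; split=> //; exists N.
pose Q : set (R * 'cV[R]_n) := `[0, 1]%classic `*` Omega.
have mQ : measurable Q by apply: measurableX => //; exact: measurable_itv.
have Q0 : (0 < mu2 Q)%E.
  have h1 : (0 < lebesgue_measure (`[0%R, 1%R]%classic : set R))%E.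
    by rewrite lebesgue_measure_itv/= lte_fin ltr01 oppr0 adde0.
  have h2 : (0 < mu Omega)%E by apply: lebesgue_n_open_gt0; [exact: st_open H|exact: st_nonempty H].
  rewrite product_measure1E; [exact: mule_gt0 h1 h2|exact: measurable_itv|exact: mO].
have [k Bk] : exists k, (0 < mu2 (B k `&` Q))%E.
  apply: contrapT => no; suff : (mu2 Q <= 0)%E by rewrite leNgt Q0.
  have nk k : mu2.-negligible (B k `&` Q).
    exists (B k `&` Q); split=> //; first by apply: measurableI => //; have [] := HB k.
    apply/eqP; rewrite eq_le measure_ge0 andbT leNgt; apply/negP => h; apply: no; by exists k.
  have /choice[N HN] (k : nat) := (HB k).2.
  have nQ : mu2.-negligible (\bigcup_k (B k `&` Q `|` N k)).
    by apply: negligible_bigcup => k; apply: negligibleU => //; have [] := HN k.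
  have QS : Q `<=` \bigcup_k (B k `&` Q `|` N k).
    move=> p Qp; have pO : Oc p.2 by apply: subset_closure; case: Qp.
    have fp := u0 p.1 p.2 pO.
    have [k hk] : exists k : nat, k.+1%:R^-1 <= f p.
      exists (Num.trunc (f p)^-1); rewrite invf_ple ?posrE//; exact: ltW (truncnS_gt _).
    exists k => //; have [_ BN] := HN k.
    have : (B k `|` N k) p by rewrite BN; split=> //=; rewrite in_itv/= andbT.
    by move=> [?|?]; [left|right].
  have [A [mA A0 SA]] := nQ; rewrite -A0; apply: le_measure; rewrite ?inE//.
  by apply: subset_trans SA.
pose D := B k `&` Q.
have mD : measurable D by apply: measurableI => //; have [] := HB k.
have [t Dt] : exists t, (0 < mu (xsection D t))%E.
  apply: contrapT => no; move: Bk; rewrite /product_measure1 integral0_eq ?ltxx// => t _.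
  by apply/eqP; rewrite eq_le measure_ge0 andbT leNgt; apply/negP => h; apply: no; exists t.
have mDt : measurable (xsection D t) by exact: measurable_xsection.
have Dsub y : xsection D t y -> Omega y /\ k.+1%:R^-1 <= u t y i 0.
  rewrite /xsection/= inE => -[Bty [_ yO]]; split=> //; have [N [_ BN]] := (HB k).2.
  have : (B k `|` N) (t, y) by left.
  by rewrite BN => -[_] /=; rewrite in_itv/= andbT.
have b1 : bounded_meas Omega (\1_(xsection D t) : 'cV[R]_n -> R).
  split; first exact: measurable_indic.
  by exists 1 => y _; rewrite indicE; case: (_ \in _); rewrite ?normr1 ?normr0.
exists t, (fun y => k.+1%:R^-1 * \1_(xsection D t) y); split.
- by apply: bounded_measM => //; exact: bounded_meas_cst.
- move=> y yO; rewrite indicE; case: (boolP (y \in xsection D t)) => [|_]; last first.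
    by rewrite mulr0 lexx ltW// u0//; exact: subset_closure.
  by rewrite inE => /Dsub[_ h]; rewrite mulr1 invr_ge0 ler0n.
rewrite RintegralZl//; last exact: bounded_meas_integrable.
rewrite mulr_gt0 ?invr_gt0// /Rintegral integral_indic// fine_gt0//.
have -> : xsection D t `&` Omega = xsection D t by apply/setIidPl => y /Dsub[].
rewrite Dt/=; apply: le_lt_trans fO; apply: le_measure; rewrite ?inE// => y /Dsub[] //.
Qed.

Lemma modulus_C_T w : (forall t x, Oc x -> M (w t x)) -> periodic_in_time Omega T w ->
  (forall e, 0 < e -> exists2 q : R, 0 < q & forall t s x y i, Oc x -> Oc y -> `|t - s| < q -> ball x q y ->
    `|w t x i 0 - w s y i 0| < e) -> C_T Omega T w.
Proof.
move=> Mw wT cw; split=> //; apply/subspace_continuousP => p pO B /nbhs_ballP[e /= e0 HB].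
have [q q0 Hq] := cw e e0; apply/nbhs_ballP; exists q => //= p' [pp1 pp2] p'O.
apply: HB; split=> // i j; rewrite ord1; exact: Hq.
Qed.

Lemma bounded_below_int_C_T_plus w (del : R) : C_T Omega T w -> 0 < del ->
  (forall t x i, Oc x -> del <= w t x i 0) -> int_C_T_plus Omega T w.
Proof.
move=> Cw del0 wd; split=> //; exists del; split=> // u Cu uw; split=> // t x xO; apply/vleP => i.
have := normX_lt uw (_ : cyl Omega (t, x)) => /(_ xO) /= h.
have := le_lt_trans (coord_le_norm (u t x - w t x) i) h.
rewrite !mxE ltr_norml => /andP[]; have := wd t x i xO; lra.
Qed.

End system.

(** * Positive growth bound and the three regimes *)

Section system.
Context {R : realType} {m n : nat} {Omega : set 'cV[R]_n} {d : 'rV[R]_m}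
  {v : 'cV[R]_m} {K : 'I_m -> R -> 'cV[R]_n -> R}
  {g : R -> 'cV[R]_n -> 'cV[R]_m -> 'cV[R]_m} {T : R}.
Hypothesis H : standing Omega d v K g T.
Implicit Types (u w : R -> 'cV[R]_n -> 'cV[R]_m) (x y : 'cV[R]_n) (t s : R).
Local Notation Oc := (closure Omega).

(** Existence, the lower bound and continuity come from the maximal solution; any
    other positive solution lies below it by maximality and above it because it is
    bounded below. *)
Lemma positive_solution (Phi : R -> R -> ('cV[R]_n -> 'cV[R]_m) -> ('cV[R]_n -> 'cV[R]_m)) (i0 : 'I_m) :
  is_evolution_family Omega d K g Phi -> (0 < growth_bound Omega Phi)%E ->
  exists w, [/\ X_tilde_box Omega T v w, solves_P Omega d K g T w,
    forall t x i, Oc x -> 0 < w t x i 0,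
    (forall u, X_tilde_box Omega T v u -> solves_P Omega d K g T u ->
       (forall t x i, Oc x -> 0 < u t x i 0) -> forall t x, Oc x -> u t x = w t x) &
    int_C_T_plus Omega T w].
Proof.
move=> evol g0.
have [C [b0 [beta [C0 b00 HC [beta_irr beta_le beta_low]]]]] := reaction_constants H.
have [kap0 [r [kap00 r0 Kk]]] := K_near0 H; have [dm dm0 dmd] := d_min H.
have [w [Mw sw bw wmax lift]] := maximal_solution H C0 HC beta_irr beta_low.
have [del del0 wd] := maximal_positive H evol C0 b00 kap00 dm0 r0 HC beta_irr beta_le beta_low Kk dmd g0 Mw sw lift.
have cw e : 0 < e -> exists2 q : R, 0 < q & forall t s x y i, Oc x -> Oc y -> `|t - s| < q -> ball x q y ->
    `|w t x i 0 - w s y i 0| < e.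
  move=> e0; have e30 : 0 < e / 3 by rewrite divr_gt0.
  have [q q0 Hq] := solution_space_modulus H C0 b00 beta_irr beta_low del0 Mw sw bw wd e30.
  pose L := (C + @dsum _ _ d) * @vsum _ _ v.
  have L0 : 0 <= L by rewrite mulr_ge0 ?(vsum_ge0 H)// addr_ge0 ?(dsum_ge0 H)// ltW.
  have L1 : 0 < L + 1 by rewrite ltr_wpDl.
  exists (Num.min q (e / 3 / (L + 1))); first by rewrite lt_min q0 divr_gt0.
  move=> t s x y i xO yO; rewrite lt_min => /andP[_ ts] xy.
  have xyq : ball x q y by apply: le_ball xy; rewrite ge_min lexx.
  have h1 := Hq t x y i xO yO xyq.
  have h2 : `|w t y i 0 - w s y i 0| <= e / 3.
    apply: (le_trans (solution_lip H C0 beta_irr beta_low Mw sw t s i yO)).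
    apply: (@le_trans _ _ ((L + 1) * (e / 3 / (L + 1)))); last by rewrite mulrC divfK// gt_eqF.
    by apply: ler_pM => //; [rewrite lerDl|exact: ltW].
  by apply: (le_lt_trans (ler_distD (w t y i 0) _ _)); lra.
have Cw : C_T Omega T w := modulus_C_T Mw sw.1 cw.
exists w; split=> //.
- by apply: (continuous_X_tilde_box H) => // [i|]; [exact: C_T_cont_on Cw|case: sw].
- by move=> t x i xO; exact: lt_le_trans (wd t x i xO).
- move=> u ub su u0 t x xO; have Mu := box_solution_M ub.
  have [s [h [bh hu I0]]] := positive_section H ub (fun t x xO => u0 t x i0 xO).
  have [del' del'0 ud] := mass_positive H C0 b00 kap00 dm0 r0 beta_irr beta_low Kk dmd Mu su bh hu I0.
  apply/colP => i; apply/eqP; rewrite eq_le wmax//=.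
  exact: (positive_le H C0 b00 beta_irr beta_low del0 del'0 Mu su Mw sw bw wd ud).
exact: bounded_below_int_C_T_plus Cw del0 wd.
Qed.

End system.

Unset Implicit Arguments.

Theorem lemma3p8 (R : realType) (m n : nat) (m_ge1 : (1 <= m)%N)
    (n_ge1 : (1 <= n)%N)
    (Omega : set 'cV[R]_n)
    (Omega_domain : is_domain Omega)
    (Omega_bounded : bounded_set Omega)
    (Omega_sc : simply_connected Omega)
    (Omega_smooth : smooth_boundary Omega)
    (d : 'rV[R]_m) (d_gt0 : forall i, 0 < d 0 i)
    (v : 'cV[R]_m) (v_int : interior Rplus v)
    (K : 'I_m -> R -> 'cV[R]_n -> R)
    (g : R -> 'cV[R]_n -> 'cV[R]_m -> 'cV[R]_m)
    (T : R) (T_gt0 : 0 < T)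
    (* (a) *)
    (K_ge0 : forall i t x, 0 <= K i t x)
    (K_cont : forall i, continuous (fun p : R * 'cV[R]_n => K i p.1 p.2))
    (K_pos : forall i t, 0 < K i t 0)
    (K_mass : forall i t, (\int[lebesgue_n n]_x (K i t x)%:E = 1)%E)
    (* (b) *)
    (g_C001 : class_C001 Omega g)
    (g_coop : forall t x u, 0 <= t -> closure Omega x -> order_box v u ->
       cooperative (jacobian_u g t x u) /\
       irreducible_mx (jacobian_u g t x u))
    (g_zero : forall i t x, closure Omega x -> g t x 0 i 0 = 0)
    (g_upper : forall i t x u, closure Omega x -> order_box v u ->
       u i 0 = v i 0 -> g t x u i 0 <= 0)
    (* (c) *)
    (g_sub : forall t x u (alpha : R), 0 <= t -> closure Omega x ->
       order_box v u -> interior Rplus u -> 0 < alpha < 1 ->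
       vlt (alpha *: g t x u) (g t x (alpha *: u)))
    (* (d) *)
    (K_per : forall i t x, K i (t + T) x = K i t x)
    (g_per : forall i t x u, closure Omega x ->
       g (t + T) x u i 0 = g t x u i 0)
    (Phi : R -> R -> ('cV[R]_n -> 'cV[R]_m) -> ('cV[R]_n -> 'cV[R]_m))
    (Phi_evol : is_evolution_family Omega d K g Phi) :
  let zero_unique :=
    (X_tilde_box Omega T v (fun _ _ => 0) /\
     solves_P Omega d K g T (fun _ _ => 0)) /\
    (forall u, X_tilde_box Omega T v u -> solves_P Omega d K g T u ->
       forall t x, closure Omega x -> u t x = 0) in
  [/\ (* (1) *)
      (growth_bound Omega Phi < 0)%E -> zero_unique,
      (* (2) *)
      growth_bound Omega Phi = 0%E ->
      (forall t x u (alpha : R), 0 <= t -> closure Omega x ->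
         order_box v u -> interior Rplus u -> 0 < alpha < 1 ->
         vll (alpha *: g t x u) (g t x (alpha *: u))) \/
      is_principal_eigenvalue Omega d K g T 0 ->
      zero_unique &
      (* (3) *)
      (0 < growth_bound Omega Phi)%E ->
      exists w : R -> 'cV[R]_n -> 'cV[R]_m,
        [/\ X_tilde_box Omega T v w,
            solves_P Omega d K g T w,
            forall t x i, closure Omega x -> 0 < w t x i 0,
            (forall u, X_tilde_box Omega T v u -> solves_P Omega d K g T u ->
               (forall t x i, closure Omega x -> 0 < u t x i 0) ->
               forall t x, closure Omega x -> u t x = w t x) &
            int_C_T_plus Omega T w]].
Proof.
have H : standing Omega d v K g T.
  have [oO cO neO] := Omega_domain.
  by split=> //; exact/interior_RplusP.
have zero : X_tilde_box Omega T v (fun _ _ => 0) /\ solves_P Omega d K g T (fun _ _ => 0).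
  by split; [exact: zero_X_tilde_box H|exact: zero_solves H].
split.
- move=> g_neg; split=> // u ub su t x xO; exact: (negative_growth_zero H Phi_evol g_neg ub su).
- move=> g_zero0 alt; split=> // u ub su t x xO.
  have [C [b0 [beta [C0 b00 HC [beta_irr beta_le beta_low]]]]] := reaction_constants H.
  have [kap0 [r [kap00 r0 Kk]]] := K_near0 H; have [dm dm0 dmd] := d_min H.
  case: alt => [strong|eig].
    have g_le0 : (growth_bound Omega Phi <= 0)%E by rewrite g_zero0.
    exact: (zero_growth_strong H Phi_evol C0 b00 kap00 dm0 r0 beta_irr beta_low Kk dmd g_le0 strong ub su).
  exact: (zero_growth_eigen H C0 b00 kap00 dm0 r0 HC beta_irr beta_le beta_low Kk dmd eig ub su).
exact: (positive_solution H (Ordinal m_ge1)).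
Qed.
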